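(* Let $L,T>0$ and let $\alpha,\beta$ be real constants satisfying $(2\alpha-|\beta|)(1-d)>|\beta|$. For each initial datum $(\eta_0,\omega_0;z_0)\in H=L^2(0,L)\times L^2(0,L)\times L^2(0,1)$ sufficiently small, the map $\Gamma:\mathcal{B}\to\mathcal{B}$, $\Gamma(\tilde\eta,\tilde\omega)=(\eta,\omega)$, defined in the context, is a contraction. Moreover, there exists a unique solution $(\eta,\omega)\in B(0,R)\subset\mathcal{B}$ of the nonlinear Boussinesq KdV-KdV system $$\begin{cases} \eta_t+\omega_x+\omega_{xxx}+(\eta\omega)_x=0,\quad \omega_t+\eta_x+\eta_{xxx}+\omega\omega_x=0, & x\in(0,L),\\ \eta(t,0)=\eta(t,L)=\eta_x(t,0)=\omega(t,0)=\omega(t,L)=0,\\ \omega_x(t,L)=-\alpha\,\eta_x(t,L)+\beta\,\eta_x(t-\tau(t),L),& t>0,\\ \eta_x(t-\tau(0),L)=z_0(t-\tau(0)),& 0<t<\tau(0),\\ (\eta(0,x),\omega(0,x))=(\eta_0(x),\omega_0(x)),& x\in(0,L). \end{cases}$$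
   Context: The delay $\tau$ satisfies, with positive constants $M$ and $d<1$: $0<\tau(0)\le\tau(t)\le M$ and $\dot\tau(t)\le d<1$ for all $t\ge0$, and $\tau\in W^{2,\infty}([0,T])$ for $T>0$; $d$ is the constant appearing in the condition on $\alpha,\beta$. Let $X_0=L^2(0,L)\times L^2(0,L)$ and $\mathcal{B}=C([0,T],X_0)\cap L^2(0,T;[H^1(0,L)]^2)$ with norm $\|(\eta,\omega)\|_{\mathcal{B}}=\sup_{t\in[0,T]}\|(\eta(t),\omega(t))\|_{X_0}+\|(\eta_x,\omega_x)\|_{L^2(0,T;X_0)}$. $B(0,R)$ denotes some closed ball of $\mathcal{B}$ centered at $0$ with radius $R>0$. For fixed initial data, $\Gamma$ sends $(\tilde\eta,\tilde\omega)\in\mathcal{B}$ to the pair $(\eta,\omega)$ formed by the first two components of the solution $(\eta,\omega,z)\in C([0,T],H)$ of the linear problem with source terms $$\begin{cases} \eta_t+\omega_x+\omega_{xxx}=-(\tilde\eta\tilde\omega)_x,\quad \omega_t+\eta_x+\eta_{xxx}=-\tilde\omega\tilde\omega_x,\\ \tau(t)z_t(t,\rho)+(1-\dot\tau(t)\rho)z_\rho(t,\rho)=0,\quad \rho\in(0,1),\\ \eta(t,0)=\eta(t,L)=\eta_x(t,0)=\omega(t,0)=\omega(t,L)=0,\\ \omega_x(t,L)=-\alpha\eta_x(t,L)+\beta z(t,1),\quad z(t,0)=\eta_x(t,L),\\ (\eta,\omega)(0,\cdot)=(\eta_0,\omega_0),\quad z(0,\rho)=z_0(-\tau(0)\rho),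 \end{cases}$$ where $z(t,\rho)$ stands for $\eta_x(t-\tau(t)\rho,L)$; the source terms belong to $L^1(0,T;L^2(0,L))$ for $(\tilde\eta,\tilde\omega)\in\mathcal{B}$. Solutions in $\mathcal{B}$ of the nonlinear system are the fixed points of $\Gamma$.
   Formalization: Γ is affine plus quadratic, so it cannot be a contraction on all of the unbounded space 𝓑; the contraction property is stated on the closed ball B(0,R), which Γ maps into itself, while Γ:𝓑→𝓑 is shown to be well defined. *)

(* Defs.v *)
From HB Require Import structures.
From mathcomp Require Import all_boot all_order all_algebra.
From mathcomp Require Import all_classical all_reals all_analysis.

Set Implicit Arguments.
Unset Strict Implicit.
Unset Printing Implicit Defensive.

Import Order.TTheory GRing.Theory Num.Theory.
Import numFieldNormedType.Exports.

Local Open Scope classical_set_scope.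
Local Open Scope ring_scope.

(** Elements of L^2(a,b) are represented by functions on the whole line of
    which only the values on ]a,b[ matter, and which are identified when they
    agree almost everywhere on ]a,b[ ([ae_eq_on]). A function of (t,x) is
    curried, with time first: [u t x]. *)

Definition L2 (R : realType) (a b : R) (f : R -> R) : Prop :=
  (f \_ `]a, b[) \in Lfun (@lebesgue_measure R) 2%:E.

Definition L2norm (R : realType) (a b : R) (f : R -> R) : \bar R :=
  'N[@lebesgue_measure R]_2%:E[EFin \o (f \_ `]a, b[)]%E.

Definition L2inner (R : realType) (a b : R) (f g : R -> R) : R :=
  \int[@lebesgue_measure R]_(x in `]a, b[) (f x * g x).

Definition Linfty (R : realType) (a b : R) (f : R -> R) : Prop :=
  (f \_ `]a, b[) \in Lfun (@lebesgue_measure R) +oo%E.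

Definition ae_eq_on (R : realType) (a b : R) (f g : R -> R) : Prop :=
  {ae @lebesgue_measure R, forall x, x \in `]a, b[ -> f x = g x}.

Definition smooth (R : realType) (phi : R -> R) : Prop :=
  forall (n : nat) (x : R), derivable (derive1n n phi) x 1.

Definition test_function (R : realType) (a b : R) (phi : R -> R) : Prop :=
  smooth phi /\
  exists a' b' : R, [/\ a < a', b' < b &
    forall x, x \notin `[a', b'] -> phi x = 0].

Definition weak_derivative (R : realType) (a b : R) (f f' : R -> R) : Prop :=
  forall phi : R -> R, test_function a b phi ->
    L2inner a b f (derive1 phi) = - L2inner a b f' phi.

Definition H1 (R : realType) (a b : R) (f : R -> R) : Prop :=
  L2 a b f /\ exists f', L2 a b f' /\ weak_derivative a b f f'.

(** A choice of square integrable weak derivative; it is unique up to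
    [ae_eq_on] when it exists, and the value is 0 when it does not. *)
Definition wderiv (R : realType) (a b : R) (f : R -> R) : R -> R :=
  xget (fun=> 0) [set f' | L2 a b f' /\ weak_derivative a b f f'].

(** W^{2,oo}([0,T]), each element being represented by its continuous
    representative (so that its values at the end points are meaningful). *)
Definition W2infty (R : realType) (T : R) (f : R -> R) : Prop :=
  {within `[0, T], continuous f} /\
  exists f1 f2 : R -> R, [/\ Linfty 0 T f1, Linfty 0 T f2,
    weak_derivative 0 T f f1 & weak_derivative 0 T f1 f2].

(** Pairs (eta, omega) of functions of x. As products and functions inherit
    pointwise subtraction, [u - v] makes sense for [u v : R -> pairs R]. *)
Definition pairs (R : realType) : Type := ((R -> R) * (R -> R))%type.

Definition in_X0 (R : realType) (L : R) (w : pairs R) : Prop :=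
  L2 0 L w.1 /\ L2 0 L w.2.

Definition X0norm (R : realType) (L : R) (w : pairs R) : \bar R :=
  ((L2norm 0 L w.1 ^+ 2 + L2norm 0 L w.2 ^+ 2) `^ 2^-1)%E.

Definition X0_eq (R : realType) (L : R) (v w : pairs R) : Prop :=
  ae_eq_on 0 L v.1 w.1 /\ ae_eq_on 0 L v.2 w.2.

Definition pair_wderiv (R : realType) (L : R) (w : pairs R) : pairs R :=
  (wderiv 0 L w.1, wderiv 0 L w.2).

Definition C_X0 (R : realType) (L T : R) (u : R -> pairs R) : Prop :=
  (forall t, t \in `[0, T] -> in_X0 L (u t)) /\
  (forall t, t \in `[0, T] ->
     (fun s => X0norm L (u s - u t : pairs R)) @ within `[0, T] (nbhs t)
       --> 0%E).

Definition C_L2 (R : realType) (a b T : R) (z : R -> R -> R) : Prop :=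
  (forall t, t \in `[0, T] -> L2 a b (z t)) /\
  (forall t, t \in `[0, T] ->
     (fun s => L2norm a b (z s - z t)) @ within `[0, T] (nbhs t) --> 0%E).

(** The L^2(0,T;X_0) norm of the x-derivative. *)
Definition dxnorm (R : realType) (L T : R) (u : R -> pairs R) : \bar R :=
  ((\int[@lebesgue_measure R]_(t in `]0%R, T[)
      (X0norm L (pair_wderiv L (u t)) ^+ 2)) `^ 2^-1)%E.

(** The space C([0,T],X_0) /\ L^2(0,T;H^1(0,L)^2). Strong measurability of
    [t |-> u t] with values in H^1 need not be required: it follows from the
    continuity in X_0. *)
Definition in_B (R : realType) (L T : R) (u : R -> pairs R) : Prop :=
  [/\ C_X0 L T u,
      {ae @lebesgue_measure R, forall t, t \in `]0, T[ ->
         H1 0 L (u t).1 /\ H1 0 L (u t).2} &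
      (dxnorm L T u < +oo)%E].

Definition Bnorm (R : realType) (L T : R) (u : R -> pairs R) : \bar R :=
  (ereal_sup [set X0norm L (u t) | t in `[0%R, T]] + dxnorm L T u)%E.

Definition in_Bball (R : realType) (L T r : R) (u : R -> pairs R) : Prop :=
  in_B L T u /\ (Bnorm L T u <= r%:E)%E.

(** Equality of two elements of C([0,T],X_0). *)
Definition traj_eq (R : realType) (L T : R) (u v : R -> pairs R) : Prop :=
  forall t, t \in `[0, T] -> X0_eq L (u t) (v t).

(** Weak (transposition) form of
      eta_t + omega_x + omega_xxx = F,   omega_t + eta_x + eta_xxx = G,
      eta(t,0) = eta(t,L) = eta_x(t,0) = omega(t,0) = omega(t,L) = 0,
      eta_x(t,L) = g(t),   omega_x(t,L) = b(t),
    obtained by multiplying by phi(x) and psi(x) and integrating over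
    ]0,t[ x ]0,L[. Integration by parts gives
      - int (omega_x + omega_xxx) phi = int omega (phi' + phi''')
          - [omega phi] - [omega_xx phi] + [omega_x phi'] - [omega phi''],
    the brackets being taken between 0 and L; phi = 0 at both ends and
    phi'(0) = 0 eliminate the unprescribed traces of omega, while leaving
    phi''(0), phi''(L), phi'(L) free enforces the conditions on omega. Likewise
    for eta, where psi'(0) is also left free because of eta_x(t,0) = 0. *)
Definition weak_KdV (R : realType) (L T : R) (u : R -> pairs R)
    (F G : R -> R -> R) (g b : R -> R) : Prop :=
  forall t, t \in `[0, T] ->
  (forall phi : R -> R, smooth phi ->
     phi 0 = 0 -> phi L = 0 -> derive1 phi 0 = 0 ->
     L2inner 0 L (u t).1 phi - L2inner 0 L (u 0).1 phi =
     \int[@lebesgue_measure R]_(s in `]0, t[)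
       (L2inner 0 L (u s).2 (derive1 phi + derive1n 3 phi)
        + b s * derive1 phi L + L2inner 0 L (F s) phi)) /\
  (forall psi : R -> R, smooth psi -> psi 0 = 0 -> psi L = 0 ->
     L2inner 0 L (u t).2 psi - L2inner 0 L (u 0).2 psi =
     \int[@lebesgue_measure R]_(s in `]0, t[)
       (L2inner 0 L (u s).1 (derive1 psi + derive1n 3 psi)
        + g s * derive1 psi L + L2inner 0 L (G s) psi)).

(** Weak form of tau(t) z_t + (1 - tau'(t) rho) z_rho = 0 on ]0,1[ with
    z(t,0) = g(t) and z(t,1) = h(t), the equation being first put in the
    equivalent divergence form (tau z)_t + ((1 - tau' rho) z)_rho = 0. *)
Definition weak_transport (R : realType) (T : R) (tau : R -> R)
    (z : R -> R -> R) (g h : R -> R) : Prop :=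
  forall t, t \in `[0, T] -> forall zeta : R -> R, smooth zeta ->
    tau t * L2inner 0 1 (z t) zeta - tau 0 * L2inner 0 1 (z 0) zeta =
    \int[@lebesgue_measure R]_(s in `]0, t[)
      (L2inner 0 1 (fun rho => (1 - derive1 tau s * rho) * z s rho)
         (derive1 zeta)
       + g s * zeta 0 - (1 - derive1 tau s) * h s * zeta 1).

(** [(u, z)] in C([0,T],H) solves the linear problem with sources [F], [G];
    [g] and [h] are the traces eta_x(t,L) = z(t,0) and z(t,1). *)
Definition linear_solution (R : realType) (L T alpha beta : R) (tau : R -> R)
    (eta0 omega0 z0 : R -> R) (F G : R -> R -> R)
    (u : R -> pairs R) (z : R -> R -> R) : Prop :=
  [/\ C_X0 L T u, C_L2 0 1 T z, X0_eq L (u 0) (eta0, omega0),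
      ae_eq_on 0 1 (z 0) (fun rho => z0 (- tau 0 * rho)) &
      exists g h : R -> R, [/\ L2 0 T g, L2 0 T h,
        weak_KdV L T u F G g (fun t => - alpha * g t + beta * h t) &
        weak_transport T tau z g h]].

Definition source_eta (R : realType) (L : R) (u : R -> pairs R) : R -> R -> R :=
  fun t => - wderiv 0 L (fun x => (u t).1 x * (u t).2 x).

Definition source_omega (R : realType) (L : R) (u : R -> pairs R)
  : R -> R -> R :=
  fun t x => - ((u t).2 x * wderiv 0 L (u t).2 x).

(** The graph of the map Gamma: [v = Gamma u]. *)
Definition Gamma (R : realType) (L T alpha beta : R) (tau : R -> R)
    (eta0 omega0 z0 : R -> R) (u v : R -> pairs R) : Prop :=
  exists z : R -> R -> R,
    linear_solution L T alpha beta tau eta0 omega0 z0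
      (source_eta L u) (source_omega L u) v z.

(** Solutions in B of the nonlinear system; [g] is the trace eta_x(t,L) for
    t in ]0,T[, extended to ]-tau(0),0[ by the history [z0]. *)
Definition nonlinear_solution (R : realType) (L T alpha beta : R)
    (tau : R -> R) (eta0 omega0 z0 : R -> R) (u : R -> pairs R) : Prop :=
  [/\ in_B L T u, X0_eq L (u 0) (eta0, omega0) &
      exists g : R -> R, [/\ L2 (- tau 0) T g, ae_eq_on (- tau 0) 0 g z0 &
        weak_KdV L T u (source_eta L u) (source_omega L u) g
          (fun t => - alpha * g t + beta * g (t - tau t))]].

Definition in_H (R : realType) (L : R) (tau eta0 omega0 z0 : R -> R) : Prop :=
  in_X0 L (eta0, omega0) /\ L2 0 1 (fun rho => z0 (- tau 0 * rho)).

Definition Hnorm (R : realType) (L : R) (tau eta0 omega0 z0 : R -> R)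
  : \bar R :=
  ((L2norm 0 L eta0 ^+ 2 + L2norm 0 L omega0 ^+ 2
    + L2norm 0 1 (fun rho => z0 (- tau 0 * rho)%R) ^+ 2) `^ 2^-1)%E.

(* Main.v *)
(* The linear problem is solved by density. Polynomial pairs satisfying the boundary
 conditions obey an energy identity and a Kato type multiplier estimate, which control
 the solution in B and the trace eta_x(t,L) by the data; the data of such pairs are
 dense, so the estimates pass to the limit. Uniqueness is by duality, because the
 adjoint problem is the original one after time reversal and a change of sign.
 The delay is handled by gluing the history to the unknown trace: the feedback maps
 traces to traces with Lipschitz constant |beta| / (alpha * sqrt (1 - d)), which the
 condition on alpha and beta makes smaller than 1. The transport equation is solved
 along characteristics. Finally the source terms are quadratic from B to
 L^1(0,T;X_0), by the algebra property of H^1(0,L), so that Gamma contracts a small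
 ball. *)
Require Import Defs.
From mathcomp Require Import all_boot all_order all_algebra.
From mathcomp Require Import all_classical all_reals all_analysis.
From mathcomp Require Import measurable_realfun ring lra.

Set Implicit Arguments.
Unset Strict Implicit.
Unset Printing Implicit Defensive.

Import Order.TTheory GRing.Theory Num.Theory.
Import numFieldNormedType.Exports.

Local Open Scope classical_set_scope.
Local Open Scope ring_scope.

(** * Semi-inner products and null sequences *)

(** The boundary input and the trace eta_x(t,L) are only square integrable in time, so neither can
    be read off a curve in C([0,T],X_0). Both are limits along smooth solutions, hence the reliance
    on a priori bounds. Polynomials in x and t are the smooth class because derivatives,
    antiderivatives and boundary values are then algebra. The hard point is that their data are
    dense, with no existence theorem at hand. A parameter s in [0,1] is put in front of the first
    order part: at s = 0 the operator is inverted by triple antiderivatives and density follows from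
    an approximate orthogonality argument, and a bound uniform in s carries density to s = 1. The
    delay loop uses the trace bound with constant 1/alpha, which comes from the energy identity with
    zero initial value and source; the generic constant of the a priori estimate would not make the
    loop contract under the given condition. Elements of the spaces stay plain functions, so norms
    are seminorms, and measurable representatives in time of H^1 norms have to be constructed and
    carried along. *)

Record semi_ip (R : realType) (V : lmodType R) := SemiIP {
 (* Vectors are plain functions, and [dom] singles out those on which the integrals behave linearly;
    symmetry and positivity hold everywhere because integrals are total. The form is only
    semidefinite, which avoids the quotient by almost everywhere equality. *)
 dom : V -> Prop;
 ip : V -> V -> R;
 dom0 : dom 0;
 domD : forall u v, dom u -> dom v -> dom (u + v);
 domZ : forall (k : R) u, dom u -> dom (k *: u);
 ipC : forall u v, ip u v = ip v u;
 ipDl : forall u v w, dom u -> dom v -> dom w -> ip (u + v) w = ip u w + ip v w;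
 ipZl : forall k u w, dom u -> dom w -> ip (k *: u) w = k * ip u w;
 ip_ge0 : forall u, 0 <= ip u u }.

Definition nrm (R : realType) (V : lmodType R) (S : semi_ip V) (u : V) : R :=
 Num.sqrt (ip S u u).

Section SemiIPTheory.
Context {R : realType} {V : lmodType R} (S : semi_ip V).
Local Notation "<< u , v >>" := (ip S u v).
Local Notation D := (dom S).
Local Notation N := (nrm S).

Lemma domN u : D u -> D (- u).
Proof. by move=> Du; rewrite -scaleN1r; apply: domZ. Qed.

Lemma domB u v : D u -> D v -> D (u - v).
Proof. by move=> Du Dv; apply: domD => //; apply: domN. Qed.

Lemma dom_sum I (r : seq I) (F : I -> V) :
 (forall i, D (F i)) -> D (\sum_(i <- r) F i).
Proof. by move=> h; elim/big_ind: _ => //; [exact: dom0|exact: domD]. Qed.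

Lemma ipNl u w : D u -> D w -> <<- u, w>> = - <<u, w>>.
Proof. by move=> Du Dw; rewrite -scaleN1r ipZl// mulN1r. Qed.

Lemma ipDr u v w : D u -> D v -> D w -> <<w, u + v>> = <<w, u>> + <<w, v>>.
Proof. by move=> Du Dv Dw; rewrite ipC ipDl// !(ipC S w). Qed.

Lemma ipZr k u w : D u -> D w -> <<w, k *: u>> = k * <<w, u>>.
Proof. by move=> Du Dw; rewrite ipC ipZl// ipC. Qed.

Lemma ipNr u w : D u -> D w -> <<w, - u>> = - <<w, u>>.
Proof. by move=> Du Dw; rewrite ipC ipNl// ipC. Qed.

Lemma ipBl u v w : D u -> D v -> D w -> <<u - v, w>> = <<u, w>> - <<v, w>>.
Proof. by move=> Du Dv Dw; rewrite ipDl ?ipNl//; apply: domN. Qed.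

Lemma ipBr u v w : D u -> D v -> D w -> <<w, u - v>> = <<w, u>> - <<w, v>>.
Proof. by move=> Du Dv Dw; rewrite ipDr ?ipNr//; apply: domN. Qed.

Lemma ip0l w : D w -> <<0, w>> = 0.
Proof. by move=> Dw; rewrite -(scale0r 0) ipZl ?mul0r//; exact: dom0. Qed.

Lemma ip0r w : D w -> <<w, 0>> = 0.
Proof. by move=> Dw; rewrite ipC ip0l. Qed.

Lemma ip_suml I (r : seq I) (F : I -> V) w : (forall i, D (F i)) -> D w ->
 <<\sum_(i <- r) F i, w>> = \sum_(i <- r) <<F i, w>>.
Proof.
move=> DF Dw; elim: r => [|i r IH]; first by rewrite !big_nil ip0l.
by rewrite !big_cons ipDl ?IH//; apply: dom_sum.
Qed.

Lemma nrm_ge0 u : 0 <= N u. Proof. exact: sqrtr_ge0. Qed.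

Lemma sqr_nrm u : N u ^+ 2 = <<u, u>>.
Proof. by rewrite sqr_sqrtr// ip_ge0. Qed.

Lemma ip_sqrD u v : D u -> D v ->
 <<u + v, u + v>> = <<u, u>> + 2 * <<u, v>> + <<v, v>>.
Proof.
move=> Du Dv; have Duv : D (u + v) by exact: domD.
by rewrite ipDl// !ipDr// (ipC S v u); ring.
Qed.

Lemma ip_sqrB u v : D u -> D v ->
 <<u - v, u - v>> = <<u, u>> - 2 * <<u, v>> + <<v, v>>.
Proof.
by move=> Du Dv; rewrite ip_sqrD ?ipNr ?ipNl ?ipNr ?opprK ?mulrN//; exact: domN.
Qed.

Lemma cauchy_schwarz u v : D u -> D v -> `|<<u, v>>| <= N u * N v.
Proof.
move=> Du Dv; have q t : 0 <= <<u, u>> - 2 * (t * <<u, v>>) + t ^+ 2 * <<v, v>>.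
 have := ip_ge0 S (u - t *: v).
 by rewrite ip_sqrB ?ipZr ?ipZl ?ipZr// ?mulrA ?expr2//; exact: domZ.
rewrite -ler_sqr ?nnegrE ?mulr_ge0 ?nrm_ge0// exprMn !sqr_nrm real_normK ?num_real//.
have uu := ip_ge0 S u; have vv := ip_ge0 S v.
have [v0|v0] := eqVneq <<v, v>> 0.
 have [->|uv0] := eqVneq <<u, v>> 0; first by rewrite v0 mulr0 expr0n.
 (* Degenerate case: the quadratic is affine in t, and this t gives it the value [-1]. *)
 have := q ((<<u, u>> + 1) / (2 * <<u, v>>)).
 rewrite v0 mulr0 addr0 (_ : 2 * _ = <<u, u>> + 1); first lra.
 by field.
have vp : 0 < <<v, v>> by rewrite lt_def v0.
(* The minimiser of the quadratic; multiplying by [<<v, v>>] clears the denominator. *)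
have /(ler_wpM2r vv) := q (<<u, v>> / <<v, v>>).
rewrite mul0r; set X := (X in 0 <= X).
have -> : X = <<u, u>> * <<v, v>> - <<u, v>> ^+ 2 by rewrite /X; field.
by rewrite subr_ge0.
Qed.

Lemma ip_le u v : D u -> D v -> <<u, v>> <= N u * N v.
Proof. by move=> Du Dv; exact/(le_trans (ler_norm _))/cauchy_schwarz. Qed.

Lemma nrmD u v : D u -> D v -> N (u + v) <= N u + N v.
Proof.
move=> Du Dv; rewrite -ler_sqr ?nnegrE ?addr_ge0 ?nrm_ge0//.
by rewrite sqr_nrm ip_sqrD// sqrrD !sqr_nrm; have := ip_le Du Dv; lra.
Qed.

Lemma nrmZ k u : D u -> N (k *: u) = `|k| * N u.
Proof.
move=> Du; rewrite /nrm ipZl// ?ipZr//; last exact: domZ.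
by rewrite mulrA -expr2 sqrtrM ?sqr_ge0// sqrtr_sqr.
Qed.

Lemma nrmN u : D u -> N (- u) = N u.
Proof. by move=> Du; rewrite -scaleN1r nrmZ// normrN1 mul1r. Qed.

Lemma nrmB u v : D u -> D v -> N (u - v) <= N u + N v.
Proof. by move=> Du Dv; rewrite -(nrmN Dv); apply: nrmD => //; exact: domN. Qed.

Lemma nrm0 : N 0 = 0.
Proof. by rewrite /nrm ip0l ?sqrtr0//; exact: dom0. Qed.

Lemma nrm_distC u v : D u -> D v -> N (u - v) = N (v - u).
Proof. by move=> Du Dv; rewrite -(nrmN (domB Du Dv)) opprB. Qed.

Lemma nrm_triangle v u w : D u -> D v -> D w -> N (u - w) <= N (u - v) + N (v - w).
Proof.
move=> Du Dv Dw; rewrite -(subrKA v u (- w)).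
by apply: nrmD; exact: domB.
Qed.

Lemma nrm_dist u v : D u -> D v -> `|N u - N v| <= N (u - v).
Proof.
move=> Du Dv; have h a b : D a -> D b -> N a - N b <= N (a - b).
 move=> Da Db; rewrite lerBlDr -{1}(subrK b a).
 by apply: nrmD => //; exact: domB.
by rewrite ler_norml h// andbT lerNl opprB nrm_distC// h.
Qed.

End SemiIPTheory.

(** Convergence is phrased through an arbitrary real-valued distance, since the function spaces
    carry seminorms and no topology; limits are unique only up to distance zero. *)
Definition cauchy_for (R : realType) (V : Type) (d : V -> V -> R) (u : nat -> V) :=
 forall e : R, 0 < e -> exists N : nat, forall m n,
  (N <= m)%N -> (N <= n)%N -> d (u m) (u n) <= e.

Definition cvg_for (R : realType) (V : Type) (d : V -> V -> R) (u : nat -> V) (l : V) :=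
 forall e : R, 0 < e -> exists N : nat, forall n, (N <= n)%N -> d (u n) l <= e.

(** One-sided on purpose: it is applied to norms and to upper bounds, where no absolute value is
    wanted. *)
Definition null (R : realType) (u : nat -> R) :=
 forall e : R, 0 < e -> exists N : nat, forall n, (N <= n)%N -> u n <= e.

Section Null.
Context {R : realType}.
Implicit Types u v : nat -> R.

Lemma ler_eq (x y : R) : x = y -> x <= y. Proof. by move->. Qed.

Lemma null_cvg u (l : R) e : null e -> (forall n, `|u n - l| <= e n) -> u @ \oo --> l.
Proof.
move=> he hu; apply/cvgrPdist_le => d d0; have [N hN] := he d d0; exists N => // n /hN.
by rewrite distrC; exact: le_trans.
Qed.

Lemma cvg_sqr u (l : R) : u @ \oo --> l -> (fun n => u n ^+ 2) @ \oo --> l ^+ 2.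
Proof. by move=> h; apply: (@continuous_cvg _ _ _ _ _ _ (fun y : R => y ^+ 2)) => //; exact: exprn_continuous. Qed.

Lemma in_oo (a b x : R) : x \in `]a, b[ -> a < x /\ x < b.
Proof. by rewrite in_itv/= => /andP. Qed.

Lemma in_cc (a b x : R) : x \in `[a, b] -> a <= x /\ x <= b.
Proof. by rewrite in_itv/= => /andP. Qed.

Lemma in_oo_le (a b x : R) : x \in `]a, b[ -> a <= x /\ x <= b.
Proof. by move=> /in_oo[/ltW ? /ltW ?]. Qed.

Lemma null_le u v : null v -> (forall n, u n <= v n) -> null u.
Proof.
move=> nv uv e e0; have [N hN] := nv _ e0; exists N => n nN.
exact: le_trans (uv n) (hN _ nN).
Qed.

Lemma nullD u v : null u -> null v -> null (fun n => u n + v n).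
Proof.
move=> nu nv e e0; have e2 : 0 < e / 2 by lra.
have [N hN] := nu _ e2; have [M hM] := nv _ e2.
exists (maxn N M) => n; rewrite geq_max => /andP[/hN ? /hM ?]; lra.
Qed.

Lemma nullZ k u : 0 <= k -> null u -> null (fun n => k * u n).
Proof.
move=> k0 nu e e0; have k1 : 0 < k + 1 by lra.
have [N hN] := nu _ (divr_gt0 e0 k1); exists N => n /hN h.
have [un|un] := leP 0 (u n); last by nra.
have : (k + 1) * u n <= e by rewrite mulrC -ler_pdivlMr.
nra.
Qed.

Lemma null_cst_le (a : R) u : null u -> (forall n, a <= u n) -> a <= 0.
Proof.
move=> nu h; rewrite leNgt; apply/negP => a0.
have [N /(_ N (leqnn N))] := nu (a / 2) ltac:(lra).
by have := h N; lra.
Qed.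

Lemma null_geo (k q : R) : 0 <= q -> q < 1 -> null (fun n => k * q ^+ n).
Proof.
move=> q0 q1 e e0.
have : (fun n => `|k| * q ^+ n) @ \oo --> `|k| * 0 by apply: cvgMr; apply: cvg_expr; rewrite ger0_norm.
rewrite mulr0 => /cvgrPdist_lt/(_ _ e0)[N _ hN]; exists N => n /hN /=.
rewrite sub0r normrN => /ltW; apply: le_trans.
by rewrite normrM normr_id -[in X in X <= _](ger0_norm (exprn_ge0 n q0)) ler_wpM2r// ler_norm.
Qed.

Lemma null_half (k : R) : null (fun n => k * 2^-1 ^+ n).
Proof. by apply: null_geo; lra. Qed.

Lemma null_harmonic : null (fun n => (n.+1%:R^-1 : R)).
Proof.
move=> e e0; have /cvgrPdist_lt/(_ _ e0)[N _ hN] := @cvg_harmonic R.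
exists N => n /hN /=; rewrite sub0r normrN => /ltW; apply: le_trans.
exact: ler_norm.
Qed.

Lemma null_sqrt u : (forall n, 0 <= u n) -> null u -> null (fun n => Num.sqrt (u n)).
Proof.
move=> u0 nu e e0; have [N hN] := nu _ (exprn_gt0 2 e0).
exists N => n /hN h; rewrite -(ger0_norm (ltW e0)) -sqrtr_sqr ler_sqrt//.
exact: exprn_ge0 (ltW e0).
Qed.

End Null.

(** The telescoped bound keeps the factor [1 - q ^+ k], so that the induction on [k] closes with an
    equality; dropping it at the end gives the Cauchy tail. *)
Lemma geometric_cauchy (R : realType) (V : lmodType R) (S : semi_ip V)
  (u : nat -> V) (c q : R) : 0 <= c -> 0 <= q -> q < 1 ->
 (forall n, dom S (u n)) -> (forall n, nrm S (u n.+1 - u n) <= c * q ^+ n) ->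
 cauchy_for (fun x y => nrm S (x - y)) u.
Proof.
move=> c0 q0 q1 Du hu.
have step n k : nrm S (u (n + k)%N - u n) <= c / (1 - q) * q ^+ n * (1 - q ^+ k).
 elim: k => [|k IH]; first by rewrite addn0 subrr nrm0 expr0 subrr mulr0.
 apply: (le_trans (nrm_triangle (Du _) (Du (n + k)%N) (Du _))).
 rewrite addnS; apply: (le_trans (lerD (hu _) IH)).
 rewrite exprD exprS; apply: ler_eq.
 field; lra.
move=> e e0.
have k0 : 0 <= c / (1 - q) by apply: divr_ge0; lra.
have [N hN] := null_geo (c / (1 - q)) q0 q1 e0.
have h m n : (N <= m)%N -> (m <= n)%N -> nrm S (u m - u n) <= e.
 move=> Nm mn; rewrite nrm_distC// -(subnKC mn); apply: (le_trans (step _ _)).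
 apply: le_trans (hN _ Nm); apply: ler_piMr.
  by apply: mulr_ge0 => //; exact: exprn_ge0.
 by have := exprn_ge0 (n - m) q0; lra.
exists N => m n Nm Nn; have [mn|/ltnW nm] := leqP m n; first exact: h.
by rewrite nrm_distC//; exact: h.
Qed.

(** * Integrals on bounded intervals *)

Notation mfn a b f := (@measurable_fun _ _ (measurableTypeR _) _ `]a, b[%classic f).

Section IntervalIntegral.
Context {R : realType}.
Notation mu := (@lebesgue_measure R).
Implicit Types (a b c x : R) (f g F : R -> R).

Definition ig a b f : Prop := mu.-integrable `]a, b[ (EFin \o f).
Definition it a b f : R := \int[mu]_(x in `]a, b[) f x.
Definition aeon a b (P : R -> Prop) : Prop :=
 {ae mu, forall x, x \in `]a, b[ -> P x}.

Lemma ae_filter : Filter (almost_everywhere mu).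
Proof. exact: ae_filter_ringOfSetsType. Qed.

Lemma aeonW a b (P : R -> Prop) : (forall x, x \in `]a, b[ -> P x) -> aeon a b P.
Proof.
by move=> h; apply: (@filterS _ _ ae_filter setT); [move=> x _; exact: h|exact: (@filterT _ _ ae_filter)].
Qed.

Lemma aeonS a b (P Q : R -> Prop) : (forall x, x \in `]a, b[ -> P x -> Q x) ->
 aeon a b P -> aeon a b Q.
Proof.
rewrite /aeon => PQ H; have F := ae_filter.
by apply: (@filterS _ _ F _ _ _ H) => x h xab; apply: PQ => //; exact: h.
Qed.

Lemma aeonS2 a b (P Q S : R -> Prop) :
 (forall x, x \in `]a, b[ -> P x -> Q x -> S x) ->
 aeon a b P -> aeon a b Q -> aeon a b S.
Proof.
rewrite /aeon => PQ H H'; apply: (@filterS2 _ _ ae_filter _ _ _ _ H H') => x h h' xab; by apply: PQ => //; [exact: h|exact: h'].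
Qed.

Lemma aeon_and a b (P Q : R -> Prop) : aeon a b P -> aeon a b Q -> aeon a b (fun x => P x /\ Q x).
Proof. by apply: aeonS2 => x _ ? ?; split. Qed.

Lemma aeon_sub a b c d (P : R -> Prop) : a <= c -> d <= b -> aeon a b P -> aeon c d P.
Proof.
rewrite /aeon => ac db H; apply: (@filterS _ _ ae_filter _ _ _ H) => x h xcd; apply: h.
by move: xcd; rewrite !in_itv/= => /andP[? ?]; apply/andP; split; lra.
Qed.

Lemma aeon_all a b (P : nat -> R -> Prop) : (forall n, aeon a b (P n)) ->
 aeon a b (fun x => forall n, P n x).
Proof.
move=> h; have H := @ae_foralln _ _ _ mu (fun n x => x \in `]a, b[ -> P n x) h.
by apply: (@filterS _ _ ae_filter _ _ _ H) => x hx xab n; exact: hx.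
Qed.

Import HBNNSimple.

(* No measurability: simple functions below [f] may be restricted to the
 complement of the null set. *)
Lemma ge0_integral_setD_null (D N : set R) (f : R -> \bar R) :
 measurable N -> mu N = 0%E -> (forall x, 0 <= f x)%E ->
 (\int[mu]_(x in D) f x = \int[mu]_(x in D `\` N) f x)%E.
Proof.
move=> mN N0 f0; rewrite !ge0_integralE//; apply/eqP; rewrite eq_le; apply/andP; split.
- apply: ge_ereal_sup => _ [h /= hf <-].
 have mNC : measurable (~` N) by exact: measurableC.
 apply: ereal_sup_ubound => /=; exists (proj_nnsfun h mNC).
  move=> x /=; rewrite /proj_nnsfun/= /patch.
  have := hf x; rewrite /patch.
  case: ifPn => [xD|xD] hx; case: ifPn => [xDN|xDN] //=.
  + apply: le_trans hx; rewrite lee_fin mindicE.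
   by case: (_ \in _); rewrite ?mulr1// mulr0.
  + rewrite mindicE memNset ?mulr0//= => xN; move/negP: xDN; apply.
   by rewrite inE; split => //; apply: set_mem.
  + by move: xDN; rewrite inE => -[xD']; rewrite notin_setE in xD.
  + by rewrite lee_fin mindicE; case: (_ \in _); rewrite ?mulr0// mulr1 -lee_fin.
 rewrite -!integralT_nnsfun/=.
 rewrite [RHS](@ge0_negligible_integral _ _ _ mu setT N)//=; last 2 first.
 - exact/measurable_EFinP.
 - by move=> x _; rewrite lee_fin.
 rewrite setTD [RHS]integral_mkcond; apply: eq_integral => x _.
 rewrite /patch mindicE.
 by case: (_ \in _) => /=; rewrite ?mulr1// mulr0.
- apply: le_ereal_sup => _ [h /= hf <-]; exists h => //= x.
 apply: (le_trans (hf x)); rewrite /patch.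
 case: ifPn => [|_]; last by case: ifP.
 by rewrite inE => -[xD _]; rewrite mem_set.
Qed.

(** Null sets are removed without measurability of the integrands. This matters for functions such
    as the norm of [pair_wderiv L (u t)], which are only known to agree almost everywhere with
    measurable ones. *)
Lemma integral_ae_congr (D : set R) (f g : R -> \bar R) :
 {ae mu, forall x, D x -> f x = g x} ->
 (\int[mu]_(x in D) f x = \int[mu]_(x in D) g x)%E.
Proof.
move=> [N [mN N0 fgN]].
have h x : (D `\` N) x -> f x = g x.
 by move=> [Dx Nx]; apply/eqP/negPn/negP => /eqP fg; apply: Nx; apply: fgN => /= /(_ Dx).
rewrite integralE [RHS]integralE; congr (_ - _)%E;
 rewrite (ge0_integral_setD_null D mN N0)// [RHS](ge0_integral_setD_null D mN N0)//;
 by apply: eq_integral => x; rewrite inE => /h fg; rewrite ?funeposE ?funenegE fg.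
Qed.

Lemma mitv a b : measurable (`]a, b[ : set (measurableTypeR R)).
Proof. exact: measurable_itv. Qed.
Hint Resolve mitv : core.

Lemma igP a b f : ig a b f <->
 mfn a b f /\ (\int[mu]_(x in `]a, b[) `|f x|%:E < +oo)%E.
Proof.
split=> [/integrableP[/measurable_EFinP ? ?]//|[mf fi]].
by apply/integrableP; split => //; apply/measurable_EFinP.
Qed.

Lemma ig_mf a b f : ig a b f -> mfn a b f.
Proof. by move=> /igP[]. Qed.

Lemma ig_eq a b f g : {in `]a, b[, f =1 g} -> ig a b f -> ig a b g.
Proof.
move=> fg; apply: eq_integrable => //= x; rewrite inE /= => /fg fgx.
by rewrite fgx.
Qed.

Lemma igD a b f g : ig a b f -> ig a b g -> ig a b (fun x => f x + g x).
Proof. by move=> If Ig; exact: (integrableD (mitv a b) If Ig). Qed.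

Lemma igN a b f : ig a b f -> ig a b (fun x => - f x).
Proof. by move=> If; have := @integrableN _ _ _ mu _ _ If. Qed.

Lemma igB a b f g : ig a b f -> ig a b g -> ig a b (fun x => f x - g x).
Proof. by move=> If Ig; apply: igD => //; exact: igN. Qed.

Lemma igZ a b k f : ig a b f -> ig a b (fun x => k * f x).
Proof. by move=> If; exact: (integrableZl (mitv a b) k If). Qed.

Lemma ig_sub a b c d f : a <= c -> d <= b -> ig a b f -> ig c d f.
Proof.
move=> ac db; apply: integrableS => //; apply: subset_itv; by rewrite bnd_simp.
Qed.

Lemma ig_le a b f g : mfn a b f ->
 aeon a b (fun x => `|f x| <= g x) -> ig a b g -> ig a b f.
Proof.
move=> mf fg /igP[mg gi]; apply/igP; split=> //; apply: le_lt_trans gi.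
apply: ae_ge0_le_integral => //.
- by apply/measurable_EFinP; exact: measurableT_comp.
- by apply/measurable_EFinP; exact: measurableT_comp.
- by apply: aeonS fg => x _; rewrite lee_fin => /le_trans; apply; exact: ler_norm.
Qed.

Lemma ig_ae a b f g : mfn a b g -> aeon a b (fun x => f x = g x) ->
 ig a b f -> ig a b g.
Proof.
move=> mg fg If; apply: (@ig_le _ _ _ (fun x => `|f x|)) => //.
 by apply: aeonS fg => x _ ->.
by move: If => /igP[mf fi]; apply/igP; split; [exact: measurableT_comp|
 under eq_integral do rewrite normr_id].
Qed.

Lemma ig_norm a b f : ig a b f -> ig a b (fun x => `|f x|).
Proof.
move=> If; apply/igP; split; first by apply: measurableT_comp => //; exact: ig_mf If.
by under eq_integral do rewrite normr_id; have /igP[] := If.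
Qed.

Lemma ig_cont a b f : {within `[a, b], continuous f} -> ig a b f.
Proof.
move=> cf; have := continuous_compact_integrable (@segment_compact _ a b) cf.
by apply: integrableS => //; apply: subset_itv_oo_cc.
Qed.

Lemma ig_continuous a b f : continuous f -> ig a b f.
Proof. by move=> cf; apply: ig_cont; apply: continuous_subspaceT. Qed.

Lemma ig_cst a b (k : R) : ig a b (fun=> k).
Proof. by apply: ig_continuous => x; exact: cvg_cst. Qed.

Lemma it_ae a b f g : aeon a b (fun x => f x = g x) -> it a b f = it a b g.
Proof.
move=> fg; rewrite /it /Rintegral; congr fine; apply: integral_ae_congr.
by apply: aeonS fg => x _ ->.
Qed.

Lemma it_eq a b f g : {in `]a, b[, f =1 g} -> it a b f = it a b g.
Proof. by move=> fg; apply: it_ae; apply: aeonW => x; exact: fg. Qed.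

Lemma itD a b f g : ig a b f -> ig a b g ->
 it a b (fun x => f x + g x) = it a b f + it a b g.
Proof. by move=> If Ig; rewrite /it RintegralD. Qed.

Lemma itB a b f g : ig a b f -> ig a b g ->
 it a b (fun x => f x - g x) = it a b f - it a b g.
Proof. by move=> If Ig; rewrite /it RintegralB. Qed.

Lemma itZ a b k f : ig a b f -> it a b (fun x => k * f x) = k * it a b f.
Proof. by move=> If; rewrite /it RintegralZl. Qed.

Lemma it0 a b : it a b (fun=> 0) = 0.
Proof. by rewrite /it Rintegral_cst// mul0r. Qed.

Lemma itN a b f : ig a b f -> it a b (fun x => - f x) = - it a b f.
Proof.
move=> If; have := itB (ig_cst a b 0) If; rewrite it0 sub0r => <-.
by apply: it_eq => x _; rewrite sub0r.
Qed.

Lemma it_cst a b k : a <= b -> it a b (fun=> k) = k * (b - a).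
Proof.
move=> ab; rewrite /it Rintegral_cst//.
congr (k * _); transitivity (fine (@lebesgue_measure R `]a, b[%classic)) => //.
rewrite (lebesgue_measure_itv `]a, b[) /= lte_fin.
move: ab; rewrite le_eqVlt => /predU1P[->|->//].
by rewrite ltxx subrr.
Qed.

Lemma EFin_it a b f : ig a b f -> (it a b f)%:E = (\int[mu]_(x in `]a, b[) (f x)%:E)%E.
Proof. by move=> If; rewrite /it /Rintegral fineK//; exact: integrable_fin_num. Qed.

Lemma it_le a b f g : ig a b f -> ig a b g -> aeon a b (fun x => f x <= g x) ->
 it a b f <= it a b g.
Proof.
(* Replacing [f] by the minimum turns the almost everywhere inequality into one valid at every
   point. *)
move=> If Ig fg; rewrite (@it_ae _ _ f (fun x => Num.min (f x) (g x))); last first.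
 by apply: aeonS fg => x _; rewrite minEle => ->.
apply: le_Rintegral => //; last by move=> x _; rewrite ge_min lexx orbT.
apply: (ig_ae _ _ If).
 by apply: measurable_minr; [exact: ig_mf If|exact: ig_mf Ig].
by apply: aeonS fg => x _; rewrite minEle => ->.
Qed.

Lemma it_ge0 a b f : aeon a b (fun x => 0 <= f x) -> 0 <= it a b f.
Proof.
move=> f0; rewrite (@it_ae _ _ f (fun x => Num.max 0 (f x))); last first.
 by apply: aeonS f0 => x _; rewrite maxEle => ->.
by apply: Rintegral_ge0 => x _; rewrite le_max lexx.
Qed.

Lemma it_abs a b f : ig a b f -> `|it a b f| <= it a b (fun x => `|f x|).
Proof. by move=> If; apply: le_normr_Rintegral. Qed.

Lemma it_deg a b f : b <= a -> it a b f = 0.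
Proof. by move=> ba; rewrite /it set_itv_ge ?Rintegral_set0// bnd_simp -leNgt. Qed.

Lemma it_split c a b f : a <= c -> c <= b -> ig a b f ->
 it a b f = it a c f + it c b f.
Proof.
move=> ac cb If; move: ac; rewrite le_eqVlt => /predU1P[<-|ac].
 by rewrite (it_deg _ (lexx a)) add0r.
move: cb; rewrite le_eqVlt => /predU1P[->|cb].
 by rewrite (it_deg _ (lexx b)) addr0.
have := @Rintegral_itvB _ f (BRight a) (BLeft b) c If.
rewrite !bnd_simp => /(_ (ltW ac) cb) h; rewrite /it -h.
rewrite -Rintegral_itv_bndo_bndc; first by ring.
by apply: ig_sub If => //; exact: ltW.
Qed.

Lemma it_sub_le a b c d f : a <= c -> d <= b -> ig a b f ->
 aeon a b (fun x => 0 <= f x) -> it c d f <= it a b f.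
Proof.
move=> ac db If f0; have [dc|/ltW cd] := leP d c.
 by rewrite (it_deg _ dc); exact: it_ge0.
have pos u v : a <= u -> v <= b -> 0 <= it u v f.
 move=> au vb; by apply: it_ge0; exact: aeon_sub f0.
rewrite (it_split (le_trans ac cd) db If) (it_split ac cd); last exact: ig_sub If.
have := pos a c (lexx a) (le_trans cd db).
have := pos d b (le_trans ac cd) (lexx b); lra.
Qed.

Lemma FTC_itv a b F f : a <= b -> continuous f -> continuous F ->
 (forall x, x \in `]a, b[ -> is_derive x 1 F (f x)) ->
 it a b f = F b - F a.
Proof.
move=> + cf0 cF0 dF; rewrite le_eqVlt => /predU1P[<-|ab].
 by rewrite it_deg// subrr.
have cf : {within `[a, b], continuous f} by exact: continuous_subspaceT.
have cF : {within `[a, b], continuous F} by exact: continuous_subspaceT.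
have If := ig_cont cf.
have : derivable_oo_LRcontinuous F a b.
 have [_ Fa Fb] := (continuous_within_itvP F ab).1 cF.
 by split => // x /dF [].
move=> /(continuous_FTC2 ab cf) h.
have /h : {in `]a, b[, derive1 F =1 f} by move=> x /dF [? ?]; rewrite derive1E.
rewrite /it /Rintegral -(@integral_itv_bndoo _ a b (EFin \o f) true false); last first.
 by apply/measurable_EFinP; exact: ig_mf If.
by move=> /= ->.
Qed.

Lemma FTC_cont a b F f : a <= b -> continuous f ->
 (forall x, is_derive x 1 F (f x)) -> it a b f = F b - F a.
Proof.
move=> ab cf dF; apply: FTC_itv => // x; apply: differentiable_continuous.
by apply/derivable1_diffP; have [] := dF x.
Qed.

Lemma it_eq0_ae a b f : ig a b f -> aeon a b (fun x => 0 <= f x) -> it a b f = 0 ->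
 aeon a b (fun x => f x = 0).
Proof.
move=> If f0 f00.
have : (\int[mu]_(x in `]a, b[) `|(f x)%:E| = 0)%E.
 transitivity (it a b f)%:E; last by rewrite f00.
 rewrite EFin_it//; apply: integral_ae_congr.
 by apply: aeonS f0 => x _ f0x; rewrite gee0_abs ?lee_fin.
move/(ae_eq_integral_abs mu (mitv a b)) => /= h.
have mf : @measurable_fun _ _ (measurableTypeR R) _ `]a, b[%classic (EFin \o f) by apply/measurable_EFinP; exact: ig_mf If.
by apply: filterS (h mf) => x /= hx xab; case: (hx xab).
Qed.

(* Markov/Borel-Cantelli in series form: [sum_n 2^n f_n] is integrable, hence
 finite almost everywhere. *)
Lemma ae_geometric_decay a b (f : nat -> R -> R) (c : R) : 0 <= c ->
 (forall n, ig a b (f n)) -> (forall n x, 0 <= f n x) ->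
 (forall n, it a b (f n) <= c * (4^-1) ^+ n) ->
 aeon a b (fun x => exists K : R, forall n, f n x <= K * (2^-1) ^+ n).
Proof.
move=> c0 If f0 fc.
pose g n x := ((2 ^+ n * f n x)%:E : \bar R).
have g0 n x : (0 <= g n x)%E by rewrite lee_fin mulr_ge0.
have mg n : @measurable_fun _ _ (measurableTypeR R) _ `]a, b[%classic (g n).
 apply/measurable_EFinP; apply: measurable_funM => //.
 exact: ig_mf (If n).
have ig n : (\int[mu]_(x in `]a, b[) g n x <= (c * (2^-1) ^+ n)%:E)%E.
 rewrite /g -(EFin_it (igZ _ (If n))) lee_fin itZ//.
 apply: (le_trans (ler_wpM2l _ (fc n))) => //.
 by rewrite mulrCA -exprMn (_ : 2 * 4^-1 = 2^-1 :> R)//; field.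
have sfin : (\int[mu]_(x in `]a, b[) (\sum_(n <oo) g n x) < +oo)%E.
 rewrite integral_nneseries//.
 apply: (@le_lt_trans _ _ (2 * c)%:E); last exact: ltry.
 apply: lime_le.
  by apply: is_cvg_nneseries => n _ _; apply: integral_ge0.
 apply: nearW => n; apply: (@le_trans _ _ (\sum_(0 <= k < n) (c * (2^-1) ^+ k)%:E)%E).
  exact: lee_sum.
 rewrite sumEFin lee_fin (_ : \sum_(0 <= k < n) _ = 2 * c * (1 - (2^-1) ^+ n)).
  by rewrite ler_piMr ?mulr_ge0// lerBlDr lerDl exprn_ge0// invr_ge0.
 elim: n => [|n IH]; first by rewrite big_geq// expr0 subrr mulr0.
 by rewrite big_nat_recr//= IH exprS; field.
have [N [mN N0 hN]] : {ae mu, forall x, `]a, b[%classic x ->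
  (\sum_(n <oo) g n x)%E \is a fin_num}.
 apply: integrable_ae => //; apply/integrableP; split.
  apply: ge0_emeasurable_sum => //.
 under eq_integral => x _ do rewrite gee0_abs ?nneseries_ge0//.
 done.
exists N; split => // x /= nx; apply: hN => /= sx; apply: nx => xab.
have {}sx := sx xab.
exists (fine (\sum_(n <oo) g n x)%E) => n.
have : (g n x <= \sum_(n <oo) g n x)%E.
 have := @nneseries_lim_ge R (fun k => g k x) xpredT 0%N n.+1 (fun k _ _ => g0 k x).
 apply: le_trans.
 by rewrite big_nat_recr//= leeDr// sume_ge0.
rewrite -(fineK sx) lee_fin => h.
by rewrite exprVn ler_pdivlMr ?exprn_gt0// mulrC.
Qed.

(** Fatou's lemma in the form used for norm limits: the bound is asked only up to [e] and for large
    [n], and integrability of the limit is part of the conclusion. *)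
Lemma it_fatou a b (f : nat -> R -> R) (g : R -> R) (M : R) :
 (forall n, ig a b (f n)) -> (forall n x, 0 <= f n x) ->
 mfn a b g ->
 aeon a b (fun x => f ^~ x @ \oo --> g x) ->
 (forall e, 0 < e -> exists N : nat, forall n, (N <= n)%N -> it a b (f n) <= M + e) ->
 ig a b g /\ it a b g <= M.
Proof.
move=> If f0 mg fg fM.
have g0 : aeon a b (fun x => 0 <= g x).
 apply: aeonS fg => x _ cv; rewrite -(cvg_lim _ cv)//.
 by apply: limr_ge; [apply/cvg_ex; exists (g x)|near=> n; exact: f0].
have gM : (\int[mu]_(x in `]a, b[) (g x)%:E <= M%:E)%E.
 have -> : (\int[mu]_(x in `]a, b[) (g x)%:E =
   \int[mu]_(x in `]a, b[) limn_einf (fun n => (f n x)%:E))%E.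
  apply: integral_ae_congr; apply: aeonS fg => x _ cv.
  have : (fun n => (f n x)%:E) @ \oo --> (g x)%:E by apply: cvg_EFin => //; apply: nearW.
  by move=> /cvg_limn_einf_sup[-> _].
 apply: le_trans (fatou mu (mitv a b) _ _) _ => //=.
 - by move=> n; apply/measurable_EFinP; exact: ig_mf.
 - by move=> n x _; rewrite lee_fin.
 apply/lee_addgt0Pr => e e0; have [N hN] := fM e e0.
 rewrite limn_einf_lim; apply: lime_le; first exact: is_cvg_einfs.
 apply: nearW => n; apply: ge_ereal_inf.
 (* An index that lies both in the tail from [n] and beyond [N]; the infimum over the tail is at
    most the corresponding integral. *)
 exists (\int[mu]_(x in `]a, b[) (f (maxn n N) x)%:E)%E.
  by exists (maxn n N) => //=; rewrite leq_maxl.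
 by rewrite -EFin_it// -EFinD lee_fin; apply: hN; rewrite leq_maxr.
have Ig : ig a b g.
 apply/igP; split=> //; apply: le_lt_trans (ltry M); apply: le_trans gM.
 rewrite le_eqVlt; apply/orP; left; apply/eqP; apply: integral_ae_congr.
 by apply: aeonS g0 => x _ gx; rewrite ger0_norm.
by split=> //; rewrite -lee_fin EFin_it.
Unshelve. all: by end_near. Qed.

Lemma it_pos a b f : (forall x, 0 <= f x) -> 0 <= it a b f.
Proof. by move=> h; apply: it_ge0; exact: aeonW. Qed.

End IntervalIntegral.
#[export] Hint Resolve mitv : core.

(** * The space L^2 *)

Section L2.
Context {R : realType}.
Notation mu := (@lebesgue_measure R).
Implicit Types (a b c x : R) (f g F : R -> R).

Lemma L2normE a b f :
 (L2norm a b f = (\int[mu]_(x in `]a, b[) (f x ^+ 2)%:E) `^ 2^-1)%E.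
Proof.
rewrite /L2norm unlock; congr (_ `^ _)%E.
rewrite [RHS]integral_mkcond; apply: eq_integral => x _ /=.
rewrite /patch; case: ifPn => _ /=; last by rewrite normr0 powR0.
by rewrite powR_mulrn// real_normK ?num_real.
Qed.

Lemma mfn_restrict a b f :
 @measurable_fun _ _ (measurableTypeR R) R setT (f \_ `]a, b[) <-> mfn a b f.
Proof. by rewrite -measurable_restrictT//; exact: mitv. Qed.

Lemma L2P a b f : L2 a b f <-> mfn a b f /\ ig a b (fun x => f x ^+ 2).
Proof.
split.
- move=> /[dup] Lf; rewrite /L2 inE => /andP[]; rewrite !inE/= => mf nf.
 have mf' : mfn a b f by apply/mfn_restrict.
 split=> //; apply/igP; split; first exact: measurable_funX.
 under eq_integral => x _ do rewrite ger0_norm ?sqr_ge0//.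
 move: nf; rewrite /finite_norm -/(L2norm a b f) L2normE => nf.
 by apply: (@lty_poweRy _ _ 2^-1).
- move=> [mf fi]; rewrite /L2 inE; apply/andP; split; rewrite inE/=.
  exact/mfn_restrict.
 rewrite /finite_norm -/(L2norm a b f) L2normE -EFin_it// poweR_EFin.
 exact: ltry.
Qed.

Lemma L2_mfn a b f : L2 a b f -> mfn a b f. Proof. by move=> /L2P[]. Qed.

Lemma L2_igsqr a b f : L2 a b f -> ig a b (fun x => f x ^+ 2).
Proof. by move=> /L2P[]. Qed.

Lemma L2_mul a b f g : L2 a b f -> L2 a b g -> ig a b (fun x => f x * g x).
Proof.
move=> /L2P[mf If] /L2P[mg Ig]; apply: (ig_le _ _ (igD If Ig)).
 exact: measurable_funM.
apply: aeonW => x _; rewrite normrM.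
have := sqr_ge0 (`|f x| - `|g x|); rewrite sqrrB !real_normK ?num_real//.
have := sqr_ge0 (f x); have := sqr_ge0 (g x); lra.
Qed.

Lemma L2_bounded a b f (K : R) : mfn a b f -> aeon a b (fun x => `|f x| <= K) -> L2 a b f.
Proof.
move=> mf fK; apply/L2P; split=> //; apply: (ig_le _ _ (ig_cst a b (K ^+ 2))).
 exact: measurable_funX.
apply: aeonS fK => x _ h; rewrite ger0_norm ?sqr_ge0// -(real_normK (num_real (f x))).
by rewrite ler_sqr ?nnegrE ?(le_trans _ h).
Qed.

Lemma L2_cont a b f : {within `[a, b], continuous f} -> L2 a b f.
Proof.
move=> cf; apply/L2P; split; first exact: ig_mf (ig_cont cf).
have -> : (fun x => f x ^+ 2) = f * f by apply/funext => x; rewrite fctE expr2.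
by apply: ig_cont => x; apply: continuousM; exact: cf.
Qed.

Lemma L2_continuous a b f : continuous f -> L2 a b f.
Proof. by move=> cf; apply: L2_cont; exact: continuous_subspaceT. Qed.

Lemma L2_cst a b (k : R) : L2 a b (fun=> k).
Proof. by apply: L2_continuous => x; exact: cvg_cst. Qed.

Lemma L2_ig a b f : L2 a b f -> ig a b f.
Proof.
move=> Lf; apply: ig_eq (L2_mul Lf (L2_cst a b 1)) => x _ /=; exact: mulr1.
Qed.

Lemma L2D a b f g : L2 a b f -> L2 a b g -> L2 a b (f + g).
Proof.
move=> Lf Lg; have [mf If] := (L2P _ _ _).1 Lf; have [mg Ig] := (L2P _ _ _).1 Lg.
apply/L2P; split; first exact: measurable_funD.
apply: ig_eq (igD (igD If (igZ 2 (L2_mul Lf Lg))) Ig) => x _ /=.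
by rewrite fctE; ring.
Qed.

Lemma L2Z a b (k : R) f : L2 a b f -> L2 a b (k *: f).
Proof.
move=> Lf; have [mf If] := (L2P _ _ _).1 Lf.
apply/L2P; split.
 by apply: (@measurable_funM _ (measurableTypeR R) R _ (cst k)) => //; exact: measurable_cst.
apply: ig_eq (igZ (k ^+ 2) If) => x _ /=; rewrite /GRing.scale/= /GRing.scale/=; ring.
Qed.

Lemma L2_mulb a b f g (K : R) : L2 a b f -> mfn a b g ->
 aeon a b (fun x => `|g x| <= K) -> L2 a b (fun x => g x * f x).
Proof.
move=> /L2P[mf If] mg gK; apply/L2P; split; first exact: measurable_funM.
apply: (ig_le _ _ (igZ (K ^+ 2) If)).
 by apply: measurable_funX; exact: measurable_funM.
apply: aeonS gK => x _ h; rewrite ger0_norm ?sqr_ge0// exprMn.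
apply: ler_wpM2r; first exact: sqr_ge0.
rewrite -(real_normK (num_real (g x))).
by rewrite ler_sqr ?nnegrE ?(le_trans _ h).
Qed.

Lemma L2_ae a b f g : mfn a b g -> aeon a b (fun x => f x = g x) -> L2 a b f -> L2 a b g.
Proof.
move=> mg fg /L2P[mf If]; apply/L2P; split=> //; apply: (ig_ae _ _ If).
 exact: measurable_funX.
by apply: aeonS fg => x _ ->.
Qed.

Lemma L2_sub a b c d f : a <= c -> d <= b -> L2 a b f -> L2 c d f.
Proof.
move=> ac db /L2P[mf If]; apply/L2P; split; last exact: ig_sub If.
by apply: measurable_funS mf => //; apply: subset_itv; rewrite bnd_simp.
Qed.

Lemma L2inner_def a b f g : L2inner a b f g = it a b (fun x => f x * g x).
Proof. by []. Qed.

Section instance.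
Variables a b : R.

Let i0 : L2 a b (0 : R -> R). Proof. exact: L2_cst. Qed.

Let iC f g : L2inner a b f g = L2inner a b g f.
Proof. by apply: it_eq => x _; exact: mulrC. Qed.

Let iD f g h : L2 a b f -> L2 a b g -> L2 a b h ->
 L2inner a b (f + g) h = L2inner a b f h + L2inner a b g h.
Proof.
move=> Lf Lg Lh; rewrite !L2inner_def -itD; try exact: L2_mul.
by apply: it_eq => x _; exact: mulrDl.
Qed.

Let iZ (k : R) f h : L2 a b f -> L2 a b h ->
 L2inner a b (k *: f) h = k * L2inner a b f h.
Proof.
move=> Lf Lh; rewrite !L2inner_def -itZ; last exact: L2_mul.
by apply: it_eq => x _; rewrite mulrA.
Qed.

Let ip_pos f : 0 <= L2inner a b f f.
Proof. by apply: it_pos => x; rewrite -expr2 sqr_ge0. Qed.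

Definition L2ip : semi_ip (R -> R) :=
 SemiIP i0 (@L2D a b) (@L2Z a b) iC iD iZ ip_pos.

End instance.

Definition nL a b f := nrm (L2ip a b) f.

Lemma L2norm_nL a b f : L2 a b f -> L2norm a b f = (nL a b f)%:E.
Proof.
move=> Lf; rewrite L2normE -EFin_it; last exact: L2_igsqr.
rewrite poweR_EFin /nL /nrm/= L2inner_def powR12_sqrt; last first.
 by apply: it_pos => x; exact: sqr_ge0.
by congr (Num.sqrt _)%:E; apply: it_eq => x _.
Qed.

Lemma L2B a b f g : L2 a b f -> L2 a b g -> L2 a b (f - g). Proof. exact: (@domB _ _ (L2ip a b)). Qed.

Lemma nL_triangle a b g f h : L2 a b f -> L2 a b g -> L2 a b h -> nL a b (f - h) <= nL a b (f - g) + nL a b (g - h).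
Proof. exact: (@nrm_triangle _ _ (L2ip a b)). Qed.

Lemma nL_distC a b f g : L2 a b f -> L2 a b g -> nL a b (f - g) = nL a b (g - f).
Proof. exact: (@nrm_distC _ _ (L2ip a b)). Qed.

Lemma nL_ge0 a b f : 0 <= nL a b f. Proof. exact: nrm_ge0. Qed.

Lemma sqr_nL a b f : nL a b f ^+ 2 = it a b (fun x => f x ^+ 2).
Proof. by rewrite sqr_nrm. Qed.

Lemma nL_le a b f (K : R) : 0 <= K -> it a b (fun x => f x ^+ 2) <= K ^+ 2 -> nL a b f <= K.
Proof. by move=> K0 h; rewrite -ler_sqr ?nnegrE ?nL_ge0// sqr_nL. Qed.

Lemma nL_ae a b f g : aeon a b (fun x => f x = g x) -> nL a b f = nL a b g.
Proof.
move=> fg; rewrite /nL /nrm/=; congr Num.sqrt; apply: it_ae.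
by apply: aeonS fg => x _ ->.
Qed.

Lemma L2inner_ae a b f f' g g' : aeon a b (fun x => f x = f' x) ->
 aeon a b (fun x => g x = g' x) -> L2inner a b f g = L2inner a b f' g'.
Proof. by move=> h h'; apply: it_ae; apply: aeonS2 h h' => x _ -> ->. Qed.

Lemma nL_sub a b c d f : a <= c -> d <= b -> L2 a b f -> nL c d f <= nL a b f.
Proof.
move=> ac db Lf; apply: nL_le; first exact: nL_ge0.
rewrite sqr_nL; apply: it_sub_le => //; first exact: L2_igsqr.
by apply: aeonW => x _; exact: sqr_ge0.
Qed.

Lemma nL_le_bound a b f (K : R) : a <= b -> L2 a b f -> 0 <= K ->
 aeon a b (fun x => `|f x| <= K) -> nL a b f <= K * Num.sqrt (b - a).
Proof.
move=> ab Lf K0 h; apply: nL_le; first by rewrite mulr_ge0 ?sqrtr_ge0.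
rewrite exprMn sqr_sqrtr ?subr_ge0// -it_cst//; apply: it_le.
- exact: L2_igsqr.
- exact: ig_cst.
apply: aeonS h => x _ h; rewrite -(real_normK (num_real (f x))).
by rewrite ler_sqr ?nnegrE ?(le_trans _ h).
Qed.

Lemma nL_mono a b f g : L2 a b f -> L2 a b g ->
 aeon a b (fun x => `|f x| <= `|g x|) -> nL a b f <= nL a b g.
Proof.
move=> Lf Lg h; apply: nL_le; first exact: nL_ge0.
rewrite sqr_nL; apply: it_le; [exact: L2_igsqr|exact: L2_igsqr|].
apply: aeonS h => x _ h; rewrite -(real_normK (num_real (f x))).
by rewrite -(real_normK (num_real (g x))) ler_sqr ?nnegrE.
Qed.

Lemma it_norm_le a b f : a <= b -> L2 a b f ->
 it a b (fun x => `|f x|) <= Num.sqrt (b - a) * nL a b f.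
Proof.
move=> ab Lf; have Lf' : L2 a b (fun x => `|f x|).
 have [mf If] := (L2P _ _ _).1 Lf; apply/L2P; split; first exact: measurableT_comp.
 by apply: ig_eq If => x _ /=; rewrite real_normK ?num_real.
have := @ip_le _ _ (L2ip a b) (fun=> 1) _ (L2_cst a b 1) Lf'.
rewrite /= L2inner_def; under [X in it _ _ X]eq_fun do rewrite mul1r.
move=> /le_trans; apply; rewrite [X in _ * X](_ : _ = nL a b f); last first.
 rewrite /nL /nrm/=; congr Num.sqrt; apply: it_eq => x _ /=.
 by rewrite -!expr2 real_normK ?num_real.
apply: ler_wpM2r; first exact: nL_ge0.
rewrite /nrm/= L2inner_def; under [X in it _ _ X]eq_fun do rewrite mulr1.
by rewrite it_cst// mul1r.
Qed.

Lemma nL0_ae a b f : L2 a b f -> nL a b f = 0 -> aeon a b (fun x => f x = 0).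
Proof.
move=> Lf f0; have : it a b (fun x => f x ^+ 2) = 0 by rewrite -sqr_nL f0 expr0n.
move/(it_eq0_ae (L2_igsqr Lf)) => h.
have /h {}h : aeon a b (fun x => 0 <= f x ^+ 2) by apply: aeonW => x _; exact: sqr_ge0.
by apply: aeonS h => x _ /eqP; rewrite sqrf_eq0 => /eqP.
Qed.

Lemma nL_eq0_aeeq a b f g : L2 a b f -> L2 a b g -> nL a b (f - g) = 0 ->
 ae_eq_on a b f g.
Proof.
move=> Lf Lg /nL0_ae h; have /h : L2 a b (f - g) by apply: (@domB _ _ (L2ip a b)).
by apply: aeonS => x _ /eqP; rewrite subr_eq0 => /eqP.
Qed.

(** The sequence is set to zero on a measurable null set containing the points of divergence; it
    then converges at every point of the interval and its limit is measurable. *)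
Lemma ae_cvg_mfn a b (f : nat -> R -> R) : (forall n, mfn a b (f n)) ->
 aeon a b (fun x => exists l : R, f ^~ x @ \oo --> l) ->
 exists2 g : R -> R, mfn a b g & aeon a b (fun x => f ^~ x @ \oo --> g x).
Proof.
move=> mf [N [mN N0 hN]].
have hx x : x \in `]a, b[ -> ~ N x -> exists l : R, f ^~ x @ \oo --> l.
 by move=> xab; apply: contra_notP => nx; apply: hN => /= /(_ xab).
pose h n := f n \_ (~` N).
have mNC : @measurable _ (measurableTypeR R) (~` N) by exact: measurableC.
have mh n : mfn a b (h n).
 apply/(measurable_restrict _ mNC (mitv a b)).
 by apply: measurable_funS (mf n); [exact: mitv|move=> x []].
have ch x : x \in `]a, b[ -> exists l : R, h ^~ x @ \oo --> l.
 move=> xab; have [Nx|Nx] := pselect (N x).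
  exists 0; rewrite (_ : h ^~ x = cst 0); first exact: cvg_cst.
  by apply/funext => n; rewrite /h /patch memNset// => /(_ Nx).
 rewrite (_ : h ^~ x = f ^~ x); first exact: hx.
 by apply/funext => n; rewrite /h /patch mem_set.
pose g x := lim (h ^~ x @ \oo).
exists g.
 apply: (measurable_fun_cvg mh) => x xab.
 by have [l hl] := ch x xab; apply/cvg_ex; exists l.
exists N; split => // x /= nx; apply: contrapT => Nx; apply: nx => xab.
have [l hl] := hx x xab Nx; rewrite /g (_ : h ^~ x = f ^~ x).
 by rewrite (cvg_lim _ hl).
by apply/funext => n; rewrite /h /patch mem_set.
Qed.

Lemma geometric_cvg (u : nat -> R) (K q : R) : 0 <= K -> 0 <= q -> q < 1 ->
 (forall n, `|u n.+1 - u n| <= K * q ^+ n) -> exists l : R, u @ \oo --> l.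
Proof.
move=> K0 q0 q1 hu.
have step n k : `|u (n + k)%N - u n| <= K / (1 - q) * q ^+ n.
 have : `|u (n + k)%N - u n| <= K / (1 - q) * q ^+ n * (1 - q ^+ k).
  elim: k => [|k IH]; first by rewrite addn0 subrr normr0 expr0 subrr mulr0.
  rewrite addnS -(subrKA (u (n + k)%N)); apply: (le_trans (ler_normD _ _)).
  apply: (le_trans (lerD (hu _) IH)).
  by rewrite exprD exprS; apply: ler_eq; field; lra.
 move=> /le_trans; apply; apply: ler_piMr.
  by apply: mulr_ge0; [apply: divr_ge0; lra|exact: exprn_ge0].
 by have := exprn_ge0 k q0; lra.
suff : cvgn u by move=> /cvg_ex.
apply: cauchy_cvg; apply: cauchy_exP => e e0.
have [N hN] := null_geo (K / (1 - q)) q0 q1 (divr_gt0 e0 (ltr0n R 2)).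
exists (u N), N => // n /= Nn; rewrite /ball/= distrC -(subnKC Nn).
by apply: (le_lt_trans (step _ _)); have := hN N (leqnn N); lra.
Qed.

Lemma fast_subsequence (V : Type) (d : V -> V -> R) (u : nat -> V) (r : nat -> R) :
 cauchy_for d u -> (forall n, 0 < r n) ->
 exists s : nat -> nat, (forall n, (n <= s n)%N) /\ (forall n, (s n <= s n.+1)%N) /\
  forall n m, (s n <= m)%N -> d (u m) (u (s n)) <= r n.
Proof.
move=> cu r0; have /choice[N hN] n := cu _ (r0 n).
(* Cumulative sums make the indices nondecreasing, at least [n], and above the threshold [N n], all
   at once. *)
exists (fun n => \sum_(k < n.+1) (N k).+1)%N; split; last split.
- by elim=> // n IH; rewrite big_ord_recr/= (leq_ltn_trans IH)// -addn1 leq_add.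
- by move=> n; rewrite [in leqRHS]big_ord_recr/= leq_addr.
- move=> n m; rewrite big_ord_recr/= => h; apply: hN.
  by apply: leq_trans h; rewrite (leq_trans (leqnSn _))// leq_addl.
 by rewrite (leq_trans (leqnSn _))// leq_addl.
Qed.

(** The ratio [3 / 4] serves because its square exceeds [2^-1]: the differences are dominated by a
    geometric sequence with rational ratio. *)
Lemma decay_step (u : nat -> R) (K : R) :
 (forall n, (u n.+1 - u n) ^+ 2 <= K * (2^-1) ^+ n) -> exists l : R, u @ \oo --> l.
Proof.
move=> h; have K0 : 0 <= K by have := h 0%N; rewrite expr0 mulr1; apply: le_trans; exact: sqr_ge0.
have q0 : 0 <= 3 / 4 :> R by lra.
have q1 : 3 / 4 < 1 :> R by lra.
apply: (geometric_cvg (sqrtr_ge0 K) q0 q1) => n.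
rewrite -ler_sqr ?nnegrE ?mulr_ge0 ?sqrtr_ge0 ?exprn_ge0//.
rewrite real_normK ?num_real// exprMn sqr_sqrtr//; apply: (le_trans (h n)).
apply: ler_wpM2l => //; rewrite -exprM mulnC exprM.
by apply: lerXn2r; rewrite ?nnegrE; lra.
Qed.

(** Riesz-Fischer: a subsequence with geometrically decaying steps converges almost everywhere, and
    Fatou's lemma shows that the whole sequence converges to that limit in norm. *)
Lemma L2_complete a b (f : nat -> R -> R) : (forall n, L2 a b (f n)) ->
 cauchy_for (fun u v => nL a b (u - v)) f ->
 exists2 g, L2 a b g & cvg_for (fun u v => nL a b (u - v)) f g.
Proof.
move=> Lf cf; have LB u v : L2 a b u -> L2 a b v -> L2 a b (u - v).
 exact: (@domB _ _ (L2ip a b)).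
have r0 n : 0 < (2^-1 : R) ^+ n by rewrite exprn_gt0.
have [s [s1 [s2 hs]]] := fast_subsequence cf r0.
have [g mg hg] : exists2 g : R -> R, mfn a b g & aeon a b (fun x => f (s n) x @[n --> \oo] --> g x).
 apply: ae_cvg_mfn; first by move=> n; exact: L2_mfn.
 have : aeon a b (fun x => exists K : R, forall n,
   (f (s n.+1) x - f (s n) x) ^+ 2 <= K * (2^-1) ^+ n).
  apply: (@ae_geometric_decay _ _ _ _ 1) => //.
  - by move=> n; apply: (L2_igsqr (LB _ _ (Lf _) (Lf _))).
  - by move=> n x; exact: sqr_ge0.
  - move=> n; rewrite mul1r -(sqr_nL _ _ (f (s n.+1) - f (s n))).
   rewrite (_ : 4^-1 = 2^-1 ^+ 2 :> R); last by field.
   rewrite -exprM mulnC exprM ler_sqr ?nnegrE ?nL_ge0 ?(ltW (r0 n))//.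
   exact: hs.
 by apply: aeonS => x _ [K hK]; exact: decay_step hK.
(* Fatou for the squares of [f (s n) - f m] gives at once that [g - f m] is in L^2 and that its norm
   is at most [e]. *)
have key m e : 0 < e -> (forall n, (m <= n)%N -> nL a b (f n - f m) <= e) ->
  L2 a b (g - f m) /\ nL a b (g - f m) <= e.
 move=> e0 he.
 have [] := @it_fatou _ a b (fun n x => (f (s n) x - f m x) ^+ 2)
  (fun x => (g x - f m x) ^+ 2) (e ^+ 2).
 - by move=> n; apply: (L2_igsqr (LB _ _ (Lf _) (Lf _))).
 - by move=> n x; exact: sqr_ge0.
 - by apply: measurable_funX; apply: measurable_funB => //; exact: L2_mfn.
 - apply: aeonS hg => x _ h.
  apply: cvg_sqr.
  by apply: cvgB => //; exact: cvg_cst.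
 - move=> e' e'0; exists m => n mn.
  rewrite -(sqr_nL _ _ (f (s n) - f m)) (@le_trans _ _ (e ^+ 2))//; last lra.
  by rewrite ler_sqr ?nnegrE ?nL_ge0 ?(ltW e0)//; apply: he; exact: leq_trans mn (s1 n).
 move=> i1 i2; split; first by apply/L2P; split=> //; apply: measurable_funB => //; exact: L2_mfn.
 by apply: nL_le => //; exact: ltW.
have Lg : L2 a b g.
 have [N hN] := cf 1 ltr01.
 have [|h _] := key N 1 ltr01; first by move=> n Nn; apply: hN.
 by rewrite -(subrK (f N) g); apply: L2D.
exists g => // e e0; have [N hN] := cf e e0; exists N => n Nn.
rewrite /nL (nrm_distC (S := L2ip a b) (Lf n) Lg).
have [|_] := key n e e0; last by [].
by move=> m nm; apply: hN => //; exact: leq_trans nm.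
Qed.

End L2.

(** * Density of polynomials *)

Section Polynomials.
Context {R : realType}.
Notation mu := (@lebesgue_measure R).
Implicit Types (a b c x : R) (f g F : R -> R) (p q : {poly R}).

Lemma it_dominated a b (f : nat -> R -> R) (g h : R -> R) :
 (forall n, mfn a b (f n)) -> ig a b h ->
 aeon a b (fun x => f ^~ x @ \oo --> g x) ->
 (forall n, aeon a b (fun x => `|f n x| <= h x)) -> mfn a b g ->
 null (fun n => `|it a b (f n) - it a b g|).
Proof.
move=> mf Ih fg fh mg.
have := @dominated_convergence _ _ _ mu `]a, b[ (mitv a b) (fun n => EFin \o f n)
 (EFin \o g) (EFin \o h).
case.
- by move=> n; apply/measurable_EFinP.
- exact/measurable_EFinP.
- rewrite /aeon in fg; apply: (@filterS _ _ ae_filter _ _ _ fg) => x /= hx xab.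
 by apply: cvg_EFin; [exact: nearW|exact: hx].
- exact: Ih.
- have {}fh := aeon_all fh; rewrite /aeon in fh.
 apply: (@filterS _ _ ae_filter _ _ _ fh) => x /= hx n xab.
 by rewrite lee_fin; exact: hx.
move=> Ig _ cv e e0.
have If n : ig a b (f n) by exact: (ig_le (mf n) (fh n) Ih).
have /cvgrPdist_le/(_ _ e0)[N _ hN] : (fun n => it a b (f n)) @ \oo --> it a b g.
 exact: (fine_cvg (fine_cvgP.2 _)) || (apply: fine_cvg; rewrite /= fineK ?integrable_fin_num//; exact: cv).
by exists N => n /hN; rewrite distrC.
Qed.

Lemma it_poly a b p q : a <= b -> q^`() = p -> it a b (horner p) = q.[b] - q.[a].
Proof.
move=> ab <-; apply: FTC_cont => //; exact: continuous_horner.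
Qed.

Lemma L2_poly a b p : L2 a b (horner p).
Proof. by apply: L2_continuous; exact: continuous_horner. Qed.

Lemma hornerf_lin (k : R) p q : horner (k *: p + q) = k *: horner p + horner q.
Proof. by apply/funext => x; rewrite hornerD hornerZ. Qed.

Lemma hornerfD p q : horner (p + q) = horner p + horner q.
Proof. by apply/funext => x; rewrite hornerD. Qed.

Lemma hornerfB p q : horner (p - q) = horner p - horner q.
Proof. by apply/funext => x; rewrite hornerD hornerN. Qed.

Lemma hornerfZ (k : R) p : horner (k *: p) = k *: horner p.
Proof. by apply/funext => x; rewrite hornerZ. Qed.

(* Bernstein's operator without binomials: conditioning on the first of [n]
 independent Bernoulli trials of parameter ['X]. *)
Fixpoint bernstein (n : nat) (f : nat -> R) : {poly R} :=
 if n is m.+1 then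
  'X * bernstein m (fun k => f k.+1) + (1 - 'X) * bernstein m f
 else (f 0%N)%:P.

Lemma bernstein_le n (f g : nat -> R) x : 0 <= x -> x <= 1 ->
 (forall k, (k <= n)%N -> f k <= g k) -> (bernstein n f).[x] <= (bernstein n g).[x].
Proof.
move=> x0 x1; elim: n f g => [|n IH] f g fg /=; first by rewrite !hornerC fg.
rewrite !hornerE; apply: lerD; apply: ler_wpM2l => //; rewrite ?subr_ge0//.
 by apply: IH => k kn; exact: fg.
by apply: IH => k kn; apply: fg; exact: leqW.
Qed.

Lemma bernstein_affine n (c d : R) (f : nat -> R) x :
 (bernstein n (fun k => c + d * f k)).[x] = c + d * (bernstein n f).[x].
Proof.
elim: n f => [|n IH] f /=; first by rewrite !hornerC.
by rewrite !hornerE (IH (fun k => f k.+1)) IH; ring.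
Qed.

(** The second moment of the binomial law about an arbitrary centre; [c] is free because
    conditioning on the first trial shifts the centre by one. *)
Lemma bernstein_var n c x : (bernstein n (fun k => (k%:R - c) ^+ 2)).[x] =
 (n%:R * x - c) ^+ 2 + n%:R * x * (1 - x).
Proof.
elim: n c => [|n IH] c /=; first by rewrite hornerC; ring.
rewrite !hornerE IH.
have -> : (fun k : nat => (k.+1%:R - c) ^+ 2) = (fun k : nat => (k%:R - (c - 1)) ^+ 2).
 by apply/funext => k; rewrite -natr1; ring.
by rewrite IH -natr1; ring.
Qed.

Lemma bernstein_bound n (f : nat -> R) x (M : R) : 0 <= x -> x <= 1 ->
 (forall k, (k <= n)%N -> `|f k| <= M) -> `|(bernstein n f).[x]| <= M.
Proof.
move=> x0 x1 fM.
have c (d : R) : (bernstein n (fun=> d)).[x] = d by elim: n {fM} => [|n IH] /=; rewrite ?hornerC// !hornerE IH; ring.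
rewrite ler_norml -{1}(c (- M)) -{2}(c M); apply/andP; split;
 by apply: bernstein_le => // k /fM; rewrite ler_norml => /andP[].
Qed.

(** Chebyshev's argument: continuity is used near [x], and away from it a quadratic majorant, whose
    Bernstein polynomial is a variance of order [1 / n]. *)
Lemma bernstein_cvg (h : R -> R) (M x : R) : 0 <= x -> x <= 1 ->
 (forall y, 0 <= y -> y <= 1 -> `|h y| <= M) -> {for x, continuous h} ->
 (bernstein n.+1 (fun k => h (k%:R / n.+1%:R))).[x] @[n --> \oo] --> h x.
Proof.
move=> x0 x1 hM hc; apply/cvgrPdist_le => e e0.
have e2 : 0 < e / 2 by lra.
have /cvgrPdist_le/(_ _ e2)[d d0 hd] : h @ x --> h x by exact: hc.
rewrite /= in d0 hd.
have M0 : 0 <= M by apply: le_trans (hM x x0 x1).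
(* With this [K], the crude bound [2 * M] is at most [K * (y - x) ^+ 2] as soon as y is at distance
   at least [d] from x. *)
pose K := 2 * M / d ^+ 2.
have K0 : 0 <= K by rewrite /K; apply: divr_ge0; [exact: mulr_ge0|exact: sqr_ge0].
have bd y : 0 <= y -> y <= 1 -> `|h y - h x| <= e / 2 + K * (y - x) ^+ 2.
 move=> y0 y1; have [yx|yx] := ltP `|x - y| d.
  rewrite distrC; apply: (le_trans (hd y yx)).
  by rewrite lerDl mulr_ge0// sqr_ge0.
 apply: (@le_trans _ _ (2 * M)).
  by apply: (le_trans (ler_normB _ _)); have := hM _ y0 y1; have := hM _ x0 x1; lra.
 apply: (@le_trans _ _ (K * (y - x) ^+ 2)); last by rewrite lerDr; lra.
 rewrite /K mulrAC ler_pdivlMr ?exprn_gt0// ler_wpM2l//; first lra.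
 by rewrite -(real_normK (num_real (y - x))) distrC ler_sqr ?nnegrE// ltW.
have K1 : 0 < K + 1 by lra.
have [N hN] := null_harmonic (divr_gt0 e2 K1).
exists N => // n /hN h1; set m := n.+1 in h1 *.
have m0 : 0 < m%:R :> R by rewrite ltr0n.
pose b k := h (k%:R / m%:R) - h x.
have kin k : (k <= m)%N -> 0 <= k%:R / m%:R :> R /\ k%:R / m%:R <= 1 :> R.
 by move=> km; split; [rewrite divr_ge0|rewrite ler_pdivrMr// mul1r ler_nat].
have up : (bernstein m (fun k => e / 2 + K / m%:R ^+ 2 * (k%:R - m%:R * x) ^+ 2)).[x] <= e.
 rewrite bernstein_affine bernstein_var subrr expr0n/= add0r.
 have -> : K / m%:R ^+ 2 * (m%:R * x * (1 - x)) = K * (x * (1 - x)) * m%:R^-1 by field; rewrite gt_eqF.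
 have : x * (1 - x) <= 1 by nra.
 have : 0 <= x * (1 - x) by nra.
 move: h1; rewrite ler_pdivlMr; last lra.
 have := invr_gt0 (m%:R : R); rewrite m0 => mi.
 move=> h1 xx0 xx1.
 have : K * (x * (1 - x)) * m%:R^-1 <= K * 1 * m%:R^-1 by apply: ler_wpM2r; [exact: ltW|exact: ler_wpM2l].
 nra.
have bk k : (k <= m)%N -> `|b k| <= e / 2 + K / m%:R ^+ 2 * (k%:R - m%:R * x) ^+ 2.
 move=> /kin[k0 k1]; apply: (le_trans (bd _ k0 k1)).
 rewrite lerD2l; apply: ler_eq; field.
 by rewrite gt_eqF.
have -> : h x - (bernstein m (fun k => h (k%:R / m%:R))).[x] = - (bernstein m b).[x].
 have -> : b = (fun k => - h x + 1 * h (k%:R / m%:R)) by apply/funext => k; rewrite /b; ring.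
 by rewrite bernstein_affine; ring.
rewrite normrN ler_norml; apply/andP; split.
 rewrite lerNl; apply: le_trans up; rewrite -[X in X <= _]add0r -[X in _ + X]mulN1r.
 rewrite -(bernstein_affine m 0 (-1) b); apply: bernstein_le => // k /bk.
 by rewrite ler_norml add0r mulN1r lerNl => /andP[].
by apply: le_trans up; apply: bernstein_le => // k /bk; rewrite ler_norml => /andP[].
Qed.

Lemma continuous_bounded a b f : continuous f -> exists2 M : R, 0 <= M &
 forall x, a <= x -> x <= b -> `|f x| <= M.
Proof.
move=> cf; have [ab|ba] := leP a b; last by exists 0 => // x ax xb; lra.
have cn : {within `[a, b], continuous (fun x => `|f x|)}.
 apply: continuous_subspaceT => x; apply: (@continuous_comp _ _ _ f (@Num.norm _ R)).
  exact: cf.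
 exact: norm_continuous.
have [c cab hc] := EVT_max ab cn.
exists `|f c| => // x ax xb; apply: hc.
by rewrite in_itv/= ax xb.
Qed.

Lemma nL_dominated a b (f : nat -> R -> R) (g h : R -> R) :
 (forall n, mfn a b (f n)) -> L2 a b h -> mfn a b g ->
 aeon a b (fun x => f ^~ x @ \oo --> g x) ->
 (forall n, aeon a b (fun x => `|f n x - g x| <= h x)) ->
 null (fun n => nL a b (f n - g)).
Proof.
move=> mf Lh mg fg fh.
have : null (fun n => `|it a b (fun x => (f n x - g x) ^+ 2) - it a b (fun=> 0)|).
 apply: (@it_dominated _ _ _ _ (fun x => h x ^+ 2)).
 - by move=> n; apply: measurable_funX; exact: measurable_funB.
 - exact: L2_igsqr.
 - apply: aeonS fg => x _ cv.
  rewrite -(_ : (g x - g x) ^+ 2 = 0); last by rewrite subrr expr0n.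
  apply: cvg_sqr.
  by apply: cvgB => //; exact: cvg_cst.
 - move=> n; apply: aeonS (fh n) => x _ hx.
  rewrite ger0_norm ?sqr_ge0// -(real_normK (num_real (f n x - g x))).
  by rewrite ler_sqr ?nnegrE ?(le_trans _ hx).
 - exact: measurable_cst.
move=> h0; have : null (fun n => it a b (fun x => (f n x - g x) ^+ 2)).
 by apply: (null_le h0) => n; rewrite it0 subr0 ler_norm.
move=> /null_sqrt; apply => n.
by apply: it_pos => x; exact: sqr_ge0.
Qed.

Definition clip (M x : R) := Num.max (- M) (Num.min M x).

Lemma clip_bound M x : 0 <= M -> `|clip M x| <= M.
Proof.
move=> M0; rewrite /clip ler_norml le_max lexx/= ge_max ge_min lexx/= andbT; lra.
Qed.

Lemma clip_id M x : `|x| <= M -> clip M x = x.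
Proof.
by rewrite ler_norml => /andP[h1 h2]; rewrite /clip min_r// max_r.
Qed.

Lemma clip_dist M x y : `|clip M x - clip M y| <= `|x - y|.
Proof.
have A := ler_norm (x - y); have B := ler_norm (y - x); rewrite distrC in B.
rewrite /clip !maxEle !minEle ler_norml.
case: (boolP (M <= x)); rewrite -?ltNge => ?;
case: (boolP (M <= y)); rewrite -?ltNge => ?;
repeat match goal with |- context [if ?b then _ else _] =>
 case: (boolP b); rewrite -?ltNge => ? end; apply/andP; split; lra.
Qed.

Lemma clip_continuous M : continuous (clip M).
Proof.
move=> x; apply/cvgrPdist_le => e e0; near=> y.
apply: (le_trans (clip_dist _ _ _)); near: y.
exact: (cvgrPdist_le _ _).1 cvg_id e e0.
Unshelve. all: by end_near. Qed.

(** Bounded pointwise convergence of the Bernstein polynomials already gives L^2 convergence by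
    domination. The affine polynomial [s] carries []a, b[] to the unit interval. *)
Lemma continuous_poly_dense a b f (e : R) : a < b -> continuous f -> 0 < e ->
 exists p, nL a b (f - horner p) <= e.
Proof.
move=> ab cf e0; have ba : 0 < b - a by lra.
have [M M0 hM] := continuous_bounded a b cf.
pose h y := f (a + (b - a) * y).
pose s : {poly R} := (b - a)^-1 *: ('X - a%:P).
pose p n := bernstein n.+1 (fun k => h (k%:R / n.+1%:R)) \Po s.
have sx x : s.[x] = (x - a) / (b - a) by rewrite /s !hornerE mulrC.
have s01 x : x \in `]a, b[ -> 0 <= s.[x] /\ s.[x] <= 1.
 move=> /in_oo[ax xb]; rewrite sx; split.
  by apply: divr_ge0; lra.
 by rewrite ler_pdivrMr//; lra.
have hs x : h s.[x] = f x by rewrite /h sx mulrC divfK ?gt_eqF// subrKC || (rewrite /h sx; congr f; field; lra).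
have h01 y : 0 <= y -> y <= 1 -> `|h y| <= M by move=> y0 y1; apply: hM; nra.
have hc : continuous h.
 move=> y; apply: (@continuous_comp _ _ _ (fun y => a + (b - a) * y) f); last exact: cf.
 apply: cvgD; first exact: cvg_cst.
 by apply: cvgM; [exact: cvg_cst|exact: cvg_id].
have : null (fun n => nL a b (horner (p n) - f)).
 apply: (@nL_dominated _ _ _ _ (fun=> 2 * M)).
 - by move=> n; apply: L2_mfn; exact: L2_poly.
 - exact: L2_cst.
 - by apply: L2_mfn; exact: L2_continuous.
 - apply: aeonW => x xab; have [s0 s1] := s01 x xab.
  rewrite -(hs x); under eq_cvg do rewrite horner_comp.
  exact: (bernstein_cvg s0 s1 h01 (hc _)).
 - move=> n; apply: aeonW => x xab; have [s0 s1] := s01 x xab.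
  apply: (le_trans (ler_normB _ _)).
  have : `|(p n).[x]| <= M.
   rewrite horner_comp; apply: bernstein_bound => // k kn; apply: h01.
    by rewrite divr_ge0.
   by rewrite ler_pdivrMr ?ltr0n// mul1r ler_nat.
  have : `|f x| <= M by apply: hM; move: xab; move=> /in_oo[]; lra.
  lra.
move=> /(_ _ e0)[N /(_ N (leqnn N)) hN]; exists (p N).
rewrite /nL (nrm_distC (S := L2ip a b))//; first exact: L2_continuous.
exact: L2_poly.
Qed.

(** Truncation, then an L^1 approximation by continuous functions, then polynomials. Truncating the
    continuous approximant too makes L^1 closeness imply L^2 closeness. *)
Lemma poly_dense a b f (e : R) : a < b -> L2 a b f -> 0 < e ->
 exists p, nL a b (f - horner p) <= e.
Proof.
move=> ab Lf e0; have e3 : 0 < e / 3 by lra.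
have mcl n : mfn a b (fun x => clip n%:R (f x)).
 apply: measurableT_comp; last exact: L2_mfn.
 by apply: continuous_measurable_fun; exact: clip_continuous.
have : null (fun n => nL a b ((fun x => clip n%:R (f x)) - f)).
 apply: (@nL_dominated _ _ _ _ (fun x => 2 * `|f x|)) => //.
 - have [mf If] := (L2P _ _ _).1 Lf; apply/L2P; split.
   by apply: measurable_funM; [exact: measurable_cst|exact: measurableT_comp].
  by apply: ig_eq (igZ 4 If) => x _ /=; rewrite exprMn real_normK ?num_real//; ring.
 - exact: L2_mfn.
 - apply: aeonW => x _; apply/cvgrPdist_le => d d0.
  exists (Num.bound `|f x|) => // n /= hn.
  rewrite clip_id ?subrr ?normr0 ?(ltW d0)//.
  by apply: ltW; apply: (lt_le_trans (archi_boundP (normr_ge0 _))); rewrite ler_nat.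
 - move=> n; apply: aeonW => x _; apply: (le_trans (ler_normB _ _)).
  have := clip_dist n%:R (f x) 0; rewrite (_ : clip n%:R 0 = 0) ?subr0; first lra.
  by rewrite clip_id// normr0.
move=> /(_ _ e3)[N /(_ N (leqnn N))]; set fN := fun x => _ => hN.
have LfN : L2 a b fN.
 apply: (@L2_bounded _ _ _ _ N%:R); first exact: mcl.
 by apply: aeonW => x _; exact: clip_bound.
have mab : (mu `]a, b[ < +oo)%E by rewrite (lebesgue_measure_itv `]a, b[) /= lte_fin ab -EFinB ltry.
have [g [gc Ig cv]] := approximation_continuous_integrable (mitv a b) mab (L2_ig LfN).
(* Both truncated functions are bounded by [N], so the square of their difference is at most [K]
   times the L^1 integrand; the added 1 keeps [K] positive. *)
pose K := 2 * N%:R + 1 : R.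
have K0 : 0 < K by rewrite ltr_wpDl// mulr_ge0.
have [k hk] : exists k, it a b (fun x => `|fN x - g k x|) <= (e / 3) ^+ 2 / K.
 have e2 : 0 < (e / 3) ^+ 2 / K by rewrite divr_gt0// exprn_gt0.
 have /fine_cvgP[_ /cvgrPdist_le/(_ _ e2)[n _ hn]] := cv.
 by exists n; have := hn n (leqnn n); rewrite /= sub0r normrN => /(le_trans (ler_norm _)).
pose G x := clip N%:R (g k x).
have cG : continuous G.
 move=> x; apply: (@continuous_comp _ _ _ (g k) (clip N%:R)); first exact: gc.
 exact: clip_continuous.
have Iabs : ig a b (fun x => `|fN x - g k x|) by apply: ig_norm; apply: igB; [exact: L2_ig|exact: Ig].
have hG : nL a b (fN - G) <= e / 3.
 apply: nL_le; first exact: ltW.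
 apply: (@le_trans _ _ (it a b (fun x => K * `|fN x - g k x|))); last first.
  rewrite itZ//.
  by rewrite mulrC -ler_pdivlMr.
 apply: it_le.
 - by apply: L2_igsqr; apply: (@domB _ _ (L2ip a b)) => //; exact: L2_continuous.
 - exact: igZ.
 apply: aeonW => x _; rewrite -real_normK ?num_real// expr2.
 have fx : `|fN x| <= N%:R by exact: clip_bound.
 have gx : `|G x| <= N%:R by exact: clip_bound.
 apply: ler_pM => //.
  by apply: (le_trans (ler_normB _ _)); rewrite /K; lra.
 by have := clip_dist N%:R (fN x) (g k x); rewrite (clip_id fx).
have [p hp] := continuous_poly_dense ab cG e3.
exists p; have LG : L2 a b G by exact: L2_continuous.
have Lp := L2_poly a b p.
have := nrm_triangle (S := L2ip a b) Lf LfN Lp.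
have := nrm_triangle (S := L2ip a b) LfN LG Lp.
have := nrm_distC (S := L2ip a b) Lf LfN.
rewrite -!/(nL a b _); lra.
Qed.

(** The squared norm of [f] equals its product with [f] minus any polynomial, hence is at most the
    norm times an arbitrarily small number. *)
Lemma poly_orth a b f : a < b -> L2 a b f ->
 (forall p, L2inner a b f (horner p) = 0) -> aeon a b (fun x => f x = 0).
Proof.
move=> ab Lf h; apply: nL0_ae => //; apply/eqP; rewrite eq_le nL_ge0 andbT.
apply/ler_addgt0Pr => e e0; rewrite add0r.
have [p hp] := poly_dense ab Lf e0.
have Lp := L2_poly a b p.
have /(_ (nL a b f)) : forall n, n = nL a b f -> n ^+ 2 <= nL a b f * e -> n <= e.
 move=> n nE; have := nL_ge0 a b f; rewrite -nE => n0 hh.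
 have [->|np] := eqVneq n 0; first exact: ltW.
 by rewrite -(ler_pM2l (_ : 0 < n)) -?expr2// lt_def np.
apply=> //; rewrite /nL sqr_nrm -[X in X <= _]subr0 -[X in _ - X](h p).
rewrite -[X in _ - X]/(ip (L2ip a b) f (horner p)) -ipBr//.
apply: (le_trans (ip_le (S := L2ip a b) Lf (domB (S := L2ip a b) Lf Lp))).
by apply: ler_wpM2l => //; exact: nrm_ge0.
Qed.

End Polynomials.

(** * Orthogonality and density without completeness *)

Section ApproximateProjection.
Context {R : realType} {V : lmodType R} (S : semi_ip V) (W : V -> Prop).
Local Notation D := (dom S).
Local Notation N := (nrm S).
Hypotheses (W0 : W 0) (WD : forall u v, W u -> W v -> W (u + v)) (WZ : forall (k : R) u, W u -> W (k *: u)).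
Hypothesis Wdom : forall u, W u -> D u.

(** A minimising sequence for the distance from [y] to [W]. The parallelogram identity makes it
    Cauchy, and minimality up to the square of [1 / (n + 1)] gives the near orthogonality. No limit
    of the sequence is taken. *)
Lemma approx_orth y : D y -> exists w : nat -> V, [/\ forall n, W (w n),
 cauchy_for (fun u v => N (u - v)) w &
 forall n v, W v -> `|ip S (y - w n) v| <= n.+1%:R^-1 * N v].
Proof.
move=> Dy; pose A := [set r : R | exists2 w, W w & r = ip S (y - w) (y - w)].
have hA : has_inf A.
 split; first by exists (ip S (y - 0) (y - 0)), 0.
 by exists 0 => _ [w _ ->]; exact: ip_ge0.
pose d := inf A.
have dle w : W w -> d <= ip S (y - w) (y - w) by move=> Ww; apply: ge_inf; [exact: hA.2|exists w].
have i0 n : 0 < (n.+1%:R^-1 : R) by rewrite invr_gt0.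
have /choice[w hw] n : exists w, W w /\ ip S (y - w) (y - w) <= d + (n.+1%:R^-1) ^+ 2.
 have [_ [w Ww ->] h] := inf_adherent (exprn_gt0 2 (i0 n)) hA.
 by exists w; split => //; exact: ltW.
exists w; split; first by move=> n; have [] := hw n.
(* Compare with the midpoint of [w m] and [w n], which also lies in [W]. *)
- have par m n : N (w m - w n) ^+ 2 <= 2 * ((m.+1%:R^-1) ^+ 2 + (n.+1%:R^-1) ^+ 2).
  have [Wm hm] := hw m; have [Wn hn] := hw n.
  have Dm : D (y - w m) by apply: domB => //; exact: Wdom.
  have Dn : D (y - w n) by apply: domB => //; exact: Wdom.
  have := dle (2^-1 *: (w m + w n)) (WZ _ (WD Wm Wn)).
  have -> : y - 2^-1 *: (w m + w n) = 2^-1 *: ((y - w m) + (y - w n)).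
   have -> : y - w m + (y - w n) = 2%:R *: y - (w m + w n) by rewrite addrACA -opprD scaler_nat mulr2n.
   by rewrite scalerBr scalerA mulVf ?scale1r// pnatr_eq0.
  have -> : w m - w n = (y - w n) - (y - w m) by rewrite opprB [RHS]addrC subrKA.
  move: Dm Dn hm hn; move: (y - w m) (y - w n) => a b Da Db hm hn.
  rewrite sqr_nrm ip_sqrB// ipZl ?ipZr ?ip_sqrD//; do ?exact: domD; do ?exact/domZ/domD.
  rewrite (ipC S b a); move: hm hn.
  move: (ip S a a) (ip S b b) (ip S a b) ((m.+1%:R^-1 : R) ^+ 2) ((n.+1%:R^-1 : R) ^+ 2).
  move=> *; lra.
 move=> e e0; have e2 : 0 < e / 2 by lra.
 have [K hK] := @null_harmonic R (e / 2) e2; exists K => m n Km Kn.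
 rewrite -ler_sqr ?nnegrE ?nrm_ge0 ?(ltW e0)//; apply: (le_trans (par m n)).
 have := hK m Km; have := hK n Kn; have := i0 n; have := i0 m.
 set a := _^-1; set b := _^-1; move=> *; nra.
- move=> n v Wv; have [Wn hn] := hw n; set p := y - w n.
 have Dp : D p by apply: domB => //; exact: Wdom.
 have Dv := Wdom Wv; have vv := ip_ge0 S v.
 have [v0|v0] := eqVneq (ip S v v) 0.
  apply: (le_trans (cauchy_schwarz Dp Dv)).
  by rewrite /nrm v0 sqrtr0 !mulr0.
 have vp : 0 < ip S v v by rewrite lt_def v0.
 rewrite -ler_sqr ?nnegrE ?mulr_ge0 ?nrm_ge0 ?(ltW (i0 _))// real_normK ?num_real//.
 (* [t] is the optimal step from [w n] in the direction [v]; the decrease of the squared distance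
    that it brings cannot exceed the slack in minimality. *)
 rewrite exprMn sqr_nrm; set t := ip S p v / ip S v v.
 have := dle (w n + t *: v) (WD Wn (WZ t Wv)).
 rewrite opprD addrA -/p ip_sqrB ?ipZl ?ipZr//; do ?exact: domZ.
 have -> : ip S p p - 2 * (t * ip S p v) + t * (t * ip S v v) =
      ip S p p - ip S p v ^+ 2 / ip S v v by rewrite /t; field.
 move=> h; rewrite -ler_pdivrMr//; move: hn h; rewrite -/p.
 by move: (_ / _) (_ ^+ 2) (ip S p p) => *; lra.
Qed.

(* Density from weak convergence to zero: completeness is not needed, because
 the minimizing sequence is Cauchy. *)
Lemma orth_dense (Z : V -> Prop) :
 (forall z, Z z -> D z) ->
 (forall u e, D u -> 0 < e -> exists2 z, Z z & N (u - z) <= e) ->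
 (forall p : nat -> V, (forall n, D (p n)) -> (exists K, forall n, N (p n) <= K) ->
  (forall n v, W v -> `|ip S (p n) v| <= n.+1%:R^-1 * N v) ->
  forall z, Z z -> null (fun n => `|ip S (p n) z|)) ->
 forall y e, D y -> 0 < e -> exists2 w, W w & N (y - w) <= e.
Proof.
move=> ZD Zdense weak y e Dy e0.
have [w [Ww cw ow]] := approx_orth Dy; pose p n := y - w n.
have Dp n : D (p n) by apply: domB => //; exact: Wdom.
have [N1 hN1] := cw 1 ltr01.
have bp : exists K, forall n, N (p n) <= K.
 exists (\sum_(i < N1.+1) N (p i) + (1 + N (p N1))) => n.
 have sp : 0 <= \sum_(i < N1.+1) N (p i) by apply: sumr_ge0 => i _; exact: nrm_ge0.
 have [nN|/ltnW nN] := leqP n N1.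
  have n1 : (n < N1.+1)%N by [].
  rewrite (bigD1 (Ordinal n1))//=.
  have : 0 <= \sum_(i < N1.+1 | i != Ordinal n1) N (p i) by apply: sumr_ge0 => i _; exact: nrm_ge0.
  by have := nrm_ge0 S (p N1); lra.
 have := nrmD (domB (Dp n) (Dp N1)) (Dp N1); rewrite subrK => h.
 apply: (le_trans h); rewrite -[X in X <= _]add0r; apply: lerD => //; rewrite lerD2r.
 have -> : p n - p N1 = w N1 - w n by rewrite /p opprB addrC addrA subrK.
 exact: hN1.
have [K hK] := bp; have K0 : 0 <= K by apply: le_trans (hK 0%N); exact: nrm_ge0.
have d0 : 0 < e ^+ 2 / (3 * (K + 1)) by rewrite divr_gt0 ?exprn_gt0//; lra.
have [m hm] := cw _ d0.
have [z Zz hz] := Zdense _ _ (Dp m) d0.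
have [k hk] := weak p Dp bp ow z Zz (e ^+ 2 / 3) ltac:(have := exprn_gt0 2 e0; lra).
pose n := maxn m k; exists (w n); first exact: Ww.
rewrite -/(p n) -ler_sqr ?nnegrE ?nrm_ge0 ?(ltW e0)// sqr_nrm.
have Dz := ZD z Zz.
(* The first two terms are small because the sequence is Cauchy and [z] approximates [p m]; only the
   third uses weak convergence. Each is at most [e ^+ 2 / 3]. *)
have -> : ip S (p n) (p n) = ip S (p n) (p n - p m) + ip S (p n) (p m - z) + ip S (p n) z.
 by rewrite (ipBr (Dp n) (Dp m) (Dp n)) (ipBr (Dp m) Dz (Dp n)); ring.
have h1 : ip S (p n) (p n - p m) <= K * (e ^+ 2 / (3 * (K + 1))).
 apply: (le_trans (ip_le (Dp n) (domB (Dp n) (Dp m)))); apply: ler_pM => //; try exact: nrm_ge0.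
 have -> : p n - p m = w m - w n by rewrite /p opprB addrC addrA subrK.
 by apply: hm => //; rewrite leq_maxl.
have h2 : ip S (p n) (p m - z) <= K * (e ^+ 2 / (3 * (K + 1))).
 by apply: (le_trans (ip_le (Dp n) (domB (Dp m) Dz))); apply: ler_pM => //; exact: nrm_ge0.
have h3 : ip S (p n) z <= e ^+ 2 / 3 by apply: (le_trans (ler_norm _)); apply: hk; rewrite leq_maxr.
have : K * (e ^+ 2 / (3 * (K + 1))) <= e ^+ 2 / 3.
 rewrite mulrA ler_pdivrMr; last lra.
 have -> : e ^+ 2 / 3 * (3 * (K + 1)) = (K + 1) * e ^+ 2 by field.
 by rewrite ler_wpM2r ?sqr_ge0//; lra.
lra.
Qed.

(** In a complete space the minimising sequence has a limit, and its difference from [y] is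
    orthogonal to [W], hence of norm zero. *)
Lemma complete_orth_dense :
 (forall u : nat -> V, (forall n, D (u n)) -> cauchy_for (fun u v => N (u - v)) u ->
  exists2 l, D l & cvg_for (fun u v => N (u - v)) u l) ->
 (forall u, D u -> (forall v, W v -> ip S u v = 0) -> N u = 0) ->
 forall y e, D y -> 0 < e -> exists2 w, W w & N (y - w) <= e.
Proof.
move=> compl orth y e Dy e0.
have [w [Ww cw ow]] := approx_orth Dy.
have Dw n : D (w n) by exact: Wdom.
have [l Dl hl] := compl w Dw cw.
have yl : N (y - l) = 0.
 apply: orth => [|v Wv]; first exact: domB.
 have Dv := Wdom Wv; apply/eqP; rewrite -normr_le0.
 apply: (@null_cst_le _ _ (fun n => n.+1%:R^-1 * N v + N (w n - l) * N v)).
  apply: nullD.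
   under [X in null X]eq_fun do rewrite mulrC.
   by apply: nullZ; [exact: nrm_ge0|exact: null_harmonic].
  under [X in null X]eq_fun do rewrite mulrC.
  by apply: nullZ; [exact: nrm_ge0|].
 move=> n; have -> : y - l = (y - w n) + (w n - l) by rewrite subrKA.
 rewrite ipDl//; do ?exact: domB.
 apply: (le_trans (ler_normD _ _)); apply: lerD; first exact: ow.
 by apply: cauchy_schwarz => //; exact: domB.
have [n hn] := hl e e0; exists (w n); first exact: Ww.
apply: (le_trans (nrm_triangle Dy Dl (Dw n))); rewrite yl add0r nrm_distC//.
exact: hn.
Qed.

End ApproximateProjection.

(** * Polynomials in time with coefficients in a vector space *)

Section TimePolynomials.
Context {R : realType}.

(** Normalised to vanish at 0: the coefficient of index 0 is a division by zero, which yields 0. *)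
Definition primp (p : {poly R}) : {poly R} := \poly_(i < (size p).+1) (p`_i.-1 / i%:R).

Lemma deriv_primp (p : {poly R}) : (primp p)^`() = p.
Proof.
apply/polyP => i; rewrite coef_deriv coef_poly ltnS.
have [ip|ip] := ltnP i (size p); last by rewrite mul0rn nth_default.
by rewrite -[LHS]mulr_natr /= -mulrA mulVf ?mulr1// pnatr_eq0.
Qed.

Lemma primp0 (p : {poly R}) : (primp p).[0] = 0.
Proof. by rewrite horner_coef0 coef_poly/= invr0 mulr0. Qed.

Variable V : lmodType R.
Implicit Types (s r : seq ({poly R} * V)).

(* [ev s] is the polynomial [sum_i theta_i(t) v_i] in [t] with coefficients in [V],
 for [s = (theta_i, v_i)_i]. *)
Definition ev s (t : R) : V := \sum_(p <- s) p.1.[t] *: p.2.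
Definition mapt (f : {poly R} -> {poly R}) s := [seq (f p.1, p.2) | p <- s].
Definition mapv (U : lmodType R) (f : V -> U) s := [seq (p.1, f p.2) | p <- s].

Lemma ev_cat s r t : ev (s ++ r) t = ev s t + ev r t.
Proof. by rewrite /ev big_cat. Qed.

Lemma ev_scale (k : R) s t : ev (mapt (fun p => k *: p) s) t = k *: ev s t.
Proof.
rewrite /ev /mapt big_map scaler_sumr; apply: eq_bigr => p _ /=.
by rewrite hornerZ scalerA.
Qed.

Lemma ev_mul (q : {poly R}) s t : ev (mapt (fun p => q * p) s) t = q.[t] *: ev s t.
Proof.
rewrite /ev /mapt big_map scaler_sumr; apply: eq_bigr => p _ /=.
by rewrite hornerM scalerA.
Qed.

Lemma ev_deriv_prim s t : ev (mapt (fun p => p^`()) (mapt primp s)) t = ev s t.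
Proof. by rewrite /ev /mapt -map_comp big_map; apply: eq_bigr => p _ /=; rewrite deriv_primp. Qed.

Lemma ev_prim0 s : ev (mapt primp s) 0 = 0.
Proof.
by rewrite /ev /mapt big_map big1// => p _ /=; rewrite primp0 scale0r.
Qed.

Variable S : semi_ip V.
Hypothesis domT : forall v, dom S v.

(** The inner product of two time polynomials as one scalar polynomial, so that continuity,
    differentiation and integration in t reduce to polynomial calculus. *)
Definition pip s r : {poly R} :=
 \sum_(p <- s) \sum_(q <- r) ip S p.2 q.2 *: (p.1 * q.1).

Lemma pipE s r t : (pip s r).[t] = ip S (ev s t) (ev r t).
Proof.
rewrite /pip /ev horner_sum ip_suml//; apply: eq_bigr => p _.
rewrite ipC ip_suml// horner_sum; apply: eq_bigr => q _.
by rewrite ipZl// ipZr// hornerZ hornerM ipC; ring.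
Qed.

Lemma deriv_pip s r : (pip s r)^`() =
 pip (mapt (fun p => p^`()) s) r + pip s (mapt (fun p => p^`()) r).
Proof.
rewrite /pip raddf_sum /= /mapt big_map -big_split/=; apply: eq_bigr => p _.
rewrite raddf_sum /= big_map -big_split/=; apply: eq_bigr => q _.
by rewrite derivZ derivM scalerDr.
Qed.

Lemma ip_ev_continuous s r : continuous (fun t => ip S (ev s t) (ev r t)).
Proof.
rewrite (_ : (fun _ => _) = horner (pip s r)); first exact: continuous_horner.
by apply/funext => t; rewrite pipE.
Qed.

Lemma it_deriv_ip s r t : 0 <= t ->
 it 0 t (fun x => ip S (ev (mapt (fun p => p^`()) s) x) (ev r x)) +
 it 0 t (fun x => ip S (ev s x) (ev (mapt (fun p => p^`()) r) x)) =
 ip S (ev s t) (ev r t) - ip S (ev s 0) (ev r 0).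
Proof.
move=> t0; rewrite -itD; do ?by apply: ig_continuous; exact: ip_ev_continuous.
rewrite -!pipE -(it_poly t0 (deriv_pip s r)); apply: it_eq => x _.
by rewrite hornerD !pipE.
Qed.

End TimePolynomials.

(** * The Boussinesq operator on polynomial pairs *)

Section SpatialOperators.
Context {R : realType}.
Variables (L al : R).
Hypotheses (hL : 0 < L) (hal : 0 < al).
Notation X := ({poly R} * {poly R})%type.
Implicit Types (e f : X).

Let L0 : 0 <= L. Proof. exact: ltW. Qed.

Definition intx (p : {poly R}) : R := it 0 L (horner p).

Lemma ig_horner a b (p : {poly R}) : ig a b (horner p).
Proof. by apply: ig_continuous; exact: continuous_horner. Qed.

Lemma intxD p q : intx (p + q) = intx p + intx q.
Proof.
rewrite /intx -itD; [|exact: ig_horner..].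
by apply: it_eq => x _; rewrite hornerD.
Qed.

Lemma intxZ (k : R) p : intx (k%:P * p) = k * intx p.
Proof.
rewrite /intx -itZ; last exact: ig_horner.
by apply: it_eq => x _; rewrite hornerM hornerC.
Qed.

Lemma intxN p : intx (- p) = - intx p.
Proof. by have := intxZ (-1) p; rewrite polyCN polyC1 !mulN1r. Qed.

Lemma intx_deriv p : intx p^`() = p.[L] - p.[0].
Proof. exact: it_poly. Qed.

Lemma intx_sqr_ge0 p : 0 <= intx (p * p).
Proof. by apply: it_pos => x; rewrite hornerM -expr2 sqr_ge0. Qed.

Let iX e f : R := intx (e.1 * f.1) + intx (e.2 * f.2).

Let iC e f : iX e f = iX f e.
Proof. by rewrite /iX mulrC (mulrC e.2). Qed.

Let iD e f h : True -> True -> True -> iX (e + f) h = iX e h + iX f h.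
Proof. by move=> _ _ _; rewrite /iX /= !mulrDl !intxD; ring. Qed.

Let iZ (k : R) e h : True -> True -> iX (k *: e) h = k * iX e h.
Proof. by move=> _ _; rewrite /iX /= -!mul_polyC -!mulrA !intxZ; ring. Qed.

Let i_ge0 e : 0 <= iX e e.
Proof. by rewrite /iX addr_ge0// intx_sqr_ge0. Qed.

Definition Xip : semi_ip X :=
 @SemiIP R X (fun=> True) iX I (fun _ _ _ _ => I) (fun _ _ _ => I) iC iD iZ i_ge0.

Lemma XipE e f : ip Xip e f = intx (e.1 * f.1) + intx (e.2 * f.2).
Proof. by []. Qed.

Lemma Xdom e : dom Xip e. Proof. by []. Qed.

(** The spatial operator with its first order part weighted by [s]: the system corresponds to
    [s = 1], while [s = 0] keeps only third derivatives and can be inverted explicitly. *)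
Definition Aop (s : R) e : X :=
 (- (s%:P * e.2^`() + e.2^`()^`()^`()), - (s%:P * e.1^`() + e.1^`()^`()^`())).
(** The multiplier x composed with the exchange of components. As [Aop] exchanges them too, the
    pairing of both splits into two independent scalar identities. *)
Definition Mop e : X := ('X * e.2, 'X * e.1).
Definition dx e : X := (e.1^`(), e.2^`()).
Definition gtr e : R := e.1^`().[L].
(** The sixth boundary value, treated as an input: along a solution of the delayed problem it equals
    beta z(t,1). The five homogeneous conditions form [bc]. *)
Definition btr e : R := e.2^`().[L] + al * e.1^`().[L].

Definition bc e : Prop :=
 [/\ e.1.[0] = 0, e.1.[L] = 0, e.1^`().[0] = 0, e.2.[0] = 0 & e.2.[L] = 0].

Lemma bc_lin (k : R) e f : bc e -> bc f -> bc (k *: e + f).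
Proof.
move=> [e1 e2 e3 e4 e5] [f1 f2 f3 f4 f5].
by split; rewrite /= ?derivD ?derivZ hornerD hornerZ ?e1 ?e2 ?e3 ?e4 ?e5 ?f1 ?f2 ?f3 ?f4 ?f5
 mulr0 addr0.
Qed.

Lemma Aop_lin s (k : R) e f : Aop s (k *: e + f) = k *: Aop s e + Aop s f.
Proof.
by congr pair; rewrite /= !(derivD, derivZ) -!mul_polyC; ring.
Qed.

Lemma AopE s s' e : Aop s' e = Aop s e + (s' - s) *: (- dx (e.2, e.1)).
Proof. by congr pair; rewrite /= -!mul_polyC polyCB; ring. Qed.

Lemma dx_lin (k : R) e f : dx (k *: e + f) = k *: dx e + dx f.
Proof. by congr pair; rewrite /= derivD derivZ. Qed.

Lemma gtr_lin (k : R) e f : gtr (k *: e + f) = k * gtr e + gtr f.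
Proof. by rewrite /gtr /= derivD derivZ hornerD hornerZ. Qed.

Lemma btr_lin (k : R) e f : btr (k *: e + f) = k * btr e + btr f.
Proof. by rewrite /btr /= !derivD !derivZ !hornerD !hornerZ; ring. Qed.

Lemma Mop_lin (k : R) e f : Mop (k *: e + f) = k *: Mop e + Mop f.
Proof. by congr pair; rewrite /= -!mul_polyC; ring. Qed.

(** The integrand is an exact derivative, and the boundary conditions leave a single term. Writing
    the trace of the second component as [btr] minus [al * gtr] exhibits the damping
    [- al * gtr e ^+ 2]. *)
Lemma dissipation s e : bc e -> ip Xip (Aop s e) e = e.2^`().[L] * gtr e.
Proof.
move=> [e1 e2 e3 e4 e5]; rewrite XipE -intxD.
pose q : {poly R} := - (s%:P * e.1 * e.2 + e.2^`()^`() * e.1 + e.1^`()^`() * e.2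
 - e.1^`() * e.2^`()).
have -> : (Aop s e).1 * e.1 + (Aop s e).2 * e.2 = q^`() by rewrite /q /= !(derivN, derivD, derivM, derivC); ring.
rewrite intx_deriv /q /gtr !(hornerN, hornerD, hornerM, hornerC) e1 e2 e3 e4 e5; ring.
Qed.

(** The multiplier identity behind the smoothing effect: pairing with x times the solution gains one
    derivative in L^2, at the price of the two boundary squares at [L]. *)
Lemma kato s e : bc e -> ip Xip (Aop s e) (Mop e) =
 - (3 / 2) * ip Xip (dx e) (dx e) + s / 2 * ip Xip e e +
 L / 2 * (gtr e ^+ 2 + e.2^`().[L] ^+ 2).
Proof.
move=> [e1 e2 e3 e4 e5].
have key (f : {poly R}) : f.[0] = 0 -> f.[L] = 0 ->
  intx (- (s%:P * f^`() + f^`()^`()^`()) * ('X * f)) =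
  - (3 / 2) * intx (f^`() * f^`()) + s / 2 * intx (f * f) + L / 2 * f^`().[L] ^+ 2.
 move=> f0 fL.
 pose g := 'X * f * f^`()^`() - f * f^`().
 pose q : {poly R} := - (g + g - 'X * f^`() * f^`() + s%:P * 'X * f * f).
 set F := _ * ('X * f); set G := f^`() * f^`().
 (* The identity is proved doubled, so that the antiderivative [q] has no fractions. *)
 have : intx (F + F) = intx (q^`() - (G + G + G) + s%:P * (f * f)).
  congr intx; rewrite /q /g /F /G !(derivN, derivD, derivM, derivC, derivX).
  by ring.
 rewrite !intxD intxN !intxD intxZ intx_deriv /q /g.
 rewrite !(hornerN, hornerD, hornerM, hornerC, hornerX) f0 fL => h.
 lra.
rewrite !XipE /= (key _ e4 e5) (key _ e1 e2) /gtr; ring.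
Qed.

(** Triple antiderivatives of the right-hand sides plus low degree corrections: [c] cancels the
    first component at [L], while [c1] and [c2] solve the linear system expressing that the second
    component vanishes at [L] and that [btr] is zero. *)
Lemma inv_ex f : exists e, [/\ bc e, btr e = 0 & Aop 0 e = f].
Proof.
have L0' : L != 0 by rewrite gt_eqF.
pose I3 (p : {poly R}) := primp (primp (primp p)).
pose c := (I3 f.2).[L] / L ^+ 2.
pose e1 : {poly R} := - I3 f.2 + c%:P * ('X * 'X).
pose k := (I3 f.1).[L] / L.
pose m := (primp (primp f.1)).[L] - al * e1^`().[L].
pose c2 := (m - k) / L; pose c1 := 2 * k - m.
pose e2 : {poly R} := - I3 f.1 + c1%:P * 'X + c2%:P * ('X * 'X).
have d1 : e1^`() = - primp (primp f.2) + c%:P * ('X + 'X).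
 by rewrite /e1 !(derivD, derivN, derivM, derivC, derivX) /I3 deriv_primp; ring.
have d2 : e2^`() = - primp (primp f.1) + c1%:P + c2%:P * ('X + 'X).
 by rewrite /e2 !(derivD, derivN, derivM, derivC, derivX) /I3 deriv_primp; ring.
have I30 p : (I3 p).[0] = 0 by exact: primp0.
exists (e1, e2); split.
- split; rewrite /= ?d1.
 + by rewrite /e1 !(hornerN, hornerD, hornerM, hornerC, hornerX) I30; ring.
 + by rewrite /e1 !(hornerN, hornerD, hornerM, hornerC, hornerX) /c; field.
 + by rewrite !(hornerN, hornerD, hornerM, hornerC, hornerX) primp0; ring.
 + by rewrite /e2 !(hornerN, hornerD, hornerM, hornerC, hornerX) I30; ring.
 + by rewrite /e2 !(hornerN, hornerD, hornerM, hornerC, hornerX) /c1 /c2 /k; field.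
- rewrite /btr /= d2 !(hornerN, hornerD, hornerM, hornerC, hornerX) /c2 /c1.
 rewrite -/(e1^`()) /m; set a := e1^`().[L]; set b := (primp _).[L]; field => //.
- rewrite [RHS]surjective_pairing /Aop /= d1 d2 polyC0; congr pair;
 by rewrite !(derivD, derivN, derivM, derivC, derivX, deriv_primp); ring.
Qed.

Lemma horner_sup (f : {poly R}) x : f.[0] = 0 -> 0 <= x -> x <= L ->
 `|f.[x]| <= Num.sqrt L * nL 0 L (horner f^`()).
Proof.
move=> f0 x0 xL.
have -> : f.[x] = it 0 x (horner f^`()) by rewrite (it_poly x0 erefl) f0 subr0.
apply: (le_trans (it_abs (ig_horner _ _ _))).
apply: (le_trans (it_sub_le (lexx 0) xL (ig_norm (ig_horner _ _ _)) _)).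
 by apply: aeonW => y _; exact: normr_ge0.
by have := it_norm_le L0 (L2_poly 0 L f^`()); rewrite subr0.
Qed.

Lemma intx_nL (f : {poly R}) : intx (f * f) = nL 0 L (horner f) ^+ 2.
Proof. by rewrite sqr_nL; apply: it_eq => x _; rewrite hornerM expr2. Qed.

Lemma poincare e : bc e -> ip Xip e e <= L ^+ 2 * ip Xip (dx e) (dx e).
Proof.
move=> [e1 _ _ e4 _].
have key (f : {poly R}) : f.[0] = 0 -> intx (f * f) <= L ^+ 2 * intx (f^`() * f^`()).
 move=> f0; rewrite !intx_nL -exprMn ler_sqr ?nnegrE ?mulr_ge0 ?nL_ge0//.
 have := @nL_le_bound _ 0 L (horner f) (Num.sqrt L * nL 0 L (horner f^`())) L0 (L2_poly _ _ _).
 rewrite mulr_ge0 ?sqrtr_ge0 ?nL_ge0// subr0 => /(_ isT) h.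
 apply: (le_trans (h _)).
  apply: aeonW => x /in_oo[x0 xL].
  by apply: horner_sup => //; exact: ltW.
 by rewrite mulrAC -expr2 sqr_sqrtr.
rewrite !XipE /= mulrDr; apply: lerD; exact: key.
Qed.

Lemma Mop_le e : ip Xip (Mop e) (Mop e) <= L ^+ 2 * ip Xip e e.
Proof.
have key (f : {poly R}) : intx ('X * f * ('X * f)) <= L ^+ 2 * intx (f * f).
 rewrite -intxZ; apply: it_le; [exact: ig_horner|exact: ig_horner|].
 apply: aeonW => x /in_oo[x0 xL].
 have -> : ('X * f * ('X * f)).[x] = x ^+ 2 * f.[x] ^+ 2 by rewrite !hornerM hornerX; ring.
 rewrite hornerM hornerC hornerM -(expr2 f.[x]).
 by apply: ler_wpM2r; [exact: sqr_ge0|rewrite ler_sqr ?nnegrE ?(ltW x0)// ltW].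
by rewrite !XipE /= mulrDr addrC; apply: lerD; exact: key.
Qed.

Lemma nrm_Mop e : nrm Xip (Mop e) <= L * nrm Xip e.
Proof.
rewrite -ler_sqr ?nnegrE ?mulr_ge0 ?nrm_ge0//.
by rewrite exprMn !sqr_nrm; exact: Mop_le.
Qed.

Lemma Mop_sym e f : ip Xip (Mop e) f = ip Xip e (Mop f).
Proof. by rewrite !XipE /= addrC; congr (_ + _); congr intx; ring. Qed.

(** Dissipation bounds the trace, the multiplier identity then bounds the derivative, and Poincare's
    inequality returns to the norm: its square is at most a constant times [a * n], and one factor
    [n] cancels. *)
Lemma elliptic : exists2 C : R, 0 <= C &
 forall e, bc e -> btr e = 0 -> nrm Xip e <= C * nrm Xip (Aop 0 e).
Proof.
(* [L] comes from pairing with the multiplier; the second summand from the boundary squares, where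
   [btr e = 0] makes the second trace [- al] times the first. *)
pose K := L + L / 2 * (1 + al ^+ 2) / al.
have K0 : 0 <= K.
 apply: addr_ge0 => //; apply: divr_ge0; last exact: ltW.
 by apply: mulr_ge0; [exact: divr_ge0|rewrite addr_ge0 ?sqr_ge0].
exists (L ^+ 2 * K); first by rewrite mulr_ge0 ?sqr_ge0.
move=> e be b0.
set n := nrm Xip e; set a := nrm Xip (Aop 0 e).
have n0 : 0 <= n by exact: nrm_ge0.
have a0 : 0 <= a by exact: nrm_ge0.
have e2L : e.2^`().[L] = - al * gtr e by move: b0; rewrite /btr /gtr; lra.
have h1 : al * gtr e ^+ 2 <= a * n.
 have := dissipation 0 be; rewrite e2L => h.
 have : - ip Xip (Aop 0 e) e <= a * n.
  by rewrite lerNl; have := cauchy_schwarz (S := Xip) (u := Aop 0 e) (v := e) I I;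
   rewrite ler_norml => /andP[].
 rewrite h; lra.
have h2 : - ip Xip (Aop 0 e) (Mop e) <= a * (L * n).
 rewrite lerNl; have := cauchy_schwarz (S := Xip) (u := Aop 0 e) (v := Mop e) I I.
 rewrite ler_norml => /andP[h _]; apply: le_trans h; rewrite lerN2.
 by apply: ler_wpM2l => //; exact: nrm_Mop.
have h3 := kato 0 be; have h4 := poincare be.
rewrite e2L in h3; rewrite -(sqr_nrm Xip e) -/n in h4.
set D := ip Xip (dx e) (dx e) in h3 h4.
have D0 : 0 <= D by exact: ip_ge0.
have h5 : D <= K * (a * n).
 have g2 : gtr e ^+ 2 <= a * n / al by rewrite ler_pdivlMr// mulrC.
 have : L / 2 * ((1 + al ^+ 2) * gtr e ^+ 2) <= L / 2 * ((1 + al ^+ 2) * (a * n / al)).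
  apply: ler_wpM2l; first exact: divr_ge0.
  by apply: ler_wpM2l => //; rewrite addr_ge0 ?sqr_ge0.
 have -> : L / 2 * ((1 + al ^+ 2) * (a * n / al)) = (K - L) * (a * n) by rewrite /K; field; rewrite gt_eqF.
 move: h3; rewrite mul0r mul0r exprMn sqrrN; lra.
have [->|nn0] := eqVneq n 0; first by rewrite !mulr_ge0 ?sqr_ge0.
have np : 0 < n by rewrite lt_def nn0.
rewrite -(ler_pM2l np) -expr2; apply: (le_trans h4).
have -> : n * (L ^+ 2 * K * a) = L ^+ 2 * (K * (a * n)) by ring.
by rewrite ler_wpM2l ?sqr_ge0.
Qed.

(** Multiples of [w], which vanishes to second order at both ends, satisfy every boundary condition.
    They are dense: if [u] is orthogonal to all of them, the product of [w] and [u] is orthogonal to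
    polynomials, and [w] has no zero inside the interval. *)
Lemma XL2_complete_dense (f : X) (eps : R) : 0 < eps ->
 exists e, [/\ bc e, btr e = 0 & nrm Xip (f - e) <= eps].
Proof.
move=> eps0.
pose w : {poly R} := ('X * ('X - L%:P)) ^+ 2.
have dense (p : {poly R}) (d : R) : 0 < d -> exists q, nL 0 L (horner p - horner (w * q)) <= d.
 move=> d0.
 pose W (u : R -> R) := exists q, u = horner (w * q).
 have [|||||||u [q ->] hq] := @complete_orth_dense R _ (L2ip 0 L) W _ _ _ _ _ _ (horner p) d _ d0.
 - by exists 0; rewrite mulr0; apply/funext => x; rewrite horner0.
 - by move=> _ _ [q ->] [r ->]; exists (q + r); rewrite mulrDr hornerfD.
 - by move=> k _ [q ->]; exists (k *: q); rewrite -scalerAr hornerfZ.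
 - by move=> _ [q ->]; exact: L2_poly.
 - exact: L2_complete.
 - move=> u Lu h.
  have Lw : L2 0 L (fun x => w.[x] * u x).
   have [K K0 hK] := continuous_bounded 0 L (@continuous_horner _ w).
   apply: (L2_mulb (K := K) Lu); first exact: L2_mfn (L2_poly _ _ _).
   by apply: aeonW => x /in_oo[x0 xL]; apply: hK; exact: ltW.
  have := poly_orth hL Lw; case=> [q|N [mN N0 hN]].
   transitivity (it 0 L (fun x => u x * (w * q).[x])); last by apply: h; exists q.
   by apply: it_eq => x _; rewrite (hornerM w q) mulrA (mulrC (u x)).
  have u0 : aeon 0 L (fun x => u x = 0).
   exists N; split => // x /= nx; apply: hN => /= hx; apply: nx => xL.
   have /eqP := hx xL; rewrite mulf_eq0 => /orP[|/eqP//].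
   rewrite /w horner_exp hornerM hornerX hornerD hornerN hornerC hornerX.
   rewrite sqrf_eq0 mulf_eq0 subr_eq0; move: xL; move=> /in_oo[x0 xL].
   by rewrite (gt_eqF x0) (lt_eqF xL).
  change (nL 0 L u = 0); rewrite (nL_ae u0); exact: (nrm0 (L2ip 0 L)).
 - exact: L2_poly.
 by exists q.
have e2 : 0 < eps / 2 by lra.
have [q1 h1] := dense f.1 _ e2; have [q2 h2] := dense f.2 _ e2.
have w0 : w.[0] = 0 by rewrite /w horner_exp hornerM hornerX mul0r expr0n.
have wL : w.[L] = 0 by rewrite /w horner_exp !hornerE subrr mulr0 expr0n.
have dw0 : w^`().[0] = 0.
 rewrite /w expr2 !(derivM, derivD, derivN, derivX, derivC);
 rewrite !(hornerD, hornerM, hornerN, hornerC, hornerX); ring.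
have dwL : w^`().[L] = 0.
 rewrite /w expr2 !(derivM, derivD, derivN, derivX, derivC);
 rewrite !(hornerD, hornerM, hornerN, hornerC, hornerX); ring.
have m0 q : (w * q).[0] = 0 by rewrite (hornerM w) w0 mul0r.
have mL q : (w * q).[L] = 0 by rewrite (hornerM w) wL mul0r.
have dm0 q : (w * q)^`().[0] = 0 by rewrite derivM hornerD (hornerM w^`()) (hornerM w) w0 dw0 !mul0r addr0.
have dmL q : (w * q)^`().[L] = 0 by rewrite derivM hornerD (hornerM w^`()) (hornerM w) wL dwL !mul0r addr0.
exists (w * q1, w * q2); split; first by split; rewrite /= ?m0 ?mL ?dm0.
 by rewrite /btr /= !dmL mulr0 addr0.
have nX (p q : {poly R}) : nrm Xip (p, q) <= nL 0 L (horner p) + nL 0 L (horner q).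
 rewrite -ler_sqr ?nnegrE ?addr_ge0 ?nrm_ge0 ?nL_ge0//.
 rewrite sqr_nrm XipE /= !intx_nL sqrrD -addrA lerD2l lerDr.
 by rewrite mulrn_wge0// mulr_ge0 ?nL_ge0.
apply: (le_trans (nX _ _)); rewrite !hornerfB; lra.
Qed.

End SpatialOperators.

(** * Energy and multiplier estimates *)

Opaque Xip it.

Section TimePolyLinear.
Context {R : realType}.
Implicit Types (V U : lmodType R).

Lemma lin0 V U (f : V -> U) : (forall (k : R) x y, f (k *: x + y) = k *: f x + f y) -> f 0 = 0.
Proof. by move=> h; have := h (-1) 0 0; rewrite scaler0 addr0 scaleN1r addNr. Qed.

Lemma ev_mapv V U (f : V -> U) u t :
 (forall (k : R) x y, f (k *: x + y) = k *: f x + f y) ->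
 ev (mapv f u) t = f (ev u t).
Proof.
move=> flin; rewrite /ev /mapv big_map; elim: u => [|p u IH].
 by rewrite !big_nil lin0.
by rewrite !big_cons flin IH.
Qed.

(** Turns scalar observables of a time polynomial, such as its traces, into genuine polynomials,
    with continuity and integrability for free. *)
Definition evl V (g : V -> R) (u : seq ({poly R} * V)) : {poly R} :=
 \sum_(p <- u) g p.2 *: p.1.

Lemma evlE V (g : V -> R) u t :
 (forall (k : R) x y, g (k *: x + y) = k * g x + g y) -> (evl g u).[t] = g (ev u t).
Proof.
move=> glin; rewrite /evl /ev; elim: u => [|p u IH].
 by rewrite !big_nil horner0 (lin0 (f := g : V -> R^o)).
by rewrite !big_cons hornerD IH glin hornerZ mulrC.
Qed.

Lemma poly_eq_deriv (p q : {poly R}) : p^`() = q^`() -> p.[0] = q.[0] -> p = q.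
Proof.
move=> /polyP h h0; apply/polyP => -[|i]; first by rewrite -!horner_coef0.
have := h i; rewrite !coef_deriv -(mulr_natr p`_i.+1) -(mulr_natr q`_i.+1).
by apply: mulIf; rewrite pnatr_eq0.
Qed.

Lemma it_ge0_sub a b (t : R) (f : R -> R) : a <= t -> t <= b -> ig a b f ->
 (forall x, 0 <= f x) -> it a t f <= it a b f.
Proof. by move=> at_ tb If f0; apply: it_sub_le => //; exact: aeonW. Qed.

Variables (V : lmodType R) (S : semi_ip V).
Hypothesis domT : forall v, dom S v.

Lemma nrm_ev_continuous (u : seq ({poly R} * V)) : continuous (fun t => nrm S (ev u t)).
Proof.
move=> t; apply: (@continuous_comp _ _ _ (fun t => ip S (ev u t) (ev u t)) (@Num.sqrt R)).
 exact: ip_ev_continuous.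
exact: sqrt_continuous.
Qed.

End TimePolyLinear.

Lemma mul_le_half_sqr {K : realFieldType} (m n : K) : m * n <= 2^-1 * m ^+ 2 + 2^-1 * n ^+ 2.
Proof. by have := sqr_ge0 (m - n); rewrite sqrrB; move: (m ^+ 2) (n ^+ 2) (m * n) => *; lra. Qed.

Section Apriori.
Context {R : realType}.
Variables (L al T : R).
Hypotheses (hL : 0 < L) (hal : 0 < al) (hT : 0 < T).
Notation X := ({poly R} * {poly R})%type.
Notation XI := (Xip L).
Implicit Types (u : seq ({poly R} * X)) (s t : R).

Definition all_bc u : Prop := foldr (fun p P => bc L p.2 /\ P) True u.
Definition dtu u := mapt (fun p : {poly R} => p^`()) u.
(** The residual of the evolution equation: [ev u] solves the problem whose source is [Fop s u].
    [Fseq] presents the same residual as a time polynomial. *)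
Definition Fop s u t : X := ev (dtu u) t - Aop s (ev u t).
Definition Fseq s u := dtu u ++ mapv (fun e => - Aop s e) u.

Let domT (e : X) : dom XI e. Proof. exact: Xdom. Qed.
Hint Resolve domT : core.

Lemma bc0 : bc L 0. Proof. by split; rewrite /= ?deriv0 horner0. Qed.

Lemma ev_bc u t : all_bc u -> bc L (ev u t).
Proof.
rewrite /ev; elim: u => [_|p u IH /= [hp hu]]; first by rewrite big_nil; exact: bc0.
by rewrite big_cons; apply: bc_lin => //; exact: IH.
Qed.

Lemma all_bc_mapt f u : all_bc u -> all_bc (mapt f u).
Proof. by elim: u => //= p u IH [hp /IH]. Qed.

Lemma all_bc_cat u v : all_bc u -> all_bc v -> all_bc (u ++ v).
Proof. by move=> + hv; elim: u => //= p u IH [hp /IH]. Qed.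

Lemma NAop_lin s (k : R) (e f : X) : - Aop s (k *: e + f) = k *: (- Aop s e) - Aop s f.
Proof. by rewrite Aop_lin opprD scalerN. Qed.

Lemma FopE s u t : Fop s u t = ev (Fseq s u) t.
Proof.
rewrite /Fop /Fseq ev_cat (ev_mapv (f := fun e => - Aop s e))//.
by move=> k x y; exact: NAop_lin.
Qed.

Lemma gtr_ev_cont u : continuous (fun t => gtr L (ev u t)).
Proof.
rewrite (_ : (fun _ => _) = horner (evl (gtr L) u)); first exact: continuous_horner.
by apply/funext => t; rewrite evlE//; exact: gtr_lin.
Qed.

Lemma btr_ev_cont u : continuous (fun t => btr L al (ev u t)).
Proof.
rewrite (_ : (fun _ => _) = horner (evl (btr L al) u)); first exact: continuous_horner.
by apply/funext => t; rewrite evlE//; exact: btr_lin.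
Qed.

Lemma ig_cMul (f g : R -> R) a b : continuous f -> continuous g ->
 ig a b (fun x => f x * g x).
Proof.
by move=> cf cg; apply: ig_continuous => x; apply: cvgM; [exact: cf|exact: cg].
Qed.

Lemma ig_cSqr (f : R -> R) a b : continuous f -> ig a b (fun x => f x ^+ 2).
Proof.
by move=> cf; under eq_fun do rewrite expr2; exact: ig_cMul.
Qed.

Lemma energy_eq s u t : all_bc u -> 0 <= t ->
 2^-1 * ip XI (ev u t) (ev u t) - 2^-1 * ip XI (ev u 0) (ev u 0) =
 it 0 t (fun x => ip XI (Fop s u x) (ev u x)) +
 it 0 t (fun x => btr L al (ev u x) * gtr L (ev u x)) -
 al * it 0 t (fun x => gtr L (ev u x) ^+ 2).
Proof.
move=> hu t0; have := it_deriv_ip domT u u t0; rewrite -/(dtu u).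
rewrite (_ : it 0 t (fun x => ip XI (ev u x) (ev (dtu u) x)) =
      it 0 t (fun x => ip XI (ev (dtu u) x) (ev u x))); last first.
 by apply: it_eq => x _; exact: ipC.
set I1 := it 0 t _ => h.
suff e : I1 = it 0 t (fun x => ip XI (Fop s u x) (ev u x)) +
 it 0 t (fun x => btr L al (ev u x) * gtr L (ev u x)) -
 al * it 0 t (fun x => gtr L (ev u x) ^+ 2) by lra.
rewrite /I1.
have i1 : ig 0 t (fun x => ip XI (Fop s u x) (ev u x)).
 by under eq_fun do rewrite FopE; apply: ig_continuous; exact: ip_ev_continuous.
have i2 := ig_cMul 0 t (@btr_ev_cont u) (@gtr_ev_cont u).
have i3 := ig_cSqr 0 t (@gtr_ev_cont u).
rewrite -itZ// -itD// -itB//; [|exact: igD|exact: igZ].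
apply: it_eq => x _; cbv beta; rewrite /Fop ipBl// (dissipation hL _ (ev_bc x hu)).
by rewrite /btr /gtr; ring.
Qed.

(** Since [Mop] is symmetric, the time derivative paired with [Mop (ev u x)] is half an exact
    derivative; the rest is [kato] at each time. *)
Lemma kato_eq s u t : all_bc u -> 0 <= t ->
 3 / 2 * it 0 t (fun x => ip XI (dx (ev u x)) (dx (ev u x))) =
 it 0 t (fun x => ip XI (Fop s u x) (Mop (ev u x))) -
 (2^-1 * ip XI (ev u t) (Mop (ev u t)) - 2^-1 * ip XI (ev u 0) (Mop (ev u 0))) +
 s / 2 * it 0 t (fun x => ip XI (ev u x) (ev u x)) +
 L / 2 * it 0 t (fun x => gtr L (ev u x) ^+ 2 +
             (btr L al (ev u x) - al * gtr L (ev u x)) ^+ 2).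
Proof.
move=> hu t0; have := it_deriv_ip domT u (mapv (@Mop R) u) t0; rewrite -/(dtu u).
have eM v x : ev (mapv (@Mop R) v) x = Mop (ev v x) by apply: ev_mapv; exact: Mop_lin.
have cM v w : ig 0 t (fun x => ip XI (ev v x) (Mop (ev w x))).
 under eq_fun do rewrite -eM.
 by apply: ig_continuous; exact: ip_ev_continuous.
have dM x : ev (mapt (fun p => p^`()) (mapv (@Mop R) u)) x = Mop (ev (dtu u) x).
 rewrite -eM /mapt /mapv /dtu /mapt -!map_comp; congr ev.
pose J := it 0 t (fun x => ip XI (ev (dtu u) x) (Mop (ev u x))).
have e1 : it 0 t (fun x => ip XI (ev (dtu u) x) (ev (mapv (@Mop R) u) x)) = J by apply: it_eq => x _; rewrite eM.
have e2 : it 0 t (fun x => ip XI (ev u x)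
  (ev (mapt (fun p => p^`()) (mapv (@Mop R) u)) x)) = J.
 by apply: it_eq => x _; rewrite dM -Mop_sym ipC.
rewrite e1 e2 !eM => h.
have i1 : ig 0 t (fun x => ip XI (Fop s u x) (Mop (ev u x))) by under eq_fun do rewrite FopE; exact: cM.
have i2 : ig 0 t (fun x => ip XI (dx (ev u x)) (dx (ev u x))).
 have ed x : dx (ev u x) = ev (mapv (@dx R) u) x by rewrite ev_mapv//; exact: dx_lin.
 by under eq_fun do rewrite ed; apply: ig_continuous; exact: ip_ev_continuous.
have i3 : ig 0 t (fun x => ip XI (ev u x) (ev u x)) by apply: ig_continuous; exact: ip_ev_continuous.
have i4 : ig 0 t (fun x => gtr L (ev u x) ^+ 2 + (btr L al (ev u x) - al * gtr L (ev u x)) ^+ 2).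
 apply: igD; apply: ig_cSqr; first exact: gtr_ev_cont.
 move=> x; apply: cvgB; first exact: btr_ev_cont.
 by apply: cvgM; [exact: cvg_cst|exact: gtr_ev_cont].
suff e : J =
 it 0 t (fun x => ip XI (Fop s u x) (Mop (ev u x))) +
 - (3 / 2) * it 0 t (fun x => ip XI (dx (ev u x)) (dx (ev u x))) +
 s / 2 * it 0 t (fun x => ip XI (ev u x) (ev u x)) +
 L / 2 * it 0 t (fun x => gtr L (ev u x) ^+ 2 +
             (btr L al (ev u x) - al * gtr L (ev u x)) ^+ 2).
 rewrite e in h *; move: h.
 move: (it 0 t _) (it 0 t _) (it 0 t _) (it 0 t _) (ip XI _ _) (ip XI _ _) => x1 x2 x3 x4 x5 x6.
 by move: (s / 2 * x2) (L / 2 * x1); clear - hL hal hT domT => *; lra.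
rewrite /J -(itZ _ i2) -(itZ _ i3) -(itZ _ i4).
rewrite -(itD i1 (igZ _ i2)) -(itD (igD i1 (igZ _ i2)) (igZ _ i3)).
rewrite -(itD (igD (igD i1 (igZ _ i2)) (igZ _ i3)) (igZ _ i4)).
apply: it_eq => x _; cbv beta; rewrite /Fop (ipBl (S := XI) (domT _) (domT _) (domT _)) (kato hL s (ev_bc x hu)).
rewrite (_ : btr L al (ev u x) - al * gtr L (ev u x) = (ev u x).2^`().[L]); last first.
 by rewrite /btr /gtr; ring.
ring.
Qed.

Section bound.
Variables (s : R) (u : seq ({poly R} * X)).
Hypothesis hu : all_bc u.
Let U0 := ip XI (ev u 0) (ev u 0).
Let N := it 0 T (fun t => nrm XI (Fop s u t)).
Let B := it 0 T (fun t => btr L al (ev u t) ^+ 2).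
Let G := it 0 T (fun t => gtr L (ev u t) ^+ 2).
Let T0 : 0 <= T. Proof. exact: ltW. Qed.

Lemma ig_nrmF a b : ig a b (fun t => nrm XI (Fop s u t)).
Proof.
under eq_fun do rewrite FopE.
by apply: ig_continuous; exact: nrm_ev_continuous.
Qed.

Lemma source_le (Q : R -> X) (k t : R) : 0 <= k -> 0 <= t -> t <= T ->
 ig 0 t (fun x => ip XI (Fop s u x) (Q x)) ->
 (forall x, 0 <= x -> x <= T -> nrm XI (Q x) <= k) ->
 it 0 t (fun x => ip XI (Fop s u x) (Q x)) <= k * N.
Proof.
move=> k0 t0 tT iG hG.
apply: (@le_trans _ _ (it 0 t (fun x => k * nrm XI (Fop s u x)))).
 apply: it_le => //; first by apply: igZ; exact: ig_nrmF.
 apply: aeonW => x /in_oo[x0 xt]; rewrite mulrC.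
 apply: (le_trans (ip_le (domT _) (domT _))); apply: ler_wpM2l; first exact: nrm_ge0.
 by apply: hG; [exact: ltW|apply: ltW; exact: lt_le_trans tT].
rewrite itZ; last exact: ig_nrmF.
apply: ler_wpM2l => //; apply: it_ge0_sub => //; first exact: ig_nrmF.
by move=> x; exact: nrm_ge0.
Qed.

Let iFu t : ig 0 t (fun x => ip XI (Fop s u x) (ev u x)).
Proof. by under eq_fun do rewrite FopE; apply: ig_continuous; exact: ip_ev_continuous. Qed.

(** The weights spend only half of the boundary damping, the other half being kept to control the
    trace. *)
Lemma young_trace t : 0 <= t -> t <= T ->
 it 0 t (fun x => btr L al (ev u x) * gtr L (ev u x)) <=
 al / 2 * it 0 t (fun x => gtr L (ev u x) ^+ 2) + al^-1 / 2 * B.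
Proof.
move=> t0 tT; have ai : 0 <= al^-1 / 2 by apply: divr_ge0 => //; rewrite invr_ge0 ltW.
have ib := ig_cSqr 0 t (@btr_ev_cont u).
have ig2 := ig_cSqr 0 t (@gtr_ev_cont u).
apply: (@le_trans _ _ (it 0 t (fun x =>
  al / 2 * gtr L (ev u x) ^+ 2 + al^-1 / 2 * btr L al (ev u x) ^+ 2))).
 apply: it_le; [exact: ig_cMul (@btr_ev_cont u) (@gtr_ev_cont u)|by apply: igD; exact: igZ|].
 apply: aeonW => x _; set b := btr _ _ _; set g := gtr _ _.
 rewrite -subr_ge0 (_ : _ - _ = al^-1 / 2 * (al * g - b) ^+ 2).
  by rewrite mulr_ge0 ?sqr_ge0.
 by field; rewrite gt_eqF.
rewrite itD ?itZ//; do ?exact: igZ.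
rewrite lerD2l; apply: ler_wpM2l => //.
apply: it_ge0_sub => //; first exact: ig_cSqr (@btr_ev_cont u).
by move=> x; exact: sqr_ge0.
Qed.

Lemma energy_le (m t : R) : 0 <= m -> 0 <= t -> t <= T ->
 (forall x, 0 <= x -> x <= T -> nrm XI (ev u x) <= m) ->
 2^-1 * ip XI (ev u t) (ev u t) + al / 2 * it 0 t (fun x => gtr L (ev u x) ^+ 2) <=
 2^-1 * U0 + m * N + al^-1 / 2 * B.
Proof.
move=> m0 t0 tT hm; have := energy_eq s hu t0; have := young_trace t0 tT.
have := source_le m0 t0 tT (iFu t) hm; rewrite -/U0.
move: (ip _ _ _) (it _ _ _) (it _ _ _) (it _ _ _) (m * N) => *; lra.
Qed.

(** The maximum in time is attained, so the bound on [m] may be read at the time where the norm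
    equals [m]. *)
Lemma sup_ex : exists m, [/\ 0 <= m,
 forall x, 0 <= x -> x <= T -> nrm XI (ev u x) <= m &
 exists c, [/\ 0 <= c, c <= T & nrm XI (ev u c) = m]].
Proof.
have [c cT hc] : exists2 c, c \in `[0, T] & forall t, t \in `[0, T] ->
  ip XI (ev u t) (ev u t) <= ip XI (ev u c) (ev u c).
 by apply: EVT_max => //; apply: continuous_subspaceT; exact: ip_ev_continuous.
have [c0 cT'] : 0 <= c /\ c <= T by move: cT; move=> /in_cc[].
exists (nrm XI (ev u c)); split; [exact: nrm_ge0| |by exists c].
move=> t t0 tT; rewrite /nrm ler_sqrt ?ip_ge0//; apply: hc.
by rewrite in_itv/= t0 tT.
Qed.

Let D := U0 + N ^+ 2 + B.
Let B0 : 0 <= B. Proof. by apply: it_pos => x; exact: sqr_ge0. Qed.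
Let U00 : 0 <= U0. Proof. exact: ip_ge0. Qed.

(** Absorbing [m ^+ 2 / 4] into the energy [m ^+ 2 / 2] leaves a quarter of [m ^+ 2], which produces
    the factors 4 and [2 * al^-1]. [C2] comes likewise from the trace term of the energy, and [C3]
    from the multiplier identity divided by [3 / 2]. *)
Definition C1 := 4 + 2 * al^-1.
Definition C2 := al^-1 * (2 + C1 + al^-1).

(** The energy inequality is read at a time [c] where the maximum is attained, so that the same [m]
    stands on both sides and can be absorbed. *)
Lemma apriori_sup (m : R) : 0 <= m ->
 (exists c, [/\ 0 <= c, c <= T & nrm XI (ev u c) = m]) ->
 (forall x, 0 <= x -> x <= T -> nrm XI (ev u x) <= m) -> m ^+ 2 <= C1 * D.
Proof.
move=> m0 [c [c0 cT mc]] hm; have := energy_le m0 c0 cT hm.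
rewrite -(sqr_nrm XI (ev u c)) mc => h.
have h2 : 0 <= al / 2 * it 0 c (fun x => gtr L (ev u x) ^+ 2).
 apply: mulr_ge0; first by apply: divr_ge0 => //; exact: ltW.
 by apply: it_pos => x; exact: sqr_ge0.
have h3 : m * N <= m ^+ 2 / 4 + N ^+ 2 by rewrite -subr_ge0 (_ : _ - _ = (m / 2 - N) ^+ 2) ?sqr_ge0//; field.
have ai : 0 <= al^-1 by rewrite invr_ge0 ltW.
have h4 : 0 <= al^-1 * U0 by apply: mulr_ge0.
have h5 : 0 <= al^-1 * N ^+ 2 by apply: mulr_ge0 => //; exact: sqr_ge0.
have h6 := sqr_ge0 N.
have -> : C1 * D = 4 * U0 + 4 * N ^+ 2 + 4 * B + 2 * (al^-1 * U0) + 2 * (al^-1 * N ^+ 2) +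
 2 * (al^-1 * B) by rewrite /C1 /D; ring.
move: h h2 h3 h4 h5 h6 B0 U00; rewrite -mulrA mulrA [al^-1 / 2 * B]mulrAC.
move: (al / 2 * _) (m * N) (m ^+ 2) (N ^+ 2) (al^-1 * U0) (al^-1 * N ^+ 2) (al^-1 * B) U0 B.
by move=> *; lra.
Qed.

Lemma apriori_trace (m : R) : 0 <= m -> m ^+ 2 <= C1 * D ->
 (forall x, 0 <= x -> x <= T -> nrm XI (ev u x) <= m) -> G <= C2 * D.
Proof.
move=> m0 hm2 hm; have := energy_le m0 T0 (lexx T) hm; rewrite -/G.
have := ip_ge0 XI (ev u T).
have h3 : m * N <= 2^-1 * m ^+ 2 + 2^-1 * N ^+ 2.
 exact: mul_le_half_sqr.
have ai : 0 <= al^-1 by rewrite invr_ge0 ltW.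
have h4 : 0 <= al^-1 * U0 by apply: mulr_ge0.
have h5 : 0 <= al^-1 * N ^+ 2 by apply: mulr_ge0 => //; exact: sqr_ge0.
have h6 := sqr_ge0 N.
move=> h7 h8.
have key : al / 2 * G <= 2^-1 * ((2 + C1 + al^-1) * D).
 have -> : (2 + C1 + al^-1) * D = 2 * U0 + 2 * N ^+ 2 + 2 * B + C1 * D +
  al^-1 * U0 + al^-1 * N ^+ 2 + al^-1 * B by rewrite /D; ring.
 move: h8 h3 h4 h5 h6 h7 hm2 B0 U00; rewrite [al^-1 / 2 * B]mulrAC.
 move: (al / 2 * G) (m * N) (m ^+ 2) (N ^+ 2) (al^-1 * U0) (al^-1 * N ^+ 2) (al^-1 * B)
  (C1 * D) (ip _ _ _) U0 B.
 by move=> *; lra.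
rewrite /C2 -mulrA mulrC ler_pdivlMr//.
by move: key; rewrite mulrAC (mulrC al); move: (G * al) (_ * D) => *; lra.
Qed.

Definition C3 := (2 / 3) * (L * (1 + C1) / 2 + L * C1 + T * C1 / 2 +
 L / 2 * (C2 + 2 + 2 * al ^+ 2 * C2)).

(** In the multiplier identity every term other than the derivative is already controlled by [m],
    [N], [G] and [B]; the range of [s] keeps the constant independent of it. *)
Lemma apriori_dx (m : R) : 0 <= s -> s <= 1 -> 0 <= m -> m ^+ 2 <= C1 * D -> G <= C2 * D ->
 (forall x, 0 <= x -> x <= T -> nrm XI (ev u x) <= m) ->
 it 0 T (fun t => ip XI (dx (ev u t)) (dx (ev u t))) <= C3 * D.
Proof.
move=> s0 s1 m0 hm2 hG hm; have := kato_eq s hu T0.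
have L0 : 0 <= L by exact: ltW.
have iFM : ig 0 T (fun x => ip XI (Fop s u x) (Mop (ev u x))).
 under eq_fun do rewrite FopE -(ev_mapv _ _ (@Mop_lin R)).
 by apply: ig_continuous; exact: ip_ev_continuous.
have k1 : it 0 T (fun x => ip XI (Fop s u x) (Mop (ev u x))) <= L * m * N.
 apply: source_le => //; first exact: mulr_ge0.
 move=> x x0 xT; apply: (le_trans (nrm_Mop hL _)).
 by apply: ler_wpM2l => //; exact: hm.
have MU t : 0 <= t -> t <= T -> `|ip XI (ev u t) (Mop (ev u t))| <= L * m ^+ 2.
 move=> t0 tT; apply: (le_trans (cauchy_schwarz (domT _) (domT _))).
 have n0 := nrm_ge0 XI (ev u t); have nm := hm t t0 tT.
 apply: (@le_trans _ _ (m * (L * m))); last by rewrite expr2 mulrCA.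
 apply: ler_pM => //; first exact: nrm_ge0.
 by apply: (le_trans (nrm_Mop hL _)); apply: ler_wpM2l.
have k2 := MU T T0 (lexx T); have k3 := MU 0 (lexx 0) T0.
have iUU : ig 0 T (fun x => ip XI (ev u x) (ev u x)) by apply: ig_continuous; exact: ip_ev_continuous.
have k4 : it 0 T (fun x => ip XI (ev u x) (ev u x)) <= T * m ^+ 2.
 rewrite mulrC -{2}(subr0 T) -it_cst//; apply: it_le => //; first exact: ig_cst.
 apply: aeonW => x /in_oo[x0 xT].
 by rewrite -sqr_nrm ler_sqr ?nnegrE ?nrm_ge0// hm// ltW.
have k40 : 0 <= it 0 T (fun x => ip XI (ev u x) (ev u x)) by apply: it_pos => x; exact: ip_ge0.
have k5 : it 0 T (fun x => gtr L (ev u x) ^+ 2 +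
  (btr L al (ev u x) - al * gtr L (ev u x)) ^+ 2) <= (1 + 2 * al ^+ 2) * G + 2 * B.
 rewrite /G /B -!itZ; [|exact: ig_cSqr (@btr_ev_cont u)|exact: ig_cSqr (@gtr_ev_cont u)].
 rewrite -itD; last 2 first.
 - by apply: igZ; exact: ig_cSqr (@gtr_ev_cont u).
 - by apply: igZ; exact: ig_cSqr (@btr_ev_cont u).
 apply: it_le.
 - apply: igD; apply: ig_cSqr; first exact: gtr_ev_cont.
  move=> x; apply: cvgB; first exact: btr_ev_cont.
  by apply: cvgM; [exact: cvg_cst|exact: gtr_ev_cont].
 - by apply: igD; apply: igZ; [exact: ig_cSqr (@gtr_ev_cont u)|exact: ig_cSqr (@btr_ev_cont u)].
 apply: aeonW => x _; set b := btr _ _ _; set g := gtr _ _.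
 rewrite -subr_ge0 (_ : _ - _ = (b + al * g) ^+ 2) ?sqr_ge0//; ring.
set I1 := it 0 T (fun x => ip XI (dx _) _); set I2 := it 0 T (fun x => ip XI (Fop _ _ _) _) in k1 *.
set I3 := it 0 T (fun x => ip XI (ev u x) (ev u x)) in k4 k40 *.
set I4 := it 0 T (fun x => gtr L _ ^+ 2 + _) in k5 *.
move=> h.
have mN : m * N <= 2^-1 * (C1 * D) + 2^-1 * D.
 have h3 : m * N <= 2^-1 * m ^+ 2 + 2^-1 * N ^+ 2.
  exact: mul_le_half_sqr.
 have : N ^+ 2 <= D by rewrite /D addrAC lerDr addr_ge0.
 by move: hm2 h3; move: (m * N) (m ^+ 2) (N ^+ 2) (C1 * D) D => *; lra.
have p1 : L * m * N <= L * (2^-1 * (C1 * D) + 2^-1 * D) by rewrite -mulrA ler_wpM2l.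
have p2 : L * m ^+ 2 <= L * (C1 * D) by rewrite ler_wpM2l.
have p3 : T * m ^+ 2 <= T * (C1 * D) by rewrite ler_wpM2l.
have p3' : s / 2 * I3 <= 2^-1 * (T * (C1 * D)).
 apply: (@le_trans _ _ (2^-1 * I3)).
  by apply: ler_wpM2r => //; rewrite ler_pdivrMr// mulVf.
 by rewrite ler_pM2l ?invr_gt0//; exact: le_trans p3.
have BD : B <= D by rewrite /D lerDr addr_ge0 ?sqr_ge0.
have p4 : L / 2 * I4 <= L / 2 * ((1 + 2 * al ^+ 2) * (C2 * D) + 2 * D).
 apply: ler_wpM2l; first exact: divr_ge0.
 apply: (le_trans k5); apply: lerD; last by rewrite ler_wpM2l.
 by apply: ler_wpM2l => //; rewrite addr_ge0// mulr_ge0// sqr_ge0.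
have -> : C3 * D = 2 / 3 * (L * (2^-1 * (C1 * D) + 2^-1 * D) + L * (C1 * D) +
 2^-1 * (T * (C1 * D)) + L / 2 * ((1 + 2 * al ^+ 2) * (C2 * D) + 2 * D)).
 by rewrite /C3; field.
move: k2 k3; rewrite !ler_norml => /andP[k2 k2'] /andP[k3 k3'].
move: h k1 k2 k2' k3 k3' p1 p2 p3' p4.
move: (L * (2^-1 * (C1 * D) + 2^-1 * D)) (L * (C1 * D)) (L * m * N) (L * m ^+ 2)
 (2^-1 * (T * (C1 * D))) (L / 2 * ((1 + 2 * al ^+ 2) * (C2 * D) + 2 * D))
 (L / 2 * I4) (s / 2 * I3) (ip _ _ _) (ip _ _ _) I1 I2 => *; lra.
Qed.

End bound.

(** One constant serves all [s] in the unit interval: this uniformity lets the continuation in [s]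
    proceed by steps of fixed length. *)
Lemma apriori : exists2 C : R, 0 <= C & forall s u, 0 <= s -> s <= 1 -> all_bc u ->
 let D := ip XI (ev u 0) (ev u 0) + it 0 T (fun t => nrm XI (Fop s u t)) ^+ 2 +
     it 0 T (fun t => btr L al (ev u t) ^+ 2) in
 [/\ forall t, 0 <= t -> t <= T -> ip XI (ev u t) (ev u t) <= C * D,
   it 0 T (fun t => gtr L (ev u t) ^+ 2) <= C * D &
   it 0 T (fun t => ip XI (dx (ev u t)) (dx (ev u t))) <= C * D].
Proof.
have L0 := ltW hL; have T0 := ltW hT; have a0 := ltW hal.
have ai : 0 <= al^-1 by rewrite invr_ge0.
have C10 : 0 <= C1 by rewrite /C1 addr_ge0 ?mulr_ge0.
have C20 : 0 <= C2 by rewrite /C2; apply: mulr_ge0 => //; apply: addr_ge0 => //; apply: addr_ge0.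
have C30 : 0 <= C3.
 have h2 (k : nat) : 0 <= k%:R :> R by exact: ler0n.
 by rewrite /C3; do ![apply: addr_ge0 => //|apply: mulr_ge0 => //|rewrite invr_ge0|exact: sqr_ge0].
exists (C1 + C2 + C3); first by apply: addr_ge0 => //; apply: addr_ge0.
move=> s u s0 s1 hu D.
have D0 : 0 <= D.
 rewrite /D; apply: addr_ge0; last by apply: it_pos => x; exact: sqr_ge0.
 by apply: addr_ge0; [exact: ip_ge0|exact: sqr_ge0].
have [m [m0 hm hc]] := sup_ex u.
have m2 := apriori_sup s hu m0 hc hm.
have g2 := apriori_trace hu m0 m2 hm.
have d2 := apriori_dx hu s0 s1 m0 m2 g2 hm.
have i1 : 0 <= C1 * D by exact: mulr_ge0.
have i2 : 0 <= C2 * D by exact: mulr_ge0.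
have i3 : 0 <= C3 * D by exact: mulr_ge0.
rewrite (mulrDl (C1 + C2)) (mulrDl C1); move: m2 g2 d2; rewrite -/D.
move: (C1 * D) (C2 * D) (C3 * D) i1 i2 i3 => c1 c2 c3 i1 i2 i3 m2 g2 d2; split.
- move=> t t0 tT; apply: (@le_trans _ _ (m ^+ 2)); last by lra.
 by rewrite -sqr_nrm ler_sqr ?nnegrE ?nrm_ge0// hm.
- by apply: (le_trans g2); lra.
- by apply: (le_trans d2); lra.
Qed.

End Apriori.

(** * Density of polynomial data *)

Section Density.
Context {R : realType}.
Variables (L al T : R).
Hypotheses (hL : 0 < L) (hal : 0 < al) (hT : 0 < T).
Notation X := ({poly R} * {poly R})%type.
Notation XI := (Xip L).
Implicit Types (u v : seq ({poly R} * X)).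

Let domT (e : X) : dom XI e. Proof. exact: Xdom. Qed.
Hint Resolve domT : core.
Let T0 : 0 <= T. Proof. exact: ltW. Qed.

Notation Y := (X * (R -> X) * {poly R})%type.
Implicit Types y : Y.

Let igF u v : ig 0 T (fun t => ip XI (ev u t) (ev v t)).
Proof. by apply: ig_continuous; exact: ip_ev_continuous. Qed.

Let igr (p q : {poly R}) : ig 0 T (fun t => p.[t] * q.[t]).
Proof. by under eq_fun do rewrite -hornerM; exact: ig_horner. Qed.

Let Ydom y : Prop := exists u, y.1.2 = ev u.
Let iY y y' : R := ip XI y.1.1 y'.1.1 + it 0 T (fun t => ip XI (y.1.2 t) (y'.1.2 t)) +
 it 0 T (fun t => y.2.[t] * y'.2.[t]).

Let Ydom0 : Ydom 0.
Proof. by exists [::]; apply/funext => t; rewrite /ev big_nil. Qed.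
Let YdomD y y' : Ydom y -> Ydom y' -> Ydom (y + y').
Proof.
move=> [u e] [v f]; exists (u ++ v); apply/funext => t.
by rewrite ev_cat -e -f.
Qed.
Let YdomZ (k : R) y : Ydom y -> Ydom (k *: y).
Proof.
move=> [u e]; exists (mapt (fun p => k *: p) u); apply/funext => t.
by rewrite ev_scale -e.
Qed.
Let iYC y y' : iY y y' = iY y' y.
Proof.
have e1 : it 0 T (fun t => ip XI (y.1.2 t) (y'.1.2 t)) =
 it 0 T (fun t => ip XI (y'.1.2 t) (y.1.2 t)) by apply: it_eq => t _; exact: ipC.
have e2 : it 0 T (fun t => y.2.[t] * y'.2.[t]) = it 0 T (fun t => y'.2.[t] * y.2.[t]).
 by apply: it_eq => t _; exact: mulrC.
by rewrite /iY e1 e2 (ipC XI y.1.1).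
Qed.
Let iYD y y' z : Ydom y -> Ydom y' -> Ydom z -> iY (y + y') z = iY y z + iY y' z.
Proof.
case: y y' z => [[a f] p] [[b g] q] [[c h] r] [u /= ->] [v /= ->] [w /= ->].
rewrite /iY /= ipDl//.
have -> : it 0 T (fun t => ip XI ((ev u + ev v) t) (ev w t)) =
 it 0 T (fun t => ip XI (ev u t) (ev w t)) + it 0 T (fun t => ip XI (ev v t) (ev w t)).
 by rewrite -itD//; apply: it_eq => t _; exact: ipDl.
have -> : it 0 T (fun t => (p + q).[t] * r.[t]) =
 it 0 T (fun t => p.[t] * r.[t]) + it 0 T (fun t => q.[t] * r.[t]).
 by rewrite -itD//; apply: it_eq => t _; rewrite hornerD mulrDl.
by rewrite (addrACA (ip _ _ _)) (addrACA (ip XI a c + _)).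
Qed.
Let iYZ (k : R) y z : Ydom y -> Ydom z -> iY (k *: y) z = k * iY y z.
Proof.
case: y z => [[a f] p] [[c h] r] [u /= ->] [w /= ->].
rewrite /iY /= ipZl//.
have -> : it 0 T (fun t => ip XI ((k *: ev u) t) (ev w t)) =
 k * it 0 T (fun t => ip XI (ev u t) (ev w t)).
 by rewrite -itZ//; apply: it_eq => t _; exact: ipZl.
have -> : it 0 T (fun t => (k *: p).[t] * r.[t]) = k * it 0 T (fun t => p.[t] * r.[t]).
 by rewrite -itZ//; apply: it_eq => t _; rewrite hornerZ mulrA.
by rewrite !mulrDr.
Qed.
Let iY_ge0 y : 0 <= iY y y.
Proof.
by apply: addr_ge0; [apply: addr_ge0; [exact: ip_ge0|]|];
 apply: it_pos => t; [exact: ip_ge0|rewrite -expr2 sqr_ge0].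
Qed.

(** The space of data: initial value, source, boundary input. Sources are restricted to time
    polynomials, so completeness is not at hand and density is obtained through weak convergence. *)
Definition Yip : semi_ip Y :=
 @SemiIP R Y Ydom iY Ydom0 YdomD YdomZ iYC iYD iYZ iY_ge0.

Lemma YipE y y' : ip Yip y y' = ip XI y.1.1 y'.1.1 +
 it 0 T (fun t => ip XI (y.1.2 t) (y'.1.2 t)) + it 0 T (fun t => y.2.[t] * y'.2.[t]).
Proof. by []. Qed.

Lemma YdomE (a : X) u (p : {poly R}) : dom Yip (a, ev u, p).
Proof. by exists u. Qed.

Definition data (s : R) u : Y := (ev u 0, Fop s u, evl (btr L al) u).

Lemma dom_data s u : dom Yip (data s u).
Proof. by exists (Fseq s u); apply/funext => t; rewrite /data /= FopE. Qed.

Definition ran s y := exists2 u, all_bc L u & y = data s u.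

Lemma dtu_cat u v : dtu (u ++ v) = dtu u ++ dtu v.
Proof. exact: map_cat. Qed.

Lemma data_cat s u v : data s (u ++ v) = data s u + data s v.
Proof.
congr (_, _, _); first exact: ev_cat.
 apply/funext => t; rewrite /Fop dtu_cat !ev_cat -[X in X + ev v t]scale1r Aop_lin scale1r.
 by rewrite opprD addrACA.
by rewrite /evl big_cat.
Qed.

Lemma data_scale s (k : R) u : data s (mapt (fun p => k *: p) u) = k *: data s u.
Proof.
congr (_, _, _); first exact: ev_scale.
 apply/funext => t; rewrite !FopE /Fseq !ev_cat.
 have -> : dtu (mapt (fun p => k *: p) u) = mapt (fun p => k *: p) (dtu u).
  by rewrite /dtu /mapt -!map_comp; apply: eq_map => p /=; rewrite derivZ.
 rewrite ev_scale !(ev_mapv (f := fun e => - Aop s e)) ?ev_scale//; do 2?exact: NAop_lin.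
 have := Aop_lin s k (ev u t) 0; rewrite addr0 => ->.
 have -> : Aop s (0 : X) = 0 by apply: (lin0 (f := Aop s)); exact: Aop_lin.
 by rewrite addr0 -scalerBr.
by rewrite /evl /mapt big_map scaler_sumr; apply: eq_bigr => p _ /=; rewrite !scalerA mulrC.
Qed.

Lemma ran0 s : ran s 0.
Proof.
exists [::] => //; congr (_, _, _); rewrite ?/evl ?/ev ?big_nil//.
apply/funext => t; rewrite /Fop /dtu /= /ev big_nil.
have -> : Aop s (0 : X) = 0 by apply: (lin0 (f := Aop s)); exact: Aop_lin.
by rewrite subr0.
Qed.

Lemma ranD s y y' : ran s y -> ran s y' -> ran s (y + y').
Proof.
move=> [u hu ->] [v hv ->]; exists (u ++ v); last by rewrite data_cat.
exact: all_bc_cat.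
Qed.

Lemma ranZ s (k : R) y : ran s y -> ran s (k *: y).
Proof.
move=> [u hu ->]; exists (mapt (fun p => k *: p) u); last by rewrite data_scale.
exact: all_bc_mapt.
Qed.

Lemma ran_dom s y : ran s y -> dom Yip y.
Proof. by move=> [u _ ->]; exact: dom_data. Qed.

Definition dense s := forall y e, dom Yip y -> 0 < e ->
 exists2 w, ran s w & nrm Yip (y - w) <= e.

Section dense0.
Variables (inv : X -> X).
Hypothesis invP : forall f, [/\ bc L (inv f), btr L al (inv f) = 0 & Aop 0 (inv f) = f].
Variable P : seq ({poly R} * X).
(** The increasing weight [w] produces the term in [iPhi]: with constant weight the pairing of [P]
    with its primitive would control only the value at the final time. This [kap] keeps [w] between
    1 and 3/2. *)
Let kap : R := (2 * T)^-1.
Let w : {poly R} := 1 + kap *: 'X.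
Let Phi := mapt (@primp R) P.
Let Psi := mapt (@primp R) Phi.
Let wP := mapt (fun p => w * p) P.
Let Om := mapt (@primp R) wP.
Let u := mapv inv Om.

Let kap0 : 0 < kap. Proof. by rewrite invr_gt0 mulr_gt0. Qed.

Let wE t : w.[t] = 1 + kap * t.
Proof. by rewrite /w hornerD hornerZ hornerX hornerC. Qed.

Let derw : w^`() = kap%:P.
Proof. by rewrite /w derivD derivZ derivX derivC add0r alg_polyC. Qed.

Let w_bnd t : 0 <= t -> t <= T -> 1 <= w.[t] <= 3 / 2.
Proof.
move=> t0 tT; rewrite wE lerDl mulr_ge0// ?(ltW kap0)//=.
have : kap * t <= kap * T by rewrite ler_wpM2l// ltW.
have -> : kap * T = 2^-1 by rewrite /kap invfM -mulrA mulVf ?mulr1// gt_eqF.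
by lra.
Qed.

Let inv_ev s t : Aop 0 (ev (mapv inv s) t) = ev s t.
Proof.
rewrite -(ev_mapv (f := Aop 0)); last exact: Aop_lin.
rewrite /ev /mapv -map_comp big_map; apply: eq_bigr => p _ /=.
by have [_ _ ->] := invP p.2.
Qed.

Let inv_bc s : all_bc L (mapv inv s).
Proof. by elim: s => //= p s IH; split => //; have [] := invP p.2. Qed.

Let inv_btr s t : btr L al (ev (mapv inv s) t) = 0.
Proof.
rewrite -evlE; last exact: btr_lin.
rewrite /evl /mapv big_map big1 ?horner0// => p _ /=.
by have [_ -> _] := invP p.2; rewrite scale0r.
Qed.

Let dPhi t : ev (dtu Phi) t = ev P t.
Proof. exact: ev_deriv_prim. Qed.
Let dPsi t : ev (dtu Psi) t = ev Phi t.
Proof. exact: ev_deriv_prim. Qed.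
Let OmE t : ev Om t = w.[t] *: ev Phi t - kap *: ev Psi t.
Proof.
rewrite /Om /wP /Psi /Phi /ev /mapt !big_map !scaler_sumr -sumrB; apply: eq_bigr => p _ /=.
rewrite !scalerA -scalerBl; congr (_ *: _).
have -> : primp (w * p.1) = w * primp p.1 - kap%:P * primp (primp p.1).
 apply: poly_eq_deriv.
  by rewrite !(derivB, derivM, derivC, deriv_primp) derw; ring.
 by rewrite !(hornerD, hornerN, hornerM) !primp0 !mulr0 subr0.
by rewrite hornerD hornerN !hornerM hornerC.
Qed.

Let ev_dtu_u t : ev (dtu u) t = ev (mapv inv wP) t.
Proof.
rewrite /u /dtu /mapt /mapv /Om /mapt -!map_comp; congr (ev _ t).
by apply: eq_map => p /=; rewrite deriv_primp.
Qed.

Let Fu t : Fop 0 u t = ev (mapv inv wP) t - ev Om t.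
Proof. by rewrite /Fop ev_dtu_u inv_ev. Qed.

Let wPE t : ev wP t = w.[t] *: ev P t.
Proof. exact: ev_mul. Qed.

(** [inv] inherits the sign of [Aop 0]: with zero boundary input the boundary product is [- al]
    times a square, and the positive weight does not change the sign. *)
Let diss t : 0 <= t -> t <= T -> ip XI (ev P t) (ev (mapv inv wP) t) <= 0.
Proof.
move=> t0 tT; have := dissipation hL 0 (ev_bc t (inv_bc wP)).
have := inv_btr wP t; rewrite /btr -/(gtr L _) => b0.
rewrite inv_ev wPE ipZl// => h.
have /andP[w1 _] := w_bnd t0 tT; have wp : 0 < w.[t] by exact: lt_le_trans w1.
rewrite -(pmulr_rle0 _ wp) h.
move: b0; rewrite /gtr; move: (_.2^`().[L]) (_.1^`().[L]) => a b e.
have -> : a = - (al * b) by lra.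
by rewrite mulNr -mulrA -expr2 oppr_le0 mulr_ge0 ?sqr_ge0// ltW.
Qed.

Let iPP := it 0 T (fun t => ip XI (ev P t) (ev P t)).
Let iPhi := it 0 T (fun t => ip XI (ev Phi t) (ev Phi t)).

Lemma it_nrm_sqr_le (s : seq ({poly R} * X)) t : 0 <= t -> t <= T ->
 it 0 t (fun x => nrm XI (ev s x)) ^+ 2 <= T * it 0 T (fun x => ip XI (ev s x) (ev s x)).
Proof.
move=> t0 tT.
have cn : {within `[0, t], continuous (fun x => nrm XI (ev s x))}.
 by apply: continuous_subspaceT; exact: nrm_ev_continuous.
have l2 : L2 0 t (fun x => nrm XI (ev s x)) by apply: L2_cont.
have := it_norm_le t0 l2.
have -> : it 0 t (fun x => `|nrm XI (ev s x)|) = it 0 t (fun x => nrm XI (ev s x)).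
 by apply: it_eq => x _; rewrite ger0_norm ?nrm_ge0.
move=> h; have i0 : 0 <= it 0 t (fun x => nrm XI (ev s x)).
 by apply: it_pos => x; exact: nrm_ge0.
apply: (@le_trans _ _ ((Num.sqrt t * nL 0 t (fun x => nrm XI (ev s x))) ^+ 2)).
 rewrite ler_sqr ?nnegrE//; first by move: h; rewrite subr0.
 by rewrite mulr_ge0 ?sqrtr_ge0 ?nL_ge0.
rewrite exprMn sqr_sqrtr// sqr_nL; apply: ler_pM => //.
 by apply: it_pos => x; rewrite sqr_ge0.
rewrite (_ : it 0 t _ = it 0 t (fun x => ip XI (ev s x) (ev s x))); last first.
 by apply: it_eq => x _; exact: sqr_nrm.
by apply: it_ge0_sub => // x; exact: ip_ge0.
Qed.

Lemma prim_sup (s : seq ({poly R} * X)) t : 0 <= t -> t <= T ->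
 ip XI (ev (mapt (@primp R) s) t) (ev (mapt (@primp R) s) t) <=
 T * it 0 T (fun x => ip XI (ev s x) (ev s x)).
Proof.
move=> t0 tT; set a := ev _ t.
have e : ip XI a a = it 0 t (fun x => ip XI (ev s x) a).
 pose c : seq ({poly R} * X) := [:: (1, a)].
 have cE x : ev c x = a by rewrite /c /ev big_seq1 hornerC scale1r.
 have := it_deriv_ip domT (mapt (@primp R) s) c t0.
 rewrite ev_prim0 !cE ip0l// subr0 => <-.
 rewrite [X in _ + X](_ : _ = 0) ?addr0; last first.
  rewrite -[RHS](it0 0 t); apply: it_eq => x _.
  by rewrite /c /ev /mapt /= big_seq1 /= derivC horner0 scale0r ip0r.
 by apply: it_eq => x _; rewrite ev_deriv_prim cE.
have h : ip XI a a <= it 0 t (fun x => nrm XI (ev s x)) * nrm XI a.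
 rewrite e mulrC -itZ; last by apply: ig_continuous; exact: nrm_ev_continuous.
 apply: it_le.
 - pose c : seq ({poly R} * X) := [:: (1, a)].
  have cE x : ev c x = a by rewrite /c /ev big_seq1 hornerC scale1r.
  rewrite (_ : (fun _ => _) = (fun x => ip XI (ev s x) (ev c x))); last first.
   by apply/funext => x; rewrite cE.
  by apply: ig_continuous; exact: ip_ev_continuous.
 - by apply: igZ; apply: ig_continuous; exact: nrm_ev_continuous.
 - by apply: aeonW => x _; rewrite mulrC; exact: ip_le.
apply: le_trans (it_nrm_sqr_le s t0 tT); rewrite -sqr_nrm ler_sqr ?nnegrE ?nrm_ge0//; last first.
 by apply: it_pos => x; exact: nrm_ge0.
move: h; rewrite -sqr_nrm expr2.
have [->|n0] := eqVneq (nrm XI a) 0.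
 by move=> _; apply: it_pos => x; exact: nrm_ge0.
by rewrite ler_pM2r// lt_def n0 nrm_ge0.
Qed.

(** Differentiate [q], using that [Om] is [w] times [Phi] minus [kap] times [Psi]; the weight is
    [3 / 2] at time [T], whence the coefficient [3 / 4]. *)
Let PO_eq : it 0 T (fun t => ip XI (ev P t) (ev Om t)) =
 3 / 4 * ip XI (ev Phi T) (ev Phi T) - kap * ip XI (ev Psi T) (ev Phi T) + kap / 2 * iPhi.
Proof.
pose q : {poly R} := 2^-1 *: (w * pip XI Phi Phi) - kap *: pip XI Psi Phi.
have dq t : (q^`()).[t] = ip XI (ev P t) (ev Om t) - kap / 2 * ip XI (ev Phi t) (ev Phi t).
 rewrite /q derivB !derivZ derivM derw !deriv_pip -/(dtu Phi) -/(dtu Psi).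
 rewrite !(hornerD, hornerN, hornerZ, hornerM, hornerC) !pipE// !dPhi !dPsi OmE.
 rewrite ipBr// !ipZr// (ipC XI (ev Phi t) (ev P t)) (ipC XI (ev Psi t) (ev P t)).
 by rewrite !wE hornerX; move: (ip _ _ _) (ip _ _ _) (ip _ _ _) kap => *; field.
have := it_poly T0 (erefl q^`()).
have -> : it 0 T (horner q^`()) =
  it 0 T (fun t => ip XI (ev P t) (ev Om t)) - kap / 2 * iPhi.
 rewrite /iPhi -itZ// -itB//; last exact: igZ.
 by apply: it_eq => t _; exact: dq.
have qE t : q.[t] = 2^-1 * (w.[t] * ip XI (ev Phi t) (ev Phi t)) - kap * ip XI (ev Psi t) (ev Phi t).
 by rewrite /q hornerD hornerN !hornerZ (hornerM w) !pipE.
rewrite !qE !ev_prim0 !ip0l// !wE.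
have -> : kap * T = 2^-1 by rewrite /kap invfM -mulrA mulVf ?mulr1// gt_eqF.
move: (it _ _ _) iPhi (ip _ _ _) (ip _ _ _) => a b c d.
rewrite !mulr0 subr0 => h; have -> : a = a - kap / 2 * b + kap / 2 * b by ring.
by rewrite h; field.
Qed.

(** The cross term is absorbed by positivity of the square of [ev Phi T - kap *: ev Psi T] together
    with [prim_sup], since [kap * T] is one half. *)
Let PO_ge : 4^-1 * ip XI (ev Phi T) (ev Phi T) + kap / 4 * iPhi <=
 it 0 T (fun t => ip XI (ev P t) (ev Om t)).
Proof.
rewrite PO_eq.
have p1 := prim_sup Phi T0 (lexx T); rewrite -/Psi -/iPhi in p1.
have := ip_ge0 XI (ev Phi T - kap *: ev Psi T).
rewrite ip_sqrB// ipZr// ipZl// ipZr// (ipC XI (ev Phi T) (ev Psi T)).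
have e : kap * (kap * ip XI (ev Psi T) (ev Psi T)) <= kap * (2^-1 * iPhi).
 rewrite ler_pM2l//; apply: (@le_trans _ _ (kap * (T * iPhi))); first by rewrite ler_pM2l.
 by rewrite mulrA /kap invfM -(mulrA 2^-1) mulVf ?mulr1// gt_eqF.
have gen (k i a b c : R) : a <= k * (2^-1 * i) -> 0 <= b - 2 * (k * c) + a ->
  4^-1 * b + k / 4 * i <= 3 / 4 * b - k * c + k / 2 * i.
 rewrite (_ : k * (2^-1 * i) = k * i / 2); last by ring.
 rewrite (_ : k / 4 * i = k * i / 4); last by ring.
 rewrite (_ : k / 2 * i = k * i / 2); last by ring.
 by move: (k * c) (k * i) => *; lra.
exact: gen e.
Qed.

(** The test solution is [inv] applied to the primitive of [w] times [P]. Its initial value and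
    boundary input vanish, its time derivative pairs with [P] with a favourable sign, and what
    remains is coercive in the primitive [Phi], a quantity weaker than the norm of [P]. *)
Lemma prim_decay (C0 : R) p : 0 <= C0 ->
 (forall e, bc L e -> btr L al e = 0 -> nrm XI e <= C0 * nrm XI (Aop 0 e)) ->
 dom Yip p -> p.1.2 = ev P ->
 exists2 y, ran 0 y &
  nrm Yip y <= Num.sqrt (9 / 2 * (C0 ^+ 2 + T ^+ 2) * iPP) /\
  4^-1 * ip XI (ev Phi T) (ev Phi T) + kap / 4 * iPhi <= - ip Yip p y.
Proof.
move=> C00 hC dp pP; exists (data 0 u); first by exists u => //; exact: inv_bc.
have u0 : ev u 0 = 0.
 rewrite /u /Om /ev /mapv /mapt -map_comp big_map big1// => q _ /=.
 by rewrite primp0 scale0r.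
have iF (s : seq ({poly R} * X)) : ig 0 T (fun t => ip XI (ev s t) (Fop 0 u t)).
 rewrite (_ : (fun _ => _) = (fun t => ip XI (ev s t) (ev (Fseq 0 u) t))); first exact: igF.
 by apply/funext => t; rewrite FopE.
have b0 (q : {poly R}) : it 0 T (fun t => q.[t] * (evl (btr L al) u).[t]) = 0.
 rewrite -[RHS](it0 0 T); apply: it_eq => t _.
 by rewrite evlE ?inv_btr ?mulr0//; exact: btr_lin.
split.
- rewrite /nrm ler_sqrt; last first.
  apply: mulr_ge0; last by apply: it_pos => t; exact: ip_ge0.
  by apply: mulr_ge0 => //; rewrite addr_ge0// sqr_ge0.
 rewrite YipE /data /= u0 ip0l// add0r b0 addr0.
 have c0 : 0 <= 9 / 2 * C0 ^+ 2 by apply: mulr_ge0 => //; exact: sqr_ge0.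
 (* [9 / 2] is twice the square of the bound [3 / 2] on [w]; the factor two comes from squaring a
    difference. *)
 rewrite (_ : 9 / 2 * (C0 ^+ 2 + T ^+ 2) * iPP = 9 / 2 * C0 ^+ 2 * iPP + 9 / 2 * T ^+ 2 * iPP); last by ring.
 apply: (@le_trans _ _ (it 0 T (fun t => 9 / 2 * C0 ^+ 2 * ip XI (ev P t) (ev P t) +
  9 / 2 * T * iPP))).
  apply: it_le.
  - rewrite (_ : (fun _ => _) = (fun t => ip XI (ev (Fseq 0 u) t) (Fop 0 u t))) //.
   by apply/funext => t; rewrite FopE.
  - by apply: igD; [exact: igZ|exact: ig_cst].
  apply: aeonW => t /in_oo_le[t0 tT].
  have /andP[w1 w2] := w_bnd t0 tT; have w0 : 0 <= w.[t] by exact: le_trans w1.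
  have e1 : nrm XI (ev (mapv inv wP) t) ^+ 2 <= C0 ^+ 2 * (9 / 4 * ip XI (ev P t) (ev P t)).
   have := hC _ (ev_bc t (inv_bc wP)) (inv_btr wP t).
   rewrite inv_ev wPE nrmZ// (ger0_norm w0) => h.
   rewrite -sqr_nrm (_ : _ * _ = (C0 * (3 / 2 * nrm XI (ev P t))) ^+ 2); last by field.
   rewrite ler_sqr ?nnegrE ?mulr_ge0 ?nrm_ge0//; apply: (le_trans h).
   by apply: ler_wpM2l => //; apply: ler_wpM2r => //; exact: nrm_ge0.
  have e2 : nrm XI (ev Om t) ^+ 2 <= T * (9 / 4 * iPP).
   rewrite sqr_nrm; apply: (le_trans (prim_sup wP t0 tT)); rewrite ler_wpM2l//.
   rewrite /iPP -itZ//; apply: it_le => //; first exact: igZ.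
   apply: aeonW => x /in_oo_le[x0 xT].
   rewrite wPE ipZl// ipZr// mulrA; apply: ler_wpM2r; first exact: ip_ge0.
   have /andP[v1 v2] := w_bnd x0 xT.
   by rewrite (_ : 9 / 4 = (3 / 2) * (3 / 2)); [apply: ler_pM => //; exact: le_trans v1|field].
  have := ip_ge0 XI (ev (mapv inv wP) t + ev Om t).
  rewrite Fu ip_sqrD// ip_sqrB//; rewrite !sqr_nrm in e1 e2.
  move: e1 e2; rewrite (_ : 9 / 2 * C0 ^+ 2 * _ = 2 * (C0 ^+ 2 * (9 / 4 * ip XI (ev P t) (ev P t)))); last by field.
  rewrite (_ : 9 / 2 * T * iPP = 2 * (T * (9 / 4 * iPP))); last by field.
  by move: (ip _ _ _) (ip _ _ _) (ip _ _ _) (C0 ^+ 2 * _) (T * _) => *; lra.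
 rewrite itD//; [|exact: igZ|exact: ig_cst].
 rewrite itZ// it_cst// subr0 -/iPP [9 / 2 * T * iPP * T](_ : _ = 9 / 2 * T ^+ 2 * iPP)//; by ring.
- apply: (le_trans PO_ge); rewrite YipE /data /= u0 ip0r// add0r b0 addr0 pP.
 rewrite -itN//; apply: it_le => //; first exact: igN.
 apply: aeonW => t /in_oo_le[t0 tT].
 have := diss t0 tT; rewrite Fu ipBr//; move: (ip _ _ _) (ip _ _ _) => *; lra.
Qed.

(** Integration by parts in time moves a derivative onto the fixed [Z], so that smallness of the
    primitive of [P] gives weak convergence of [P]. *)
Lemma weak_le (Z : seq ({poly R} * X)) :
 `|it 0 T (fun t => ip XI (ev P t) (ev Z t))| <=
 nrm XI (ev Phi T) * nrm XI (ev Z T) +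
 Num.sqrt iPhi * Num.sqrt (it 0 T (fun t => ip XI (ev (dtu Z) t) (ev (dtu Z) t))).
Proof.
have := it_deriv_ip domT Phi Z T0; rewrite -/(dtu Phi) -/(dtu Z) ev_prim0 ip0l// subr0.
rewrite (_ : it 0 T (fun t => ip XI (ev (dtu Phi) t) (ev Z t)) =
 it 0 T (fun t => ip XI (ev P t) (ev Z t))); last by apply: it_eq => t _; rewrite dPhi.
move=> /(canRL (addrK _)) ->; apply: (le_trans (ler_normB _ _)); apply: lerD.
 exact: cauchy_schwarz.
have z : it 0 T (fun t => (0 : {poly R}).[t] * (0 : {poly R}).[t]) = 0.
 by rewrite -[RHS](it0 0 T); apply: it_eq => t _; rewrite horner0 mul0r.
have eY (s r : seq ({poly R} * X)) : ip Yip (0, ev s, 0) (0, ev r, 0) =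
  it 0 T (fun t => ip XI (ev s t) (ev r t)).
 by rewrite YipE z addr0 [X in X + _](_ : _ = 0) ?add0r//; exact: ip0l.
by have := cauchy_schwarz (YdomE 0 Phi 0) (YdomE 0 (dtu Z) 0); rewrite /nrm !eY.
Qed.

End dense0.

(** By [orth_dense], bounded and asymptotically orthogonal data have to tend weakly to zero. The
    source component is settled by [prim_decay]; it can then be dropped from the pairing ([dsub]) to
    reach the initial and boundary components. *)
Lemma data_dense0 : dense 0.
Proof.
have [inv invP] := choice (@inv_ex R L al hL).
have [C0 C00 hC] := (@elliptic R L al hL hal).
move=> y0 e0 Dy0 he0; apply: (@orth_dense _ _ Yip (ran 0) (ran0 0) (@ranD 0) (@ranZ 0) (@ran_dom 0) (dom Yip)) Dy0 he0 => //.
- by move=> u e du e0'; exists u; rewrite ?subrr ?nrm0// ltW.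
move=> p dp [K hK] hp.
have K0 : 0 <= K by apply: le_trans (hK 0%N); exact: nrm_ge0.
pose wk z := null (fun n => `|ip Yip (p n) z|).
have wkD z z' : dom Yip z -> dom Yip z' -> wk z -> wk z' -> wk (z + z').
 move=> dz dz' hz hz'; apply: null_le (nullD hz hz') _ => n.
 by rewrite ipDr//; exact: ler_normD.
have wkN z : dom Yip z -> wk z -> wk (- z) by move=> dz hz; apply: null_le hz _ => n; rewrite ipNr// normrN.
have wkran z : ran 0 z -> wk z.
 move=> rz; apply: null_le (nullZ (nrm_ge0 Yip z) (@null_harmonic R)) _ => n.
 by rewrite mulrC; exact: hp.
have z0 (f : R -> X) : it 0 T (fun t => ip XI (f t) 0) = 0 by rewrite -[RHS](it0 0 T); apply: it_eq => t _; exact: ip0r.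
have z0' (f : {poly R}) : it 0 T (fun t => f.[t] * (0 : {poly R}).[t]) = 0.
 by rewrite -[RHS](it0 0 T); apply: it_eq => t _; rewrite horner0 mulr0.
have evn : ev ([::] : seq ({poly R} * X)) = 0 by apply/funext => t; rewrite /ev big_nil.
have dA a : dom Yip (a, 0, 0) by exists [::]; rewrite evn.
have dR r : dom Yip (0, 0, r) by exists [::]; rewrite evn.
have wkP Z : wk (0, ev Z, 0).
 pose A := 4^-1 : R; pose kap : R := (2 * T)^-1.
 have kap0 : 0 < kap by rewrite invr_gt0 mulr_gt0.
 have main n : exists P, p n = ((p n).1.1, ev P, (p n).2) by
  have [P hP] := dp n; exists P; rewrite -hP; case: (p n) => [[]].
 have [P hP] := choice main.
 pose Phi n := mapt (@primp R) (P n).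
 pose K1 := Num.sqrt (9 / 2 * (C0 ^+ 2 + T ^+ 2) * K ^+ 2).
 have hn n : 4^-1 * ip XI (ev (Phi n) T) (ev (Phi n) T) +
   kap / 4 * it 0 T (fun t => ip XI (ev (Phi n) t) (ev (Phi n) t)) <= K1 * n.+1%:R^-1.
  have [y ry [ny hy]] := prim_decay (P := P n) invP C00 hC (dp n) (congr1 (fun x => x.1.2) (hP n)).
  apply: (le_trans hy); apply: (le_trans (ler_norm _)); rewrite normrN.
  apply: (le_trans (hp n y ry)); rewrite mulrC ler_wpM2r ?invr_ge0//.
  apply: (le_trans ny); rewrite ler_sqrt; last first.
   by apply: mulr_ge0; [apply: mulr_ge0 => //; rewrite addr_ge0 ?sqr_ge0|exact: sqr_ge0].
  apply: ler_wpM2l; first by apply: mulr_ge0 => //; rewrite addr_ge0 ?sqr_ge0.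
  apply: (@le_trans _ _ (nrm Yip (p n) ^+ 2)).
   rewrite sqr_nrm YipE (hP n) /=.
   have := ip_ge0 XI (p n).1.1.
   have : 0 <= it 0 T (fun t => (p n).2.[t] * (p n).2.[t]).
    by apply: it_pos => t; rewrite -expr2 sqr_ge0.
   by move: (it _ _ _) (it _ _ _) (ip _ _ _) => *; lra.
  by rewrite ler_sqr ?nnegrE ?nrm_ge0.
 have K10 : 0 <= K1 by exact: sqrtr_ge0.
 have nh := nullZ K10 (@null_harmonic R).
 have i0 n : 0 <= it 0 T (fun t => ip XI (ev (Phi n) t) (ev (Phi n) t)).
  by apply: it_pos => t; exact: ip_ge0.
 have n1 : null (fun n => nrm XI (ev (Phi n) T)).
  rewrite /nrm; apply: null_sqrt => [n|]; first exact: ip_ge0.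
  apply: null_le (nullZ (ler0n R 4) nh) _ => n.
  have := mulr_ge0 (ltW kap0) (i0 n); have := hn n.
  rewrite (mulrAC kap); move: (kap * _) (ip _ _ _) (K1 * _) => *; lra.
 have n2 : null (fun n => Num.sqrt (it 0 T (fun t => ip XI (ev (Phi n) t) (ev (Phi n) t)))).
  apply: null_sqrt => [n|]; first exact: i0.
  have k40 : 0 <= 4 / kap by rewrite divr_ge0// ltW.
  apply: null_le (nullZ k40 nh) _ => n.
  rewrite mulrAC ler_pdivlMr//.
  have := ip_ge0 XI (ev (Phi n) T); have := hn n.
  rewrite (mulrAC kap) (mulrC kap); move: (_ * kap) (ip _ _ _) (K1 * _) => *; lra.
 apply: null_le (nullD (nullZ (nrm_ge0 XI (ev Z T)) n1) (nullZ (sqrtr_ge0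
  (it 0 T (fun t => ip XI (ev (dtu Z) t) (ev (dtu Z) t)))) n2)) _ => n.
 rewrite YipE /= z0' addr0 ip0r// add0r (hP n) /=.
 rewrite (mulrC (nrm XI (ev Z T))) (mulrC (Num.sqrt (it 0 T (fun t => ip XI (ev (dtu Z) t) _)))).
 exact: weak_le.
have dsub a f r s : f = ev s -> wk (a, f, r) -> wk (a, 0, r).
 move=> -> h; have -> : (a, 0, r) = (a, ev s, r) + - (0, ev s, 0) :> Y.
  by congr (_, _, _); rewrite /= ?subr0 ?subrr.
 by apply: wkD => //; [exact: YdomE|apply: domN; exact: YdomE|apply: wkN; [exact: YdomE|]].
(* A time-independent test solution with zero boundary input isolates the initial component. *)
have wke e : bc L e -> btr L al e = 0 -> wk (e, 0, 0).
 move=> be te; have : wk (data 0 [:: (1, e)]) by apply: wkran; exists [:: (1, e)].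
 have -> : data 0 [:: (1, e)] = (e, Fop 0 [:: (1, e)], 0).
  congr (_, _, _); first by rewrite /ev big_seq1 hornerC scale1r.
  by rewrite /evl big_seq1 /= te scale0r.
 by apply: (dsub _ _ _ (Fseq 0 [:: (1, e)])); apply/funext => t; rewrite FopE.
have wka a : wk (a, 0, 0).
 move=> ep ep0; have d0 : 0 < ep / 2 / (K + 1) by rewrite !divr_gt0//; lra.
 have [e [be te ne]] := @XL2_complete_dense R L al hL a _ d0.
 have e20 : 0 < ep / 2 by rewrite divr_gt0.
 have [N hN] := wke e be te _ e20; exists N => n /hN.
 have E b : ip Yip (p n) (b, 0, 0) = ip XI (p n).1.1 b by rewrite YipE /= z0 z0' !addr0.
 rewrite !E => h; have -> : a = (a - e) + e by rewrite subrK.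
 rewrite ipDr//; apply: (le_trans (ler_normD _ _)).
 have : `|ip XI (p n).1.1 (a - e)| <= K * (ep / 2 / (K + 1)).
  apply: (le_trans (cauchy_schwarz _ _)) => //; apply: ler_pM => //; try exact: nrm_ge0.
  apply: le_trans (hK n); rewrite /nrm ler_sqrt ?ip_ge0// YipE.
  rewrite -addrA lerDl addr_ge0//; apply: it_pos => t; first exact: ip_ge0.
  by rewrite -expr2 sqr_ge0.
 have : K * (ep / 2 / (K + 1)) <= ep / 2.
  rewrite mulrA ler_pdivrMr; last by lra.
  by rewrite mulrC ler_wpM2l ?(ltW e20)// lerDl.
 by move: h; move: (K * _) => *; lra.
have wkr r : wk (0, 0, r).
 (* A profile with [btr] equal to 1: multiplied by [r] it isolates the boundary component. *)
 pose g : X := (0, (L^-1)%:P * ('X * ('X - L%:P))).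
 have bg : bc L g by split; rewrite /g /= ?(deriv0, horner0)// !(hornerM, hornerD, hornerN, hornerX, hornerC); ring.
 have tg : btr L al g = 1.
  rewrite /btr /g /= deriv0 horner0 !(derivM, derivC, derivX, derivB).
  rewrite !(hornerM, hornerD, hornerN, hornerX, hornerC, horner0).
  by field; rewrite gt_eqF.
 have : wk (data 0 [:: (r, g)]) by apply: wkran; exists [:: (r, g)].
 have -> : data 0 [:: (r, g)] = (r.[0] *: g, Fop 0 [:: (r, g)], r).
  congr (_, _, _); first by rewrite /ev big_seq1.
  by rewrite /evl big_seq1 /= tg scale1r.
 move/(dsub _ _ _ (Fseq 0 [:: (r, g)])) => h.
 have {}h : wk (r.[0] *: g, 0, r) by apply: h; apply/funext => t; rewrite FopE.
 have -> : (0, 0, r) = (r.[0] *: g, 0, r) + - (r.[0] *: g, 0, 0) :> Y by congr (_, _, _); rewrite /= ?subr0 ?subrr.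
 have d1 : dom Yip (r.[0] *: g, 0, r) by exists [::]; rewrite evn.
 exact: (wkD _ _ d1 (domN (dA _)) h (wkN _ (dA _) (wka _))).
move=> [[a f] r] [Z /= ->]; rewrite -/(wk _).
have -> : (a, ev Z, r) = (a, 0, 0) + ((0, ev Z, 0) + (0, 0, r)) :> Y by congr (_, _, _); rewrite /= ?addr0 ?add0r.
have dZ := YdomE 0 Z 0.
exact: (wkD _ _ (dA _) (domD dZ (dR _)) (wka _) (wkD _ _ dZ (dR _) (wkP _) (wkr _))).
Qed.

(** Continuity method. Changing [s] perturbs the source by a first order term, bounded through the
    smoothing estimate. For nearby parameters the approximation error is at most half of the data,
    and iterating the halving gives density. *)
Lemma data_step : exists2 del : R, 0 < del & forall s s',
 0 <= s -> s <= 1 -> `|s' - s| <= del -> dense s -> dense s'.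
Proof.
have [C C0 hC] := apriori hL hal hT.
pose C' := Num.sqrt (C * (1 + T)).
have C'0 : 0 <= C' by exact: sqrtr_ge0.
have c1 : 0 < C' + 1 by lra.
(* Approximating [y] up to a quarter of its norm uses data of norm at most [5 / 4] of it; this step
   length keeps the perturbation below another quarter. *)
exists (5 * (C' + 1))^-1 => [|s s' s0 s1 hss ds]; first by rewrite invr_gt0 mulr_gt0.
have half y : dom Yip y -> exists2 w, ran s' w & nrm Yip (y - w) <= 2^-1 * nrm Yip y.
 move=> dy; have [n0|n0] := eqVneq (nrm Yip y) 0.
  by exists 0; [exact: ran0|rewrite subr0 n0 mulr0].
 have np : 0 < nrm Yip y by rewrite lt_def n0 nrm_ge0.
 have q0 : 0 < nrm Yip y / 4 by lra.
 have [_ [u hu ->] hw] := ds y _ dy q0.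
 exists (data s' u); first by exists u.
 have nd : nrm Yip (data s u) <= 5 / 4 * nrm Yip y.
  have := nrm_triangle (domN dy) (domN (dom_data s u)) (dom0 Yip).
  have := nrmB dy (domB dy (dom_data s u)).
  rewrite opprB addrC subrK; move: hw; move: (nrm Yip y) => *; lra.
 pose w' := mapv (fun e => (s' - s) *: - dx (e.2, e.1)) u.
 have e : data s u - data s' u = (0, ev w', 0).
  congr (_, _, _); rewrite /= ?subrr//; apply/funext => t.
  change (Fop s u t - Fop s' u t = ev w' t); rewrite /Fop (AopE s s').
  have E (a b c : X) : a - b - (a - (b + c)) = c by rewrite opprB addrC addrA subrK addrC addKr.
  rewrite E /w' ev_mapv// => k x x'; congr pair => /=;
   rewrite !derivD !derivZ -!mul_polyC; ring.
 have ndx : nrm Yip (data s u - data s' u) <= `|s' - s| * (C' * nrm Yip (data s u)).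
  rewrite e; set N := nrm Yip (data s u).
  rewrite -ler_sqr ?nnegrE ?nrm_ge0 ?mulr_ge0 ?nrm_ge0//.
  rewrite sqr_nrm YipE /= ip0l// add0r.
  rewrite [X in _ + X](_ : _ = 0) ?addr0; last first.
   by rewrite -[RHS](it0 0 T); apply: it_eq => t _; rewrite horner0 mul0r.
  have h1 t : ip XI (ev w' t) (ev w' t) =
    `|s' - s| ^+ 2 * ip XI (dx (ev u t)) (dx (ev u t)).
   rewrite real_normK ?num_real//.
   have -> : ev w' t = (s' - s) *: - dx ((ev u t).2, (ev u t).1).
    rewrite /w' (ev_mapv (f := fun e : X => (s' - s) *: - dx (e.2, e.1)))// => k x x'.
    by congr pair => /=; rewrite !derivD !derivZ -!mul_polyC; ring.
   rewrite ipZl// ipZr// ipNl// ipNr// opprK mulrA -expr2; congr (_ * _).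
   by rewrite !XipE /= addrC.
  have [_ _ hdx] := hC s u s0 s1 hu.
  have iD : ig 0 T (fun x => ip XI (dx (ev u x)) (dx (ev u x))).
   have ed x : dx (ev u x) = ev (mapv (@dx R) u) x by rewrite ev_mapv//; exact: dx_lin.
   by under eq_fun do rewrite ed; exact: igF.
  rewrite (it_eq (g := fun t => `|s' - s| ^+ 2 * ip XI (dx (ev u t)) (dx (ev u t)))); last first.
   by move=> t _; exact: h1.
  rewrite itZ// exprMn ler_wpM2l ?sqr_ge0//; apply: (le_trans hdx).
  rewrite exprMn /C' sqr_sqrtr; last by rewrite mulr_ge0// addr_ge0.
  rewrite -mulrA ler_wpM2l// /N sqr_nrm YipE /=.
  have hF := it_nrm_sqr_le (Fseq s u) T0 (lexx T).
  rewrite (it_eq (g := fun t => nrm XI (Fop s u t))) in hF; last by move=> t _; rewrite FopE.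
  rewrite [X in _ <= T * X](it_eq (g := fun t => ip XI (Fop s u t) (Fop s u t))) in hF; last first.
   by move=> t _; rewrite FopE.
  rewrite (it_eq (f := fun t => _.[t] * _.[t]) (g := fun t => btr L al (ev u t) ^+ 2)); last first.
   by move=> t _; rewrite evlE ?expr2//; exact: btr_lin.
  have U0 := ip_ge0 XI (ev u 0).
  have B0 : 0 <= it 0 T (fun t => btr L al (ev u t) ^+ 2) by apply: it_pos => t; exact: sqr_ge0.
  have F0 : 0 <= it 0 T (fun t => ip XI (Fop s u t) (Fop s u t)) by apply: it_pos => t; exact: ip_ge0.
  move: hF U0 B0 F0; move: (it _ _ _) (it _ _ _) (ip _ _ _) (it 0 T (fun t => nrm XI _) ^+ 2) => c b a f h h1' h2 h3.
  have := mulr_ge0 T0 h1'; have := mulr_ge0 T0 h2; have := T0; rewrite mulrDl mul1r.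
  rewrite !mulrDr; move: h; move: (T * a) (T * b) (T * c) => *; lra.
 rewrite -(subrKA (data s u)); apply: (le_trans (nrmD _ _)).
 - by apply: domB => //; exact: dom_data.
 - by apply: domB; exact: dom_data.
 have : `|s' - s| * (C' * nrm Yip (data s u)) <= nrm Yip y / 4.
  apply: (@le_trans _ _ ((5 * (C' + 1))^-1 * ((C' + 1) * (5 / 4 * nrm Yip y)))).
   apply: ler_pM => //; first by rewrite mulr_ge0 ?nrm_ge0.
   by apply: ler_pM; rewrite ?nrm_ge0// lerDl.
  by apply: ler_eq; field; rewrite gt_eqF.
 by move: hw ndx; move: (_ * (_ * _)) (nrm _ _) (nrm _ _) (nrm _ _) => *; lra.
move=> y e dy e0.
have iter n : exists2 w, ran s' w & nrm Yip (y - w) <= nrm Yip y * 2^-1 ^+ n.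
 elim: n => [|n [w rw hw]]; first by exists 0; [exact: ran0|rewrite subr0 mulr1].
 have dw := ran_dom rw; have [v rv hv] := half _ (domB dy dw).
 exists (w + v); first exact: ranD.
 rewrite opprD addrA exprS mulrCA; apply: (le_trans hv).
 by rewrite ler_pM2l ?invr_gt0.
have [N hN] := null_half (nrm Yip y) e0.
have [w rw hw] := iter N; exists w => //; apply: (le_trans hw); exact: hN.
Qed.

Lemma data_dense : dense 1.
Proof.
have [del d0 hdel] := data_step.
pose N := (Num.truncn del^-1).+1.
have N0 : 0 < N%:R :> R by rewrite ltr0n.
have hN : N%:R^-1 <= del.
 rewrite -(invrK del) lef_pV2 ?posrE ?invr_gt0// ltW//.
 by rewrite /N truncnS_gt.
have h k : (k <= N)%N -> dense (k%:R / N%:R).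
 elim: k => [_|k IH kN]; first by rewrite mul0r; exact: data_dense0.
 apply: hdel (IH (ltnW kN)).
 - by rewrite divr_ge0.
 - by rewrite ler_pdivrMr// mul1r ler_nat ltnW.
 - by rewrite -mulrBl -natrB// subSnn mul1r ger0_norm// invr_ge0 ltW.
by have := h N (leqnn N); rewrite divff// gt_eqF.
Qed.

End Density.
Transparent Xip it.

(** * Primitives of square integrable functions and integration by parts *)

Section Parts.
Context {R : realType}.
Implicit Types (a b c : R) (f g : R -> R) (p q : {poly R}).

(** Precomposition with [clamp] continues a curve given on [[a, b]] by its end values, so that
    statements about globally continuous functions apply. *)
Definition clamp a b (x : R) := Num.max a (Num.min b x).

Lemma clamp_itv a b x : a <= b -> a <= clamp a b x /\ clamp a b x <= b.
Proof.
move=> ab; rewrite /clamp; split; first by rewrite le_max lexx.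
by rewrite ge_max ab ge_min lexx.
Qed.

Lemma clamp_id a b x : a <= x -> x <= b -> clamp a b x = x.
Proof. by move=> ax xb; rewrite /clamp min_r// max_r. Qed.

Lemma clamp_mono a b x y : x <= y -> clamp a b x <= clamp a b y.
Proof.
move=> xy; rewrite /clamp; apply: le_max2 => //.
by apply: le_min2.
Qed.

Lemma clamp_lip a b x y : `|clamp a b x - clamp a b y| <= `|x - y|.
Proof.
wlog xy : x y / x <= y => [h|].
 by have [/h//|/ltW/h] := leP x y; rewrite distrC [X in _ <= X -> _]distrC.
rewrite (distrC x) (ger0_norm (_ : 0 <= y - x)) ?subr_ge0// /clamp !maxEle !minEle.
case: (leP b x) => h1; case: (leP b y) => h2; try lra; case: (leP a _) => h3; try lra;
 try (case: (leP a _) => h4; try lra); rewrite ler_norml; apply/andP; split; lra.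
Qed.

(** Dividing by [C + 1] rather than [C] covers the case of a zero constant. *)
Lemma frac_le (C e : R) : 0 <= C -> 0 <= e -> C * (e / (C + 1)) <= e.
Proof.
move=> C0 e0; have C1 : 0 < C + 1 by lra.
by rewrite mulrA ler_pdivrMr// mulrC ler_wpM2l// lerDl.
Qed.

Lemma sqrt_le (x e : R) : 0 <= e -> x <= e ^+ 2 -> Num.sqrt x <= e.
Proof. by move=> e0 h; rewrite -(ger0_norm e0) -sqrtr_sqr ler_sqrt// sqr_ge0. Qed.

Lemma continuous_of_modulus (F : R -> R) a b (K : R) : a <= b -> 0 <= K ->
 (forall s t, a <= s -> s <= t -> t <= b -> `|F t - F s| <= K * Num.sqrt (t - s)) ->
 continuous (F \o clamp a b).
Proof.
move=> ab K0 h x; apply/cvgrPdist_le => e e0.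
have k1 : 0 < K + 1 by lra.
near=> y; rewrite /comp.
have hxy : `|x - y| <= (e / (K + 1)) ^+ 2.
 near: y; apply: cvgr_dist_le; [exact: cvg_id|by rewrite exprn_gt0// divr_gt0].
have st : Num.sqrt `|x - y| <= e / (K + 1) by apply: sqrt_le => //; exact: ltW (divr_gt0 e0 k1).
have key s t : s <= t -> `|s - t| <= `|x - y| ->
  `|F (clamp a b s) - F (clamp a b t)| <= e.
 move=> le_st hst; have [s1 s2] := clamp_itv s ab; have [t1 t2] := clamp_itv t ab.
 rewrite distrC; apply: (le_trans (h _ _ s1 (clamp_mono a b le_st) t2)).
 apply: (@le_trans _ _ (K * (e / (K + 1)))).
  apply: ler_wpM2l => //; apply: le_trans st; rewrite ler_sqrt//.
  apply: (le_trans (ler_norm _)); apply: (le_trans (clamp_lip _ _ _ _)).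
  by rewrite distrC.
 by apply: frac_le => //; exact: ltW.
have [xy|/ltW yx] := leP x y; first exact: key.
by rewrite distrC; apply: key => //; rewrite distrC.
Unshelve. all: by end_near.
Qed.

Lemma prim_modulus a b f s t : a <= s -> s <= t -> t <= b -> L2 a b f ->
 `|it a t f - it a s f| <= nL a b f * Num.sqrt (t - s).
Proof.
move=> as_ st tb Lf.
have If : ig a t f by apply: ig_sub (L2_ig Lf).
rewrite (it_split as_ st If) addrAC subrr add0r.
have Ls : L2 s t f by exact: L2_sub as_ tb Lf.
apply: (le_trans (it_abs (L2_ig Ls))); apply: (le_trans (it_norm_le st Ls)).
by rewrite mulrC ler_wpM2r ?sqrtr_ge0//; exact: nL_sub.
Qed.

Lemma prim_continuous a b f : a <= b -> L2 a b f ->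
 continuous ((fun x => it a x f) \o clamp a b).
Proof.
move=> ab Lf; apply: (@continuous_of_modulus _ _ _ (nL a b f)) => //; first exact: nL_ge0.
by move=> s t as_ st tb; exact: prim_modulus.
Qed.

Lemma prim_L2 a b f : a <= b -> L2 a b f -> L2 a b (fun x => it a x f).
Proof.
move=> ab Lf; have h := L2_continuous a b (prim_continuous ab Lf).
have /L2P[m i] := h; apply/L2P; split.
 by apply: eq_measurable_fun m => x; rewrite inE/= in_itv/= => /andP[/ltW ax /ltW xb]; rewrite clamp_id.
by apply: ig_eq i => x /in_oo_le[ax xb]; rewrite /= clamp_id.
Qed.

Lemma prim_le a b f x : a <= x -> x <= b -> L2 a b f ->
 `|it a x f| <= nL a b f * Num.sqrt (b - a).
Proof.
move=> ax xb Lf; have := prim_modulus (lexx a) ax xb Lf.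
rewrite (it_deg _ (lexx a)) subr0 => h; apply: (le_trans h).
by rewrite ler_wpM2l ?nL_ge0// ler_sqrt ?lerD2r// subr_ge0 (le_trans ax).
Qed.

Lemma L2_mulC a b f g : continuous g -> L2 a b f -> L2 a b (fun x => f x * g x).
Proof.
move=> cg Lf; have [K K0 hK] := continuous_bounded a b cg.
rewrite (_ : (fun _ => _) = (fun x => g x * f x)); last by apply/funext => x; rewrite mulrC.
apply: (L2_mulb (K := K)) => //; first exact: ig_mf (ig_continuous a b cg).
apply: aeonW => x /in_oo_le[ax xb]; exact: hK.
Qed.

Lemma null_eq (x y : R) : (forall e, 0 < e -> `|x - y| <= e) -> x = y.
Proof.
move=> h; apply/eqP; rewrite -subr_eq0 -normr_le0; apply/ler_addgt0Pr => e e0.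
by rewrite add0r; exact: h.
Qed.

Lemma it_mul_le a b f g : L2 a b f -> L2 a b g -> `|it a b (fun x => f x * g x)| <= nL a b f * nL a b g.
Proof. by move=> Lf Lg; rewrite -L2inner_def; exact: (cauchy_schwarz (S := L2ip a b)). Qed.

(** Extension principle: an identity is encoded as the vanishing of its defect [D]. When the defect
    is subtractive and bounded in L^2, checking polynomials suffices. *)
Lemma L2_poly_ext a b (D : (R -> R) -> R) (C : R) f : a < b -> 0 <= C ->
 (forall g h, L2 a b g -> L2 a b h -> D (g - h) = D g - D h) ->
 (forall g, L2 a b g -> `|D g| <= C * nL a b g) -> (forall p, D (horner p) = 0) -> L2 a b f -> D f = 0.
Proof.
move=> ab C0 DB DC Dp Lf; apply: null_eq => e e0; have C1 : 0 < C + 1 by rewrite ltr_wpDl.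
have [p hp] := poly_dense ab Lf (divr_gt0 e0 C1); have Lp := L2_poly a b p.
rewrite -(Dp p) -DB//; apply: (le_trans (DC _ (L2B Lf Lp))).
by apply: (le_trans (ler_wpM2l C0 hp)); apply: frac_le => //; exact: ltW.
Qed.

(** For polynomials this is the fundamental theorem of calculus for a product; [L2_poly_ext] carries
    it to L^2, so the primitive is never differentiated. *)
Lemma it_parts a b f (th th' : R -> R) : a <= b -> L2 a b f ->
 continuous th -> continuous th' ->
 (forall x, x \in `]a, b[ -> is_derive x 1 th (th' x)) ->
 it a b (fun x => it a x f * th' x) + it a b (fun x => f x * th x) = it a b f * th b.
Proof.
move=> ab Lf cth cth' dth.
have Lth := L2_continuous a b cth; have Lth' := L2_continuous a b cth'.
have [ltab|ba] := ltP a b; last by rewrite !it_deg// mul0r addr0.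
have key p : it a b (fun x => it a x (horner p) * th' x) + it a b (fun x => (horner p) x * th x) =
  it a b (horner p) * th b.
 pose q := primp p - (primp p).[a]%:P.
 have dq : q^`() = p by rewrite /q derivB derivC subr0 deriv_primp.
 have qE x : a <= x -> it a x (horner p) = q.[x].
  by move=> ax; rewrite (it_poly ax dq) /q !hornerD !hornerN !hornerC subrr subr0.
 have cq (r : {poly R}) : continuous (horner r) by exact: continuous_horner.
 rewrite -itD; [|exact: L2_mul (prim_L2 ab (L2_poly a b p)) Lth'|exact: L2_mul (L2_poly a b p) Lth].
 have -> : it a b (fun x => it a x (horner p) * th' x + p.[x] * th x) =
   it a b (fun x => q.[x] * th' x + p.[x] * th x).
  by apply: it_eq => x /in_oo[/ltW ax _]; rewrite qE.
 have c1 : continuous (fun x => q.[x] * th' x + p.[x] * th x).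
  by move=> x; apply: cvgD; apply: cvgM; [exact: cq|exact: cth'|exact: cq|exact: cth].
 have c2 : continuous (fun x => q.[x] * th x) by move=> x; apply: cvgM; [exact: cq|exact: cth].
 have c3 x : x \in `]a, b[ -> is_derive x 1 (fun x => q.[x] * th x) (q.[x] * th' x + p.[x] * th x).
  move=> /dth d1.
  have d2 : is_derive x 1 (horner q) p.[x] by rewrite -dq; exact: is_derive_poly.
  apply: is_derive_eq (@is_deriveM R R (horner q) th x 1 _ _ d2 d1) _.
  by rewrite /GRing.scale /= (mulrC (th x)).
 rewrite (FTC_itv ab c1 c2 c3).
 by rewrite qE// /q !hornerD !hornerN !hornerC subrr mul0r subr0.
pose D g := it a b (fun x => it a x g * th' x) + it a b (fun x => g x * th x) - it a b g * th b.
pose C := (b - a) * nL a b th' + nL a b th + Num.sqrt (b - a) * `|th b|.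
have ba0 : 0 <= b - a by rewrite subr_ge0.
have C0 : 0 <= C
 by apply: addr_ge0; [apply: addr_ge0; [apply: mulr_ge0 => //; exact: nL_ge0|exact: nL_ge0]|exact: mulr_ge0].
have DB g h : L2 a b g -> L2 a b h -> D (g - h) = D g - D h.
 move=> Lg Lh; rewrite /D.
 have -> : it a b (g - h) = it a b g - it a b h by apply: itB; exact: L2_ig.
 have -> : it a b (fun x => (g - h) x * th x) =
  it a b (fun x => g x * th x) - it a b (fun x => h x * th x).
  by rewrite -itB; [apply: it_eq => x _; exact: mulrBl|exact: L2_mul|exact: L2_mul].
 have -> : it a b (fun x => it a x (g - h) * th' x) =
  it a b (fun x => it a x g * th' x) - it a b (fun x => it a x h * th' x).
  rewrite -itB; [|by apply: L2_mul => //; exact: prim_L2..].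
  apply: it_eq => x /in_oo[_ /ltW xb]; rewrite -mulrBl; congr (_ * _).
  by apply: itB; [apply: ig_sub (L2_ig Lg)|apply: ig_sub (L2_ig Lh)].
 by move: (it _ _ _) (it _ _ _) (it _ _ _) (it _ _ _) (it _ _ _) (it _ _ _) => *; ring.
have DC g : L2 a b g -> `|D g| <= C * nL a b g.
 move=> Lg; rewrite /D /C (mulrC (_ + _)) !mulrDr.
 apply: (le_trans (ler_normB _ _)); apply: lerD; first apply: (le_trans (ler_normD _ _)); first apply: lerD.
 - apply: (le_trans (it_mul_le (prim_L2 ab Lg) Lth')); rewrite mulrA ler_wpM2r ?nL_ge0//.
  have := @nL_le_bound _ a b (fun x => it a x g) (nL a b g * Num.sqrt (b - a)) ab (prim_L2 ab Lg).
  rewrite -mulrA -expr2 sqr_sqrtr//; apply; first by rewrite mulr_ge0 ?nL_ge0 ?sqrtr_ge0.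
  by apply: aeonW => x /in_oo_le[ax xb]; exact: prim_le.
 - exact: it_mul_le.
 - rewrite normrM mulrA ler_wpM2r//; apply: (le_trans (it_abs (L2_ig Lg))).
  by rewrite mulrC; exact: it_norm_le.
apply/eqP; rewrite -subr_eq0; apply/eqP; rewrite -/(D f).
by apply: (L2_poly_ext ltab C0 DB DC) => // p; rewrite /D key subrr.
Qed.

(** Integrating by parts against a polynomial leaves only primitives of [g], so [g] is orthogonal to
    all polynomials. *)
Lemma prim0_ae a b g : a < b -> L2 a b g -> (forall x, a <= x -> x <= b -> it a x g = 0) ->
 aeon a b (fun x => g x = 0).
Proof.
move=> ab Lg h; apply: poly_orth => // p; rewrite L2inner_def.
have := @it_parts a b g (horner p) (horner p^`()) (ltW ab) Lg
 (@continuous_horner _ _) (@continuous_horner _ _) (fun x _ => is_derive_poly _ _).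
rewrite h ?(ltW ab)// mul0r => <-.
rewrite [X in X + _](_ : _ = 0) ?add0r//.
rewrite -[RHS](it0 a b); apply: it_eq => x /in_oo_le[ax xb].
by rewrite h// mul0r.
Qed.

(** Exhaust the interval by smaller ones at distance [1 / (n + 1)] from the ends; [prim0_ae] applies
    on each. *)
Lemma sub_itv0_ae a b g : L2 a b g ->
 (forall c d, a < c -> c < d -> d < b -> it c d g = 0) -> aeon a b (fun x => g x = 0).
Proof.
move=> Lg h; have H0 (i : R) : 0 < i -> aeon (a + i) (b - i) (fun x => g x = 0).
 move=> i0; have [cd|dc] := ltP (a + i) (b - i); last first.
  by apply: aeonW => x /in_oo[cx xd]; have := lt_le_trans (lt_trans cx xd) dc; rewrite ltxx.
 apply: prim0_ae => //; first by apply: L2_sub Lg; lra.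
 move=> x; rewrite le_eqVlt => /predU1P[<- _|cx xd]; first by rewrite it_deg.
 by apply: h => //; lra.
have H n : aeon (a + n.+1%:R^-1) (b - n.+1%:R^-1) (fun x => g x = 0) by apply: H0; rewrite invr_gt0.
have H' := @ae_foralln _ _ _ (@lebesgue_measure R) (fun n x => x \in `]a + n.+1%:R^-1, b - n.+1%:R^-1[ -> g x = 0) H.
apply: (@filterS _ _ ae_filter _ _ _ H') => x hx /in_oo[ax xb].
have m0 : 0 < Num.min (x - a) (b - x) by rewrite lt_min !subr_gt0 ax.
have m2 : 0 < Num.min (x - a) (b - x) / 2 by rewrite divr_gt0.
have [N /(_ N (leqnn N))] := null_harmonic m2.
have : Num.min (x - a) (b - x) <= x - a by rewrite ge_min lexx.
have : Num.min (x - a) (b - x) <= b - x by rewrite ge_min lexx orbT.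
have := hx N; move: (N.+1%:R^-1 : R) (Num.min _ _) m0 {m2 hx H' H} => i m m1 hi h1 h2 h3.
by apply: hi; rewrite in_itv/=; apply/andP; split; lra.
Qed.

End Parts.

(** * Smooth functions with compact support *)

Section SmoothBumps.
Context {R : realType}.
Implicit Types (p : {poly R}) (f g : R -> R).

(** Differentiability of order [n + 1], by recursion on the derivative: products and flat functions
    are then handled by induction, without formulas for iterated derivatives. *)
Fixpoint Dk (n : nat) f : Prop :=
 (forall x, derivable f x 1) /\ if n is n'.+1 then Dk n' (derive1 f) else True.

Lemma DkE n f : Dk n f <-> forall k, (k <= n)%N -> forall x, derivable (derive1n k f) x 1.
Proof.
elim: n f => [|n IH] f; first by split => [[h _] [|k]//|h]; split => //; exact: (h 0%N).
split => [[h /IH h'] [|k] kn x //|h]; first by rewrite derive1Sn; exact: h'.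
split; first exact: (h 0%N).
by apply/IH => k kn x; rewrite -derive1Sn; exact: h.
Qed.

Lemma smoothP f : smooth f <-> forall n, Dk n f.
Proof.
split => [h n|h n x]; first by apply/DkE => k _; exact: h.
by have /DkE := h n; exact.
Qed.

Lemma DkS n f : Dk n.+1 f -> Dk n f.
Proof. by move=> /DkE h; apply/DkE => k kn; apply: h; exact: leqW. Qed.

Lemma is_derive1P f f' : (forall x : R, is_derive x 1 f (f' x)) ->
 (forall x, derivable f x 1) /\ derive1 f = f'.
Proof.
move=> h; split => [x|]; first by have [] := h x.
by apply/funext => x; rewrite derive1E; have [_] := h x.
Qed.

Lemma DkI n f f' : (forall x : R, is_derive x 1 f (f' x)) -> Dk n f' -> Dk n.+1 f.
Proof. by move=> /is_derive1P[h1 h2] h; split => //; rewrite h2. Qed.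

Lemma derivable_is f x : derivable f x 1 -> is_derive x 1 f (derive1 f x).
Proof. by move=> h; rewrite derive1E; exact: derivableP. Qed.

Lemma Dk_cst n (k : R) : Dk n (cst k).
Proof.
elim: n k => [|n IH] k; first by split.
by apply: (DkI (f' := cst 0)) => // x; exact: is_derive_cst.
Qed.

Lemma DkD n f g : Dk n f -> Dk n g -> Dk n (fun x => f x + g x).
Proof.
elim: n f g => [|n IH] f g [df hf] [dg hg]; first by split; [move=> x; exact: derivableD|].
apply: (DkI (f' := fun x => derive1 f x + derive1 g x)); last exact: IH.
by move=> x; apply: is_deriveD; exact: derivable_is.
Qed.

Lemma DkM n f g : Dk n f -> Dk n g -> Dk n (fun x => f x * g x).
Proof.
elim: n f g => [|n IH] f g Df Dg; first by split; [move=> x; apply: derivableM; [case: Df|case: Dg]|].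
have [[df hf] [dg hg]] := (Df, Dg).
apply: (DkI (f' := fun x => f x * derive1 g x + g x * derive1 f x)).
 by move=> x; apply: is_deriveM; exact: derivable_is.
by apply: DkD; apply: IH => //; exact: DkS.
Qed.

Lemma Dk_affine n f (k r c : R) : Dk n f -> Dk n (fun x => k * f (r * x + c)).
Proof.
have d (g : R -> R) (l x : R) : (forall x, derivable g x 1) ->
  is_derive x 1 (fun x => l * g (r * x + c)) (l * r * derive1 g (r * x + c)).
 move=> dg; have h1 : is_derive x 1 (fun x => r * x + c) r.
  have -> : (fun x => r * x + c) = horner (r *: 'X + c%:P).
   by apply/funext => y; rewrite hornerD hornerZ hornerX hornerC.
  apply: is_derive_eq (is_derive_poly (r *: 'X + c%:P) x) _.
  by rewrite derivD derivZ derivX derivC addr0 alg_polyC hornerC.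
 have h2 := @is_derive1_comp R g (fun x => r * x + c) x _ _ (derivable_is (dg _)) h1.
 have h3 : is_derive x 1 (fun x => l * g (r * x + c)) (l * (derive1 g (r * x + c) * r)).
  exact: (@is_deriveZ R R R (g \o (fun x => r * x + c)) l x 1 _ h2).
 by apply: is_derive_eq h3 _; ring.
elim: n f k => [|n IH] f k [df hf]; first by split; [move=> x; have [] := d f k x df|].
by apply: (DkI (d f k ^~ df)); exact: IH.
Qed.

(** The flat function exp(-1/x) times a polynomial in 1/x. The polynomial factor makes the family
    stable under differentiation, hence all its members smooth. *)
Definition eb p (x : R) := if 0 < x then p.[x^-1] * expR (- x^-1) else 0.

(** For positive [n], raise the inequality between y/n and exp(y/n) to the power n. *)
Lemma expR_pow_le n (y : R) : 0 <= y -> y ^+ n * expR (- y) <= n%:R ^+ n.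
Proof.
move=> y0; case: n => [|n]; first by rewrite !expr0 mul1r expR_le1 oppr_le0.
have n0 : 0 < n.+1%:R :> R by rewrite ltr0n.
rewrite expRN ler_pdivrMr ?expR_gt0//.
have -> : y = n.+1%:R * (y / n.+1%:R) by field; rewrite gt_eqF.
rewrite exprMn ler_pM2l ?exprn_gt0//.
have -> : n.+1%:R * (y / n.+1%:R) = \sum_(i < n.+1) (y / n.+1%:R) by rewrite sumr_const card_ord -[RHS]mulr_natr mulrC.
rewrite expR_sum prodr_const card_ord ler_pXn2r ?nnegrE ?expR_ge0 ?divr_ge0//.
by apply: le_trans (expR_ge1Dx _); rewrite lerDr.
Qed.

(** A quadratic bound makes the difference quotient at 0 tend to zero; it costs two more powers of
    1/x, whence the exponent [(size p).+2]. *)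
Lemma eb_bound p : exists2 C : R, 0 <= C & forall x, x <= 1 -> `|eb p x| <= C * x ^+ 2.
Proof.
pose n := (size p).+2; pose S := \sum_(i < size p) `|p`_i|.
have S0 : 0 <= S by apply: sumr_ge0.
exists (S * n%:R ^+ n) => [|x x1]; first by rewrite mulr_ge0// exprn_ge0.
rewrite /eb; case: ltP => x0; last first.
 by rewrite normr0; apply: mulr_ge0; [apply: mulr_ge0 => //; exact: exprn_ge0|exact: sqr_ge0].
set y := x^-1; have y1 : 1 <= y by rewrite /y invf_ge1.
have y0 : 0 <= y by lra.
rewrite normrM (ger0_norm (expR_ge0 _)).
have h1 : `|p.[y]| <= S * y ^+ size p.
 rewrite horner_coef; apply: (le_trans (ler_norm_sum _ _ _)).
 rewrite mulr_suml; apply: ler_sum => i _; rewrite normrM ler_wpM2l// ger0_norm ?exprn_ge0//.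
 by rewrite ler_weXn2l// ltnW.
have h2 := expR_pow_le n y0.
have -> : x ^+ 2 = y ^- 2 by rewrite /y exprVn invrK.
rewrite ler_pdivlMr ?exprn_gt0 ?invr_gt0// mulrAC.
apply: (@le_trans _ _ (S * y ^+ size p * y ^+ 2 * expR (- y))).
 by rewrite ler_wpM2r ?expR_ge0// ler_wpM2r// exprn_ge0.
have -> : S * y ^+ size p * y ^+ 2 * expR (- y) = S * (y ^+ n * expR (- y)).
 have -> : y ^+ n = y ^+ 2 * y ^+ size p by rewrite -exprD.
 by move: (y ^+ 2) (y ^+ size p) (expR _) => *; ring.
by rewrite ler_wpM2l.
Qed.

Lemma eb_derive p (x : R) : is_derive x 1 (eb p) (eb ('X^2 * (p - p^`())) x).
Proof.
have [x0|x0|x0] := ltgtP 0 x.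
- pose h (y : R) := p.[y] * expR (- y).
 have dh (y : R) : is_derive y 1 h (p^`().[y] * expR (- y) - p.[y] * expR (- y)).
  have d1 := is_derive_poly p y.
  have d2 : is_derive y 1 (fun y => expR (- y)) (expR (- y) * -1).
   exact: (@is_derive1_comp R expR (fun y => - y) y _ _ (is_derive_expR _)).
  apply: is_derive_eq (@is_deriveM R R (horner p) (fun y => expR (- y)) y 1 _ _ d1 d2) _.
  by rewrite /GRing.scale /=; ring.
 have dV : is_derive x 1 (fun x : R => x^-1) (- x ^- 2).
  apply: is_derive_eq (@is_deriveV R (fun x => x) x 1 1 (lt0r_neq0 x0) (is_derive_id x 1)) _.
  by rewrite /GRing.scale /= mulr1.
 have := @is_derive1_comp R h (fun x => x^-1) x _ _ (dh _) dV.
 have -> : eb ('X^2 * (p - p^`())) x = (p^`().[x^-1] * expR (- x^-1) - p.[x^-1] * expR (- x^-1)) * - x ^- 2.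
  by rewrite /eb x0 hornerM hornerXn hornerD hornerN exprVn; ring.
 apply: near_eq_is_derive; near=> y; rewrite /eb /h /=.
 by have -> : 0 < y by near: y; exact: lt_nbhsr.
- rewrite {2}/eb ltNge (ltW x0) /=.
 have := is_derive_cst (0 : R) x 1; apply: near_eq_is_derive; near=> y.
 rewrite /eb; have y0 : y < 0 by near: y; exact: lt_nbhsl.
 by rewrite ltNge (ltW y0).
- have [C C0 hC] := eb_bound p.
 rewrite -x0 {2}/eb ltxx; have e0 : eb p 0 = 0 by rewrite /eb ltxx.
 have cv : (fun h : R => h^-1 *: ((eb p \o shift 0) (h *: 1) - eb p 0)) @ 0^' --> (0 : R).
  apply/cvgr0Pnorm_le => e ep; near=> h.
  rewrite e0 subr0 /= addr0 /GRing.scale /= mulr1 normrM normfV.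
  have h0 : h != 0 by near: h; exact: nbhs_dnbhs_neq.
  have hp : 0 < `|h| by rewrite normr_gt0.
  have h1 : `|h| <= Num.min 1 (e / (C + 1)).
   near: h; apply: dnbhs0_le; rewrite lt_min ltr01 divr_gt0//; lra.
  move: h1; rewrite le_min => /andP[h1 h2].
  rewrite mulrC ler_pdivrMr//; apply: (le_trans (hC h _)); first exact: le_trans (ler_norm _) h1.
  rewrite -real_normK ?num_real// expr2 mulrA ler_wpM2r//.
  move: h2; rewrite ler_pdivlMr; last lra.
  by move=> h2; apply: le_trans h2; rewrite mulrC ler_wpM2l//; lra.
 split; first by apply/cvg_ex; exists 0.
 exact: cvg_lim cv.
Unshelve. all: by end_near.
Qed.

Lemma Dk_eb n p : Dk n (eb p).
Proof.
elim: n p => [|n IH] p; first by split => // x; have [] := eb_derive p x.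
exact: (DkI (eb_derive p)).
Qed.

(* [bmp n c d] vanishes off ]c,d[ and tends to 1 on it as [n] grows. *)
Definition bmp (n : nat) (c d x : R) := eb 1 (n.+1%:R * (x - c)) * eb 1 (n.+1%:R * (d - x)).

Lemma Dk_bmp k n c d : Dk k (bmp n c d).
Proof.
apply: DkM.
 have := @Dk_affine k (eb 1) 1 n.+1%:R (- (n.+1%:R * c)) (Dk_eb k 1).
 by congr (Dk k _); apply/funext => x; rewrite mul1r mulrBr.
have := @Dk_affine k (eb 1) 1 (- n.+1%:R) (n.+1%:R * d) (Dk_eb k 1).
by congr (Dk k _); apply/funext => x; rewrite mul1r mulrBr mulNr addrC.
Qed.

Lemma eb1_01 x : 0 <= eb 1 x <= 1.
Proof.
rewrite /eb; case: ltP => x0; last by rewrite lexx ler01.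
by rewrite hornerC mul1r expR_ge0 expR_le1 oppr_le0 invr_ge0 ltW.
Qed.

Lemma bmp_01 n c d x : 0 <= bmp n c d x <= 1.
Proof.
have /andP[a0 a1] := eb1_01 (n.+1%:R * (x - c)); have /andP[b0 b1] := eb1_01 (n.+1%:R * (d - x)).
by rewrite /bmp mulr_ge0//= mulr_ile1.
Qed.

Lemma bmp_out n c d x : x <= c \/ d <= x -> bmp n c d x = 0.
Proof.
have n0 : 0 <= n.+1%:R :> R by [].
case=> h; rewrite /bmp.
 by rewrite [eb 1 _](_ : _ = 0) ?mul0r// /eb ltNge mulr_ge0_le0// subr_le0.
by rewrite [X in _ * X](_ : _ = 0) ?mulr0// /eb ltNge mulr_ge0_le0// subr_le0.
Qed.

Lemma bmp_cvg c d x : c < x -> x < d -> bmp n c d x @[n --> \oo] --> (1 : R).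
Proof.
move=> cx xd.
have key (y : R) : 0 < y -> (fun n => eb 1 (n.+1%:R * y)) @ \oo --> (1 : R).
 move=> y0; rewrite (_ : (fun _ => _) = (fun n => expR (- (n.+1%:R^-1 * y^-1)))); last first.
  by apply/funext => n; rewrite /eb mulr_gt0// hornerC mul1r invfM.
 rewrite -[X in _ --> X](_ : expR (- (0 * y^-1)) = 1); last by rewrite mul0r oppr0 expR0.
 apply: (@cvg_comp _ _ _ (fun n => - (n.+1%:R^-1 * y^-1)) (@expR R)); last exact: continuous_expR.
 by apply: cvgN; apply: cvgMl; exact: cvg_harmonic.
rewrite -[X in _ --> X]mulr1; apply: cvgM; apply: key; rewrite subr_gt0//.
Qed.
End SmoothBumps.

(** * Weak derivatives and H^1 *)

Section WeakDerivatives.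
Context {R : realType}.
Notation mu := (@lebesgue_measure R).
Implicit Types (a b c d : R) (f g phi psi : R -> R) (p q : {poly R}).

Lemma derivable_cts f : (forall x, derivable f x 1) -> continuous f.
Proof. by move=> h x; apply: differentiable_continuous; exact/derivable1_diffP. Qed.

Lemma smooth_cts f : smooth f -> continuous f.
Proof. by move=> h; apply: derivable_cts; exact: (h 0%N). Qed.

Lemma smooth_deriv f : smooth f -> smooth (derive1 f).
Proof. by move=> h n x; rewrite -derive1Sn. Qed.

Lemma smooth_is f (x : R) : smooth f -> is_derive x 1 f (derive1 f x).
Proof. by move=> h; apply: derivable_is; exact: (h 0%N). Qed.

Lemma derive1_poly p : derive1 (horner p) = horner p^`().
Proof.
by apply/funext => x; rewrite derive1E; have [_ ->] := is_derive_poly p x.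
Qed.

Lemma smooth_poly p : smooth (horner p).
Proof.
move=> n; elim: n p => [|n IH] p x; first by have [] := is_derive_poly p x.
by rewrite derive1Sn derive1_poly; exact: IH.
Qed.

Lemma smoothD f g : smooth f -> smooth g -> smooth (fun x => f x + g x).
Proof. by move=> /smoothP hf /smoothP hg; apply/smoothP => n; exact: DkD. Qed.

Lemma smoothM f g : smooth f -> smooth g -> smooth (fun x => f x * g x).
Proof. by move=> /smoothP hf /smoothP hg; apply/smoothP => n; exact: DkM. Qed.

Lemma smoothZ (k : R) f : smooth f -> smooth (fun x => k * f x).
Proof. by move=> h; apply: smoothM; [apply/smoothP => n; exact: Dk_cst|exact: h]. Qed.

Lemma smooth_prim psi phi : smooth psi -> (forall x : R, is_derive x 1 phi (psi x)) ->
 smooth phi /\ derive1 phi = psi.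
Proof.
move=> /smoothP h d; split; last by have [] := is_derive1P d.
by apply/smoothP => n; apply: DkS; exact: DkI d (h n).
Qed.

Lemma test_cts a b phi : test_function a b phi -> continuous phi.
Proof. by move=> [/smooth_cts]. Qed.

Lemma test_end a b phi : test_function a b phi -> phi a = 0 /\ phi b = 0.
Proof.
move=> [_ [a' [b' [aa bb h]]]].
by split; apply: h; rewrite in_itv/= negb_and -!ltNge ?aa ?bb ?orbT.
Qed.

Lemma bmp_test n a b c d : a < c -> d < b -> test_function a b (bmp n c d).
Proof.
move=> ac db; split; first by apply/smoothP => k; exact: Dk_bmp.
exists c, d; split => // x; rewrite in_itv/= negb_and -!ltNge => /orP[h|h].
 by apply: bmp_out; left; exact: ltW.
by apply: bmp_out; right; exact: ltW.
Qed.

Lemma bmp_cts n c d : continuous (bmp n c d).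
Proof. by have [/smooth_cts] := @bmp_test n (c - 1) (d + 1) c d ltac:(lra) ltac:(lra). Qed.

Lemma it_supp a b c d h : a <= c -> c <= d -> d <= b -> ig a b h ->
 (forall x, x < c \/ d < x -> h x = 0) -> it a b h = it c d h.
Proof.
move=> ac cd db i out; rewrite (it_split ac (le_trans cd db) i) (it_split cd db (ig_sub ac (lexx b) i)).
have z u v : (forall x, x \in `]u, v[ -> x < c \/ d < x) -> it u v h = 0.
 by move=> k; rewrite -[RHS](it0 u v); apply: it_eq => x /k /out.
by rewrite (z a c) ?(z d b) ?add0r ?addr0// => x /in_oo[? ?]; [right|left].
Qed.

Lemma it_bmp a b c d n g : a < c -> c < d -> d < b -> L2 a b g ->
 it a b (fun x => g x * bmp n c d x) = it c d (fun x => g x * bmp n c d x).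
Proof.
move=> ac cd db Lg; apply: it_supp; rewrite ?ltW//; first exact: L2_ig (L2_mulC (@bmp_cts n c d) Lg).
by move=> x [|] /ltW h; rewrite bmp_out ?mulr0//; [left|right].
Qed.

(** Dominated convergence of the bumps to the indicator of []c, d[]: orthogonality to test functions
    thus forces zero integrals on inner intervals. *)
Lemma bmp_lim a b c d g : a < c -> c < d -> d < b -> L2 a b g ->
 null (fun n => `|it a b (fun x => g x * bmp n c d x) - it c d g|).
Proof.
move=> ac cd db Lg; have Lcd : L2 c d g by apply: L2_sub Lg; exact: ltW.
under [X in null X]eq_fun => n do rewrite it_bmp//.
apply: (@it_dominated _ c d (fun n x => g x * bmp n c d x) g (fun x => `|g x|)).
- by move=> n; exact: L2_mfn (L2_mulC (@bmp_cts n c d) Lcd).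
- exact: ig_norm (L2_ig Lcd).
- apply: aeonW => x /in_oo[cx xd].
 rewrite -[X in _ --> X]mulr1; apply: cvgMr; exact: bmp_cvg.
- move=> n; apply: aeonW => x _; have /andP[b0 b1] := bmp_01 n c d x.
 by rewrite normrM (ger0_norm b0) ler_piMr.
- exact: L2_mfn.
Qed.

Lemma test_orth a b g : a < b -> L2 a b g ->
 (forall phi, test_function a b phi -> it a b (fun x => g x * phi x) = 0) ->
 aeon a b (fun x => g x = 0).
Proof.
move=> ab Lg h; apply: sub_itv0_ae => // c d ac cd db.
apply/eqP; rewrite -normr_le0; apply: null_cst_le (bmp_lim ac cd db Lg) _ => n.
by rewrite h ?sub0r ?normrN//; exact: bmp_test.
Qed.

Lemma it_is_derive (psi : R -> R) (c x : R) : continuous psi -> c < x ->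
 is_derive x 1 (fun y => it c y psi) (psi x).
Proof.
move=> cpsi cx.
have i u : mu.-integrable [set` Interval (BRight c) (BRight u)] (EFin \o psi).
 apply: (@integrableS _ _ _ mu `[c, u]%classic) => //.
  by move=> y /=; rewrite !in_itv/= => /andP[/ltW -> ->].
 apply: continuous_compact_integrable; first exact: segment_compact.
 exact: continuous_subspaceT.
have xu : x < x + 1 by rewrite ltrDl.
have [d1 d2] := continuous_FTC1 xu (i (x + 1)) cx (cpsi x).
have e y : \int[mu]_(t in [set` Interval (BRight c) (BRight y)]) psi t = it c y psi.
 rewrite /it /Rintegral (@integral_itv_bndoo _ c y (EFin \o psi) false false)//.
 by apply/measurable_EFinP; exact: ig_mf (ig_continuous c y cpsi).
have E : (fun y => \int[mu]_(t in [set` Interval (BRight c) (BRight y)]) psi t) =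
 (fun y => it c y psi) by apply/funext.
rewrite E in d1 d2; rewrite -d2; exact: derivable_is.
Qed.

(** The vanishing integral makes the primitive zero to the right of the support, hence a test
    function. *)
Lemma compact_prim a b lo hi psi : smooth psi -> a < lo -> lo <= hi -> hi < b ->
 (forall x, x \notin `[lo, hi] -> psi x = 0) -> it lo hi psi = 0 ->
 exists2 phi, test_function a b phi & derive1 phi = psi.
Proof.
move=> spsi alo lohi hib out tot; have cpsi := smooth_cts spsi.
(* The base point lies strictly to the left of the support, so that differentiation under a variable
   upper bound is available on all of it. *)
pose phi x := it (lo - 1) x psi.
have phi0 x : x <= lo -> phi x = 0.
 move=> xlo; rewrite /phi -[RHS](it0 (lo - 1) x); apply: it_eq => y.
 move=> /in_oo[_ yx]; apply: out.
 by rewrite in_itv/= negb_and -!ltNge (lt_le_trans yx xlo).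
have phi1 x : hi <= x -> phi x = 0.
 move=> hix; have i := ig_continuous (lo - 1) x cpsi.
 rewrite /phi (@it_split _ lo _ _ _ _ _ i); [|lra|lra].
 rewrite -/(phi lo) phi0// add0r (@it_split _ hi _ _ _ lohi hix); last first.
  exact: ig_continuous.
 rewrite tot add0r -[RHS](it0 hi x); apply: it_eq => y.
 move=> /in_oo[hy _]; apply: out.
 by rewrite in_itv/= negb_and -!ltNge hy orbT.
have d (x : R) : is_derive x 1 phi (psi x).
 have [h|h] := ltP (lo - 1) x; first exact: it_is_derive.
 have -> : psi x = 0 by apply: out; rewrite in_itv/= negb_and -!ltNge; apply/orP; left; lra.
 have := is_derive_cst (0 : R) x 1; apply: near_eq_is_derive; near=> y.
 rewrite phi0//; have : y < lo by near: y; apply: lt_nbhsl; lra.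
 exact: ltW.
have [s1 s2] := smooth_prim spsi d.
exists phi => //; split => //; exists lo, hi; split => // x.
by rewrite in_itv/= negb_and -!ltNge => /orP[/ltW /phi0|/ltW /phi1].
Unshelve. all: by end_near.
Qed.

Lemma bmp_mass (c d : R) : c < d -> 0 < it c d (bmp 0 c d).
Proof.
move=> cd; have i := ig_continuous c d (@bmp_cts 0 c d).
have p0 : aeon c d (fun x => 0 <= bmp 0 c d x) by apply: aeonW => x _; have /andP[] := bmp_01 0 c d x.
rewrite lt_neqAle it_ge0// andbT eq_sym; apply/eqP => h.
have := it_eq0_ae i p0 h => h0.
have : it c d (fun=> 1 : R) = it c d (fun=> 0).
 apply: it_ae; apply: aeonS h0 => x /in_oo[cx xd] bx.
 have : 0 < bmp 0 c d x by rewrite /bmp /eb !mul1r !subr_gt0 cx xd !hornerC !mul1r mulr_gt0// expR_gt0.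
 by rewrite bx ltxx.
by rewrite it0 it_cst ?(ltW cd)// mul1r => h1; move: cd; rewrite -subr_gt0 h1 ltxx.
Qed.

(** Du Bois-Reymond: subtracting the multiple [M] of a fixed bump gives a test function zero
    integral, hence makes it the derivative of a test function. The constant [k] is the mean of [f]
    against that bump. *)
Lemma weak0_const a b f : a < b -> L2 a b f ->
 (forall phi, test_function a b phi -> it a b (fun x => f x * derive1 phi x) = 0) ->
 exists k : R, aeon a b (fun x => f x = k).
Proof.
move=> ab Lf h.
pose c := a + (b - a) / 3; pose d := a + 2 * (b - a) / 3.
have [h1 h2 h3] : [/\ a < c, c < d & d < b] by rewrite /c /d; split; lra.
pose B := bmp 0 c d; have [sB _] := @bmp_test 0 a b c d h1 h3.
have cB : continuous B := @bmp_cts 0 c d; have iB := ig_continuous a b cB.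
have outB x : x < c \/ d < x -> B x = 0 by case=> /ltW k; rewrite /B bmp_out//; [left|right].
have m0 : 0 < it a b B by rewrite (it_supp _ _ _ iB outB) ?ltW//; exact: bmp_mass.
pose k := it a b (fun x => f x * B x) / it a b B; exists k.
suff : aeon a b (fun x => f x - k = 0) by apply: aeonS => x _ /eqP; rewrite subr_eq0 => /eqP.
apply: test_orth => // [|phi tphi]; first exact: (domB (S := L2ip a b) Lf (L2_cst a b k)).
have [sphi [a' [b' [aa bb out]]]] := tphi; have cphi := test_cts tphi; have iphi := ig_continuous a b cphi.
pose M := it a b phi / it a b B; pose psi x := phi x + (- M) * B x.
have spsi : smooth psi by apply: smoothD; [exact: sphi|exact: (smoothZ (k := - M) sB)].
have [l1 l2 l3] : [/\ a < Num.min a' c, Num.min a' c <= Num.max b' d & Num.max b' d < b].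
 by rewrite lt_min aa gt_max bb; split=> //; rewrite ge_min; apply/orP; right; rewrite le_max (ltW h2) orbT.
have outp x : x < Num.min a' c \/ Num.max b' d < x -> psi x = 0.
 move=> o; rewrite /psi out ?outB ?mulr0 ?addr0//; move: o; rewrite lt_min gt_max ?in_itv/= ?negb_and -?ltNge.
  by case=> /andP[_ ?]; [left|right].
 by case=> /andP[-> _]; rewrite ?orbT.
have tot : it (Num.min a' c) (Num.max b' d) psi = 0.
 rewrite -(it_supp (ltW l1) l2 (ltW l3) _ outp); last exact/ig_continuous/smooth_cts.
 by rewrite itD//; [rewrite itZ// mulNr divfK ?gt_eqF// subrr|exact: igZ].
have [|chi tchi dchi] := compact_prim spsi l1 l2 l3 _ tot.
 by move=> x; rewrite in_itv/= negb_and -!ltNge => /orP; exact: outp.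
have j1 := L2_ig (L2_mulC cphi Lf); have j2 := L2_ig (L2_mulC cB Lf).
have -> : it a b (fun x => (f x - k) * phi x) = it a b (fun x => f x * phi x) - k * it a b phi.
 by rewrite -itZ// -itB//; [apply: it_eq => x _; rewrite mulrBl|exact: igZ].
have := h chi tchi; rewrite dchi => e; rewrite -[RHS]e.
have -> : it a b (fun x => f x * psi x) = it a b (fun x => f x * phi x) + (- M) * it a b (fun x => f x * B x).
 by rewrite -itZ// -itD//; [apply: it_eq => x _; rewrite /psi; ring|exact: igZ].
by rewrite /k /M; ring.
Qed.

Definition isH1 a b f f' := [/\ L2 a b f, L2 a b f' & weak_derivative a b f f'].

Lemma isH1E a b f f' : isH1 a b f f' <-> [/\ L2 a b f, L2 a b f' &
 forall phi, test_function a b phi ->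
  it a b (fun x => f x * derive1 phi x) + it a b (fun x => f' x * phi x) = 0].
Proof.
split=> -[Lf Lf' h]; split => // phi tphi.
 by have := h phi tphi; rewrite !L2inner_def => ->; rewrite addNr.
by have := h phi tphi; rewrite !L2inner_def => /eqP; rewrite addr_eq0 => /eqP.
Qed.

Lemma H1P a b f : H1 a b f <-> exists f', isH1 a b f f'.
Proof.
by split => [[Lf [f' [Lf' w]]]|[f' [Lf Lf' w]]]; [exists f'|split => //; exists f'].
Qed.

Lemma wderivP a b f : H1 a b f -> isH1 a b f (wderiv a b f).
Proof.
move=> [Lf [f' [Lf' w]]].
have [Lw ww] : [set f' | L2 a b f' /\ weak_derivative a b f f'] (wderiv a b f) by apply: xgetPex; exists f'.
by split.
Qed.

Lemma isH1_uniq a b f f1 f2 : a < b -> isH1 a b f f1 -> isH1 a b f f2 ->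
 aeon a b (fun x => f1 x = f2 x).
Proof.
move=> ab /isH1E[Lf L1 h1] /isH1E[_ L2' h2].
suff : aeon a b (fun x => (f1 - f2) x = 0).
 by apply: aeonS => x _ /eqP; rewrite subr_eq0 => /eqP.
apply: test_orth => //; first exact: (domB (S := L2ip a b) L1 L2').
move=> phi tphi; have cphi := test_cts tphi.
have -> : it a b (fun x => (f1 - f2) x * phi x) =
 it a b (fun x => f1 x * phi x) - it a b (fun x => f2 x * phi x).
 rewrite -itB; [|exact: L2_ig (L2_mulC cphi L1)|exact: L2_ig (L2_mulC cphi L2')].
 by apply: it_eq => x _; exact: mulrBl.
by have := h1 phi tphi; have := h2 phi tphi; move: (it _ _ _) (it _ _ _) (it _ _ _) => *; lra.
Qed.

Lemma isH1_ae a b f g f' g' : mfn a b g -> mfn a b g' -> aeon a b (fun x => f x = g x) ->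
 aeon a b (fun x => f' x = g' x) -> isH1 a b f f' -> isH1 a b g g'.
Proof.
move=> mg mg' e e' /isH1E[Lf Lf' h]; apply/isH1E; split; [exact: L2_ae e Lf|exact: L2_ae e' Lf'|].
move=> phi tphi; rewrite -[RHS](h phi tphi); congr (_ + _); apply: it_ae.
 by apply: aeonS e => x _ ->.
by apply: aeonS e' => x _ ->.
Qed.

Lemma isH1_prim a b f (k : R) : a <= b -> L2 a b f -> isH1 a b (fun x => k + it a x f) f.
Proof.
move=> ab Lf; have Lp := prim_L2 ab Lf.
have Lk : L2 a b (fun x => k + it a x f) by exact: (L2D (L2_cst a b k) Lp).
apply/isH1E; split => // phi tphi; have [sphi _] := tphi.
have [pa pb] := test_end tphi; have c1 := test_cts tphi.
have c2 := smooth_cts (smooth_deriv sphi).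
have := it_parts ab Lf c1 c2 (fun x _ => smooth_is x sphi); rewrite pb mulr0 => e.
have -> : it a b (fun x => (k + it a x f) * derive1 phi x) =
  k * it a b (derive1 phi) + it a b (fun x => it a x f * derive1 phi x).
 rewrite -itZ; last exact: ig_continuous.
 rewrite -itD; [|by apply: igZ; exact: ig_continuous|exact: L2_ig (L2_mulC c2 Lp)].
 by apply: it_eq => x _; exact: mulrDl.
rewrite (@FTC_cont _ a b phi (derive1 phi) ab c2 (fun x => smooth_is x sphi)).
by rewrite pa pb subrr mulr0 add0r.
Qed.

Lemma isH1_poly a b p : a <= b -> isH1 a b (horner p) (horner p^`()).
Proof.
move=> ab; have h := isH1_prim p.[a] ab (L2_poly a b p^`()).
apply: (isH1_ae _ _ _ _ h); try exact: L2_mfn (L2_poly _ _ _); apply: aeonW => x //.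
by move=> /in_oo[/ltW ax _]; rewrite (it_poly ax (erefl _)) addrC subrK.
Qed.

(** Both [f] and the primitive of [f'] have weak derivative [f'], so [weak0_const] applies to their
    difference. This absolutely continuous representative underlies the sup bound and the
    integration by parts below. *)
Lemma isH1_repr a b f f' : a < b -> isH1 a b f f' ->
 exists k, aeon a b (fun x => f x = k + it a x f').
Proof.
move=> ab h; have /isH1E[Lf Lf' w] := h; have ab' := ltW ab.
have /isH1E[Lp _ wp] := isH1_prim 0 ab' Lf'.
have Lfp : L2 a b (f - (fun x => 0 + it a x f')) by exact: (domB (S := L2ip a b) Lf Lp).
have [k hk] : exists k : R, aeon a b (fun x => (f - (fun x => 0 + it a x f')) x = k).
 apply: weak0_const => // phi tphi; have c2 := smooth_cts (smooth_deriv tphi.1).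
 have := w phi tphi; have := wp phi tphi.
 have -> : it a b (fun x => (f - (fun x => 0 + it a x f')) x * derive1 phi x) =
  it a b (fun x => f x * derive1 phi x) - it a b (fun x => (0 + it a x f') * derive1 phi x).
  rewrite -itB; [|exact: L2_ig (L2_mulC c2 Lf)|exact: L2_ig (L2_mulC c2 Lp)].
  by apply: it_eq => x _; exact: mulrBl.
 by move: (it _ _ _) (it _ _ _) (it _ _ _) => *; lra.
exists k; apply: aeonS hk => x _ <-.
by rewrite [(f - _) x](_ : _ = f x - (0 + it a x f'))// add0r subrK.
Qed.

(** Approximate [f'] by [q] and integrate [q] with the constant of [isH1_repr]: a single polynomial
    is then close in H^1 and uniformly. *)
Lemma isH1_approx a b f f' (e : R) : a < b -> isH1 a b f f' -> 0 < e ->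
 exists p, [/\ nL a b (f - horner p) <= e, nL a b (f' - horner p^`()) <= e &
  aeon a b (fun x => `|f x - p.[x]| <= e)].
Proof.
move=> ab h e0; have [k hk] := isH1_repr ab h; have [Lf Lf' _] := h.
have ba : 0 < b - a by rewrite subr_gt0.
(* Dominates the three constants by which the error on the derivative enters the three required
   bounds. *)
pose C := 1 + Num.sqrt (b - a) + (b - a).
have s0 := sqrtr_ge0 (b - a).
have C1 : 1 <= C by rewrite /C; lra.
have d0 : 0 < e / C by rewrite divr_gt0//; lra.
have ee : C * (e / C) = e by field; rewrite gt_eqF//; lra.
have [q hq] := poly_dense ab Lf' d0; have Lq := L2_poly a b q.
pose p := primp q + (k - (primp q).[a])%:P.
have dp : p^`() = q by rewrite /p derivD deriv_primp derivC addr0.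
have Lfq : L2 a b (f' - horner q) by exact: (domB (S := L2ip a b) Lf' Lq).
have pt : aeon a b (fun x => `|f x - p.[x]| <= Num.sqrt (b - a) * (e / C)).
 apply: aeonS hk => x /in_oo_le[ax xb] ->.
 have -> : k + it a x f' - p.[x] = it a x (f' - horner q).
  rewrite [RHS](_ : _ = it a x f' - it a x (horner q)); last first.
   by apply: itB; [apply: ig_sub (L2_ig Lf')|apply: ig_sub (L2_ig Lq)].
  by rewrite (it_poly ax (deriv_primp q)) /p hornerD hornerC; ring.
 by apply: (le_trans (prim_le ax xb Lfq)); rewrite mulrC ler_wpM2l.
exists p; rewrite dp; split.
- have Lfp : L2 a b (f - horner p) by exact: (domB (S := L2ip a b) Lf (L2_poly a b p)).
 have k0 : 0 <= Num.sqrt (b - a) * (e / C) by rewrite mulr_ge0// ltW.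
 apply: (le_trans (nL_le_bound (ltW ab) Lfp k0 pt)).
 rewrite mulrAC -expr2 sqr_sqrtr ?(ltW ba)// -[leRHS]ee ler_wpM2r ?(ltW d0)//.
 by rewrite /C; lra.
- by apply: (le_trans hq); rewrite -[leRHS]ee -[leLHS]mul1r ler_wpM2r ?(ltW d0).
- apply: aeonS pt => x _ /le_trans; apply; rewrite -[leRHS]ee ler_wpM2r ?(ltW d0)//.
 by rewrite /C; lra.
Qed.

(** Weak derivatives are closed under L^2 limits, since both sides of the defining identity are L^2
    continuous. *)
Lemma isH1_limit a b f f' : L2 a b f -> L2 a b f' ->
 (forall e, 0 < e -> exists g g', [/\ isH1 a b g g', nL a b (f - g) <= e & nL a b (f' - g') <= e]) ->
 isH1 a b f f'.
Proof.
move=> Lf Lf' h; apply/isH1E; split => // phi tphi.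
have c1 := test_cts tphi; have c2 := smooth_cts (smooth_deriv tphi.1).
have L1 := L2_continuous a b c1; have L2' := L2_continuous a b c2.
apply: null_eq => e e0; rewrite subr0.
pose C := nL a b (derive1 phi) + nL a b phi.
have C0 : 0 <= C by rewrite addr_ge0// nL_ge0.
have d0 : 0 < e / (C + 1) by rewrite divr_gt0//; lra.
have [g [g' [/isH1E[Lg Lg' w] h1 h2]]] := h _ d0.
have -> : it a b (fun x => f x * derive1 phi x) + it a b (fun x => f' x * phi x) =
 it a b (fun x => (f - g) x * derive1 phi x) + it a b (fun x => (f' - g') x * phi x).
 have -> : it a b (fun x => (f - g) x * derive1 phi x) =
  it a b (fun x => f x * derive1 phi x) - it a b (fun x => g x * derive1 phi x).
  rewrite -itB; [|exact: L2_mul|exact: L2_mul].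
  by apply: it_eq => x _; exact: mulrBl.
 have -> : it a b (fun x => (f' - g') x * phi x) =
  it a b (fun x => f' x * phi x) - it a b (fun x => g' x * phi x).
  rewrite -itB; [|exact: L2_mul|exact: L2_mul].
  by apply: it_eq => x _; exact: mulrBl.
 have := w phi tphi; move: (it _ _ _) (it _ _ _) (it _ _ _) (it _ _ _) => *; lra.
apply: (le_trans (ler_normD _ _)).
have k1 := it_mul_le (domB (S := L2ip a b) Lf Lg) L2'.
have k2 := it_mul_le (domB (S := L2ip a b) Lf' Lg') L1.
apply: (@le_trans _ _ (C * (e / (C + 1)))); last by apply: frac_le => //; exact: ltW.
rewrite /C mulrDl; apply: lerD.
 by apply: (le_trans k1); rewrite mulrC ler_wpM2l ?nL_ge0.
by apply: (le_trans k2); rewrite mulrC ler_wpM2l ?nL_ge0.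
Qed.

(** Sobolev embedding. The constant of integration is estimated by the L^2 norm of the constant
    function, which is [f] minus the primitive; the primitive is bounded pointwise by
    Cauchy-Schwarz. *)
Lemma isH1_bound a b : a < b -> exists2 C : R, 0 <= C & forall f f', isH1 a b f f' ->
 aeon a b (fun x => `|f x| <= C * (nL a b f + nL a b f')).
Proof.
move=> ab; have ba : 0 < b - a by rewrite subr_gt0.
have s0 : 0 < Num.sqrt (b - a) by rewrite sqrtr_gt0.
pose S := Num.sqrt (b - a).
exists (S^-1 + 2 * S) => [|f f' h].
 by rewrite addr_ge0 ?mulr_ge0 ?invr_ge0// ltW.
have [k hk] := isH1_repr ab h; have [Lf Lf' _] := h.
have Lp := prim_L2 (ltW ab) Lf'.
have kb : `|k| <= S^-1 * nL a b f + S * nL a b f'.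
 have e1 : nL a b (fun=> k) = `|k| * S.
  rewrite /nL /nrm /= L2inner_def it_cst ?(ltW ab)// -expr2 sqrtrM ?sqr_ge0//.
  by rewrite sqrtr_sqr.
 have e2 : nL a b (fun=> k) = nL a b (f - (fun x => it a x f')).
  apply: nL_ae; apply: aeonS hk => x _ e.
  by rewrite [(f - _) x](_ : _ = f x - it a x f')// e addrK.
 have p1 : nL a b (fun x => it a x f') <= nL a b f' * S * S.
  apply: nL_le_bound => //; first exact: ltW.
   by rewrite mulr_ge0 ?nL_ge0// ltW.
  by apply: aeonW => x /in_oo_le[ax xb]; exact: prim_le.
 have := nrmB (S := L2ip a b) Lf Lp; rewrite -!/(nL _ _ _) -e2 e1 => h1.
 rewrite -(ler_pM2r s0); apply: (le_trans h1).
 rewrite mulrDl [S^-1 * _ * _]mulrAC mulVf ?gt_eqF// mul1r lerD2l.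
 by rewrite (mulrC S).
apply: aeonS hk => x /in_oo_le[ax xb] ->.
apply: (le_trans (ler_normD _ _)); have h2 := prim_le ax xb Lf'.
have n1 := nL_ge0 a b f; have n2 := nL_ge0 a b f'.
have : 0 <= S^-1 * nL a b f' by rewrite mulr_ge0// invr_ge0 ltW.
have : 0 <= S * nL a b f by rewrite mulr_ge0// ltW.
move: h2 kb; rewrite (mulrC (nL a b f')) mulrDl !mulrDr -!mulrA -/S.
move: (S * nL a b f) (S * nL a b f') (S^-1 * _) (S^-1 * _) `|k| `|it _ _ _| => *; lra.
Qed.

Lemma isH1_mulp a b f f' p : isH1 a b f f' ->
 isH1 a b (fun x => f x * p.[x]) (fun x => f' x * p.[x] + f x * p^`().[x]).
Proof.
move=> /isH1E[Lf Lf' h]; have cp := @continuous_horner R p; have cp' := @continuous_horner R p^`().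
have L1 := L2_mulC cp Lf; have L2' := L2_mulC cp Lf'; have L3 := L2_mulC cp' Lf.
apply/isH1E; split => //; first exact: (L2D L2' L3).
move=> phi tphi; have [sphi [a' [b' [aa bb out]]]] := tphi.
have t2 : test_function a b (fun x => p.[x] * phi x).
 split; first by apply: smoothM; [exact: smooth_poly|exact: sphi].
 by exists a', b'; split => // x /out ->; rewrite mulr0.
have := h _ t2.
have -> : derive1 (fun x => p.[x] * phi x) = fun x => p.[x] * derive1 phi x + phi x * p^`().[x].
 apply/funext => x; rewrite derive1E.
 by have [_ ->] := @is_deriveM R R (horner p) phi x 1 _ _ (is_derive_poly p x) (smooth_is x sphi).
have c1 := test_cts tphi; have c2 := smooth_cts (smooth_deriv sphi).
have i1 := L2_ig (L2_mulC c2 L1); have i2 := L2_ig (L2_mulC c1 L2'); have i3 := L2_ig (L2_mulC c1 L3).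
move=> e; rewrite -[RHS]e.
have -> : it a b (fun x => f x * (p.[x] * derive1 phi x + phi x * p^`().[x])) =
 it a b (fun x => f x * p.[x] * derive1 phi x) + it a b (fun x => f x * p^`().[x] * phi x).
 by rewrite -itD//; apply: it_eq => x _; ring.
have -> : it a b (fun x => (f' x * p.[x] + f x * p^`().[x]) * phi x) =
 it a b (fun x => f' x * p.[x] * phi x) + it a b (fun x => f x * p^`().[x] * phi x).
 by rewrite -itD//; apply: it_eq => x _; ring.
rewrite (it_eq (f := fun x => f' x * (p.[x] * phi x)) (g := fun x => f' x * p.[x] * phi x)).
 by rewrite addrA addrAC.
by move=> x _; rewrite mulrA.
Qed.

(** A polynomial factor can be moved into the test function. A general [g] is approximated by
    polynomials in H^1 and uniformly; in each error term one factor is bounded and the other is in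
    L^2. *)
Lemma isH1_mul a b f f' g g' : a < b -> isH1 a b f f' -> isH1 a b g g' ->
 isH1 a b (fun x => f x * g x) (fun x => f' x * g x + f x * g' x).
Proof.
move=> ab hf hg; have [C C0 hC] := isH1_bound ab.
have [Lf Lf' _] := hf; have [Lg Lg' _] := hg.
have bf := hC _ _ hf; have bg := hC _ _ hg.
have L1 : L2 a b (fun x => f x * g x) := L2_mulb Lg (L2_mfn Lf) bf.
have L3 : L2 a b (fun x => f x * g' x) := L2_mulb Lg' (L2_mfn Lf) bf.
have L2' : L2 a b (fun x => f' x * g x).
 rewrite (_ : (fun _ => _) = (fun x => g x * f' x)); last by apply/funext => x; rewrite mulrC.
 exact: L2_mulb Lf' (L2_mfn Lg) bg.
apply: isH1_limit => //; first exact: (L2D L2' L3).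
move=> e e0; pose K := nL a b f + nL a b f' + C * (nL a b f + nL a b f').
have K0 : 0 <= K by rewrite !addr_ge0 ?mulr_ge0 ?addr_ge0 ?nL_ge0.
have d0 : 0 < e / (K + 1) by rewrite divr_gt0//; lra.
have [p [h1 h2 h3]] := isH1_approx ab hg d0.
exists (fun x => f x * p.[x]), (fun x => f' x * p.[x] + f x * p^`().[x]).
have n1 := nL_ge0 a b f; have n2 := nL_ge0 a b f'.
have Lmp (h : R -> R) : L2 a b h -> L2 a b (fun x => h x * (g x - p.[x])).
 move=> Lh; rewrite (_ : (fun _ => _) = (fun x => (g x - p.[x]) * h x)); last first.
  by apply/funext => x; rewrite mulrC.
 apply: L2_mulb Lh _ h3; apply: L2_mfn.
 exact: (domB (S := L2ip a b) Lg (L2_poly a b p)).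
have bnd (h : R -> R) : L2 a b h -> nL a b (fun x => h x * (g x - p.[x])) <= e / (K + 1) * nL a b h.
 move=> Lh; rewrite -(ger0_norm (ltW d0)) -(nrmZ (S := L2ip a b) _ Lh).
 apply: nL_mono; [exact: Lmp|exact: L2Z|].
 apply: aeonS h3 => x _ h4; rewrite [(_ *: h) x](_ : _ = e / (K + 1) * h x)//.
 by rewrite normrM (normrM (e / (K + 1))) (ger0_norm (ltW d0)) mulrC ler_wpM2r.
split; first exact: isH1_mulp.
- have -> : (fun x => f x * g x) - (fun x => f x * p.[x]) = fun x => f x * (g x - p.[x]).
  by apply/funext => x; rewrite [LHS](_ : _ = f x * g x - f x * p.[x])// mulrBr.
 apply: (le_trans (bnd _ Lf)); apply: le_trans (frac_le K0 (ltW e0)); rewrite mulrC.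
 apply: ler_wpM2r; first exact: ltW.
 rewrite /K -addrA lerDl; apply: addr_ge0 => //; apply: mulr_ge0 => //; exact: addr_ge0.
- pose w x := f x * (g' x - p^`().[x]).
 have Lw : L2 a b w.
  apply: L2_mulb (L2_mfn Lf) bf; exact: (domB (S := L2ip a b) Lg' (L2_poly a b p^`())).
 have -> : (fun x => f' x * g x + f x * g' x) - (fun x => f' x * p.[x] + f x * p^`().[x]) =
   (fun x => f' x * (g x - p.[x])) + w.
  apply/funext => x; rewrite [LHS](_ : _ = f' x * g x + f x * g' x - (f' x * p.[x] + f x * p^`().[x]))//.
  rewrite [RHS](_ : _ = f' x * (g x - p.[x]) + f x * (g' x - p^`().[x]))//; ring.
 apply: (le_trans (nrmD (S := L2ip a b) (Lmp _ Lf') Lw)).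
 apply: (@le_trans _ _ (K * (e / (K + 1)))); last by apply: frac_le => //; exact: ltW.
 have bw : nL a b w <= C * (nL a b f + nL a b f') * (e / (K + 1)).
  have c0 : 0 <= C * (nL a b f + nL a b f') by rewrite mulr_ge0// addr_ge0.
  apply: (@le_trans _ _ (C * (nL a b f + nL a b f') * nL a b (g' - horner p^`()))); last by rewrite ler_wpM2l.
  have Ld : L2 a b (g' - horner p^`()) by exact: (domB (S := L2ip a b) Lg' (L2_poly a b p^`())).
  rewrite -[X in X * _](ger0_norm c0) -(nrmZ (S := L2ip a b) _ Ld).
  apply: nL_mono => //; first exact: L2Z.
  apply: aeonS bf => x _ h4; rewrite [(_ *: _) x](_ : _ = C * (nL a b f + nL a b f') * (g' x - p^`().[x]))//.
  by rewrite /w normrM (normrM (C * _)) (ger0_norm c0) ler_wpM2r.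
 have := bnd _ Lf'; rewrite -!/(nL _ _ _) /K => b1.
 have : 0 <= nL a b f * (e / (K + 1)) by rewrite mulr_ge0// ltW.
 rewrite !mulrDl; move: b1 bw; rewrite (mulrC _ (nL a b f')) -/K.
 by move: (nL a b (fun x => f' x * _)) (nL a b w) (nL a b f' * _) (nL a b f * _) (C * _ * _) => *; lra.
Qed.

Lemma isH1_ibp a b f f' p : a < b -> isH1 a b f f' -> p.[a] = 0 -> p.[b] = 0 ->
 L2inner a b f' (horner p) = - L2inner a b f (horner p^`()).
Proof.
move=> ab hf pa pb; have [k hk] := isH1_repr ab hf; have [Lf Lf' _] := hf.
have ab' := ltW ab; have Lp := prim_L2 ab' Lf'.
have cp := @continuous_horner R p; have cp' := @continuous_horner R p^`().
have := it_parts ab' Lf' cp cp' (fun x _ => is_derive_poly p x); rewrite pb mulr0 => e.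
rewrite !L2inner_def.
have -> : it a b (fun x => f x * p^`().[x]) = it a b (fun x => it a x f' * p^`().[x]).
 rewrite (it_ae (g := fun x => k * p^`().[x] + it a x f' * p^`().[x])); last first.
  by apply: aeonS hk => x _ ->; rewrite mulrDl.
 rewrite itD; [|by apply: igZ; exact: ig_horner|exact: L2_ig (L2_mulC cp' Lp)].
 rewrite itZ; last exact: ig_horner.
 by rewrite (it_poly ab' (erefl _)) pa pb subrr mulr0 add0r.
by move: e; move: (it _ _ _) (it _ _ _) => *; lra.
Qed.

End WeakDerivatives.

(** * Measurability of norms *)

Section GramSchmidt.
Context {R : realType} {V : lmodType R} (S : semi_ip V) (v : nat -> V).
Hypothesis Dv : forall n, dom S (v n).

(** Gram-Schmidt without normalisation: a residual of norm zero gets coefficient 0, the value of a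
    division by zero. Norms of projections become finite sums of scalar terms, from which
    measurability in time is read off. *)
Fixpoint gsproj (n : nat) (w : V) : V :=
 if n is m.+1 then
  let r := v m - gsproj m (v m) in gsproj m w + (ip S w r / ip S r r) *: r
 else 0.

Definition gsr m := v m - gsproj m (v m).

Lemma gsprojS n w : gsproj n.+1 w = gsproj n w + (ip S w (gsr n) / ip S (gsr n) (gsr n)) *: gsr n.
Proof. by []. Qed.

Lemma dom_gsproj n w : dom S (gsproj n w).
Proof.
elim: n w => [|n IH] w; first exact: dom0.
by apply: domD => //; apply: domZ; exact: domB.
Qed.
Hint Resolve dom_gsproj : core.

Lemma dom_gsr n : dom S (gsr n).
Proof. exact: domB. Qed.
Hint Resolve dom_gsr domB domZ : core.

Lemma ip_null x y : dom S x -> dom S y -> ip S y y = 0 -> ip S x y = 0.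
Proof.
move=> Dx Dy y0; apply/eqP; rewrite -normr_le0; apply: (le_trans (cauchy_schwarz Dx Dy)).
by rewrite /nrm y0 sqrtr0 mulr0.
Qed.

Lemma gs_perp n x w : dom S x -> (forall k, (k < n)%N -> ip S x (v k) = 0) -> ip S x (gsproj n w) = 0.
Proof.
move=> Dx; elim: n w => [|n IH] w h; first exact: ip0r.
have h' k : (k < n)%N -> ip S x (v k) = 0 by move=> kn; apply: h; exact: ltnW.
have r0 : ip S x (gsr n) = 0 by rewrite (ipBr (Dv n) (dom_gsproj n _) Dx) h// IH// subr0.
by rewrite gsprojS (ipDr (dom_gsproj n w) (domZ _ (dom_gsr n)) Dx) ipZr// r0 mulr0 addr0 IH.
Qed.

Lemma gs_orth n w k : dom S w -> (k < n)%N -> ip S (w - gsproj n w) (v k) = 0.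
Proof.
elim: n w k => // n IH w k Dw; have Q x : ip S (gsr n) (gsproj n x) = 0.
 by apply: gs_perp => // j; exact: IH.
rewrite ltnS leq_eqVlt gsprojS opprD addrA (ipBl (domB Dw (dom_gsproj n w)) (domZ _ (dom_gsr n)) (Dv k)) ipZl//; case/predU1P => [->|kn]; last first.
 by rewrite IH// [X in _ * X]IH// mulr0 subr0.
have P : ip S (w - gsproj n w) (gsproj n (v n)) = 0 by apply: gs_perp => [|j jn]; [exact: domB|exact: IH].
have vE x : dom S x -> ip S x (v n) = ip S x (gsr n) + ip S x (gsproj n (v n)) by move=> Dx; rewrite -ipDr// subrK.
rewrite (vE _ (domB Dw (dom_gsproj n w))) (vE _ (dom_gsr n)) P Q !addr0 ipBl// [ip S (gsproj n w) _]ipC Q subr0.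
have [z|z] := eqVneq (ip S (gsr n) (gsr n)) 0; last by rewrite divfK// subrr.
by rewrite z mulr0 subr0 ip_null.
Qed.

Lemma gs_normS n w : dom S w -> ip S (gsproj n.+1 w) (gsproj n.+1 w) = ip S (gsproj n w) (gsproj n w) +
 (ip S w (gsr n) / ip S (gsr n) (gsr n)) ^+ 2 * ip S (gsr n) (gsr n).
Proof.
move=> Dw; have o : ip S (gsr n) (gsproj n w) = 0 by apply: gs_perp => // k; exact: gs_orth.
rewrite gsprojS (ip_sqrD (dom_gsproj n w) (domZ _ (dom_gsr n))) !ipZr ?ipZl ?[ip S (gsproj n w) (gsr n)]ipC ?o; auto.
by ring.
Qed.

Lemma gs_best n w y : dom S w -> dom S y -> ip S (w - gsproj n w) y = 0 ->
 nrm S (w - gsproj n w) <= nrm S (w - y).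
Proof.
move=> Dw Dy o; rewrite -(subrKA (gsproj n w) w (- y)) /nrm ler_sqrt ?ip_ge0// (ip_sqrD (domB Dw (dom_gsproj n w)) (domB (dom_gsproj n w) Dy)).
have o' : ip S (w - gsproj n w) (gsproj n w) = 0 by apply: gs_perp => [|k]; [exact: domB|exact: gs_orth].
by rewrite (ipBr (dom_gsproj n w) Dy (domB Dw (dom_gsproj n w))) o o' subr0 mulr0 addr0 lerDl ip_ge0.
Qed.

End GramSchmidt.

Section MeasurableNorm.
Context {R : realType}.
Variables (L T : R).
Hypotheses (hL : 0 < L) (hT : 0 < T).
Notation SL := (L2ip 0 L).
Implicit Types (p q e : {poly R}) (w : R -> R -> R).

(** These span the polynomials vanishing at both ends. Against them a weak derivative is integrated
    by parts without boundary terms, so its coefficients are expressed through the function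
    itself. *)
Definition vpoly (k : nat) : {poly R} := 'X * ('X - L%:P) * 'X^k.
Definition vfun k : R -> R := horner (vpoly k).
Let Dv k : dom SL (vfun k). Proof. exact: L2_poly. Qed.
Let r := gsr SL vfun.
Let Dr k : dom SL (r k). Proof. exact: dom_gsr. Qed.

Definition vanish e := e.[0] = 0 /\ e.[L] = 0.

Lemma vpoly_vanish k : vanish (vpoly k).
Proof. by split; rewrite /vpoly !(hornerM, hornerD, hornerN, hornerX, hornerC); ring. Qed.

Lemma vanish_lin (k : R) e e' : vanish e -> vanish e' -> vanish (k *: e + e').
Proof. by move=> [a b] [c d]; split; rewrite hornerD hornerZ ?a ?b ?c ?d mulr0 addr0. Qed.

Lemma gsproj_poly n (w : R -> R) : exists2 e, vanish e & gsproj SL vfun n w = horner e.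
Proof.
elim: n w => [|n IH] w.
 exists 0; first by split; rewrite horner0.
 by apply/funext => x; rewrite horner0.
have [e1 v1 h1] := IH w; have [e2 v2 h2] := IH (vfun n).
set c := ip SL w (gsr SL vfun n) / ip SL (gsr SL vfun n) (gsr SL vfun n).
exists (c *: ((- 1) *: e2 + vpoly n) + e1).
 by apply: vanish_lin => //; apply: vanish_lin => //; exact: vpoly_vanish.
rewrite gsprojS -/c h1 /gsr h2 hornerf_lin (hornerf_lin (-1)) scaleN1r addrC.
by congr (_ *: _ + _); rewrite addrC.
Qed.

Lemma gsr_poly k : exists2 e, vanish e & r k = horner e.
Proof.
have [e v h] := gsproj_poly k (vfun k); exists ((- 1) *: e + vpoly k).
 by apply: vanish_lin => //; exact: vpoly_vanish.
by rewrite /r /gsr h hornerf_lin scaleN1r addrC.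
Qed.

Lemma vanish_dense f (eps : R) : L2 0 L f -> 0 < eps ->
 exists2 e, vanish e & nL 0 L (f - horner e) <= eps.
Proof.
move=> Lf e0; have e2 : 0 < eps / 2 by lra.
have [p hp] := poly_dense hL Lf e2.
have [u [[u1 u2 _ _ _] _ hu]] := @XL2_complete_dense R L 1 hL (p, 0) _ e2.
exists u.1 => //.
have h : nL 0 L (horner p - horner u.1) <= eps / 2.
 apply: le_trans hu; rewrite -hornerfB /nL /nrm ler_sqrt ?ip_ge0//.
 have -> : ip SL (horner (p - u.1)) (horner (p - u.1)) = intx L ((p - u.1) * (p - u.1)).
  by rewrite /= L2inner_def; apply: it_eq => x _; rewrite hornerM.
 by rewrite XipE /= lerDl sub0r mulrNN intx_sqr_ge0.
have := nrm_triangle (S := SL) Lf (L2_poly 0 L p) (L2_poly 0 L u.1).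
by rewrite -!/(nL _ _ _); move: hp h; lra.
Qed.

Lemma vanish_span e : vanish e -> exists s : {poly R}, forall m, (size s <= m)%N ->
 horner e = \sum_(k < m) s`_k *: vfun k.
Proof.
move=> [e0 eL]; have /factor_theorem [q hq] : root e 0 by apply/rootP.
have : root q L.
 apply/rootP; move: eL; rewrite hq hornerM hornerD hornerN hornerX hornerC subr0.
 by move=> /eqP; rewrite mulf_eq0 (gt_eqF hL) orbF => /eqP.
move=> /factor_theorem [s hs]; exists s => m sm.
apply/funext => x; rewrite [RHS](_ : _ = \sum_(k < m) s`_k * (vpoly k).[x]); last first.
 elim: m {sm} => [|m IH]; first by rewrite !big_ord0.
 by rewrite !big_ord_recr /= -IH.
rewrite hq hs polyC0 subr0 !hornerM (horner_coef_wide _ sm) !mulr_suml; apply: eq_bigr => i _.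
by rewrite /vpoly !(hornerM, hornerX, hornerXn); ring.
Qed.

Lemma gs_cvg f : L2 0 L f -> null (fun n => nL 0 L (f - gsproj SL vfun n f)).
Proof.
move=> Lf eps e0; have [e ve he] := vanish_dense Lf e0.
have [s hs] := vanish_span ve; exists (size s) => m nm; apply: le_trans he.
apply: gs_best => //; first exact: L2_poly.
have Lr : dom SL (f - gsproj SL vfun m f) := L2B Lf (dom_gsproj Dv m f).
rewrite (hs m nm) ipC ip_suml; [|by move=> k; exact: (L2Z _ (Dv k))|exact: Lr].
rewrite big1// => k _; rewrite (@ipZl _ _ SL _ _ _ (Dv k) Lr) (ipC SL (vfun k)).
by rewrite [ip _ _ _](gs_orth Dv Lf (ltn_ord k)) mulr0.
Qed.

(** A weak form of measurability in time. It can be checked for derivatives and products along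
    curves, and it suffices for the norm and for approximation by time polynomials. *)
Definition ccoef w := forall e, vanish e -> exists2 c : R -> R, continuous c &
 aeon 0 T (fun t => L2inner 0 L (w t) (horner e) = c t).

Lemma gs_coef w : ccoef w -> exists2 c : nat -> R -> R, forall k, continuous (c k) &
 aeon 0 T (fun t => forall k, ip SL (w t) (r k) / ip SL (r k) (r k) = c k t).
Proof.
move=> cw; have /choice[c hc] k : exists c : R -> R, continuous c /\
  aeon 0 T (fun t => ip SL (w t) (r k) / ip SL (r k) (r k) = c t).
 have [e ve ee] := gsr_poly k; have [c cc hc] := cw e ve.
 exists (fun t => c t / ip SL (r k) (r k)); split; first by move=> t; apply: cvgMl; exact: cc.
 by apply: aeonS hc => t _ <-; rewrite ee.
by exists c => [k|]; [have [] := hc k|apply: aeon_all => k; have [] := hc k].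
Qed.

Lemma gs_partial_norm w n : ccoef w -> aeon 0 T (fun t => L2 0 L (w t)) ->
 exists c : R -> R, continuous c /\
  aeon 0 T (fun t => ip SL (gsproj SL vfun n (w t)) (gsproj SL vfun n (w t)) = c t).
Proof.
move=> cw Lw; have [c cc hc] := gs_coef cw; elim: n => [|n [C [cC hC]]].
 by exists (cst 0); split; [exact: cst_continuous|apply: aeonW => t _; exact/ip0l/dom0].
exists (fun t => C t + c n t * c n t * ip SL (r n) (r n)); split.
 move=> t; apply: cvgD; first exact: cC.
 by apply: cvgMl; apply: cvgM; exact: cc.
by apply: aeonS2 hc (aeon_and Lw hC) => t _ h [Lt hCt]; rewrite gs_normS// hCt -/(r n) h.
Qed.

Lemma gsproj_ccoef w n : ccoef w -> ccoef (fun t => gsproj SL vfun n (w t)).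
Proof.
move=> cw e ve; have [c cc hc] := gs_coef cw; have Le := L2_poly 0 L e; elim: n => [|n [C cC hC]].
 by exists (cst 0); [exact: cst_continuous|apply: aeonW => t _; exact: (ip0l (S := SL))].
exists (fun t => C t + c n t * ip SL (r n) (horner e)).
 by move=> t; apply: cvgD; [exact: cC|apply: cvgMl; exact: cc].
apply: aeonS2 hc hC => t _ h <-; rewrite -[LHS]/(ip SL _ _) gsprojS.
by rewrite (ipDl (s := SL) (dom_gsproj Dv n _) (L2Z _ (Dr n)) Le) (ipZl (s := SL) _ (Dr n) Le) -/(r n) h.
Qed.

(** The norm is the limit of the norms of the Gram-Schmidt projections, each of which agrees almost
    everywhere with a continuous function of time. *)
Lemma measurable_norm w : ccoef w -> aeon 0 T (fun t => L2 0 L (w t)) ->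
 exists2 N : R -> R, mfn 0 T N & aeon 0 T (fun t => nL 0 L (w t) = N t).
Proof.
move=> cw Lw; have /choice[c hc] n := gs_partial_norm n cw Lw.
have h : aeon 0 T (fun t => forall n,
  ip SL (gsproj SL vfun n (w t)) (gsproj SL vfun n (w t)) = c n t).
 by apply: aeon_all => n; have [] := hc n.
have lim : aeon 0 T (fun t => (fun n => Num.sqrt (c n t)) @ \oo --> nL 0 L (w t)).
 apply: aeonS2 Lw h => t _ Lwt ht; apply/cvgrPdist_le => eps e0.
 have [K hK] := gs_cvg Lwt e0; exists K => // n /= /hK hn.
 rewrite -ht; apply: le_trans hn; apply: (nrm_dist (S := SL)) => //.
 exact: dom_gsproj.
have [N mN hN] : exists2 g : R -> R, mfn 0 T g & aeon 0 T (fun t => (fun n => Num.sqrt (c n t)) @ \oo --> g t).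
 apply: ae_cvg_mfn.
  move=> n; apply: ig_mf; apply: ig_continuous => t.
  apply: (@continuous_comp _ _ _ (c n) (@Num.sqrt R)); last exact: sqrt_continuous.
  by have [cc _] := hc n; exact: cc.
 by apply: aeonS lim => t _ ht; exists (nL 0 L (w t)).
exists N => //; apply: aeonS2 lim hN => t _ l1 l2.
by apply: (cvg_unique _ l1 l2); exact: norm_hausdorff.
Qed.

Lemma ccoefB w w' : aeon 0 T (fun t => L2 0 L (w t)) -> aeon 0 T (fun t => L2 0 L (w' t)) ->
 ccoef w -> ccoef w' -> ccoef (fun t => w t - w' t).
Proof.
move=> Lw Lw' cw cw' e ve; have [c cc hc] := cw e ve; have [c' cc' hc'] := cw' e ve.
exists (fun t => c t - c' t); first by move=> t; apply: cvgB; [exact: cc|exact: cc'].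
apply: aeonS2 (aeon_and Lw Lw') (aeon_and hc hc') => t _ [a b] [<- <-].
exact: (@ipBl _ _ SL _ _ _ a b (L2_poly 0 L e)).
Qed.

Lemma gsproj_approx w n (eps : R) : ccoef w -> 0 < eps ->
 exists s : seq ({poly R} * {poly R}), exists M : R -> R, [/\ ig 0 T M,
  aeon 0 T (fun t => nL 0 L (gsproj SL vfun n (w t) - horner (ev s t)) <= M t) & it 0 T M <= eps].
Proof.
move=> cw; have [c cc hc] := gs_coef cw; elim: n eps => [|n IH] eps e0.
 exists [::], (cst 0); rewrite it0 ltW//; split => //; first exact: ig_cst.
 apply: aeonW => t _; rewrite /ev big_nil (_ : horner 0 = 0) ?subrr ?[nL _ _ _](nrm0 SL)//.
 by apply/funext => x; rewrite horner0.
have e2 : 0 < eps / 2 by lra.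
have [s [M [iM hM leM]]] := IH _ e2; have [e ve he] := gsr_poly n.
have A0 : 0 <= nL 0 L (r n) := nL_ge0 _ _ _; have sT0 := sqrtr_ge0 T.
have k1 : 0 < Num.sqrt T * nL 0 L (r n) + 1 by rewrite ltr_wpDl// mulr_ge0.
have [p hp] := continuous_poly_dense hT (cc n) (divr_gt0 e2 k1).
have Lp : L2 0 T (c n - horner p) by exact: (L2B (L2_continuous 0 T (cc n)) (L2_poly 0 T p)).
have iN : ig 0 T (fun t => `|(c n - horner p) t|) by apply: ig_norm; exact: L2_ig.
exists ((p, e) :: s), (fun t => nL 0 L (r n) * `|(c n - horner p) t| + M t); split.
- by apply: igD => //; exact: igZ.
- apply: aeonS2 hc hM => t _ h hMt; rewrite gsprojS -/(r n) h /ev big_cons hornerf_lin -he.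
 rewrite [X in X - _]addrC opprD addrACA -scalerBl; have LD := L2B (dom_gsproj Dv n (w t)) (L2_poly 0 L (ev s t)).
 apply: (le_trans (nrmD (S := SL) (L2Z _ (Dr n)) LD)).
 by rewrite (nrmZ (S := SL) _ (Dr n)) mulrC lerD2l.
- rewrite (itD (igZ _ iN) iM) (itZ _ iN); have -> : eps = eps / 2 + eps / 2 by field.
 apply: lerD => //; have := it_norm_le (ltW hT) Lp; rewrite subr0 => h1.
 apply: (le_trans (ler_wpM2l A0 (le_trans h1 (ler_wpM2l sT0 hp)))).
 by rewrite mulrA [nL _ _ _ * _]mulrC; apply: frac_le; [exact: mulr_ge0|exact: ltW].
Qed.

(** The distance to the projections tends to zero pointwise and is dominated by [m], hence tends to
    zero in L^1. The finitely many continuous coefficients are then replaced by polynomials in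
    time. *)
Lemma poly_source w (m : R -> R) (eps : R) : ccoef w -> aeon 0 T (fun t => L2 0 L (w t)) ->
 ig 0 T m -> aeon 0 T (fun t => nL 0 L (w t) <= m t) -> 0 < eps ->
 exists s : seq ({poly R} * {poly R}), exists M : R -> R,
  [/\ ig 0 T M, aeon 0 T (fun t => nL 0 L (w t - horner (ev s t)) <= M t) & it 0 T M <= eps].
Proof.
move=> cw Lw im hm e0; have e2 : 0 < eps / 2 by lra.
pose wn n t : R -> R := gsproj SL vfun n (w t).
have Lwn n t : L2 0 L (wn n t) := dom_gsproj Dv n (w t).
have /choice[d hd] n : exists d, mfn 0 T d /\ aeon 0 T (fun t => nL 0 L (w t - wn n t) = d t).
 have Ln := aeonW (fun t _ => Lwn n t) : aeon 0 T _.
 have [|d md hd] := measurable_norm (ccoefB Lw Ln cw (gsproj_ccoef n cw)); last by exists d.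
 by apply: aeonS Lw => t _ a; exact: L2B.
have hdall : aeon 0 T (fun t => forall n, nL 0 L (w t - wn n t) = d n t) by apply: aeon_all => n; have [] := hd n.
have dle n : aeon 0 T (fun t => `|d n t| <= m t).
 apply: aeonS2 (aeon_and Lw hm) hdall => t _ [a b] ht; rewrite -ht ger0_norm ?nL_ge0//.
 apply: le_trans b; rewrite -{2}(subr0 (w t)); apply: (gs_best Dv) => //; first exact: (dom0 SL).
 exact: (ip0r (S := SL) (L2B a (Lwn n t))).
have dlim : aeon 0 T (fun t => d ^~ t @ \oo --> (0 : R)).
 apply: aeonS2 Lw hdall => t _ a ht; apply/cvgr0Pnorm_le => e e1.
 have [K hK] := gs_cvg a e1; exists K => // n /= /hK; rewrite -ht ger0_norm ?nL_ge0//.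
have md n : mfn 0 T (d n) by have [] := hd n.
have [n hn] : exists n, it 0 T (d n) <= eps / 2.
 have [K hK] := it_dominated md im dlim dle (ig_mf (ig_cst 0 T 0)) e2.
 exists K; have := hK K (leqnn K).
 by rewrite it0 subr0 => /(le_trans (ler_norm _)).
have idn : ig 0 T (d n) by apply: ig_le (md n) (dle n) im.
have [s [M [iM hM leM]]] := gsproj_approx n cw e2.
exists s, (fun t => d n t + M t); split; first exact: igD.
- apply: aeonS2 (aeon_and Lw hdall) hM => t _ [Lt h] hMt.
 by apply: (le_trans (nL_triangle Lt (Lwn n t) (L2_poly 0 L _))); rewrite h lerD2l.
- by rewrite itD//; have -> : eps = eps / 2 + eps / 2 by [field]; exact: lerD.
Qed.

End MeasurableNorm.

(** * Continuous curves in a semi-inner product space *)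

Section IpCurves.
Context {R : realType} {V : lmodType R} (S : semi_ip V).
Variables (T : R) (u : R -> V).

Definition icts : Prop :=
 (forall t, 0 <= t -> t <= T -> dom S (u t)) /\
 (forall t e : R, 0 <= t -> t <= T -> 0 < e -> exists2 d : R, 0 < d & forall s, 0 <= s -> s <= T ->
  `|s - t| < d -> nrm S (u s - u t) <= e).

Lemma ictsP (N : V -> \bar R) : (forall w, dom S w -> N w = (nrm S w)%:E) ->
 ((forall t, t \in `[0, T] -> dom S (u t)) /\
 (forall t, t \in `[0, T] -> (fun s => N (u s - u t)) @ within `[0, T] (nbhs t) --> 0%E)) <-> icts.
Proof.
move=> NE; split=> -[h1 h2]; split.
- by move=> t t0 tT; apply: h1; rewrite in_itv/= t0.
- move=> t e t0 tT e0; have tI : t \in `[0, T] by rewrite in_itv/= t0.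
 have := h2 t tI; move=> /fine_cvgP [_ ]; move=> /cvgr0Pnorm_le /(_ e e0) [d d0 hd].
 exists d => // s s0 sT sd; have sI : s \in `[0, T] by rewrite in_itv/= s0.
 have := hd s; rewrite /= distrC => /(_ sd sI) /=.
 by rewrite NE ?ger0_norm ?nrm_ge0//; apply: domB; exact: h1.
- by move=> t /in_cc[]; exact: h1.
- move=> t /in_cc[t0 tT]; apply/fine_cvgP; split.
  exists 1 => //= s _ /in_cc[s0 sT].
  by rewrite NE//; apply: domB; exact: h1.
 apply/cvgr0Pnorm_le => e e0; have [d d0 hd] := h2 t e t0 tT e0.
 exists d => // s; rewrite /= distrC => sd /in_cc[s0 sT].
 by rewrite NE; [rewrite /= ger0_norm ?nrm_ge0// hd|apply: domB; exact: h1].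
Qed.

Hypotheses (T0 : 0 <= T) (cu : icts).
Let uc t := u (clamp 0 T t).
Let ucX t : dom S (uc t).
Proof. by have [a b] := clamp_itv t T0; apply: cu.1. Qed.

Lemma icts_fun (Q : V -> R) (K : R) : 0 <= K ->
 (forall v w, dom S v -> dom S w -> `|Q v - Q w| <= K * nrm S (v - w)) ->
 continuous (fun t => Q (uc t)).
Proof.
move=> K0 hQ t; apply/cvgrPdist_le => e e0.
have e1 : 0 < e / (K + 1) by rewrite divr_gt0//; lra.
have [a b] := clamp_itv t T0.
have [d d0 hd] := cu.2 _ _ a b e1.
exists d => // s /= sd; rewrite distrC; apply: (le_trans (hQ _ _ (ucX s) (ucX t))).
apply: le_trans (frac_le K0 (ltW e0)); rewrite ler_wpM2l//.
have [a' b'] := clamp_itv s T0; apply: hd => //.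
by apply: (le_lt_trans (clamp_lip _ _ _ _)); rewrite distrC.
Qed.

Lemma icts_ip w : dom S w -> continuous (fun t => ip S (uc t) w).
Proof.
move=> Dw; apply: (@icts_fun (fun v => ip S v w) (nrm S w)) => [|v v' Dv Dv']; first exact: nrm_ge0.
by rewrite -ipBl// mulrC; apply: cauchy_schwarz => //; exact: domB.
Qed.

Lemma icts_nrm : continuous (fun t => nrm S (uc t)).
Proof. by apply: (@icts_fun (nrm S) 1) => // v w Dv Dw; rewrite mul1r; exact: nrm_dist. Qed.

Lemma icts_bounded : exists2 K, 0 <= K & forall t, 0 <= t -> t <= T -> nrm S (u t) <= K.
Proof.
have [K K0 hK] := continuous_bounded 0 T icts_nrm; exists K => // t t0 tT.
by have := hK t t0 tT; rewrite /uc clamp_id// ger0_norm ?nrm_ge0.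
Qed.

End IpCurves.

(** * The energy space, its curves and the weak formulation for polynomials *)

Section X0.
Context {R : realType}.
Variable L : R.
Hypothesis hL : 0 < L.
Notation X := ({poly R} * {poly R})%type.
Notation XI := (Xip L).
Notation SL := (L2ip 0 L).
Implicit Types (v w : pairs R) (e f : X).

Let dX w : Prop := in_X0 L w.
Let iX v w : R := L2inner 0 L v.1 w.1 + L2inner 0 L v.2 w.2.
Let dX0 : dX 0. Proof. by split; exact: (L2_cst 0 L 0). Qed.
Let dXD v w : dX v -> dX w -> dX (v + w).
Proof. by move=> [a b] [c d]; split; exact: L2D. Qed.
Let dXZ (k : R) w : dX w -> dX (k *: w).
Proof. by move=> [a b]; split; exact: L2Z. Qed.
Let iXC v w : iX v w = iX w v.
Proof. by rewrite /iX; congr (_ + _); exact: (ipC SL). Qed.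
Let iXD v v' w : dX v -> dX v' -> dX w -> iX (v + v') w = iX v w + iX v' w.
Proof.
move=> [a b] [c d] [e f]; rewrite /iX.
have h1 := @ipDl _ _ SL _ _ _ a c e; have h2 := @ipDl _ _ SL _ _ _ b d f.
rewrite -[L2inner 0 L (v + v').1 w.1]/(ip SL (v.1 + v'.1) w.1).
rewrite -[L2inner 0 L (v + v').2 w.2]/(ip SL (v.2 + v'.2) w.2) h1 h2.
by rewrite addrACA.
Qed.
Let iXZ (k : R) v w : dX v -> dX w -> iX (k *: v) w = k * iX v w.
Proof.
move=> [a b] [e f]; rewrite /iX.
have h1 := @ipZl _ _ SL k _ _ a e; have h2 := @ipZl _ _ SL k _ _ b f.
rewrite -[L2inner 0 L (k *: v).1 w.1]/(ip SL (k *: v.1) w.1).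
by rewrite -[L2inner 0 L (k *: v).2 w.2]/(ip SL (k *: v.2) w.2) h1 h2 mulrDr.
Qed.
Let iX0 w : 0 <= iX w w.
Proof. by rewrite /iX addr_ge0//; exact: (ip_ge0 SL). Qed.

Definition X0ip : semi_ip (pairs R) :=
 @SemiIP R (pairs R) dX iX dX0 dXD dXZ iXC iXD iXZ iX0.
Definition nX w : R := nrm X0ip w.

Lemma nX_ge0 w : 0 <= nX w. Proof. exact: nrm_ge0. Qed.
Lemma sqr_nX w : nX w ^+ 2 = nL 0 L w.1 ^+ 2 + nL 0 L w.2 ^+ 2.
Proof. by rewrite /nX /nL !sqr_nrm. Qed.

Lemma nX1 w : nL 0 L w.1 <= nX w.
Proof.
by rewrite -ler_sqr ?nnegrE ?nX_ge0 ?nL_ge0// sqr_nX lerDl sqr_ge0.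
Qed.
Lemma nX2 w : nL 0 L w.2 <= nX w.
Proof.
by rewrite -ler_sqr ?nnegrE ?nX_ge0 ?nL_ge0// sqr_nX lerDr sqr_ge0.
Qed.
Lemma nX_le w : nX w <= nL 0 L w.1 + nL 0 L w.2.
Proof.
have a := nL_ge0 0 L w.1; have b := nL_ge0 0 L w.2.
rewrite -ler_sqr ?nnegrE ?nX_ge0 ?addr_ge0// sqr_nX sqrrD addrAC lerDl.
by rewrite mulrn_wge0// mulr_ge0.
Qed.

Lemma X0normE w : in_X0 L w -> X0norm L w = (nX w)%:E.
Proof.
move=> [a b]; rewrite /X0norm (L2norm_nL a) (L2norm_nL b).
rewrite -!EFin_expe -EFinD poweR_EFin powR12_sqrt; last by rewrite addr_ge0// sqr_ge0.
by rewrite -sqr_nX sqrtr_sqr ger0_norm ?nX_ge0.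
Qed.

Lemma nX0_eq v w : in_X0 L v -> in_X0 L w -> nX (v - w) <= 0 -> X0_eq L v w.
Proof.
move=> [a b] [c d] h; split; apply: nL_eq0_aeeq => //; apply/eqP; rewrite eq_le nL_ge0 andbT.
 exact: le_trans (nX1 (v - w)) h.
exact: le_trans (nX2 (v - w)) h.
Qed.

Lemma X0_eq_nX v w : X0_eq L v w -> nX (v - w) = 0.
Proof.
move=> [a b]; apply/eqP; rewrite -sqrf_eq0 sqr_nX.
have z (f g : R -> R) : ae_eq_on 0 L f g -> nL 0 L (f - g) = 0.
 move=> h; rewrite (@nL_ae _ _ _ _ (fun=> 0)).
  by rewrite /nL /nrm /= L2inner_def (it_eq (g := fun=> 0)) ?it0 ?sqrtr0// => x _; rewrite mulr0.
 by apply: aeonS h => x _ e; rewrite [LHS](_ : _ = f x - g x)// e subrr.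
by rewrite (z _ _ a) (z _ _ b) expr0n addr0.
Qed.

Lemma X0_complete (f : nat -> pairs R) : (forall n, in_X0 L (f n)) ->
 cauchy_for (fun u v => nX (u - v)) f ->
 exists2 g, in_X0 L g & cvg_for (fun u v => nX (u - v)) f g.
Proof.
move=> Df cf.
have [g1 L1 h1] : exists2 g, L2 0 L g & cvg_for (fun u v : R -> R => nL 0 L (u - v)) (fun n => (f n).1) g.
 apply: L2_complete; first by move=> n; have [] := Df n.
 move=> e e0; have [N hN] := cf e e0; exists N => m n Nm Nn.
 by apply: le_trans (hN m n Nm Nn); exact: (nX1 (f m - f n)).
have [g2 L2' h2] : exists2 g, L2 0 L g & cvg_for (fun u v : R -> R => nL 0 L (u - v)) (fun n => (f n).2) g.
 apply: L2_complete; first by move=> n; have [] := Df n.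
 move=> e e0; have [N hN] := cf e e0; exists N => m n Nm Nn.
 by apply: le_trans (hN m n Nm Nn); exact: (nX2 (f m - f n)).
exists (g1, g2) => // e e0; have e2 : 0 < e / 2 by lra.
have [N1 k1] := h1 _ e2; have [N2 k2] := h2 _ e2; exists (maxn N1 N2) => n.
rewrite geq_max => /andP[/k1 a /k2 b]; apply: (le_trans (nX_le _)).
have -> : e = e / 2 + e / 2 by field.
exact: lerD.
Qed.

Definition hp e : pairs R := (horner e.1, horner e.2).

Lemma hp_X0 e : in_X0 L (hp e). Proof. by split; exact: L2_poly. Qed.
Lemma hp_lin (k : R) e f : hp (k *: e + f) = k *: hp e + hp f.
Proof. by congr pair; exact: hornerf_lin. Qed.
Lemma hpB e f : hp (e - f) = hp e - hp f.
Proof. by congr pair; exact: hornerfB. Qed.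
Lemma ip_hp e f : ip X0ip (hp e) (hp f) = ip XI e f.
Proof.
rewrite XipE; congr (_ + _); rewrite L2inner_def; apply: it_eq => x _; by rewrite hornerM.
Qed.
Lemma nX_hp e : nX (hp e) = nrm XI e.
Proof. by rewrite /nX /nrm ip_hp. Qed.

Lemma X0_poly_dense w (eps : R) : in_X0 L w -> 0 < eps -> exists e, nX (w - hp e) <= eps.
Proof.
move=> [a b] e0; have e2 : 0 < eps / 2 by lra.
have [p hp1] := poly_dense hL a e2; have [q hq] := poly_dense hL b e2.
exists (p, q); apply: (le_trans (nX_le _)).
have -> : eps = eps / 2 + eps / 2 by field.
exact: lerD.
Qed.

Definition cX T (u : R -> pairs R) : Prop := icts X0ip T u.

Lemma C_X0P T u : C_X0 L T u <-> cX T u.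
Proof. exact: (ictsP (S := X0ip) T u X0normE). Qed.

Section curve.
Variables (T : R) (u : R -> pairs R).
Hypotheses (hT : 0 < T) (cu : cX T u).

Lemma cX_ip w : in_X0 L w -> continuous (fun t => ip X0ip (u (clamp 0 T t)) w).
Proof. exact: (icts_ip (ltW hT) cu). Qed.

Lemma cX_nrm : continuous (fun t => nX (u (clamp 0 T t))).
Proof. exact: (icts_nrm (ltW hT) cu). Qed.

Lemma cX_bounded : exists2 K, 0 <= K & forall t, 0 <= t -> t <= T -> nX (u t) <= K.
Proof. exact: (icts_bounded (ltW hT) cu). Qed.

End curve.

Lemma cX_ev T (s : seq ({poly R} * X)) : cX T (fun t => hp (ev s t)).
Proof.
split=> [t _ _|t e t0 tT e0]; first exact: hp_X0.
pose c : seq ({poly R} * X) := s ++ [:: (- 1, ev s t)].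
have cE x : ev c x = ev s x - ev s t by rewrite /c ev_cat [X in _ + X]/ev big_seq1 hornerN hornerC scaleN1r.
have := @nrm_ev_continuous _ _ XI (fun e => Xdom L e) c t.
move/cvgrPdist_le => /(_ e e0)[d d0 hd]; exists d => // x x0 xT xd.
have := hd x; rewrite /= distrC => /(_ xd).
rewrite !cE subrr (nrm0 XI) sub0r normrN (ger0_norm (nrm_ge0 XI _)).
by rewrite -hpB -/(nX _) nX_hp.
Qed.

Lemma cX_uniform_limit T (un : nat -> R -> pairs R) u : (forall n, cX T (un n)) ->
 (forall t, 0 <= t -> t <= T -> in_X0 L (u t)) ->
 (forall e : R, 0 < e -> exists n, forall t, 0 <= t -> t <= T -> nX (un n t - u t) <= e) -> cX T u.
Proof.
move=> cn Du h; split => // t e t0 tT e0; have e3 : 0 < e / 3 by lra.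
have [n hn] := h _ e3; have [d d0 hd] := (cn n).2 t _ t0 tT e3.
exists d => // s s0 sT sd; have Ds := (cn n).1 s s0 sT; have Dt := (cn n).1 t t0 tT.
have us := Du s s0 sT; have ut := Du t t0 tT.
have := nrm_triangle (S := X0ip) us Ds ut; have := nrm_triangle (S := X0ip) Ds Dt ut.
rewrite (nrm_distC (S := X0ip) us Ds) -!/(nX _); have := hn s s0 sT; have := hn t t0 tT; have := hd s s0 sT sd.
rewrite -!/(nX _); move: (nX _) (nX _) (nX _) (nX _) (nX _) => *; lra.
Qed.

Lemma smooth_D3 (phi : R -> R) : smooth phi -> continuous (derive1 phi + derive1n 3 phi).
Proof.
move=> sp x; have s1 := smooth_deriv sp; apply: cvgD; first exact: (smooth_cts s1).
exact: (smooth_cts (smooth_deriv (smooth_deriv s1))).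
Qed.

Lemma L2inner0r (f : R -> R) : L2inner 0 L f 0 = 0.
Proof. by rewrite L2inner_def -[RHS](it0 0 L); apply: it_eq => x _; exact: mulr0. Qed.

Lemma ip_inl v (f : R -> R) : ip X0ip v (f, 0) = L2inner 0 L v.1 f.
Proof. by rewrite [LHS](_ : _ = L2inner 0 L v.1 f + L2inner 0 L v.2 0)// L2inner0r addr0. Qed.

Lemma ip_inr v (f : R -> R) : ip X0ip v (0, f) = L2inner 0 L v.2 f.
Proof. by rewrite [LHS](_ : _ = L2inner 0 L v.1 0 + L2inner 0 L v.2 f)// L2inner0r add0r. Qed.

Lemma X0_inl (f : R -> R) : L2 0 L f -> in_X0 L (f, 0).
Proof. by split => //; exact: (L2_cst 0 L 0). Qed.

Lemma X0_inr (f : R -> R) : L2 0 L f -> in_X0 L (0, f).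
Proof. by split => //; exact: (L2_cst 0 L 0). Qed.

Lemma nX_triangle v u w : in_X0 L u -> in_X0 L v -> in_X0 L w -> nX (u - w) <= nX (u - v) + nX (v - w).
Proof. exact: (@nrm_triangle _ _ X0ip). Qed.

Lemma nX_distC u v : in_X0 L u -> in_X0 L v -> nX (u - v) = nX (v - u).
Proof. exact: (@nrm_distC _ _ X0ip). Qed.

Lemma X0B u v : in_X0 L u -> in_X0 L v -> in_X0 L (u - v). Proof. exact: (@domB _ _ X0ip). Qed.

Section polyweak.
Variables (al : R) (u : seq ({poly R} * X)).
Hypothesis hu : all_bc L u.

Lemma evl_deriv (V : lmodType R) (g : V -> R) (s : seq ({poly R} * V)) :
 evl g (mapt (fun p : {poly R} => p^`()) s) = (evl g s)^`().
Proof.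
by rewrite /evl /mapt big_map raddf_sum /=; apply: eq_bigr => p _; rewrite derivZ.
Qed.

(** [g] is the derivative of [G]; as both functions vanish at the ends, only products of first
    derivatives survive there. *)
Lemma space_ibp (f : {poly R}) (phi : R -> R) : smooth phi -> f.[0] = 0 -> f.[L] = 0 ->
 phi 0 = 0 -> phi L = 0 ->
 L2inner 0 L (horner (- (1%:P * f^`() + f^`()^`()^`()))) phi =
 L2inner 0 L (horner f) (derive1 phi + derive1n 3 phi) +
 f^`().[L] * derive1 phi L - f^`().[0] * derive1 phi 0.
Proof.
move=> sphi f0 fL p0 pL; have s1 := smooth_deriv sphi; have s2 := smooth_deriv s1.
have s3 := smooth_deriv s2.
have c0 := smooth_cts sphi; have c1 := smooth_cts s1; have c2 := smooth_cts s2.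
have c3 := smooth_cts s3.
have cp (q : {poly R}) : continuous (horner q) by exact: continuous_horner.
pose G x := f.[x] * phi x + f^`()^`().[x] * phi x - f^`().[x] * derive1 phi x + f.[x] * derive1 (derive1 phi) x.
pose g x := (f^`().[x] + f^`()^`()^`().[x]) * phi x + f.[x] * (derive1 phi x + derive1 (derive1 (derive1 phi)) x).
have d (q : {poly R}) (h : R -> R) (x : R) : smooth h ->
  is_derive x 1 (fun x => q.[x] * h x) (q^`().[x] * h x + q.[x] * derive1 h x).
 move=> sh; apply: is_derive_eq (@is_deriveM R R (horner q) h x 1 _ _ (is_derive_poly q x) (smooth_is x sh)) _.
 by rewrite /GRing.scale /=; ring.
have dG (x : R) : is_derive x 1 G (g x).
 have h := is_deriveD (is_deriveB (is_deriveD (d f _ x sphi) (d f^`()^`() _ x sphi)) (d f^`() _ x s1)) (d f _ x s2).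
 apply: is_derive_eq h _; rewrite /g.
 move: (phi x) (derive1 phi x) (derive1 (derive1 phi) x) (derive1 (derive1 (derive1 phi)) x).
 by move: f.[x] f^`().[x] f^`()^`().[x] f^`()^`()^`().[x] => *; ring.
have cg : continuous g.
 move=> x; apply: cvgD; apply: cvgM; [apply: cvgD; exact: cp|exact: c0|exact: cp|].
 by apply: cvgD; [exact: c1|exact: c3].
have e : it 0 L g = G L - G 0 := FTC_cont (ltW hL) cg dG.
have {}e : it 0 L g = f^`().[0] * derive1 phi 0 - f^`().[L] * derive1 phi L.
 rewrite e /G f0 fL p0 pL.
 move: (derive1 phi 0) (derive1 phi L) (derive1 (derive1 phi) 0) (derive1 (derive1 phi) L).
 by move: f^`().[0] f^`().[L] f^`()^`().[0] f^`()^`().[L] => *; ring.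
rewrite !L2inner_def.
have i1 : ig 0 L (fun x => f.[x] * (derive1 phi + derive1n 3 phi) x).
 apply: ig_continuous => x; apply: cvgM; first exact: cp.
 by apply: cvgD; [exact: c1|exact: c3].
have -> : it 0 L (fun x => (- (1%:P * f^`() + f^`()^`()^`())).[x] * phi x) =
  it 0 L (fun x => f.[x] * (derive1 phi + derive1n 3 phi) x) - it 0 L g.
 rewrite -itB//; last exact: ig_continuous.
 apply: it_eq => x _; rewrite /g hornerN hornerD polyC1 mul1r.
 by rewrite [(_ + _) x](_ : _ = derive1 phi x + derive1 (derive1 (derive1 phi)) x)//; ring.
by rewrite e; ring.
Qed.

Lemma L2inner_poly_lin (phi : R -> R) (k : R) (p q : {poly R}) : L2 0 L phi ->
 L2inner 0 L (horner (k *: p + q)) phi = k * L2inner 0 L (horner p) phi + L2inner 0 L (horner q) phi.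
Proof.
move=> Lphi; have Lp := L2_poly 0 L p; have Lq := L2_poly 0 L q.
rewrite hornerf_lin -[LHS]/(ip SL (k *: horner p + horner q) phi).
by rewrite (@ipDl _ _ SL _ _ _ (L2Z k Lp) Lq Lphi) (@ipZl _ _ SL k _ _ Lp Lphi).
Qed.

Lemma L2inner_polyN (phi : R -> R) p : L2 0 L phi ->
 L2inner 0 L (horner (- p)) phi = - L2inner 0 L (horner p) phi.
Proof.
move=> /(L2inner_poly_lin (-1) p 0); rewrite addr0 scaleN1r mulN1r => ->.
rewrite [X in _ + X](_ : _ = 0) ?addr0//.
by rewrite L2inner_def -[RHS](it0 0 L); apply: it_eq => x _; rewrite horner0 mul0r.
Qed.

Lemma time_ftc (pr : X -> {poly R}) (phi : R -> R) t : L2 0 L phi -> 0 <= t ->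
 (forall (k : R) e f, pr (k *: e + f) = k *: pr e + pr f) ->
 L2inner 0 L (horner (pr (ev u t))) phi - L2inner 0 L (horner (pr (ev u 0))) phi =
 it 0 t (fun s => L2inner 0 L (horner (pr (ev (dtu u) s))) phi).
Proof.
move=> Lphi t0 prlin; pose g e := L2inner 0 L (horner (pr e)) phi.
have glin (k : R) e f : g (k *: e + f) = k * g e + g f by rewrite /g prlin L2inner_poly_lin.
rewrite -/(g _) -/(g (ev u 0)) -!(evlE _ _ glin) -(it_poly t0 (erefl _)).
by apply: it_eq => s _; rewrite -evl_deriv -/(dtu u) evlE.
Qed.

(** The boundary term at [L] is the trace of the second component, written as [btr] minus [al * gtr]
    to match the feedback form of the boundary condition. *)
Lemma poly_weak1 phi t : 0 <= t -> smooth phi -> phi 0 = 0 -> phi L = 0 -> derive1 phi 0 = 0 ->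
 L2inner 0 L (hp (ev u t)).1 phi - L2inner 0 L (hp (ev u 0)).1 phi =
 it 0 t (fun s => L2inner 0 L (hp (ev u s)).2 (derive1 phi + derive1n 3 phi) +
  (btr L al (ev u s) - al * gtr L (ev u s)) * derive1 phi L +
  L2inner 0 L (hp (Fop 1 u s)).1 phi).
Proof.
move=> t0 sphi p0 pL dp0; have Lphi := L2_continuous 0 L (smooth_cts sphi).
rewrite /hp /= (time_ftc (pr := fst))//.
apply: it_eq => s _; have [e1 e2 e3 e4 e5] := ev_bc s hu.
have -> : horner (ev (dtu u) s).1 = horner ((-1) *: - (Aop 1 (ev u s)).1 + (Fop 1 u s).1).
 by congr horner; rewrite /Fop scaleN1r opprK addrC /= subrK.
have h := space_ibp sphi e4 e5 p0 pL; rewrite dp0 mulr0 subr0 in h.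
by rewrite L2inner_poly_lin// L2inner_polyN// mulN1r opprK /Aop h /btr /gtr; ring.
Qed.

Lemma poly_weak2 psi t : 0 <= t -> smooth psi -> psi 0 = 0 -> psi L = 0 ->
 L2inner 0 L (hp (ev u t)).2 psi - L2inner 0 L (hp (ev u 0)).2 psi =
 it 0 t (fun s => L2inner 0 L (hp (ev u s)).1 (derive1 psi + derive1n 3 psi) +
  gtr L (ev u s) * derive1 psi L + L2inner 0 L (hp (Fop 1 u s)).2 psi).
Proof.
move=> t0 sphi p0 pL; have Lphi := L2_continuous 0 L (smooth_cts sphi).
rewrite /hp /= (time_ftc (pr := snd))//.
apply: it_eq => s _; have [e1 e2 e3 e4 e5] := ev_bc s hu.
have -> : horner (ev (dtu u) s).2 = horner ((-1) *: - (Aop 1 (ev u s)).2 + (Fop 1 u s).2).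
 by congr horner; rewrite /Fop scaleN1r opprK addrC /= subrK.
have h := space_ibp sphi e1 e2 p0 pL; rewrite e3 mul0r subr0 in h.
by rewrite L2inner_poly_lin// L2inner_polyN// mulN1r opprK /Aop h /gtr; ring.
Qed.

End polyweak.

End X0.

(** * Solutions of the linear problem *)

Opaque Xip it.
Arguments ip : simpl never.

Section Solver.
Context {R : realType}.
Variables (L al T : R).
Hypotheses (hL : 0 < L) (hal : 0 < al) (hT : 0 < T).
Notation X := ({poly R} * {poly R})%type.
Notation XI := (Xip L).
Notation XX := (@X0ip R L).
Notation nX := (nX L).
Implicit Types (U V : seq ({poly R} * X)) (F G : R -> R -> R) (b g : R -> R).
Let T0 : 0 <= T. Proof. exact: ltW. Qed.
Let domT (e : X) : dom XI e. Proof. exact: Xdom. Qed.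
Hint Resolve domT : core.

(** Strong measurability and integrability in one: sources are L^1 limits in time of time
    polynomials. The majorant [M] stands for the norm of the error, whose measurability is not
    presupposed. *)
Definition src F G := aeon 0 T (fun t => in_X0 L (F t, G t)) /\
 forall eps : R, 0 < eps -> exists (s : seq ({poly R} * X)) (M : R -> R),
  [/\ ig 0 T M, aeon 0 T (fun t => nX ((F t, G t) - hp (ev s t)) <= M t) & it 0 T M <= eps].

Lemma src_pos F G (eps : R) : src F G -> 0 < eps -> exists (s : seq ({poly R} * X)) (M : R -> R),
 [/\ forall t, 0 <= M t, ig 0 T M,
   aeon 0 T (fun t => nX ((F t, G t) - hp (ev s t)) <= M t) & it 0 T M <= eps].
Proof.
move=> [_ h] e0; have [s [M [iM hM le]]] := h eps e0.
exists s, (fun t => `|M t|); split => //; first exact: ig_norm.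
 by apply: aeonS hM => t _ /le_trans; apply; exact: ler_norm.
rewrite (it_ae (g := M))//; apply: aeonS hM => t _ h1.
by rewrite ger0_norm//; apply: le_trans h1; exact: nX_ge0.
Qed.

Lemma it_nrm_ev_le (s : seq ({poly R} * X)) (k : R) : 0 <= k ->
 it 0 T (fun t => ip XI (ev s t) (ev s t)) <= k ^+ 2 ->
 it 0 T (fun t => nrm XI (ev s t)) <= Num.sqrt T * k.
Proof.
move=> k0 h; have i0 : 0 <= it 0 T (fun t => nrm XI (ev s t)).
 by apply: it_pos => t; exact: nrm_ge0.
rewrite -ler_sqr ?nnegrE ?mulr_ge0 ?sqrtr_ge0//.
apply: (le_trans (it_nrm_sqr_le L s T0 (lexx T))).
by rewrite exprMn sqr_sqrtr// ler_wpM2l.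
Qed.

Definition negs U : seq ({poly R} * X) := mapt (fun p => (-1) *: p) U.

Lemma ev_diff U V t : ev (U ++ negs V) t = ev U t - ev V t.
Proof. by rewrite ev_cat ev_scale scaleN1r. Qed.

Lemma all_bc_diff U V : all_bc L U -> all_bc L V -> all_bc L (U ++ negs V).
Proof. by move=> hU hV; apply: all_bc_cat => //; exact: all_bc_mapt. Qed.

Lemma Fop_diff s U V t : Fop s (U ++ negs V) t = Fop s U t - Fop s V t.
Proof.
have := congr1 (fun y => y.1.2 t) (data_cat L al s U (negs V)).
have /= := congr1 (fun y => y.1.2 t) (data_scale L al s (-1) V).
by rewrite -/(negs V) => e1 /= ->; rewrite [(_ + _) t](_ : _ = Fop s U t + Fop s (negs V) t)// e1 [(_ *: _) t](_ : _ = (-1) *: Fop s V t)// scaleN1r.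
Qed.

Lemma dense_split t (a : X) (s : seq ({poly R} * X)) (r : {poly R}) (del : R) : 0 < t -> 0 < del ->
 exists U, [/\ all_bc L U, nrm XI (a - ev U 0) <= del,
  it 0 t (fun x => ip XI (ev s x - Fop 1 U x) (ev s x - Fop 1 U x)) <= del ^+ 2 &
  it 0 t (fun x => (r.[x] - btr L al (ev U x)) ^+ 2) <= del ^+ 2].
Proof.
move=> t0 d0; have dy : dom (Yip L t) (a, ev s, r) := YdomE L t a s r.
have [_ [U hU ->] hn] := data_dense hL hal t0 dy d0.
pose q := r - evl (btr L al) U; exists U.
have -> : it 0 t (fun x => (r.[x] - btr L al (ev U x)) ^+ 2) = it 0 t (fun x => q.[x] * q.[x]).
 by apply: it_eq => x _; rewrite /q hornerD hornerN (evlE _ _ (@btr_lin R L al)) expr2.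
have i1 := ip_ge0 XI (a - ev U 0).
have i2 : 0 <= it 0 t (fun x => ip XI (ev s x - Fop 1 U x) (ev s x - Fop 1 U x)) by apply: it_pos => x; exact: ip_ge0.
have i3 : 0 <= it 0 t (fun x => q.[x] * q.[x]) by apply: it_pos => x; rewrite -expr2 sqr_ge0.
have : nrm (Yip L t) ((a, ev s, r) - data L al 1 U) ^+ 2 <= del ^+ 2 by rewrite ler_sqr ?nnegrE ?nrm_ge0 ?(ltW d0).
rewrite -[nrm XI _ <= _]ler_sqr ?nnegrE ?nrm_ge0 ?(ltW d0)// !sqr_nrm YipE /=.
rewrite -[X in _ + X + _ <= _]/(it 0 t (fun x => ip XI (ev s x - Fop 1 U x) (ev s x - Fop 1 U x))) -/q.
by move: i1 i2 i3; move: (ip _ _ _) (it _ _ _) (it _ _ _) (del ^+ 2) => *; split=> //; lra.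
Qed.

Lemma approx_data u0 F G b (eps : R) : in_X0 L u0 -> src F G -> L2 0 T b -> 0 < eps ->
 exists U (M : R -> R), [/\ all_bc L U, nX (u0 - hp (ev U 0)) <= eps,
  [/\ forall t, 0 <= M t, ig 0 T M,
   aeon 0 T (fun t => nX ((F t, G t) - hp (Fop 1 U t)) <= M t) & it 0 T M <= eps] &
  nL 0 T (b - (fun t => btr L al (ev U t))) <= eps].
Proof.
move=> D0 sF Lb e0; have sT := sqrtr_ge0 T.
(* Leaves room for two successive approximations and for passing from L^2 to L^1 in time, which
   costs the square root of [T]. *)
pose del := eps / (2 * (1 + Num.sqrt T)).
have q0 : 0 < 2 * (1 + Num.sqrt T) by lra.
have d0 : 0 < del by exact: divr_gt0.
have d1 : del + del <= eps.
 rewrite /del -mulr2n -[X in X <= _]mulr_natl mulrA ler_pdivrMr// mulrC ler_wpM2l ?(ltW e0)//; lra.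
have d2 : del + Num.sqrt T * del <= eps.
 have e : eps = 2 * (1 + Num.sqrt T) * del by rewrite /del; field; rewrite gt_eqF//; lra.
 have : 0 <= Num.sqrt T * del by rewrite mulr_ge0// ltW.
 have {}e : 2 * del + 2 * (Num.sqrt T * del) = eps by rewrite [RHS]e; ring.
  by move: e; move: (Num.sqrt T * del) (ltW d0) => z; lra.
have [a ha] := X0_poly_dense hL D0 d0.
have [s [M [M0 iM hM leM]]] := src_pos sF d0.
have [r hr] := poly_dense hT Lb d0.
have [U [hU m1 m2 m3]] := dense_split a s r hT d0.
pose W := s ++ negs (Fseq 1 U).
have WE t : ev W t = ev s t - Fop 1 U t by rewrite /W ev_diff FopE.
have {}m2 : it 0 T (fun t => nrm XI (ev W t)) <= Num.sqrt T * del.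
 by apply: it_nrm_ev_le; [exact: ltW|under eq_fun do rewrite WE].
have {}m3 : nL 0 T (horner r - (fun t => btr L al (ev U t))) <= del by apply: nL_le; [exact: ltW|exact: m3].
have iW : ig 0 T (fun t => nrm XI (ev W t)) by apply: ig_continuous; exact: nrm_ev_continuous.
exists U, (fun t => M t + nrm XI (ev W t)); split => //.
- have := nX_triangle D0 (hp_X0 L a) (hp_X0 L (ev U 0)).
 rewrite -hpB -!/(nX _) nX_hp => h; apply: (le_trans h); apply: le_trans d1; exact: lerD.
- split; [by move=> t; rewrite addr_ge0 ?nrm_ge0|exact: igD| |].
  have h : aeon 0 T (fun t => in_X0 L (F t, G t)) by case: sF.
  apply: aeonS2 h hM => t _ Dt ht.
  have := nX_triangle Dt (hp_X0 L (ev s t)) (hp_X0 L (Fop 1 U t)).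
  rewrite -hpB -!/(nX _) nX_hp -WE => h'; apply: (le_trans h'); exact: lerD.
 by rewrite itD//; apply: le_trans d2; exact: lerD.
- have Lr := L2_poly 0 T r; have Lbt : L2 0 T (fun t => btr L al (ev U t)).
  by apply: L2_continuous; exact: btr_ev_cont.
 have := nL_triangle Lb Lr Lbt; rewrite -!/(nL _ _ _) => h.
 by apply: (le_trans h); apply: le_trans d1; exact: lerD.
Qed.

(** Along approximants with summable errors the pairings converge almost everywhere; being
    continuous for each approximant, they have a measurable limit, which the first approximant and
    its error dominate. *)
Lemma src_coef F G w : src F G -> in_X0 L w ->
 exists2 h, ig 0 T h & aeon 0 T (fun t => ip XX (F t, G t) w = h t).
Proof.
move=> sF Dw; have e4 n : 0 < (4^-1 : R) ^+ n by rewrite exprn_gt0.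
have /choice[s hs] n := src_pos sF (e4 n); have /choice[M hM] := hs.
have nw := nX_ge0 L w.
have dec : aeon 0 T (fun t => exists K : R, forall n, M n t <= K * 2^-1 ^+ n).
 apply: (@ae_geometric_decay _ _ _ _ 1) => //.
 - by move=> n; have [] := hM n.
 - by move=> n x; have [] := hM n.
 - by move=> n; rewrite mul1r; have [] := hM n.
have bnd : aeon 0 T (fun t => forall n, nX ((F t, G t) - hp (ev (s n) t)) <= M n t).
 by apply: aeon_all => n; have [] := hM n.
have dif : aeon 0 T (fun t => forall n, `|ip XX (F t, G t) w - ip XX (hp (ev (s n) t)) w| <= M n t * nX w).
 have h : aeon 0 T (fun t => in_X0 L (F t, G t)) by case: sF.
 apply: aeonS2 h bnd => t _ Dt ht n; rewrite -(@ipBl _ _ XX _ _ _ Dt (hp_X0 L _) Dw).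
 apply: (le_trans (cauchy_schwarz (S := XX) _ Dw)); first exact: (X0B Dt (hp_X0 L _)).
 exact: (ler_wpM2r nw (ht n)).
have cs n : continuous (fun t => ip XX (hp (ev (s n) t)) w).
 have e : (fun t => ip XX (hp (ev (s n) t)) w) = horner (evl (fun e => ip XX (hp e) w) (s n)).
  apply/funext => t; rewrite (evlE (g := fun e => ip XX (hp e) w))// => k x y.
  rewrite hp_lin (@ipDl _ _ XX _ _ _ (domZ (s := XX) k (hp_X0 L x)) (hp_X0 L y) Dw).
  by rewrite (@ipZl _ _ XX k _ _ (hp_X0 L x) Dw).
 by rewrite e; exact: continuous_horner.
have lim : aeon 0 T (fun t => (fun n => ip XX (hp (ev (s n) t)) w) @ \oo --> ip XX (F t, G t) w).
 apply: aeonS2 dec dif => t _ [K hK] hd; apply/cvgrPdist_le => e e0.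
 have [N hN] := null_half (K * nX w) e0.
 exists N => // n /= /hN h; apply: (le_trans (hd n)); apply: le_trans h.
 by rewrite mulrAC ler_wpM2r.
have [h mh hh] : exists2 h : R -> R, mfn 0 T h & aeon 0 T (fun t => (fun n => ip XX (hp (ev (s n) t)) w) @ \oo --> h t).
 apply: ae_cvg_mfn; first by move=> n; apply: ig_mf; exact: ig_continuous.
 by apply: aeonS lim => t _ l; exists (ip XX (F t, G t) w).
have eqh : aeon 0 T (fun t => ip XX (F t, G t) w = h t).
 by apply: aeonS2 lim hh => t _ l1 l2; apply: (cvg_unique _ l1 l2); exact: norm_hausdorff.
exists h => //; apply: (@ig_le _ _ _ _ (fun t => M 0%N t * nX w + `|ip XX (hp (ev (s 0%N) t)) w|)) => //.
 apply: aeonS2 eqh dif => t _ <- /(_ 0%N) hd.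
 rewrite -lerBlDr; apply: le_trans hd; exact: lerB_dist.
apply: igD; last by apply: ig_norm; exact: ig_continuous.
by under eq_fun do rewrite mulrC; apply: igZ; have [] := hM 0%N.
Qed.

Lemma gtrB (e f : X) : gtr L (e - f) = gtr L e - gtr L f.
Proof. by have := gtr_lin L (-1) f e; rewrite scaleN1r mulN1r addrC => ->; rewrite addrC. Qed.

Lemma btrB (e f : X) : btr L al (e - f) = btr L al e - btr L al f.
Proof. by have := btr_lin L al (-1) f e; rewrite scaleN1r mulN1r addrC => ->; rewrite addrC. Qed.

Lemma dxB (e f : X) : dx (e - f) = dx e - dx f.
Proof. by have := dx_lin (-1) f e; rewrite !scaleN1r addrC => ->; rewrite addrC. Qed.

Lemma dist_le (x y c : R) : `|x - y| <= c -> x <= y + c /\ y <= x + c.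
Proof. by rewrite ler_norml => /andP[h1 h2]; split; lra. Qed.

Lemma geometric_limit (V : lmodType R) (S : semi_ip V) (un : nat -> V) (c : R) :
 (forall v, (forall n, dom S (v n)) -> cauchy_for (fun x y => nrm S (x - y)) v ->
  exists2 l, dom S l & cvg_for (fun x y => nrm S (x - y)) v l) ->
 (forall n, dom S (un n)) -> (forall n m, (n <= m)%N -> nrm S (un n - un m) <= c * 2^-1 ^+ n) ->
 exists2 l, dom S l & forall n, nrm S (un n - l) <= c * 2^-1 ^+ n.
Proof.
move=> cpl D h; have nul : null (fun n => c * 2^-1 ^+ n) by exact: null_half.
have [|l Dl cl] := cpl un D.
 move=> e e0; have [N hN] := nul e e0; exists N => m n Nm Nn.
 have [mn|/ltnW nm] := leqP m n; first exact: le_trans (h _ _ mn) (hN _ Nm).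
 rewrite nrm_distC//; exact: le_trans (h _ _ nm) (hN _ Nn).
exists l => // n; apply/ler_addgt0Pr => e e0; have [N hN] := cl e e0.
apply: (le_trans (nrm_triangle (D n) (D (maxn n N)) Dl)); apply: lerD; first by apply: h; rewrite leq_maxl.
by apply: hN; rewrite leq_maxr.
Qed.

Lemma X0_uniform_limit (un : nat -> R -> pairs R) (c : R) : (forall n, cX L T (un n)) ->
 (forall n m t, (n <= m)%N -> 0 <= t -> t <= T -> nX (un n t - un m t) <= c * 2^-1 ^+ n) ->
 exists u, cX L T u /\ forall n t, 0 <= t -> t <= T -> nX (un n t - u t) <= c * 2^-1 ^+ n.
Proof.
move=> cn h; have lim t : exists l : pairs R, 0 <= t -> t <= T ->
  in_X0 L l /\ forall n, nX (un n t - l) <= c * 2^-1 ^+ n.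
 have [t0|] := leP 0 t; last by exists 0.
 have [tT|] := leP t T; last by exists 0.
 have [l Dl hl] := @geometric_limit _ XX (un ^~ t) c (@X0_complete _ L) (fun n => (cn n).1 t t0 tT)
  (fun n m nm => h n m t nm t0 tT).
 by exists l.
have [u hu] := choice lim; exists u; split; last by move=> n t t0 tT; have [_] := hu t t0 tT; exact.
apply: (@cX_uniform_limit _ L T un) => // [t t0 tT|e e0]; first by have [] := hu t t0 tT.
have [N hN] := null_half c e0; exists N => t t0 tT.
by have [_ k] := hu t t0 tT; exact: le_trans (k N) (hN N (leqnn N)).
Qed.

(** The derivatives form a Cauchy sequence; by closedness its limit is a weak derivative of [v],
    hence agrees almost everywhere with the chosen [pair_wderiv]. *)
Lemma H1_pair_limit (v : pairs R) (wn dn : nat -> pairs R) (k : R) : in_X0 L v ->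
 (forall n, isH1 0 L (wn n).1 (dn n).1 /\ isH1 0 L (wn n).2 (dn n).2) ->
 cvg_for (fun x y => nX (x - y)) wn v -> (forall n, nX (dn n - dn n.+1) ^+ 2 <= k * 2^-1 ^+ n) ->
 (H1 0 L v.1 /\ H1 0 L v.2) /\ cvg_for (fun x y => nX (x - y)) dn (pair_wderiv L v).
Proof.
move=> Dv hw cw hd; have k0 : 0 <= k.
 by have := hd 0%N; rewrite expr0 mulr1; apply: le_trans; exact: sqr_ge0.
have D n : in_X0 L (wn n) by have [[h1 _ _] [h2 _ _]] := hw n; split.
have D' n : in_X0 L (dn n) by have [[_ h1 _] [_ h2 _]] := hw n; split.
have [q /andP[q0 q1] q2] : exists2 q : R, 0 <= q < 1 & q ^+ 2 = 2^-1.
 exists (Num.sqrt 2^-1); last by rewrite sqr_sqrtr//; lra.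
 by rewrite sqrtr_ge0 -[X in _ < X]sqrtr1 ltr_sqrt//; lra.
have cauc : cauchy_for (fun x y => nX (x - y)) dn.
 apply: (@geometric_cauchy _ _ XX _ (Num.sqrt k) q (sqrtr_ge0 k) q0 q1) => n; first exact: D'.
 rewrite [nrm _ _](nX_distC (D' n.+1) (D' n)).
 rewrite -ler_sqr ?nnegrE ?nX_ge0 ?mulr_ge0 ?sqrtr_ge0 ?exprn_ge0//.
 have -> : (Num.sqrt k * q ^+ n) ^+ 2 = k * 2^-1 ^+ n by rewrite exprMn sqr_sqrtr// -q2 -!exprM mulnC.
 exact: hd.
have [l Dl cl] := X0_complete D' cauc.
have app e : 0 < e -> exists n, nX (v - wn n) <= e /\ nX (l - dn n) <= e.
 move=> e0; have [N1 hN1] := cw e e0; have [N2 hN2] := cl e e0; exists (maxn N1 N2).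
 rewrite (nX_distC Dv (D _)) (nX_distC Dl (D' _)).
 by split; [apply: hN1; rewrite leq_maxl|apply: hN2; rewrite leq_maxr].
have h1 : isH1 0 L v.1 l.1.
 apply: (isH1_limit Dv.1 Dl.1) => e /app[n [n1 n2]]; exists (wn n).1, (dn n).1.
 by split; [have [] := hw n|exact: le_trans (nX1 L (v - wn n)) n1|exact: le_trans (nX1 L (l - dn n)) n2].
have h2 : isH1 0 L v.2 l.2.
 apply: (isH1_limit Dv.2 Dl.2) => e /app[n [n1 n2]]; exists (wn n).2, (dn n).2.
 by split; [have [] := hw n|exact: le_trans (nX2 L (v - wn n)) n1|exact: le_trans (nX2 L (l - dn n)) n2].
have p1 : H1 0 L v.1 by apply/H1P; exists l.1.
have p2 : H1 0 L v.2 by apply/H1P; exists l.2.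
have [w1 w2] := (wderivP p1, wderivP p2).
have Dw : in_X0 L (pair_wderiv L v) by have [[_ a _] [_ b _]] := (w1, w2); split.
split; first by split.
have E : nX (l - pair_wderiv L v) = 0.
 by apply: X0_eq_nX; split; [exact: (isH1_uniq hL h1 w1)|exact: (isH1_uniq hL h2 w2)].
move=> e e0; have [N hN] := cl e e0; exists N => n Nn.
by apply: (le_trans (nX_triangle (D' n) Dl Dw)); rewrite -!/(nX _) E addr0; exact: hN.
Qed.

Section limit.
Variables (C : R) (u0 : pairs R) (F G : R -> R -> R) (b : R -> R).
Hypothesis C0 : 0 <= C.
Hypothesis hC : forall s u, 0 <= s -> s <= 1 -> all_bc L u ->
 let D := ip XI (ev u 0) (ev u 0) + it 0 T (fun t => nrm XI (Fop s u t)) ^+ 2 +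
     it 0 T (fun t => btr L al (ev u t) ^+ 2) in
 [/\ forall t, 0 <= t -> t <= T -> ip XI (ev u t) (ev u t) <= C * D,
   it 0 T (fun t => gtr L (ev u t) ^+ 2) <= C * D &
   it 0 T (fun t => ip XI (dx (ev u t)) (dx (ev u t))) <= C * D].
Hypotheses (D0 : in_X0 L u0) (sF : src F G) (Lb : L2 0 T b).
Let eps (n : nat) : R := 2^-1 ^+ n.
Let eps0 n : 0 < eps n. Proof. by rewrite exprn_gt0. Qed.
Let eps_le n m : (n <= m)%N -> eps m <= eps n.
Proof. by move=> nm; rewrite /eps ler_wiXn2l//; lra. Qed.
Let eps_null k : null (fun n => k * eps n).
Proof. exact: null_half. Qed.
Variables (U : nat -> seq ({poly R} * X)) (M : nat -> R -> R).
Hypotheses (hU : forall n, all_bc L (U n)) (h0 : forall n, nX (u0 - hp (ev (U n) 0)) <= eps n).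
Hypotheses (M0 : forall n t, 0 <= M n t) (iM : forall n, ig 0 T (M n)).
Hypothesis hM : forall n, aeon 0 T (fun t => nX ((F t, G t) - hp (Fop 1 (U n) t)) <= M n t).
Hypothesis leM : forall n, it 0 T (M n) <= eps n.
Let bn n t := btr L al (ev (U n) t).
Let gn n t := gtr L (ev (U n) t).
Let un n t : pairs R := hp (ev (U n) t).
Hypothesis hb : forall n, nL 0 T (b - bn n) <= eps n.
(** Each of the three data differences between approximants is at most [2 * eps n], so their squares
    sum to at most [12 * eps n ^+ 2]. *)
Let K := Num.sqrt (12 * C).
Let K0 : 0 <= K. Proof. exact: sqrtr_ge0. Qed.

Let Lbn n : L2 0 T (bn n). Proof. by apply: L2_continuous; exact: btr_ev_cont. Qed.
Let Lgn n : L2 0 T (gn n). Proof. by apply: L2_continuous; exact: gtr_ev_cont. Qed.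
Let Fae : aeon 0 T (fun t => in_X0 L (F t, G t)). Proof. by case: sF. Qed.

Let iF s V : ig 0 T (fun t => nrm XI (Fop s V t)).
Proof. exact: ig_nrmF. Qed.

(** The difference of two approximants is again a time polynomial with the boundary conditions, and
    its data are small because both approximate the same data; [hC] then applies. *)
Lemma diff_bound n m : (n <= m)%N ->
 [/\ forall t, 0 <= t -> t <= T -> nX (un n t - un m t) <= K * eps n,
   nL 0 T (gn n - gn m) <= K * eps n &
   it 0 T (fun t => nrm XI (dx (ev (U n) t) - dx (ev (U m) t)) ^+ 2) <= (K * eps n) ^+ 2].
Proof.
move=> nm; pose W := U n ++ negs (U m); have hW := all_bc_diff (hU n) (hU m).
have := hC (ler01 : 0 <= 1) (lexx 1) hW; rewrite -/W => -[].
set D := ip _ _ _ + _ + _ => e1 e2 e3.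
have en := eps_le nm; have e0 := ltW (eps0 n); have em0 := ltW (eps0 m).
have WE t : ev W t = ev (U n) t - ev (U m) t by exact: ev_diff.
have d1 : nrm XI (ev W 0) <= 2 * eps n.
 have := nX_triangle (hp_X0 L (ev (U n) 0)) D0 (hp_X0 L (ev (U m) 0)).
 rewrite (nX_distC (hp_X0 L (ev (U n) 0)) D0) -hpB -WE -!/(nX _) nX_hp.
 have := h0 n; have := h0 m; move: (nrm _ _) (nX _) (nX _) => *; lra.
have d2 : it 0 T (fun t => nrm XI (Fop 1 W t)) <= 2 * eps n.
 apply: (@le_trans _ _ (it 0 T (fun t => M n t + M m t))); last first.
  by rewrite itD//; have := leM n; have := leM m; lra.
 apply: it_le; [exact: iF|exact: igD|].
 have hnm := aeon_and (hM n) (hM m).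
 apply: aeonS2 Fae hnm => t _ Dt [k1 k2].
 have := nX_triangle (hp_X0 L (Fop 1 (U n) t)) Dt (hp_X0 L (Fop 1 (U m) t)).
 rewrite (nX_distC (hp_X0 L (Fop 1 (U n) t)) Dt) -hpB -Fop_diff -!/(nX _) nX_hp.
 by move=> h; apply: (le_trans h); exact: lerD.
have d3 : it 0 T (fun t => btr L al (ev W t) ^+ 2) <= (2 * eps n) ^+ 2.
 have e : it 0 T (fun t => btr L al (ev W t) ^+ 2) = nL 0 T (bn n - bn m) ^+ 2.
  rewrite sqr_nL; apply: it_eq => t _; congr (_ ^+ 2).
  by rewrite WE btrB.
 rewrite e ler_sqr ?nnegrE ?nL_ge0 ?mulr_ge0//.
 have := nL_triangle (Lbn n) Lb (Lbn m).
 rewrite (nL_distC (Lbn n) Lb) -!/(nL _ _ _).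
 have := hb n; have := hb m; move: (nL _ _ _) (nL _ _ _) (nL _ _ _) => *; lra.
have DD : C * D <= (K * eps n) ^+ 2.
 have -> : (K * eps n) ^+ 2 = C * (3 * (2 * eps n) ^+ 2) by rewrite exprMn /K sqr_sqrtr ?mulr_ge0//; ring.
 apply: ler_wpM2l => //; rewrite /D -sqr_nrm.
 have q1 : nrm XI (ev W 0) ^+ 2 <= (2 * eps n) ^+ 2 by rewrite ler_sqr ?nnegrE ?nrm_ge0 ?mulr_ge0.
 have q2 : it 0 T (fun t => nrm XI (Fop 1 W t)) ^+ 2 <= (2 * eps n) ^+ 2.
  rewrite ler_sqr ?nnegrE ?mulr_ge0//.
  by apply: it_pos => t; exact: nrm_ge0.
 move: q1 q2 d3; move: (nrm XI (ev W 0) ^+ 2) (it 0 T (fun t => nrm XI (Fop 1 W t)) ^+ 2).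
 by move: (it 0 T (fun t => btr L al (ev W t) ^+ 2)) ((2 * eps n) ^+ 2) => *; lra.
have ke0 : 0 <= K * eps n by exact: mulr_ge0.
split.
- move=> t t0 tT; rewrite -hpB nX_hp -WE -ler_sqr ?nnegrE ?nrm_ge0//.
 by rewrite sqr_nrm; apply: le_trans DD; exact: e1.
- apply: nL_le => //; apply: le_trans DD; apply: le_trans e2.
 apply: ler_eq; apply: it_eq => t _; congr (_ ^+ 2).
 by rewrite WE gtrB.
- apply: le_trans DD; apply: le_trans e3.
 apply: ler_eq; apply: it_eq => t _.
 rewrite sqr_nrm; have -> : dx (ev W t) = dx (ev (U n) t) - dx (ev (U m) t) => //.
 by rewrite WE dxB.
Qed.

Lemma limits : exists u g, [/\ cX L T u, L2 0 T g,
 forall n t, 0 <= t -> t <= T -> nX (un n t - u t) <= K * eps n &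
 forall n, nL 0 T (gn n - g) <= K * eps n].
Proof.
have [|n m t nm t0 tT|u [cu hu]] := @X0_uniform_limit un K; first by move=> n; exact: cX_ev.
 by have [h _ _] := diff_bound nm; exact: h.
have [n m nm|g Lg hg] := @geometric_limit _ (L2ip 0 T) gn K (@L2_complete _ 0 T) Lgn.
 by have [_ h _] := diff_bound nm.
by exists u, g.
Qed.

Variables (u : R -> pairs R) (g : R -> R).
Hypotheses (lim_cX : cX L T u) (Lg : L2 0 T g).
Hypothesis cu : forall n t, 0 <= t -> t <= T -> nX (un n t - u t) <= K * eps n.
Hypothesis cg : forall n, nL 0 T (gn n - g) <= K * eps n.

Let Du t : 0 <= t -> t <= T -> in_X0 L (u t). Proof. exact: lim_cX.1. Qed.

Lemma lim_init : X0_eq L (u 0) u0.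
Proof.
have Du0 := Du (lexx 0) T0; apply: nX0_eq => //.
apply: null_cst_le (eps_null (K + 1)) _ => n.
have := nX_triangle Du0 (hp_X0 L (ev (U n) 0)) D0.
rewrite (nX_distC Du0 (hp_X0 L (ev (U n) 0))) (nX_distC (hp_X0 L (ev (U n) 0)) D0).
rewrite -!/(nX _) mulrDl mul1r => h; apply: (le_trans h); apply: lerD; last exact: h0.
exact: (cu n (lexx 0) T0).
Qed.

(** The constants [c1] and [c2] let one statement cover both equations: the boundary flux is
    [b - al * g] in the first and [g] in the second. *)
Lemma lim_weak w w' (c1 c2 : R) t : 0 <= t -> t <= T -> in_X0 L w -> in_X0 L w' ->
 (forall n, ip XX (un n t) w - ip XX (un n 0) w =
  it 0 t (fun s => ip XX (un n s) w' + (c1 * bn n s + c2 * gn n s) + ip XX (hp (Fop 1 (U n) s)) w)) ->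
 ip XX (u t) w - ip XX (u 0) w =
  it 0 t (fun s => ip XX (u s) w' + (c1 * b s + c2 * g s) + ip XX (F s, G s) w).
Proof.
move=> t0 tT Dw Dw' hn.
have [h ih hh] := src_coef sF Dw; have I0 v : cX L T v -> ig 0 t (fun s => ip XX (v s) w').
 by move=> cv; have := cX_ip hT cv Dw' => c; apply: (@ig_eq _ _ _ (fun s => ip XX (v (clamp 0 T s)) w'));
  [move=> s /in_oo_le[s0 st]; rewrite clamp_id//; exact: le_trans tT|exact: ig_continuous].
have ipc v s n : in_X0 L v -> 0 <= s -> s <= T -> `|ip XX (un n s) v - ip XX (u s) v| <= K * nX v * eps n.
 move=> Dv s0 sT; rewrite -(@ipBl _ _ XX _ _ _ (hp_X0 L _) (Du s0 sT) Dv).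
 apply: (le_trans (cauchy_schwarz (S := XX) (X0B (hp_X0 L _) (Du s0 sT)) Dv)).
 by rewrite mulrAC ler_wpM2r ?nX_ge0// cu.
have cI s : 0 <= s -> s <= T -> (fun n => ip XX (un n s) w) @ \oo --> ip XX (u s) w.
 by move=> s0 sT; apply: (null_cvg (eps_null (K * nX w))) => n; exact: ipc.
have cA : (fun n => it 0 t (fun s => ip XX (un n s) w')) @ \oo --> it 0 t (fun s => ip XX (u s) w').
 apply: (null_cvg (eps_null (K * nX w' * t))) => n; have iu := I0 _ (cX_ev L T (U n)).
 rewrite -itB//; last exact: I0; apply: (le_trans (it_abs (igB iu (I0 _ lim_cX)))).
 rewrite mulrAC -[X in _ * X](subr0 t) -(it_cst _ t0); apply: it_le; [|exact: ig_cst|].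
  by apply: ig_norm; apply: igB => //; exact: I0.
 by apply: aeonW => s /in_oo_le[s0 st]; apply: ipc => //; exact: le_trans tT.
have cP l (ln : nat -> R -> R) k : L2 0 T l -> (forall n, L2 0 T (ln n)) -> (forall n, nL 0 T (ln n - l) <= k * eps n) ->
  (fun n => it 0 t (ln n)) @ \oo --> it 0 t l.
 move=> Ll Lln hl; apply: (null_cvg (eps_null (k * Num.sqrt T))) => n.
 rewrite -itB; [|by apply: L2_ig; exact: L2_sub (lexx 0) tT _..].
 apply: (le_trans (prim_le t0 tT (L2B (Lln n) Ll))); rewrite subr0 (mulrAC k).
 by rewrite ler_wpM2r ?sqrtr_ge0.
have cB : (fun n => it 0 t (bn n)) @ \oo --> it 0 t b.
 by apply: (cP _ _ 1) => // n; rewrite nL_distC// mul1r.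
have cG : (fun n => it 0 t (gn n)) @ \oo --> it 0 t g by exact: cP cg.
have J3 n : ig 0 t (fun s => ip XX (hp (Fop 1 (U n) s)) w).
 rewrite (_ : (fun _ => _) = horner (evl (fun e => ip XX (hp e) w) (Fseq 1 (U n)))); first exact: ig_horner.
 apply/funext => s; rewrite (evlE (g := fun e => ip XX (hp e) w)) ?FopE// => k x y.
 rewrite hp_lin (@ipDl _ _ XX _ _ _ (domZ (s := XX) k (hp_X0 L x)) (hp_X0 L y) Dw).
 by rewrite (@ipZl _ _ XX k _ _ (hp_X0 L x) Dw).
have ih' := ig_sub (lexx 0) tT ih.
have cF : (fun n => it 0 t (fun s => ip XX (hp (Fop 1 (U n) s)) w)) @ \oo --> it 0 t h.
 apply: (null_cvg (eps_null (nX w))) => n; rewrite -itB//; apply: (le_trans (it_abs (igB (J3 n) ih'))).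
 have iM' : ig 0 T (fun s => nX w * M n s) by exact: igZ.
 apply: (@le_trans _ _ (it 0 T (fun s => nX w * M n s))); last by rewrite itZ// ler_wpM2l ?nX_ge0.
 apply: (@le_trans _ _ (it 0 t (fun s => nX w * M n s))); last first.
  by apply: it_sub_le => //; apply: aeonW => s _; rewrite mulr_ge0 ?nX_ge0.
 apply: it_le; [by apply: ig_norm; exact: igB|exact: ig_sub (lexx 0) tT iM'|].
 have hMh := aeon_sub (lexx 0) tT (aeon_and (hM n) hh).
 apply: aeonS2 (aeon_sub (lexx 0) tT Fae) hMh => s _ Ds [m1 <-].
 rewrite distrC -(@ipBl _ _ XX _ _ _ Ds (hp_X0 L _) Dw) mulrC.
 by apply: (le_trans (cauchy_schwarz (S := XX) (X0B Ds (hp_X0 L _)) Dw)); rewrite -!/(nX _) ler_wpM2r ?nX_ge0.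
have Lt l : L2 0 T l -> ig 0 t l by move=> Ll; apply: L2_ig; exact: L2_sub Ll.
have split4 v l1 l2 z : ig 0 t v -> ig 0 t l1 -> ig 0 t l2 -> ig 0 t z ->
  it 0 t (fun s => v s + (c1 * l1 s + c2 * l2 s) + z s) = it 0 t v + (c1 * it 0 t l1 + c2 * it 0 t l2) + it 0 t z.
 move=> i1 i2 i3 i4; have i23 := igD (igZ c1 i2) (igZ c2 i3).
 by rewrite (itD (igD i1 i23) i4) (itD i1 i23) (itD (igZ c1 i2) (igZ c2 i3)) !itZ.
have -> : it 0 t (fun s => ip XX (u s) w' + (c1 * b s + c2 * g s) + ip XX (F s, G s) w) =
  it 0 t (fun s => ip XX (u s) w') + (c1 * it 0 t b + c2 * it 0 t g) + it 0 t h.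
 rewrite -split4; [|exact: I0|exact: Lt|exact: Lt|exact: ih'].
 by apply: it_ae; apply: aeonS (aeon_sub (lexx 0) tT hh) => s _ ->.
apply: (cvg_unique _ (cvgB (cI t t0 tT) (cI 0 (lexx 0) T0))); first exact: norm_hausdorff.
have -> : (fun n => ip XX (un n t) w) - (fun n => ip XX (un n 0) w) = fun n =>
  it 0 t (fun s => ip XX (un n s) w') + (c1 * it 0 t (bn n) + c2 * it 0 t (gn n)) +
  it 0 t (fun s => ip XX (hp (Fop 1 (U n) s)) w).
 apply/funext => n; rewrite [LHS](hn n) split4; [by []|exact: I0 _ (cX_ev L T (U n))|exact: Lt|exact: Lt|exact: J3].
apply: cvgD cF; apply: cvgD cA _; apply: cvgD; [exact: cvgM (cvg_cst c1) cB|exact: cvgM (cvg_cst c2) cG].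
Qed.

(** For almost every time the derivatives of the approximants converge, their squared steps decaying
    geometrically. [N] is a measurable representative of the norm of the limit, to which Fatou
    passes any asymptotic bound. *)
Lemma lim_H1 : exists N : R -> R, [/\ mfn 0 T N,
 aeon 0 T (fun t => H1 0 L (u t).1 /\ H1 0 L (u t).2),
 aeon 0 T (fun t => nX (pair_wderiv L (u t)) = N t) &
 forall c, (forall e, 0 < e -> exists n0, forall n, (n0 <= n)%N ->
  it 0 T (fun t => nrm XI (dx (ev (U n) t)) ^+ 2) <= c + e) ->
  ig 0 T (fun t => N t ^+ 2) /\ it 0 T (fun t => N t ^+ 2) <= c].
Proof.
pose d n t := dx (ev (U n) t).
have dE n t : d n t = ev (mapv (@dx R) (U n)) t by rewrite ev_mapv//; exact: dx_lin.
have cd n : continuous (fun t => nrm XI (d n t)) by under eq_fun do rewrite dE; exact: nrm_ev_continuous.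
have idif n : ig 0 T (fun t => nrm XI (d n t - d n.+1 t) ^+ 2).
 under eq_fun do rewrite !dE -ev_diff sqr_nrm.
 by apply: ig_continuous; exact: ip_ev_continuous.
have dec : aeon 0 T (fun t => exists c : R, forall n, nrm XI (d n t - d n.+1 t) ^+ 2 <= c * 2^-1 ^+ n).
 apply: (@ae_geometric_decay _ _ _ _ (K ^+ 2)) => //; first exact: sqr_ge0.
  by move=> n t; exact: sqr_ge0.
 move=> n; have [_ _ h] := diff_bound (leqnSn n); apply: (le_trans h).
 rewrite exprMn ler_wpM2l ?sqr_ge0// /eps -exprM mulnC exprM.
 by rewrite (_ : 2^-1 ^+ 2 = 4^-1 :> R)//; field.
have lim : aeon 0 T (fun t => (H1 0 L (u t).1 /\ H1 0 L (u t).2) /\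
  (fun n => nrm XI (d n t)) @ \oo --> nX (pair_wderiv L (u t))).
 apply: aeonS dec => t /in_oo_le[t0 tT] [c hc].
 have [//|n|e e0|n|hH cl] := @H1_pair_limit (u t) (un ^~ t) (fun n => hp (d n t)) c; first exact: Du.
 - by split; apply: isH1_poly; exact: ltW.
 - have [N hN] := eps_null K e0; exists N => n /hN; exact: le_trans (cu n t0 tT).
 - by rewrite -hpB nX_hp; exact: hc.
 have [Da Db] := hH; have Dw : in_X0 L (pair_wderiv L (u t)).
  by have [[_ ? _] [_ ? _]] := (wderivP Da, wderivP Db); split.
 split=> //; apply/cvgrPdist_le => e e0; have [N hN] := cl e e0; exists N => // n /= /hN h.
 rewrite -nX_hp distrC; apply: le_trans h; exact: (nrm_dist (S := XX) (hp_X0 L _) Dw).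
have [N mN hN] : exists2 g : R -> R, mfn 0 T g & aeon 0 T (fun t => (fun n => nrm XI (d n t)) @ \oo --> g t).
 apply: ae_cvg_mfn; first by move=> n; apply: ig_mf; exact: ig_continuous.
 by apply: aeonS lim => t _ [_ h]; exists (nX (pair_wderiv L (u t))).
exists N; split => //.
- by apply: aeonS lim => t _ [h _].
- apply: aeonS2 lim hN => t _ [_ h3] h4.
 by apply: (cvg_unique _ h3 h4); exact: norm_hausdorff.
- move=> c hc; apply: (@it_fatou _ 0 T (fun n t => nrm XI (d n t) ^+ 2)) => //.
 + by move=> n; apply: ig_cSqr; exact: cd.
 + by move=> n t; exact: sqr_ge0.
 + exact: measurable_funX.
 + apply: aeonS hN => t _ h.
  exact: cvg_sqr.
Qed.

Let eps_cvg (x : R) : (fun n => (x + eps n) ^+ 2) @ \oo --> x ^+ 2.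
Proof.
apply: cvg_sqr; apply: (null_cvg (eps_null 1)) => n.
by rewrite addrAC subrr add0r mul1r ger0_norm// ltW.
Qed.

Let gn_cvg : (fun n => nL 0 T (gn n)) @ \oo --> nL 0 T g.
Proof.
by apply: (null_cvg (eps_null K)) => n; exact: le_trans (nrm_dist (S := L2ip 0 T) (Lgn n) Lg) (cg n).
Qed.

Let bn_dist n : `|nL 0 T (bn n) - nL 0 T b| <= eps n.
Proof. by rewrite distrC; exact: le_trans (nrm_dist (S := L2ip 0 T) Lb (Lbn n)) (hb n). Qed.

Let U0_dist n : `|nrm XI (ev (U n) 0) - nX u0| <= eps n.
Proof. by rewrite -nX_hp distrC; exact: le_trans (nrm_dist (S := XX) D0 (hp_X0 L _)) (h0 n). Qed.

Let Fop_le m : ig 0 T m -> aeon 0 T (fun t => nX (F t, G t) <= m t) ->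
 forall n, it 0 T (fun t => nrm XI (Fop 1 (U n) t)) <= it 0 T m + eps n.
Proof.
move=> im hm n; apply: (@le_trans _ _ (it 0 T (fun t => m t + M n t))); last by rewrite itD// lerD2l.
apply: it_le; [exact: iF|exact: igD|].
apply: aeonS2 Fae (aeon_and (hM n) hm) => t _ Dt [k1 k2].
have /dist_le[_ h] := nrm_dist (S := XX) Dt (hp_X0 L (Fop 1 (U n) t)).
rewrite -nX_hp; apply: (le_trans h); exact: lerD.
Qed.

Lemma lim_bounds m : ig 0 T m -> aeon 0 T (fun t => nX (F t, G t) <= m t) ->
 let D := nX u0 ^+ 2 + it 0 T m ^+ 2 + nL 0 T b ^+ 2 in
 [/\ forall t, 0 <= t -> t <= T -> nX (u t) ^+ 2 <= C * D, nL 0 T g ^+ 2 <= C * D &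
  forall e, 0 < e -> exists n0, forall n, (n0 <= n)%N ->
   it 0 T (fun t => nrm XI (dx (ev (U n) t)) ^+ 2) <= C * D + e].
Proof.
move=> im hm D; pose E n := (nX u0 + eps n) ^+ 2 + (it 0 T m + eps n) ^+ 2 + (nL 0 T b + eps n) ^+ 2.
have cE : (fun n => C * E n) @ \oo --> C * D.
 by apply: cvgM; [exact: cvg_cst|apply: cvgD; [apply: cvgD|]; exact: eps_cvg].
have DE n : C * (ip XI (ev (U n) 0) (ev (U n) 0) + it 0 T (fun t => nrm XI (Fop 1 (U n) t)) ^+ 2 +
  it 0 T (fun t => bn n t ^+ 2)) <= C * E n.
 have sq (x y : R) : 0 <= x -> x <= y -> x ^+ 2 <= y ^+ 2 by move=> x0 xy; rewrite lerXn2r// nnegrE// (le_trans x0).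
 rewrite ler_wpM2l// -sqr_nrm -sqr_nL; apply: lerD; [apply: lerD|]; apply: sq.
 - exact: nrm_ge0.
 - by have [h _] := dist_le (U0_dist n).
 - by apply: it_pos => t; exact: nrm_ge0.
 - exact: Fop_le.
 - exact: nL_ge0.
 - by have [h _] := dist_le (bn_dist n).
have bnd n := hC (ler01 : 0 <= 1) (lexx 1) (hU n).
have lim (x : R) (y : nat -> R) : y @ \oo --> x -> (forall n, y n ^+ 2 <= C * E n) -> x ^+ 2 <= C * D.
 by move=> cy h; apply: (ler_cvg_to (cvg_sqr cy) cE); exact: nearW.
split.
- move=> t t0 tT; apply: (lim _ (fun n => nrm XI (ev (U n) t))) => [|n].
  apply: (null_cvg (eps_null K)) => n; rewrite -nX_hp.
  exact: le_trans (nrm_dist (S := XX) (hp_X0 L _) (Du t0 tT)) (cu n t0 tT).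
 by have [b1 _ _] := bnd n; rewrite sqr_nrm; exact: le_trans (b1 t t0 tT) (DE n).
- apply: (lim _ _ gn_cvg) => n; have [_ b2 _] := bnd n.
 by rewrite sqr_nL; exact: le_trans b2 (DE n).
- move=> e e0; have [N _ hN] := (cvgrPdist_le _ _).1 cE e e0; exists N => n /hN /= h.
 have [_ _ b3] := bnd n; have [_ h'] := dist_le h.
 rewrite (it_eq (g := fun t => ip XI (dx (ev (U n) t)) (dx (ev (U n) t)))); last by move=> t _; exact: sqr_nrm.
 exact: le_trans (le_trans b3 (DE n)) h'.
Qed.

(** With zero initial value and source, the limit of the energy identity bounds [al] times the
    squared trace by the pairing with [b]. The constant 1 in this bound, unlike [C], is what lets
    the delay loop contract. *)
Lemma lim_trace : nX u0 = 0 -> aeon 0 T (fun t => nX (F t, G t) = 0) -> al * nL 0 T g <= nL 0 T b.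
Proof.
move=> u00 F0; have [B B0 hB] := cX_bounded hT lim_cX.
suff main : al * nL 0 T g ^+ 2 <= nL 0 T b * nL 0 T g.
 have [->|x0] := eqVneq (nL 0 T g) 0; first by rewrite mulr0 nL_ge0.
 have xp : 0 < nL 0 T g by rewrite lt_def x0 nL_ge0.
 by rewrite -(ler_pM2r xp) -mulrA -expr2.
have supU n t : 0 <= t -> t <= T -> nrm XI (ev (U n) t) <= B + K.
 move=> t0 tT; have [h _] := dist_le (nrm_dist (S := XX) (hp_X0 L (ev (U n) t)) (Du t0 tT)).
 rewrite -nX_hp; apply: (le_trans h); apply: lerD; first exact: hB.
 apply: (le_trans (cu n t0 tT)); rewrite ler_piMr// /eps exprn_ile1//; lra.
have F0' : aeon 0 T (fun t => nX (F t, G t) <= 0) by apply: aeonS F0 => t _ ->.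
have cF : (fun n => it 0 T (fun t => nrm XI (Fop 1 (U n) t))) @ \oo --> (0 : R).
 apply: (null_cvg (eps_null 1)) => n; have := Fop_le (ig_cst 0 T 0) F0' n.
 rewrite it0 add0r subr0 mul1r ger0_norm//.
 by apply: it_pos => t; exact: nrm_ge0.
have cU : (fun n => nrm XI (ev (U n) 0)) @ \oo --> (0 : R).
 by apply: (null_cvg (eps_null 1)) => n; rewrite mul1r; have := U0_dist n; rewrite u00.
have cb : (fun n => nL 0 T (bn n)) @ \oo --> nL 0 T b by apply: (null_cvg (eps_null 1)) => n; rewrite mul1r.
have -> : nL 0 T b * nL 0 T g = 0 ^+ 2 + (B + K) * 0 + nL 0 T b * nL 0 T g by rewrite mulr0 expr0n !add0r.
apply: (ler_cvg_to (cvgM (cvg_cst al) (cvg_sqr gn_cvg))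
 (cvgD (cvgD (cvg_sqr cU) (cvgM (cvg_cst (B + K)) cF)) (cvgM cb gn_cvg))).
apply: nearW => n; have en := energy_eq al hL 1 (hU n) T0.
have FU : it 0 T (fun t => ip XI (Fop 1 (U n) t) (ev (U n) t)) <= (B + K) * it 0 T (fun t => nrm XI (Fop 1 (U n) t)).
 rewrite -itZ//; apply: it_le; [|exact: igZ|].
  by under eq_fun do rewrite FopE; apply: ig_continuous; exact: ip_ev_continuous.
 apply: aeonW => t /in_oo_le[t0 tT].
 by rewrite mulrC; apply: (le_trans (ip_le (domT _) (domT _))); rewrite ler_wpM2l ?nrm_ge0// supU.
have bg : it 0 T (fun t => btr L al (ev (U n) t) * gtr L (ev (U n) t)) <= nL 0 T (bn n) * nL 0 T (gn n).
 by apply: (le_trans (ler_norm _)); exact: (it_mul_le (Lbn n) (Lgn n)).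
have UT := ip_ge0 XI (ev (U n) T); have U0 := ip_ge0 XI (ev (U n) 0).
rewrite -(sqr_nL 0 T (gn n)) in en; rewrite -[X in X <= _]/(al * nL 0 T (gn n) ^+ 2).
rewrite -[X in _ <= X]/(nrm XI (ev (U n) 0) ^+ 2 + (B + K) * it 0 T (fun t => nrm XI (Fop 1 (U n) t)) +
 nL 0 T (bn n) * nL 0 T (gn n)) sqr_nrm; move: en FU bg UT U0.
by move: (it _ _ _) (it _ _ _) (ip _ _ _) (ip _ _ _) (al * _) ((B + K) * _) (nL _ _ _ * _) => *; lra.
Qed.

End limit.

Definition wid (u : R -> pairs R) F G (k : R -> R) (w w' : pairs R) := forall t, 0 <= t -> t <= T ->
 ip XX (u t) w - ip XX (u 0) w = it 0 t (fun s => ip XX (u s) w' + k s + ip XX (F s, G s) w).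

Lemma weakP u F G g b : weak_KdV L T u F G g b <->
 (forall phi, smooth phi -> phi 0 = 0 -> phi L = 0 -> derive1 phi 0 = 0 ->
  wid u F G (fun s => b s * derive1 phi L) (phi, 0) (0, derive1 phi + derive1n 3 phi)) /\
 (forall psi, smooth psi -> psi 0 = 0 -> psi L = 0 ->
  wid u F G (fun s => g s * derive1 psi L) (0, psi) (derive1 psi + derive1n 3 psi, 0)).
Proof.
have A t f f' (k : R -> R) : it 0 t (fun s => ip XX (u s) (0, f') + k s + ip XX (F s, G s) (f, 0)) =
  it 0 t (fun s => L2inner 0 L (u s).2 f' + k s + L2inner 0 L (F s) f).
 by apply: it_eq => s _; rewrite ip_inl ip_inr.
have A' t f f' (k : R -> R) : it 0 t (fun s => ip XX (u s) (f', 0) + k s + ip XX (F s, G s) (0, f)) =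
  it 0 t (fun s => L2inner 0 L (u s).1 f' + k s + L2inner 0 L (G s) f).
 by apply: it_eq => s _; rewrite ip_inl ip_inr.
split=> [W|[W1 W2] t].
 have tI t : 0 <= t -> t <= T -> t \in `[0, T] by rewrite in_itv/= => -> ->.
 split=> [phi sp p0 pL dp|psi sp p0 pL] t t0 tT; have [W1 W2] := W t (tI t t0 tT).
  by rewrite !ip_inl A; exact: W1.
 by rewrite !ip_inr A'; exact: W2.
move=> /in_cc[t0 tT]; split=> [phi sp p0 pL dp|psi sp p0 pL].
 by have := W1 phi sp p0 pL dp t t0 tT; rewrite !ip_inl A.
by have := W2 psi sp p0 pL t t0 tT; rewrite !ip_inr A'.
Qed.

(** The bounds hold for every integrable majorant [m] of the source norm, whose own measurability in
    time is not assumed. *)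
Lemma lin_exists : exists2 C : R, 0 <= C & forall u0 F G b, in_X0 L u0 -> src F G -> L2 0 T b ->
 exists u g N, [/\ cX L T u, X0_eq L (u 0) u0, L2 0 T g,
  weak_KdV L T u F G g (fun t => - al * g t + b t) &
  [/\ aeon 0 T (fun t => H1 0 L (u t).1 /\ H1 0 L (u t).2),
   mfn 0 T N /\ aeon 0 T (fun t => nX (pair_wderiv L (u t)) = N t),
   (forall m, ig 0 T m -> aeon 0 T (fun t => nX (F t, G t) <= m t) ->
    let D := nX u0 ^+ 2 + it 0 T m ^+ 2 + nL 0 T b ^+ 2 in
    [/\ forall t, 0 <= t -> t <= T -> nX (u t) ^+ 2 <= C * D, nL 0 T g ^+ 2 <= C * D,
     ig 0 T (fun t => N t ^+ 2) & it 0 T (fun t => N t ^+ 2) <= C * D]) &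
   (nX u0 = 0 -> aeon 0 T (fun t => nX (F t, G t) = 0) -> al * nL 0 T g <= nL 0 T b)]].
Proof.
have [C C0 hC] := apriori hL hal hT; exists C => // u0 F G b D0 sF Lb.
have e0 n : 0 < (2^-1 : R) ^+ n by rewrite exprn_gt0.
have /choice[U hU'] n := approx_data D0 sF Lb (e0 n); have /choice[M hM'] := hU'.
have hU n : all_bc L (U n) by have [] := hM' n.
have h0 n : nX (u0 - hp (ev (U n) 0)) <= 2^-1 ^+ n by have [] := hM' n.
have M0 n t : 0 <= M n t by have [_ _ []] := hM' n.
have iM n : ig 0 T (M n) by have [_ _ []] := hM' n.
have hM n : aeon 0 T (fun t => nX ((F t, G t) - hp (Fop 1 (U n) t)) <= M n t) by have [_ _ []] := hM' n.
have leM n : it 0 T (M n) <= 2^-1 ^+ n by have [_ _ []] := hM' n.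
have hb n : nL 0 T (b - (fun t => btr L al (ev (U n) t))) <= 2^-1 ^+ n by have [] := hM' n.
have [u [g [Du Lg cu cg]]] := limits C0 hC D0 sF Lb hU h0 iM hM leM hb.
have [N [mN hH1 hN hNb]] := lim_H1 C0 hC D0 sF Lb hU h0 iM hM leM hb Du cu.
exists u, g, N; split.
- exact: Du.
- exact: (lim_init D0 h0 Du cu).
- exact: Lg.
- apply/weakP; split => [phi sp p0 pL dp|psi sp p0 pL] t t0 tT.
 + have := lim_weak sF Lb M0 iM hM leM hb Du Lg cu cg (c1 := derive1 phi L) (c2 := - al * derive1 phi L) t0 tT
   (X0_inl (L2_continuous 0 L (smooth_cts sp))) (X0_inr (L2_continuous 0 L (smooth_D3 sp))).
  move=> ->; first by apply: it_eq => s _; congr (_ + _ + _); ring.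
  move=> n; rewrite !ip_inl (poly_weak1 hL al (hU n) t0 sp p0 pL dp).
  by apply: it_eq => s _; rewrite ip_inr ip_inl; congr (_ + _ + _); ring.
 + have := lim_weak sF Lb M0 iM hM leM hb Du Lg cu cg (c1 := 0) (c2 := derive1 psi L) t0 tT
   (X0_inr (L2_continuous 0 L (smooth_cts sp))) (X0_inl (L2_continuous 0 L (smooth_D3 sp))).
  move=> ->; first by apply: it_eq => s _; congr (_ + _ + _); ring.
  move=> n; rewrite !ip_inr (poly_weak2 hL (hU n) t0 sp p0 pL).
  by apply: it_eq => s _; rewrite ip_inl ip_inr; congr (_ + _ + _); ring.
split => //.
- move=> m im hm D; have [b1 b2 b3] := lim_bounds C0 hC D0 sF Lb hU h0 iM hM leM hb Du Lg cu cg im hm.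
 by have [i1 i2] := hNb _ b3; split.
- exact: (lim_trace D0 sF Lb hU h0 iM hM leM hb Du Lg cu cg).
Qed.

End Solver.

(** * Uniqueness by duality *)

Section Uniqueness.
Context {R : realType}.
Variables (L al T : R).
Hypotheses (hL : 0 < L) (hal : 0 < al) (hT : 0 < T).
Notation X := ({poly R} * {poly R})%type.
Notation XI := (Xip L).
Notation XX := (@X0ip R L).
Notation nX := (nX L).
Implicit Types (U V : seq ({poly R} * X)) (F G : R -> R -> R) (b g : R -> R).
Let T0 : 0 <= T. Proof. exact: ltW. Qed.
Let domT (e : X) : dom XI e. Proof. exact: Xdom. Qed.
Hint Resolve domT : core.

Lemma cX_clamp (Q : pairs R -> R) u t : cX L T u -> t <= T ->
 continuous (fun s => Q (u (clamp 0 T s))) ->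
 ig 0 t (fun s => Q (u s)) /\ L2 0 t (fun s => Q (u s)).
Proof.
move=> cu tT c.
have e s : s \in `]0, t[ -> Q (u (clamp 0 T s)) = Q (u s).
 by move=> /in_oo_le[s0 st]; rewrite clamp_id// (le_trans st).
split; first by apply: (ig_eq e); exact: ig_continuous.
have := L2_continuous 0 t c => /L2P[m i]; apply/L2P; split.
 by apply: eq_measurable_fun m => s; rewrite inE/= => /e.
by apply: ig_eq i => s /e ->.
Qed.

Lemma cX_igL2 u w t : cX L T u -> in_X0 L w -> t <= T ->
 ig 0 t (fun s => ip XX (u s) w) /\ L2 0 t (fun s => ip XX (u s) w).
Proof. by move=> cu Dw tT; apply: (@cX_clamp (fun v => ip XX v w)) => //; exact: cX_ip. Qed.

Lemma cX_ig_ev u V t : cX L T u -> t <= T -> ig 0 t (fun s => ip XX (u s) (hp (ev V s))).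
Proof.
move=> cu tT; elim: V => [|p V IH].
 apply: (@ig_eq _ _ _ (fun=> 0)); last exact: ig_cst.
 move=> s /in_oo_le[s0 st].
 have Du := cu.1 s s0 (le_trans st tT).
 by rewrite /ev big_nil [hp 0](_ : _ = 0) ?(ip0r (S := XX))//; congr pair; apply/funext => x /=; rewrite horner0.
apply: (@ig_eq _ _ _ (fun s => p.1.[s] * ip XX (u s) (hp p.2) + ip XX (u s) (hp (ev V s)))).
 move=> s /in_oo_le[s0 st].
 have Du := cu.1 s s0 (le_trans st tT).
 rewrite /ev big_cons -/(ev V s) hp_lin (ipDr (S := XX) (domZ (s := XX) _ (hp_X0 L _)) (hp_X0 L _) Du).
 by rewrite (ipZr (S := XX) _ (hp_X0 L _) Du).
by apply: igD => //; apply: L2_mul; [exact: L2_poly|have [] := cX_igL2 cu (hp_X0 L p.2) tT].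
Qed.

(** The boundary operator of the adjoint problem: with input [- al * g], the boundary terms of the
    two equations combine into [bt e * g]. *)
Definition bt (e : X) : R := e.2^`().[L] - al * e.1^`().[L].

Lemma bt_lin (k : R) e f : bt (k *: e + f) = k * bt e + bt f.
Proof. by rewrite /bt /= !derivD !derivZ !hornerD !hornerZ; ring. Qed.

Definition wform (u : R -> pairs R) g := forall t, 0 <= t -> t <= T -> forall e, bc L e ->
 ip XX (u t) (hp e) = it 0 t (fun s => ip XX (u s) (hp (- Aop 1 e)) + bt e * g s).

Lemma weak_wform u F G g b : cX L T u -> L2 0 T g -> nX (u 0) = 0 ->
 aeon 0 T (fun t => in_X0 L (F t, G t) /\ nX (F t, G t) = 0) ->
 aeon 0 T (fun t => b t = - al * g t) -> weak_KdV L T u F G g b -> wform u g.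
Proof.
move=> cu Lg u0 F0 bg W t t0 tT e [e1 e2 e3 e4 e5].
have ue : ip XX (u 0) (hp e) = 0.
 apply/eqP; rewrite -normr_eq0 eq_le normr_ge0 andbT.
 have := cauchy_schwarz (S := XX) (cu.1 0 (lexx 0) T0) (hp_X0 L e).
 by rewrite -!/(nX _) u0 mul0r.
have tI : t \in `[0, T] by rewrite in_itv/= t0.
have [W1 W2] := W t tI.
have := W1 (horner e.1) (@smooth_poly R e.1) e1 e2; rewrite derive1_poly => /(_ e3) {}W1.
have := W2 (horner e.2) (@smooth_poly R e.2) e4 e5; rewrite derive1_poly => {}W2.
have d3 (p : {poly R}) : derive1n 3 (horner p) = horner p^`()^`()^`() by rewrite /= !derive1_poly.
rewrite !d3 in W1 W2.
have sm (p : {poly R}) : horner p^`() + horner p^`()^`()^`() = horner (- - (1%:P * p^`() + p^`()^`()^`())).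
 by rewrite opprK polyC1 mul1r hornerfD.
rewrite !sm in W1 W2.
have Lt : L2 0 t g by exact: L2_sub Lg.
have F1 : aeon 0 t (fun s => L2inner 0 L (F s) (horner e.1) = 0 /\ L2inner 0 L (G s) (horner e.2) = 0).
 apply: aeonS (aeon_sub (lexx 0) tT F0) => s _ [[DF DG] n0].
 have [n1 n2] : nL 0 L (F s) = 0 /\ nL 0 L (G s) = 0.
  have a1 := nX1 L (F s, G s); have a2 := nX2 L (F s, G s); rewrite n0 /= in a1 a2.
  by split; apply/eqP; rewrite eq_le nL_ge0 ?a1 ?a2.
 split; apply/eqP; rewrite -normr_eq0 eq_le normr_ge0 andbT.
  by have := cauchy_schwarz (S := L2ip 0 L) DF (L2_poly 0 L e.1); rewrite -!/(nL _ _ _) n1 mul0r.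
 by have := cauchy_schwarz (S := L2ip 0 L) DG (L2_poly 0 L e.2); rewrite -!/(nL _ _ _) n2 mul0r.
have bg' := aeon_sub (lexx 0) tT bg.
pose f1 s := L2inner 0 L (u s).2 (horner (- Aop 1 e).2) - al * e.1^`().[L] * g s.
pose f2 s := L2inner 0 L (u s).1 (horner (- Aop 1 e).1) + e.2^`().[L] * g s.
have {}W1 : L2inner 0 L (u t).1 (horner e.1) - L2inner 0 L (u 0).1 (horner e.1) = it 0 t f1.
 rewrite W1; apply: it_ae; apply: aeonS2 F1 bg' => s _ [-> _] ->.
 by rewrite addr0 /f1 mulNr [_ * _ * g s]mulrAC mulNr.
have {}W2 : L2inner 0 L (u t).2 (horner e.2) - L2inner 0 L (u 0).2 (horner e.2) = it 0 t f2.
 rewrite W2; apply: it_ae; apply: aeonS F1 => s _ [_ ->].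
 by rewrite addr0 /f2 [g s * _]mulrC.
have i1 : ig 0 t f1.
 apply: igB; last by apply: igZ; exact: L2_ig.
 have [h _] := cX_igL2 cu (X0_inr (L2_poly 0 L (- Aop 1 e).2)) tT.
 by apply: ig_eq h => s _; exact: ip_inr.
have i2 : ig 0 t f2.
 apply: igD; last by apply: igZ; exact: L2_ig.
 have [h _] := cX_igL2 cu (X0_inl (L2_poly 0 L (- Aop 1 e).1)) tT.
 by apply: ig_eq h => s _; exact: ip_inl.
have -> : ip XX (u t) (hp e) = ip XX (u t) (hp e) - ip XX (u 0) (hp e) by rewrite ue subr0.
have ipE v : ip XX v (hp e) = L2inner 0 L v.1 (horner e.1) + L2inner 0 L v.2 (horner e.2) by [].
rewrite !ipE opprD addrACA W1 W2 -itD//; apply: it_eq => s _.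
rewrite /f1 /f2 /bt [ip XX _ _](_ : _ = L2inner 0 L (u s).1 (horner (- Aop 1 e).1) + L2inner 0 L (u s).2 (horner (- Aop 1 e).2))//.
by rewrite mulrBl; move: (L2inner _ _ _ _) (L2inner _ _ _ _) => *; ring.
Qed.

Section dual.
Variables (u : R -> pairs R) (g : R -> R).
Hypotheses (cu : cX L T u) (Lg : L2 0 T g) (W : wform u g).

Lemma Fop_cons (q : {poly R}) (e : X) V s :
 Fop 1 ((q, e) :: V) s = q^`().[s] *: e + q.[s] *: (- Aop 1 e) + Fop 1 V s.
Proof.
by rewrite /Fop /ev /= !big_cons /= Aop_lin opprD addrACA scalerN.
Qed.

(** From fixed to time-dependent test functions: the product rule in time, in the integrated form
    [it_parts], for one summand of [V] at a time. *)
Lemma duhamel V t : all_bc L V -> 0 <= t -> t <= T -> ip XX (u t) (hp (ev V t)) =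
 it 0 t (fun s => ip XX (u s) (hp (Fop 1 V s)) + bt (ev V s) * g s).
Proof.
move=> + t0 tT; have Dut := cu.1 t t0 tT.
have hp0 : hp 0 = 0 :> pairs R by congr pair; apply/funext => x /=; rewrite horner0.
elim: V => [_|p V IH /= [hp2 hV]].
 rewrite [ev _ _]big_nil hp0 (ip0r (S := XX))// -[LHS](it0 0 t); apply: it_eq => s.
 move=> /in_oo_le[s0 st].
 have Du := cu.1 s s0 (le_trans st tT).
 have b0 : bt 0 = 0 by rewrite /bt /= deriv0 horner0 mulr0 subrr.
 have a0 : Fop 1 [::] s = 0.
  rewrite /Fop /ev /= !big_nil; apply/eqP; rewrite sub0r oppr_eq0; apply/eqP.
  by congr pair; rewrite /= !deriv0 mulr0 addr0 oppr0.
 by rewrite a0 hp0 (ip0r (S := XX))// [ev _ _]big_nil b0 mul0r addr0.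
have Lt : L2 0 t g by exact: L2_sub Lg.
pose f s := ip XX (u s) (hp (- Aop 1 p.2)) + bt p.2 * g s.
have Lf : L2 0 t f.
 have [_ h] := cX_igL2 cu (hp_X0 L (- Aop 1 p.2)) tT.
 exact: (L2D h (L2Z (bt p.2) Lt)).
have key := it_parts t0 Lf (@continuous_horner _ p.1) (@continuous_horner _ p.1^`()) (fun x _ => is_derive_poly p.1 x).
have e1 : it 0 t (fun x => it 0 x f * p.1^`().[x]) = it 0 t (fun x => p.1^`().[x] * ip XX (u x) (hp p.2)).
 apply: it_eq => s /in_oo_le[s0 st].
 by rewrite -(W s0 (le_trans st tT) hp2) mulrC.
rewrite e1 -(W t0 tT hp2) in key.
have i1 : ig 0 t (fun x => p.1^`().[x] * ip XX (u x) (hp p.2)).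
 by apply: L2_mul; [exact: L2_poly|have [] := cX_igL2 cu (hp_X0 L p.2) tT].
have i2 : ig 0 t (fun x => f x * p.1.[x]) by apply: L2_mul => //; exact: L2_poly.
have i3 : ig 0 t (fun s => ip XX (u s) (hp (Fop 1 V s)) + bt (ev V s) * g s).
 apply: igD; first by under eq_fun do rewrite FopE; exact: cX_ig_ev.
 apply: L2_mul => //.
 have -> : (fun x => bt (ev V x)) = horner (evl bt V) by apply/funext => x; rewrite evlE//; exact: bt_lin.
 exact: L2_poly.
have -> : ev (p :: V) t = p.1.[t] *: p.2 + ev V t by rewrite /ev big_cons.
rewrite hp_lin (ipDr (S := XX) (domZ (s := XX) _ (hp_X0 L _)) (hp_X0 L _) Dut) (ipZr (S := XX) _ (hp_X0 L _) Dut).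
rewrite IH// mulrC -key -itD// -itD//; last exact: igD.
apply: it_eq => s /in_oo_le[s0 st].
have Du := cu.1 s s0 (le_trans st tT).
have -> : ev (p :: V) s = p.1.[s] *: p.2 + ev V s by rewrite /ev big_cons.
have -> : Fop 1 (p :: V) s = p.1^`().[s] *: p.2 + (p.1.[s] *: (- Aop 1 p.2) + Fop 1 V s).
 by case: (p) => q e; rewrite Fop_cons; exact/esym/addrA.
rewrite bt_lin hp_lin (ipDr (S := XX) (domZ (s := XX) _ (hp_X0 L _)) (hp_X0 L _) Du) (ipZr (S := XX) _ (hp_X0 L _) Du).
rewrite hp_lin (ipDr (S := XX) (domZ (s := XX) _ (hp_X0 L _)) (hp_X0 L _) Du) (ipZr (S := XX) _ (hp_X0 L _) Du).
by rewrite /f; move: (ip _ _ _) (ip _ _ _) (ip _ _ _) => *; ring.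
Qed.

(* The adjoint of the spatial operator is its conjugate by [sg], so that time reversal combined
 with [sg] maps the class of test functions of the forward problem to that of the adjoint one. *)
Definition sg (e : X) : X := (e.1, - e.2).

Lemma sg_lin (k : R) e f : sg (k *: e + f) = k *: sg e + sg f.
Proof. by congr pair; rewrite /= opprD scalerN. Qed.

Lemma sgD e f : sg (e + f) = sg e + sg f.
Proof. by congr pair; rewrite /= opprD. Qed.

Lemma sgZ (k : R) e : sg (k *: e) = k *: sg e.
Proof. by congr pair; rewrite /= scalerN. Qed.

Lemma sgN e : sg (- e) = - sg e. Proof. by []. Qed.

Lemma sgK e : sg (sg e) = e. Proof. by case: e => p q; rewrite /sg /= opprK. Qed.

Lemma ip_sg e f : ip XI (sg e) (sg f) = ip XI e f.
Proof. by rewrite !XipE /= mulrNN. Qed.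

Lemma sg_bc e : bc L e -> bc L (sg e).
Proof. by move=> [e1 e2 e3 e4 e5]; split; rewrite //= hornerN ?e4 ?e5 oppr0. Qed.

Lemma bt_sg e : bt (sg e) = - btr L al e.
Proof. by rewrite /bt /btr /= derivN hornerN; ring. Qed.

Lemma Aop_sg e : Aop 1 (sg e) = - sg (Aop 1 e).
Proof. by congr pair; rewrite /= ?derivN; ring. Qed.

Definition revs (t : R) V : seq ({poly R} * X) :=
 [seq (p.1 \Po (t%:P - 'X), sg p.2) | p <- V].

Lemma ev_revs t V s : ev (revs t V) s = sg (ev V (t - s)).
Proof.
rewrite /ev /revs big_map; elim: V => [|p V IH]; first by rewrite !big_nil; congr pair; rewrite oppr0.
by rewrite !big_cons IH sg_lin /= horner_comp !hornerE.
Qed.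

Lemma all_bc_revs t V : all_bc L V -> all_bc L (revs t V).
Proof. by elim: V => //= p V IH [/sg_bc h /IH]. Qed.

Lemma Fop_revs t V s : Fop 1 (revs t V) s = - sg (Fop 1 V (t - s)).
Proof.
elim: V => [|p V IH].
 rewrite /Fop /ev /= !big_nil; congr pair; rewrite /= !deriv0 !mulr0 !addr0 !oppr0 ?addr0 ?oppr0//.
case: p => q e; have -> : revs t ((q, e) :: V) = (q \Po (t%:P - 'X), sg e) :: revs t V by [].
rewrite !Fop_cons IH Aop_sg opprK deriv_comp derivB derivC derivX sub0r mulrN1 hornerN !horner_comp hornerD hornerN hornerC hornerX.
by move: (Fop 1 V (t - s)) => f; rewrite !sgD !sgZ sgN !opprD scaleNr scalerN opprK.
Qed.

Lemma it_rev_poly (q : {poly R}) (t : R) : 0 <= t ->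
 it 0 t (fun s => q.[t - s]) = it 0 t (horner q).
Proof.
move=> t0; have e : (fun s => q.[t - s]) = horner (q \Po (t%:P - 'X)).
 by apply/funext => s; rewrite horner_comp !hornerE.
rewrite e (it_poly (q := - (primp q \Po (t%:P - 'X))) t0); last first.
 by rewrite derivN deriv_comp derivB derivC derivX sub0r mulrN1 opprK deriv_primp.
rewrite (it_poly (q := primp q) t0) ?deriv_primp//.
by rewrite !hornerN !horner_comp !hornerE subrr subr0; ring.
Qed.

(** Density of the forward data on []0, t[], carried over by [revs]: a dual solution may have any
    terminal value and boundary input up to small errors, with almost no source. *)
Lemma dual_zero t (a : X) (r : {poly R}) : 0 < t -> t <= T ->
 ip XX (u t) (hp (sg a)) + it 0 t (fun s => r.[t - s] * g s) = 0.
Proof.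
move=> tp tT; have t0 := ltW tp; have Dut := cu.1 t t0 tT.
have [K K0 hK] := cX_bounded hT cu.
have Lt : L2 0 t g by exact: L2_sub Lg.
have st0 := sqrtr_ge0 t; have ng := nL_ge0 0 t g.
(* Weights of the errors in the terminal value, the source and the boundary input; the added 1 keeps
   [C] positive. *)
pose C := K + K * Num.sqrt t + nL 0 t g + 1.
have C0 : 0 < C by rewrite /C; have := mulr_ge0 K0 st0; move: (K * _) => *; lra.
apply/eqP; rewrite -normr_eq0 eq_le normr_ge0 andbT; apply/ler_addgt0Pr => e e0; rewrite add0r.
pose del := e / C; have d0 : 0 < del by exact: divr_gt0.
have [U [hU m1 + m3]] := dense_split hL hal a [::] r tp d0.
under [X in X <= _ -> _]it_eq => s _ do rewrite [ev [::] s]big_nil sub0r ipNl// ipNr// opprK.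
move=> m2.
have := duhamel (all_bc_revs t hU) t0 tT; rewrite ev_revs subrr.
pose Wq := Fseq 1 (revs t U).
pose q := r - evl (btr L al) U.
have qE s : q.[s] = r.[s] - btr L al (ev U s) by rewrite /q hornerD hornerN (evlE _ _ (@btr_lin R L al)).
have e1 : it 0 t (fun s => ip XX (u s) (hp (Fop 1 (revs t U) s)) + bt (ev (revs t U) s) * g s) =
  it 0 t (fun s => ip XX (u s) (hp (ev Wq s))) - it 0 t (fun s => r.[t - s] * g s) + it 0 t (fun s => q.[t - s] * g s).
 have L1 (p : {poly R}) : ig 0 t (fun s => p.[t - s] * g s).
  have -> : (fun s => p.[t - s] * g s) = (fun s => (p \Po (t%:P - 'X)).[s] * g s).
   by apply/funext => s; rewrite horner_comp !hornerE.
  by apply: L2_mul => //; exact: L2_poly.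
 rewrite -itB ?L1//; last exact: cX_ig_ev.
 rewrite -itD ?L1//; last by apply: igB => //; exact: cX_ig_ev.
 by apply: it_eq => s _; rewrite -FopE ev_revs bt_sg qE; move: (ip _ _ _) => *; ring.
rewrite e1 => key.
have b1 : `|it 0 t (fun s => ip XX (u s) (hp (ev Wq s)))| <= K * (Num.sqrt t * del).
 have i1 : ig 0 t (fun s => nrm XI (ev Wq s)) by apply: ig_continuous; exact: nrm_ev_continuous.
 have iu := cX_ig_ev Wq cu tT.
 apply: (le_trans (it_abs iu)).
 apply: (@le_trans _ _ (it 0 t (fun s => K * nrm XI (ev Wq s)))).
  apply: it_le; [exact: ig_norm|exact: igZ|].
  apply: aeonW => s /in_oo_le[s0 st].
  have Du := cu.1 s s0 (le_trans st tT).
  have := cauchy_schwarz (S := XX) Du (hp_X0 L (ev Wq s)).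
  rewrite -!/(nX _) nX_hp => h; apply: (le_trans h); apply: ler_wpM2r; first exact: nrm_ge0.
  by apply: hK => //; exact: le_trans st tT.
 rewrite itZ// ler_wpM2l//; apply: (it_nrm_ev_le tp); first exact: ltW.
 apply: le_trans m2.
 pose Q := pip XI (Fseq 1 U) (Fseq 1 U).
 have QE x : Q.[x] = ip XI (Fop 1 U x) (Fop 1 U x) by rewrite /Q (pipE domT) FopE.
 rewrite (it_eq (g := fun s => Q.[t - s])); last first.
  by move=> s _; rewrite QE (_ : ev Wq s = - sg (Fop 1 U (t - s))) ?ipNl// ?ipNr// ?opprK ?ip_sg// -Fop_revs FopE.
 by rewrite it_rev_poly// (it_eq (g := fun s => ip XI (Fop 1 U s) (Fop 1 U s)))// => s _; exact: QE.
have b2 : `|it 0 t (fun s => q.[t - s] * g s)| <= del * nL 0 t g.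
 have -> : it 0 t (fun s => q.[t - s] * g s) = it 0 t (fun s => (q \Po (t%:P - 'X)).[s] * g s).
  by apply: it_eq => s _; rewrite horner_comp !hornerE.
 apply: (le_trans (it_mul_le (L2_poly 0 t _) Lt)); rewrite ler_wpM2r//.
 apply: nL_le; first exact: ltW.
 apply: le_trans m3; rewrite (it_eq (g := fun s => (q * q).[t - s])); last first.
  by move=> s _; rewrite horner_comp !hornerE expr2.
 by rewrite it_rev_poly// (it_eq (g := fun s => (r.[s] - btr L al (ev U s)) ^+ 2))// => s _; rewrite hornerM qE expr2.
have b3 : `|ip XX (u t) (hp (sg (a - ev U 0)))| <= K * del.
 apply: (le_trans (cauchy_schwarz (S := XX) Dut (hp_X0 L _))).
 rewrite -!/(nX _); apply: ler_pM; rewrite ?nX_ge0//; first exact: hK.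
 by rewrite nX_hp /nrm ip_sg.
have e2 : ip XX (u t) (hp (sg a)) = ip XX (u t) (hp (sg (a - ev U 0))) + ip XX (u t) (hp (sg (ev U 0))).
 rewrite -(ipDr (S := XX) (hp_X0 L _) (hp_X0 L _) Dut); congr (ip _ _ _).
 by rewrite -[hp (sg (a - _))]scale1r -hp_lin -sg_lin scale1r subrK.
rewrite e2 key; have -> : e = K * del + K * (Num.sqrt t * del) + del * nL 0 t g + del.
 have h : e = C * del by rewrite /del; field; rewrite gt_eqF.
 by rewrite [LHS]h /C; ring.
move: b1 b2 b3 (ltW d0).
move: (it _ _ _) (it _ _ _) (it _ _ _) (K * _) (K * _) (del * nL _ _ _) (ip _ _ _) => x1 x2 x3 y1 y2 y3 z.
have -> : z + (x3 - x1 + x2) + x1 = z + x3 + x2 by ring.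
move=> h1 h2 h3 h4; apply: (le_trans (ler_normD _ _)).
have := ler_normD z x3; move: h1 h2 h3; move: (`|z + x3|) (`|z|) (`|x3|) (`|x2|) => *; lra.
Qed.

(** Arbitrary terminal values of the dual problem give [u], and arbitrary boundary inputs on the
    whole time interval give [g]. *)
Lemma zero_unique : (forall t, 0 < t -> t <= T -> nX (u t) = 0) /\ aeon 0 T (fun t => g t = 0).
Proof.
split=> [t t0 tT|].
 have Dut := cu.1 t (ltW t0) tT.
 have z a : ip XX (u t) (hp a) = 0.
  have := dual_zero (sg a) 0 t0 tT; rewrite sgK (it_eq (g := fun=> 0)) ?it0 ?addr0// => s _.
  by rewrite horner0 mul0r.
 have n0 := nX_ge0 L (u t); apply/eqP; rewrite -[_ == 0]negbK; apply/negP => n1.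
 have np : 0 < nX (u t) by rewrite lt_def n1.
 have n2 : 0 < nX (u t) / 2 by lra.
 have [a ha] := X0_poly_dense hL Dut n2.
 have := ip_le (S := XX) Dut (X0B Dut (hp_X0 L a)).
 rewrite (ipBr (S := XX) Dut (hp_X0 L a) Dut) z subr0 -sqr_nrm -!/(nX _) expr2 ler_pM2l//.
 by move: ha; move: (nX _) (nX _) np => *; lra.
apply: (poly_orth hT Lg) => p.
have := dual_zero 0 (p \Po (T%:P - 'X)) hT (lexx T).
have -> : sg 0 = 0 by congr pair; rewrite oppr0.
have -> : hp 0 = 0 :> pairs R by congr pair; apply/funext => x /=; rewrite horner0.
rewrite (ip0r (S := XX)) ?add0r; last exact: cu.1.
rewrite L2inner_def => h; rewrite -[RHS]h; apply: it_eq => s _.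
by rewrite horner_comp !hornerE opprB addrC subrK mulrC.
Qed.

End dual.

Lemma aeon_in F G : src L T F G -> aeon 0 T (fun t => in_X0 L (F t, G t)).
Proof. by case. Qed.

Lemma src_sub F G F' G' : src L T F G -> src L T F' G' -> src L T (F - F') (G - G').
Proof.
move=> [D h] [D' h']; split.
 by apply: aeonS2 D D' => t _ D D'; exact: (X0B D D').
move=> e e0; have e2 : 0 < e / 2 by lra.
have [s [M [iM hM le]]] := h _ e2; have [s' [M' [iM' hM' le']]] := h' _ e2.
exists (s ++ negs s'), (fun t => M t + M' t); split; first exact: igD.
 have DD := aeon_and D D'.
 have MM := aeon_and hM hM'.
 apply: aeonS2 DD MM => t _ [D1 D2] [M1 M2].
 have -> : ((F - F') t, (G - G') t) - hp (ev (s ++ negs s') t) =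
  ((F t, G t) - hp (ev s t)) - ((F' t, G' t) - hp (ev s' t)) :> pairs R.
  rewrite ev_diff hpB; have -> : ((F - F') t, (G - G') t) = (F t, G t) - (F' t, G' t) :> pairs R by [].
  by rewrite !opprB addrACA [RHS]addrACA; congr (_ + _); rewrite addrC.
 apply: (le_trans (nrmB (S := XX) (X0B D1 (hp_X0 L _)) (X0B D2 (hp_X0 L _)))).
 exact: lerD.
by rewrite itD//; move: le le'; move: (it _ _ _) (it _ _ _) => *; lra.
Qed.

Lemma wid_sub u F G k u' F' G' k' w w' : cX L T u -> cX L T u' -> src L T F G -> src L T F' G' ->
 L2 0 T k -> L2 0 T k' -> in_X0 L w -> in_X0 L w' ->
 wid L T u F G k w w' -> wid L T u' F' G' k' w w' -> wid L T (u - u') (F - F') (G - G') (k - k') w w'.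
Proof.
move=> cu cu' sF sF' Lk Lk' Dw Dw' W W' t t0 tT.
have SB s v : 0 <= s -> s <= T -> in_X0 L v -> ip XX ((u - u') s) v = ip XX (u s) v - ip XX (u' s) v.
 by move=> s0 sT Dv; exact: (@ipBl _ _ XX _ _ _ (cu.1 s s0 sT) (cu'.1 s s0 sT) Dv).
have [[h ih eh] [h' ih' eh']] := (src_coef sF Dw, src_coef sF' Dw).
have [[i1 _] [i2 _]] := (cX_igL2 cu Dw' tT, cX_igL2 cu' Dw' tT).
have j l k0 z : ig 0 t l -> L2 0 T k0 -> ig 0 T z -> ig 0 t (fun s => l s + k0 s + z s).
 move=> il Lk0 iz; apply: igD; last exact: ig_sub iz.
 by apply: igD => //; apply: L2_ig; exact: L2_sub Lk0.
have red v E H l z : aeon 0 T (fun s => ip XX (E s, H s) w = z s) ->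
  it 0 t (fun s => ip XX (v s) w' + l s + ip XX (E s, H s) w) = it 0 t (fun s => ip XX (v s) w' + l s + z s).
 by move=> ez; apply: it_ae; apply: aeonS (aeon_sub (lexx 0) tT ez) => s _ ->.
rewrite !SB//; have -> : forall x y z r : R, x - y - (z - r) = (x - z) - (y - r) by move=> *; ring.
rewrite (W t t0 tT) (W' t t0 tT) (red u _ _ _ _ eh) (red u' _ _ _ _ eh') -itB; [|exact: j..].
have DF := aeon_sub (lexx 0) tT (aeon_and (aeon_in sF) (aeon_in sF')).
apply: it_ae; apply: aeonS2 DF (aeon_sub (lexx 0) tT (aeon_and eh eh')) => s /in_oo_le[s0 st] [D1 D2] [<- <-].
have -> : ip XX ((F - F') s, (G - G') s) w = ip XX (F s, G s) w - ip XX (F' s, G' s) w.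
 exact: (@ipBl _ _ XX _ _ _ D1 D2 Dw).
rewrite SB//; last exact: le_trans tT.
by rewrite [(k - k') s](_ : _ = k s - k' s)//; move: (ip _ _ _) (ip _ _ _) (ip _ _ _) (ip _ _ _) => *; ring.
Qed.

Lemma weak_sub u F G g b u' F' G' g' b' : cX L T u -> cX L T u' -> src L T F G -> src L T F' G' ->
 L2 0 T g -> L2 0 T g' -> L2 0 T b -> L2 0 T b' ->
 weak_KdV L T u F G g b -> weak_KdV L T u' F' G' g' b' ->
 weak_KdV L T (u - u') (F - F') (G - G') (g - g') (b - b').
Proof.
move=> cu cu' sF sF' Lg Lg' Lb Lb' /weakP[W1 W2] /weakP[W1' W2'].
have Lc (f : R -> R) c : L2 0 T f -> L2 0 T (fun s => f s * c).
 by move=> Lf; have -> : (fun s => f s * c) = c *: f by [apply/funext => s; exact: mulrC]; exact: L2Z.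
have kE (f f' : R -> R) c : (fun s => (f - f') s * c) = (fun s => f s * c) - (fun s => f' s * c).
 by apply/funext => s; exact: mulrBl.
apply/weakP; split => [phi sp p0 pL dp|psi sp p0 pL]; rewrite kE.
 apply: (wid_sub cu cu' sF sF' (Lc _ _ Lb) (Lc _ _ Lb') (X0_inl (L2_continuous 0 L (smooth_cts sp)))
  (X0_inr (L2_continuous 0 L (smooth_D3 sp)))); [exact: W1|exact: W1'].
apply: (wid_sub cu cu' sF sF' (Lc _ _ Lg) (Lc _ _ Lg') (X0_inr (L2_continuous 0 L (smooth_cts sp)))
 (X0_inl (L2_continuous 0 L (smooth_D3 sp)))); [exact: W2|exact: W2'].
Qed.

End Uniqueness.

(** * Estimates for arbitrary weak solutions *)

Section Estimate.
Context {R : realType}.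
Variables (L al T : R).
Hypotheses (hL : 0 < L) (hal : 0 < al) (hT : 0 < T).
Notation XX := (@X0ip R L).
Notation nX := (nX L).
Implicit Types (F G : R -> R -> R) (b g : R -> R).
Let T0 : 0 <= T. Proof. exact: ltW. Qed.

Lemma isH1_congr f v f' : L2 0 L v -> ae_eq_on 0 L f v -> isH1 0 L f f' -> isH1 0 L v f'.
Proof.
move=> Lv e h; have [_ Lf' _] := h.
apply: (isH1_ae (L2_mfn Lv) (L2_mfn Lf') e _ h).
by apply: aeonW.
Qed.

Lemma H1_congr f v : L2 0 L v -> ae_eq_on 0 L f v -> H1 0 L f ->
 H1 0 L v /\ nL 0 L (wderiv 0 L v) = nL 0 L (wderiv 0 L f).
Proof.
move=> Lv e Hf; have h := isH1_congr Lv e (wderivP Hf).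
have Hv : H1 0 L v by apply/H1P; exists (wderiv 0 L f).
split; first exact: Hv.
apply: nL_ae; exact: isH1_uniq hL (wderivP Hv) h.
Qed.

Lemma nX_pair_eq (v w : pairs R) : nL 0 L v.1 = nL 0 L w.1 -> nL 0 L v.2 = nL 0 L w.2 -> nX v = nX w.
Proof. by move=> e1 e2; apply/eqP; rewrite -(@eqrXn2 _ 2) ?nX_ge0// !sqr_nX e1 e2. Qed.

Lemma pairH1_congr v w : in_X0 L w -> X0_eq L v w -> H1 0 L v.1 /\ H1 0 L v.2 ->
 (H1 0 L w.1 /\ H1 0 L w.2) /\ nX (pair_wderiv L w) = nX (pair_wderiv L v).
Proof.
move=> [L1 L2'] [e1 e2] [h1 h2].
have [k1 n1] := H1_congr L1 e1 h1; have [k2 n2] := H1_congr L2' e2 h2.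
by split; [split; [exact: k1|exact: k2]|exact: (@nX_pair_eq (pair_wderiv L w) (pair_wderiv L v) n1 n2)].
Qed.

Lemma nX_congr v w : X0_eq L v w -> nX v = nX w.
Proof. by move=> [e1 e2]; apply: nX_pair_eq; exact: nL_ae. Qed.

Lemma cX_sub u v : cX L T u -> cX L T v -> cX L T (u - v).
Proof.
move=> cu cv; split=> [t t0 tT|t e t0 tT e0]; first exact: (X0B (cu.1 t t0 tT) (cv.1 t t0 tT)).
have e2 : 0 < e / 2 by lra.
have [d1 d10 h1] := cu.2 t _ t0 tT e2; have [d2 d20 h2] := cv.2 t _ t0 tT e2.
exists (Num.min d1 d2); first by rewrite lt_min d10.
move=> s s0 sT; rewrite lt_min => /andP[sd1 sd2].
have -> : (u - v) s - (u - v) t = (u s - u t) - (v s - v t) :> pairs R.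
 have -> : (u - v) s - (u - v) t = (u s - v s) - (u t - v t) :> pairs R by [].
 by rewrite !opprB addrACA [RHS]addrACA; congr (_ + _); rewrite addrC.
have Dd w : cX L T w -> in_X0 L (w s - w t) by move=> cw; exact: (X0B (cw.1 s s0 sT) (cw.1 t t0 tT)).
apply: (le_trans (nrmB (S := XX) (Dd u cu) (Dd v cv))); rewrite -!/(nX _).
have -> : e = e / 2 + e / 2 by field.
exact: lerD (h1 s s0 sT sd1) (h2 s s0 sT sd2).
Qed.

(** The bounds of [lin_exists] hold for every weak solution: its difference from the constructed one
    has zero data and source, and vanishes by duality. *)
Lemma lin_estimates : exists2 C : R, 0 <= C & forall u F G g b, cX L T u -> src L T F G ->
 L2 0 T g -> L2 0 T b -> weak_KdV L T u F G g (fun t => - al * g t + b t) ->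
 exists N, [/\ aeon 0 T (fun t => H1 0 L (u t).1 /\ H1 0 L (u t).2),
   mfn 0 T N /\ aeon 0 T (fun t => nX (pair_wderiv L (u t)) = N t),
   (forall m, ig 0 T m -> aeon 0 T (fun t => nX (F t, G t) <= m t) ->
    let D := nX (u 0) ^+ 2 + it 0 T m ^+ 2 + nL 0 T b ^+ 2 in
    [/\ forall t, 0 <= t -> t <= T -> nX (u t) ^+ 2 <= C * D, nL 0 T g ^+ 2 <= C * D,
     ig 0 T (fun t => N t ^+ 2) & it 0 T (fun t => N t ^+ 2) <= C * D]) &
   (nX (u 0) = 0 -> aeon 0 T (fun t => nX (F t, G t) = 0) -> al * nL 0 T g <= nL 0 T b)].
Proof.
have [C C0 hC] := lin_exists hL hal hT; exists C => // u F G g b cu sF Lg Lb W.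
have Du0 : in_X0 L (u 0) by apply: cu.1.
have [v [ga [N [cv v0 Lga Wv [hH1 [mN hN] hbd htr]]]]] := hC (u 0) F G b Du0 sF Lb.
have Lgb (k : R) f h : L2 0 T f -> L2 0 T h -> L2 0 T (fun t => k * f t + h t).
 by move=> Lf Lh; exact: (L2D (L2Z k Lf) Lh).
have Ws := weak_sub hT cu cv sF sF Lg Lga (Lgb (- al) _ _ Lg Lb) (Lgb (- al) _ _ Lga Lb) W Wv.
have cs := cX_sub cu cv.
have sF0 : aeon 0 T (fun t => in_X0 L ((F - F) t, (G - G) t) /\ nX ((F - F) t, (G - G) t) = 0).
 apply: aeonW => t _; have -> : ((F - F) t, (G - G) t) = 0 :> pairs R by rewrite !subrr.
 by split; [exact: (dom0 XX)|exact: (nrm0 XX)].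
have s0 : nX ((u - v) 0) = 0.
 have Dv0 : in_X0 L (v 0) by apply: cv.1.
 have := X0_eq_nX v0; rewrite (nX_distC Dv0 Du0); exact.
have bg : aeon 0 T (fun t => ((fun t => - al * g t + b t) - (fun t => - al * ga t + b t)) t = - al * (g - ga) t).
 apply: aeonW => t _; rewrite [LHS](_ : _ = (- al * g t + b t) - (- al * ga t + b t))//.
 by rewrite [(g - ga) t](_ : _ = g t - ga t)//; ring.
have Lgs : L2 0 T (g - ga) by exact: (L2B Lg Lga).
have Wf := weak_wform hT cs Lgs s0 sF0 bg Ws.
have [z1 z2] := zero_unique hL hal hT cs Lgs Wf.
have eqX t : 0 <= t -> t <= T -> X0_eq L (v t) (u t).
 move=> t0 tT; have Du := cu.1 t t0 tT; have Dv := cv.1 t t0 tT.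
 apply: nX0_eq => //; rewrite (nX_distC Dv Du) -/(nX _).
 have [tp|] := ltP 0 t; first by have := z1 t tp tT => ->.
 move=> tn; have -> : t = 0 by apply/eqP; rewrite eq_le tn t0.
 by rewrite -[u 0 - v 0]/((u - v) 0) s0.
have eqg : aeon 0 T (fun t => g t = ga t).
 by apply: aeonS z2 => t _ /eqP; rewrite [(g - ga) t](_ : _ = g t - ga t)// subr_eq0 => /eqP.
have tr : aeon 0 T (fun t => (H1 0 L (u t).1 /\ H1 0 L (u t).2) /\ nX (pair_wderiv L (u t)) = nX (pair_wderiv L (v t))).
 apply: aeonS hH1 => t /in_oo_le[t0 tT] h.
 by apply: pairH1_congr => //; [exact: cu.1|exact: eqX].
exists N; split.
- by apply: aeonS tr => t _ [].
- split; first exact: mN.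
 apply: aeonS2 tr hN => t _ [_ e1] e2; exact: etrans e1 e2.
- move=> m im hm D; have [b1 b2 b3 b4] := hbd m im hm; split => //.
  by move=> t t0 tT; rewrite -(nX_congr (eqX t t0 tT)); exact: b1.
 by rewrite (nL_ae eqg).
- by move=> h1 h2; rewrite (nL_ae eqg); exact: htr.
Qed.

End Estimate.

(** * Change of variables along the delay *)

Section Substitution.
Context {R : realType}.
Notation mu := (@lebesgue_measure R).
Implicit Types (f y : R -> R).

Lemma null_cover (A : set (measurableTypeR R)) (e : R) : measurable A -> mu A = 0%E -> 0 < e ->
 exists M : nat -> R * R, [/\ A `<=` \bigcup_n `](M n).1, (M n).2]%classic,
  forall n, (M n).1 <= (M n).2 &
  (\sum_(n <oo) ((M n).2 - (M n).1)%:E <= e%:E)%E].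
Proof.
move=> mA A0 e0.
have /ereal_inf_lt[z [/= M' [hM AM] sMz zDe]] : (mu A < e%:E)%E by rewrite A0 lte_fin.
have ex n : exists x : R * R, x.1 <= x.2 /\ M' n = `]x.1, x.2]%classic.
 have /ocitvP[-> |[[a b] /= ab ->]] : ocitv (M' n) by exact: hM.
  by exists (0, 0); split => //=; rewrite set_itv_ge// bnd_simp ltxx.
 by exists (a, b); split => //=; exact: ltW.
have /choice[M hM'] := ex; exists M; split.
- by move=> x /AM[n _ h]; exists n => //; have [_ <-] := hM' n.
- by move=> n; have [] := hM' n.
- apply: ltW; apply: le_lt_trans zDe; rewrite -sMz; apply: lee_nneseries => i _.
  by rewrite lee_fin subr_ge0; have [] := hM' i.
 by have [h ->] := hM' i; rewrite (@wlength_itv_bnd _ idfun).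
Qed.

(* Covering by intervals replaces a change of variables for Borel sets. *)
Lemma null_preimage (D : set R) y (c : R) (N : set (measurableTypeR R)) : 0 < c ->
 (forall s t, D s -> D t -> c * `|t - s| <= `|y t - y s|) ->
 mu.-negligible N -> mu.-negligible ((D `&` y @^-1` N) : set (measurableTypeR R)).
Proof.
move=> c0 hy [A [mA A0 NA]].
have cov (e : R) : 0 < e -> exists B : set (measurableTypeR R),
  [/\ measurable B, (mu B <= e%:E)%E & D `&` y @^-1` N `<=` B].
 move=> e0; have d0 : 0 < e * c / 2 by rewrite divr_gt0// mulr_gt0.
 have [M [AM M12 sM]] := null_cover mA A0 d0.
 pose S n := [set x | D x /\ y x \in `](M n).1, (M n).2]].
 (* Any point of the n-th preimage piece: expansion by the factor [c] confines the piece to the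
    interval of radius [l n] around it. *)
 have /choice[p hp] n : exists p, S n !=set0 -> S n p.
  have [[p Sp]|h] := pselect (S n !=set0); first by exists p.
  by exists 0 => /h.
 pose l n := ((M n).2 - (M n).1) / c.
 have l0 n : 0 <= l n by rewrite divr_ge0 ?subr_ge0 ?(ltW c0).
 pose J n : set (measurableTypeR R) := `[p n - l n, p n + l n]%classic.
 exists (\bigcup_n J n); split.
 - by apply: bigcupT_measurable => n; exact: measurable_itv.
 - apply: (@le_trans _ _ (\sum_(n <oo) mu (J n))%E).
   apply: measure_sigma_subadditive => //; first by move=> n; exact: measurable_itv.
   by apply: bigcupT_measurable => n; exact: measurable_itv.
  apply: (@le_trans _ _ (\sum_(n <oo) ((2 / c)%:E * ((M n).2 - (M n).1)%:E))%E).
   apply: lee_nneseries => // n _; rewrite lebesgue_measure_itv /= lte_fin.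
   have e2 : p n + l n - (p n - l n) = 2 / c * ((M n).2 - (M n).1) by rewrite /l; field; rewrite gt_eqF.
   case: ifPn => _; first by rewrite -EFinB e2.
   by rewrite lee_fin mulr_ge0 ?subr_ge0// divr_ge0// ltW.
  rewrite nneseriesZl; last by move=> n _; rewrite lee_fin subr_ge0.
  have -> : e%:E = ((2 / c)%:E * (e * c / 2)%:E)%E by rewrite -EFinM; congr EFin; field; rewrite gt_eqF.
  by rewrite lee_wpmul2l// lee_fin divr_ge0// ltW.
 - move=> x [Dx /NA/AM[n _ hn]]; exists n => //.
  have Sx : S n x by split => //; move: hn; rewrite /= in_itv.
  have [Dp yp] : S n (p n) by apply: hp; exists x.
  have xp : `|x - p n| <= l n.
   rewrite /l ler_pdivlMr// mulrC; apply: (le_trans (hy _ _ Dp Dx)).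
   have [_ yx] := Sx; move: yp yx; rewrite !in_itv/= => /andP[a1 a2] /andP[a3 a4].
   by rewrite ler_norml; apply/andP; split; lra.
  by rewrite /J /= in_itv/=; move: xp; rewrite ler_norml => /andP[? ?]; apply/andP; split; lra.
have /choice[B hB] n : exists B : set (measurableTypeR R),
  [/\ measurable B, (mu B <= (n.+1%:R^-1)%:E)%E & D `&` y @^-1` N `<=` B].
 by apply: cov; rewrite invr_gt0.
exists (\bigcap_n B n); split.
- by apply: bigcapT_measurable => n; have [] := hB n.
- apply/eqP; rewrite eq_le measure_ge0 andbT; apply/lee_addgt0Pr => e e0; rewrite add0e.
 have [n hn] := null_harmonic e0.
 have [mB lB _] := hB n; apply: (@le_trans _ _ (mu (B n))).
  apply: le_measure; rewrite ?inE//.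
   by apply: bigcapT_measurable => k; have [] := hB k.
  by move=> x; apply.
 by apply: (le_trans lB); rewrite lee_fin; exact: hn.
- by move=> x h n _; have [_ _] := hB n; exact.
Qed.

Section cmp.
Variables (a b c l T : R) (y : R -> R).
Hypotheses (ab : a < b) (c0 : 0 < c) (cy : continuous y) (hin : forall t, t \in `]l, T[ -> y t \in `]a, b[).
Hypothesis hexp : forall s t, `]l, T[%classic s -> `]l, T[%classic t -> c * `|t - s| <= `|y t - y s|.
Hypotheses (hpoly : forall p : {poly R}, it l T (fun t => p.[y t] ^+ 2) <= c^-1 * it a b (fun x => p.[x] ^+ 2)).

Lemma cmp_ae (P : R -> Prop) : aeon a b P -> aeon l T (fun t => P (y t)).
Proof.
move=> h; have := @null_preimage `]l, T[%classic y c _ c0 _ h.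
rewrite /aeon /almost_everywhere => H.
apply: negligibleS (H hexp).
move=> t /= nh; split.
 by apply: contrapT => tn; apply: nh => tI; rewrite tI in tn.
by move=> hyt; apply: nh => tI; apply: hyt; exact: hin.
Qed.

Lemma cmp_mfn f : L2 a b f -> mfn l T (f \o y).
Proof.
move=> /L2P[mf _]; have /mfn_restrict mf' := mf.
have my : measurable_fun setT y by exact: continuous_measurable_fun.
have h : mfn l T ((f \_ `]a, b[) \o y).
 apply: (@measurable_funS _ _ _ _ setT) => //.
 exact: measurableT_comp.
apply: eq_measurable_fun h => t; rewrite inE/= => tI.
by rewrite /= patchE mem_set//=; exact: hin.
Qed.

(** The substitution inequality is known for polynomials, where it is calculus. Fatou extends it
    along polynomials converging almost everywhere, the exceptional set being pulled back by
    [cmp_ae]. *)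
Lemma cmp_L2 f : L2 a b f -> L2 l T (f \o y) /\ nL l T (f \o y) ^+ 2 <= c^-1 * nL a b f ^+ 2.
Proof.
move=> Lf; have mfy := cmp_mfn Lf.
have e0 n : 0 < (2^-1 : R) ^+ n by rewrite exprn_gt0.
have /choice[p hp] n := poly_dense ab Lf (e0 n).
have c1 : 0 <= c^-1 by rewrite invr_ge0 ltW.
have Lp n : L2 a b (f - horner (p n)) by apply: (L2B) => //; exact: L2_poly.
have cv : aeon a b (fun x => (fun n => (p n).[x]) @ \oo --> f x).
 have : aeon a b (fun x => exists K : R, forall n, (f x - (p n).[x]) ^+ 2 <= K * 2^-1 ^+ n).
  apply: (@ae_geometric_decay _ _ _ _ 1) => //.
  - by move=> n; exact: (L2_igsqr (Lp n)).
  - by move=> n x; exact: sqr_ge0.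
  - move=> n; rewrite mul1r -[X in X <= _]/(it a b (fun x => (f - horner (p n)) x ^+ 2)) -sqr_nL.
   apply: (@le_trans _ _ ((2^-1 ^+ n) ^+ 2)); first by rewrite ler_sqr ?nnegrE ?nL_ge0 ?hp// ltW.
   by rewrite -exprM mulnC exprM expr2 -invfM -natrM.
 apply: aeonS => x _ [K hK]; apply/cvgrPdist_le => e ep.
 have e2 : 0 < e ^+ 2 by rewrite exprn_gt0.
 have [n0 hn0] := null_half K e2.
 exists n0 => // n /= /hn0 h; rewrite -ler_sqr ?nnegrE ?(ltW ep)// real_normK ?num_real//.
 exact: le_trans (hK n) h.
have cv' := cmp_ae cv.
have i1 n : ig l T (fun t => (p n).[y t] ^+ 2).
 by apply: ig_cSqr => t; apply: continuous_comp; [exact: cy|exact: continuous_horner].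
have := @it_fatou _ l T (fun n t => (p n).[y t] ^+ 2) (fun t => (f \o y) t ^+ 2) (c^-1 * nL a b f ^+ 2) i1.
case.
- by move=> n t; exact: sqr_ge0.
- exact: measurable_funX.
- apply: aeonS cv' => t _ h.
 exact: cvg_sqr.
- move=> e ep; have k0 : 0 <= c^-1 * (2 * nL a b f + 1).
  by rewrite mulr_ge0// addr_ge0// mulr_ge0// nL_ge0.
 have [N hN] := null_half (c^-1 * (2 * nL a b f + 1)) ep.
 exists N => n /hN h; apply: (le_trans (hpoly _)).
 have d0 := ltW (e0 n); have d1 : (2^-1 : R) ^+ n <= 1 by rewrite exprn_ile1//; lra.
 have np : nL a b (horner (p n)) <= nL a b f + 2^-1 ^+ n.
  have /dist_le[_ h'] := le_trans (nrm_dist (S := L2ip a b) Lf (L2_poly a b (p n))) (hp n).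
  exact: h'.
 rewrite -sqr_nL; apply: (@le_trans _ _ (c^-1 * (nL a b f ^+ 2 + (2 * nL a b f + 1) * 2^-1 ^+ n))).
  rewrite ler_wpM2l//; apply: (@le_trans _ _ ((nL a b f + 2^-1 ^+ n) ^+ 2)).
   by rewrite ler_sqr ?nnegrE ?nL_ge0// addr_ge0// nL_ge0.
  rewrite sqrrD -addrA lerD2l mulrDl mul1r -mulrA -mulr_natl lerD2l expr2.
  by rewrite ler_piMr.
 by rewrite mulrDr lerD2l mulrA.
move=> i2 le; split; first by apply/L2P.
by rewrite sqr_nL.
Qed.

End cmp.

Section comp.
Variables (a b c T : R) (y y' : R -> R).
Hypotheses (c0 : 0 < c) (T0 : 0 < T) (cy : continuous y) (cy' : continuous y').
Hypotheses (dy : forall t, t \in `]0, T[ -> is_derive t 1 y (y' t)) (y'c : forall t, t \in `]0, T[ -> c <= y' t).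
Hypotheses (ay : a <= y 0) (yb : y T <= b).

Lemma comp_grow s t : 0 <= s -> s <= t -> t <= T -> c * (t - s) <= y t - y s.
Proof.
move=> s0 st tT; rewrite -(it_cst c st).
have <- : it s t y' = y t - y s.
 have d x : x \in `]s, t[ -> is_derive x 1 y (y' x).
  move=> /in_oo[sx xt]; apply: dy; rewrite in_itv/=.
  by apply/andP; split; [exact: le_lt_trans sx|exact: lt_le_trans tT].
 exact: (FTC_itv st cy' cy d).
apply: it_le; [exact: ig_cst|exact: ig_continuous|].
apply: aeonW => x /in_oo[sx xt]; apply: y'c; rewrite in_itv/=.
by apply/andP; split; [exact: le_lt_trans sx|exact: lt_le_trans tT].
Qed.

Lemma comp_lt s t : 0 <= s -> s < t -> t <= T -> y s < y t.
Proof.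
move=> s0 st tT; have := comp_grow s0 (ltW st) tT.
have : 0 < c * (t - s) by rewrite mulr_gt0// subr_gt0.
lra.
Qed.

Lemma comp_in t : t \in `]0, T[ -> y t \in `]a, b[.
Proof.
rewrite !in_itv/= => /andP[t0 tT]; apply/andP; split.
 exact: le_lt_trans ay (comp_lt (lexx 0) t0 (ltW tT)).
exact: lt_le_trans (comp_lt (ltW t0) tT (lexx T)) yb.
Qed.

Lemma comp_exp s t : `]0, T[%classic s -> `]0, T[%classic t -> c * `|t - s| <= `|y t - y s|.
Proof.
rewrite /= !in_itv/= => /andP[s0 sT] /andP[t0 tT].
have [st|/ltW ts] := leP s t.
 have g := comp_grow (ltW s0) st (ltW tT).
 by rewrite (ger0_norm (_ : 0 <= t - s)) ?subr_ge0// (le_trans g)// ler_norm.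
have g := comp_grow (ltW t0) ts (ltW sT).
by rewrite distrC (distrC (y t)) (ger0_norm (_ : 0 <= s - t)) ?subr_ge0// (le_trans g)// ler_norm.
Qed.

(** Insert the factor [y'], which is at least [c], substitute by the fundamental theorem, and
    enlarge the range of [y] to []a, b[]. *)
Lemma comp_poly (p : {poly R}) : it 0 T (fun t => p.[y t] ^+ 2) <= c^-1 * it a b (fun x => p.[x] ^+ 2).
Proof.
have cpy (q : {poly R}) : continuous (fun t => q.[y t]).
 by move=> t; apply: continuous_comp; [exact: cy|exact: continuous_horner].
pose Q := primp (p * p).
have yy : y 0 <= y T by apply: ltW; apply: comp_lt.
have e1 : it (y 0) (y T) (fun x => p.[x] ^+ 2) = Q.[y T] - Q.[y 0].
 rewrite -(it_poly yy (deriv_primp (p * p))); apply: it_eq => x _; by rewrite hornerM expr2.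
have e2 : it 0 T (fun t => (p * p).[y t] * y' t) = Q.[y T] - Q.[y 0].
 have T0' := ltW T0.
 have c1 : continuous (fun t => (p * p).[y t] * y' t) by move=> t; apply: cvgM; [exact: cpy|exact: cy'].
 apply: (FTC_itv T0' c1 (cpy Q)) => t tI.
 have h1 := dy tI; have h2 := is_derive_poly Q (y t).
 have h3 := @is_derive1_comp R (horner Q) y t _ _ h2 h1.
 by apply: (is_derive_eq h3); rewrite deriv_primp.
have -> : it 0 T (fun t => p.[y t] ^+ 2) = c^-1 * it 0 T (fun t => c * p.[y t] ^+ 2).
 rewrite itZ; first by rewrite mulrA mulVf ?mul1r// gt_eqF.
 by apply: ig_cSqr.
rewrite ler_pM2l ?invr_gt0//; apply: (@le_trans _ _ (Q.[y T] - Q.[y 0])).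
 rewrite -e2; apply: it_le; first by apply: igZ; exact: ig_cSqr.
  exact: ig_cMul.
 by apply: aeonW => t tI; rewrite hornerM -expr2 mulrC ler_wpM2l ?sqr_ge0// y'c.
rewrite -e1; apply: it_sub_le => //.
 by apply: ig_cSqr; exact: continuous_horner.
by apply: aeonW => x _; exact: sqr_ge0.
Qed.

Let ab : a < b.
Proof. exact: lt_le_trans (le_lt_trans ay (comp_lt (lexx 0) T0 (lexx T))) yb. Qed.

Lemma comp_L2 f : L2 a b f -> L2 0 T (f \o y) /\ nL 0 T (f \o y) ^+ 2 <= c^-1 * nL a b f ^+ 2.
Proof. exact: cmp_L2 ab c0 cy comp_in comp_exp comp_poly f. Qed.

End comp.

Section affine_decreasing.
Variables (a b t r l m : R).
Hypotheses (r0 : 0 < r) (lm : l < m) (tb : t - r * l <= b) (ta : a <= t - r * m).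
Let rlm : r * l < r * m. Proof. by rewrite ltr_pM2l. Qed.
Let ab : a < b.
Proof. move: rlm tb ta; move: (r * l) (r * m) => *; lra. Qed.
Let le_tr : t - r * m <= t - r * l. Proof. by rewrite lerD2l lerN2 ltW. Qed.

Let y (x : R) := t - r * x.

Let cy : continuous y.
Proof. by move=> x; apply: cvgB; [exact: cvg_cst|apply: cvgMr; exact: cvg_id]. Qed.

Let yin x : x \in `]l, m[ -> y x \in `]a, b[.
Proof.
rewrite !in_itv/= /y => /andP[x0 x1]; apply/andP; split.
 by apply: (le_lt_trans ta); rewrite ltrD2l ltrN2 ltr_pM2l.
by apply: lt_le_trans tb; rewrite ltrD2l ltrN2 ltr_pM2l.
Qed.

Let yexp s x : `]l, m[%classic s -> `]l, m[%classic x -> r * `|x - s| <= `|y x - y s|.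
Proof.
move=> _ _; have -> : y x - y s = r * (s - x) by rewrite /y; ring.
by rewrite normrM (gtr0_norm r0) distrC.
Qed.

Let ypoly (p : {poly R}) : it l m (fun x => p.[y x] ^+ 2) <= r^-1 * it a b (fun x => p.[x] ^+ 2).
Proof.
pose Q := primp (p * p).
have e : (fun x => p.[y x] ^+ 2) = horner ((p * p) \Po (t%:P - r *: 'X)).
 by apply/funext => x; rewrite horner_comp !hornerE expr2.
have e2 : it (t - r * m) (t - r * l) (fun x => p.[x] ^+ 2) = Q.[t - r * l] - Q.[t - r * m].
 by rewrite -(it_poly le_tr (deriv_primp (p * p))); apply: it_eq => x _; rewrite hornerM expr2.
have -> : it l m (fun x => p.[y x] ^+ 2) = r^-1 * it (t - r * m) (t - r * l) (fun x => p.[x] ^+ 2).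
 rewrite e (it_poly (q := - (r^-1 *: (Q \Po (t%:P - r *: 'X)))) (ltW lm)).
  rewrite e2 !hornerN !hornerZ !horner_comp !hornerD !hornerN !hornerZ hornerC hornerX hornerC hornerX.
  ring.
 rewrite derivN derivZ deriv_comp deriv_primp derivB derivC derivZ derivX sub0r mulrN scalerN opprK.
 by rewrite -scalerAr scalerA mulVf ?scale1r ?mulr1// gt_eqF.
rewrite ler_wpM2l ?invr_ge0 ?(ltW r0)//; apply: it_sub_le => //.
 by apply: ig_cSqr; exact: continuous_horner.
by apply: aeonW => x _; exact: sqr_ge0.
Qed.

Lemma affine_ae (P : R -> Prop) : aeon a b P -> aeon l m (fun x => P (t - r * x)).
Proof. exact: cmp_ae r0 yin yexp P. Qed.

Lemma affine_L2 f : L2 a b f ->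
 L2 l m (fun x => f (t - r * x)) /\ nL l m (fun x => f (t - r * x)) ^+ 2 <= r^-1 * nL a b f ^+ 2.
Proof. exact: cmp_L2 ab r0 cy yin yexp ypoly f. Qed.

End affine_decreasing.
End Substitution.

(** * Regularity of the delay *)

Section DelayC1.
Context {R : realType}.
Notation mu := (@lebesgue_measure R).
Implicit Types (f y : R -> R).

Lemma Linfty_L2 a b f : Linfty a b f -> L2 a b f.
Proof.
move=> /[dup] Lf; rewrite /Linfty inE => /andP[]; rewrite !inE/= => mf nf.
have mf' : mfn a b f by apply/mfn_restrict.
have muT : (0 < mu setT)%E.
 apply: (@lt_le_trans _ _ (mu `]0, 1[%classic)).
  by rewrite lebesgue_measure_itv/= lte_fin ltr01 oppr0 adde0 lte_fin.
 by apply: le_measure; rewrite ?inE//; exact: measurable_itv.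
have := nf; rewrite /finite_norm unlock muT => h.
have [K hK] := @ess_sup_inf.ess_supr_bounded _ _ _ mu (fun x => `|(f \_ `]a, b[) x|) h.
apply: (@L2_bounded _ _ _ _ K) => //; apply: (filterS _ hK) => x hx xI.
by move: hx; rewrite patchE mem_set.
Qed.

(** The primitive of the absolute difference is zero, and so is its derivative inside the interval;
    the end points follow by continuity. *)
Lemma ae_eq_cont a b f g : a < b -> continuous f -> continuous g ->
 aeon a b (fun x => f x = g x) -> forall x, a <= x -> x <= b -> f x = g x.
Proof.
move=> ab cf cg h.
pose psi x := `|f x - g x|.
have cpsi : continuous psi.
 move=> x; apply: (@continuous_comp _ _ _ (fun x => f x - g x) (@Num.norm _ R)); last exact: norm_continuous.
 by apply: cvgB; [exact: cf|exact: cg].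
have inner x : a < x -> x < b -> psi x = 0.
 move=> ax xb; have d1 := it_is_derive cpsi ax.
 have z w : w < b -> it a w psi = 0.
  move=> yb; rewrite -(it0 a w); apply: it_ae.
  by apply: aeonS (aeon_sub (lexx a) (ltW yb) h) => s _ e; rewrite /psi e subrr normr0.
 have d2 : is_derive x 1 (fun w : R => it a w psi) 0.
  have d3 := is_derive_cst (0 : R) x (1 : R).
  apply: (near_eq_is_derive _ d3).
  near=> w; rewrite [LHS]/=; apply/esym/z; near: w; exact: lt_nbhsl.
 have [_ e1] := d1; have [_ e2] := d2; by rewrite -e1 e2.
have key x : a <= x -> x <= b -> psi x = 0.
 move=> ax xb; have [ltxb|bx] := ltP x b.
  have l1 := cvg_at_right_filter (cpsi x); apply: (cvg_unique _ l1); first exact: norm_hausdorff.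
  apply: cvg_near_cst; near=> y; apply: inner; last by near: y; exact: nbhs_right_lt.
  by apply: (le_lt_trans ax); near: y; exact: nbhs_right_gt.
 have l1 := cvg_at_left_filter (cpsi x); apply: (cvg_unique _ l1); first exact: norm_hausdorff.
 apply: cvg_near_cst; near=> y; apply: inner; first by near: y; apply: nbhs_left_gt; exact: lt_le_trans bx.
 by apply: lt_le_trans xb; near: y; exact: nbhs_left_lt.
by move=> x ax xb; have /normr0_eq0/eqP := key x ax xb; rewrite subr_eq0 => /eqP.
Unshelve. all: by end_near.
Qed.

(** [q] is the absolutely continuous representative of the first weak derivative. [tau] equals its
    primitive up to a constant, almost everywhere and then everywhere by continuity. *)
Lemma W2infty_C1 (T : R) tau : 0 < T -> W2infty T tau ->
 exists q : R -> R, [/\ continuous q,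
  forall t, 0 <= t -> t <= T -> tau t = tau 0 + it 0 t q &
  forall t, t \in `]0, T[ -> is_derive t 1 tau (q t)].
Proof.
move=> T0 [ct [f1 [f2 [/Linfty_L2 L1 /Linfty_L2 L2' w1 w2]]]].
have T0' := ltW T0.
have h1 : isH1 0 T tau f1 by split => //; exact: L2_cont.
have h2 : isH1 0 T f1 f2 by split.
have [k hk] := isH1_repr T0 h1; have [k1 hk1] := isH1_repr T0 h2.
pose q t := k1 + it 0 (clamp 0 T t) f2.
have cq : continuous q by move=> t; apply: cvgD; [exact: cvg_cst|exact: (prim_continuous T0' L2')].
have eq1 : aeon 0 T (fun t => f1 t = q t) by apply: aeonS hk1 => t /in_oo_le[t0 tT] ->; rewrite /q clamp_id.
have Lq := L2_continuous 0 T cq.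
have cF : continuous (fun t => k + it 0 (clamp 0 T t) q).
 by move=> t; apply: cvgD; [exact: cvg_cst|exact: (prim_continuous T0' Lq)].
have ctc : continuous (fun t => tau (clamp 0 T t)).
 move=> t; apply/cvgrPdist_le => e e0.
 have [c1 c2] := clamp_itv t T0'.
 have cI : clamp 0 T t \in `[0, T] by rewrite in_itv/= c1.
 move: ct => /subspace_continuousP/(_ _ cI)/cvgrPdist_le/(_ e e0) [d /= d0 hd].
 exists d => // s /= sd; have [s1 s2] := clamp_itv s T0'; apply: hd => /=.
  exact: le_lt_trans (clamp_lip _ _ _ _) sd.
 by rewrite in_itv/= s1.
have E t : 0 <= t -> t <= T -> tau t = k + it 0 t q.
 move=> t0 tT; have := @ae_eq_cont _ _ _ _ T0 ctc cF _ t t0 tT; rewrite !clamp_id//; apply.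
 apply: aeonS hk => s /in_oo_le[s0 sT] hs; rewrite clamp_id// hs; congr (_ + _).
 by apply: it_ae; exact: aeon_sub (lexx 0) sT eq1.
have k0 : k = tau 0 by rewrite (E 0)// it_deg// addr0.
exists q; split => //; first by rewrite -k0.
move=> t /in_oo[t0 tT].
have d1 := it_is_derive cq t0.
have d2 : is_derive t 1 (fun w : R => k + it 0 w q) (q t).
 by apply: (is_derive_eq (is_deriveD (is_derive_cst k t 1) d1)); rewrite add0r.
apply: (near_eq_is_derive _ d2).
near=> s; apply/esym/E.
 by apply: ltW; near: s; exact: lt_nbhsr.
by apply: ltW; near: s; exact: lt_nbhsl.
Unshelve. all: by end_near.
Qed.

End DelayC1.

(** * The transport equation *)

Section L2curves.
Context {R : realType}.

Lemma L2_eq a b (f g : R -> R) : {in `]a, b[, f =1 g} -> L2 a b f -> L2 a b g.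
Proof.
move=> e /L2P[m i]; apply/L2P; split.
 by apply: eq_measurable_fun m => s; rewrite inE/= => /e.
by apply: ig_eq i => s /e ->.
Qed.

Lemma nL_eq a b (f g : R -> R) : {in `]a, b[, f =1 g} -> nL a b f = nL a b g.
Proof. by move=> e; apply: nL_ae; exact: aeonW. Qed.

Definition cL a b T (z : R -> R -> R) : Prop := icts (L2ip a b) T z.

Lemma C_L2P a b T z : C_L2 a b T z <-> cL a b T z.
Proof. exact: (ictsP (S := L2ip a b) T z (@L2norm_nL R a b)). Qed.

Lemma cL_inner_L2 a b T z (w : R -> R) t : 0 <= T -> t <= T -> cL a b T z -> L2 a b w ->
 L2 0 t (fun s => L2inner a b (z s) w).
Proof.
move=> T0 tT cz Lw; apply: L2_eq (L2_continuous 0 t (icts_ip T0 cz Lw)) => s.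
by move=> /in_oo_le[s0 st]; rewrite clamp_id// (le_trans st).
Qed.

Lemma idmul_L2 (w : R -> R) : L2 0 1 w -> L2 0 1 (fun rho => rho * w rho).
Proof.
move=> Lw; have ci : continuous (fun x : R => x) by move=> x; exact: cvg_id.
by apply: L2_eq (L2_mulC ci Lw) => x _; rewrite mulrC.
Qed.

Lemma inner_flux (z w : R -> R) (k : R) : L2 0 1 z -> L2 0 1 w ->
 L2inner 0 1 (fun rho => (1 - k * rho) * z rho) w =
 L2inner 0 1 z w - k * L2inner 0 1 z (fun rho => rho * w rho).
Proof.
move=> Lz Lw.
have Lw' := idmul_L2 Lw.
have i1 := L2_mul Lz Lw; have i2 := igZ k (L2_mul Lz Lw').
rewrite !L2inner_def -itZ; last exact: L2_mul.
by rewrite -itB//; apply: it_eq => x _; ring.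
Qed.

End L2curves.

Section Transport.
Context {R : realType}.
Variables (T d : R) (tau q : R -> R).
Hypotheses (hT : 0 < T) (d0 : 0 < d) (d1 : d < 1) (ht0 : 0 < tau 0) (cq : continuous q).
Hypothesis tauE : forall t, 0 <= t -> t <= T -> tau t = tau 0 + it 0 t q.
Hypotheses (dtau : forall t : R, t \in `]0, T[ -> is_derive t 1 tau (q t)) (qd : forall t, t \in `]0, T[ -> q t <= d).
Hypothesis tge : forall t, 0 <= t -> t <= T -> tau 0 <= tau t.

Let T0 : 0 <= T. Proof. exact: ltW. Qed.

(** Regularity of [tau] is known on [[0, T]]; this continuation by constants is continuous on the
    whole line. *)
Definition te (t : R) : R := tau 0 + it 0 (clamp 0 T t) q.

Lemma te_cont : continuous te.
Proof.
by move=> t; apply: cvgD; [exact: cvg_cst|exact: (prim_continuous T0 (L2_continuous 0 T cq))].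
Qed.

Lemma teE t : 0 <= t -> t <= T -> te t = tau t.
Proof. by move=> t0 tT; rewrite /te clamp_id// (tauE t0 tT). Qed.

Lemma dte (t : R) : t \in `]0, T[ -> is_derive t 1 te (q t).
Proof.
move=> tI; have [t0 tT] := in_oo tI.
apply: (near_eq_is_derive _ (dtau tI)).
near=> s; apply/esym/teE.
 by apply: ltW; near: s; exact: lt_nbhsr.
by apply: ltW; near: s; exact: lt_nbhsl.
Unshelve. all: by end_near. Qed.

Let y (t : R) := t - te t.
Let y' (t : R) := 1 - q t.
Let c1 : 0 < 1 - d. Proof. by rewrite subr_gt0. Qed.

Let cy : continuous y.
Proof. by move=> t; apply: cvgB; [exact: cvg_id|exact: te_cont]. Qed.
Let cy' : continuous y'.
Proof. by move=> t; apply: cvgB; [exact: cvg_cst|exact: cq]. Qed.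
Let dy (t : R) : t \in `]0, T[ -> is_derive t 1 y (y' t).
Proof. by move=> /dte h; exact: (is_deriveB (is_derive_id t 1) h). Qed.
Let y'c t : t \in `]0, T[ -> 1 - d <= y' t.
Proof. by move=> /qd h; rewrite lerD2l lerN2. Qed.
Let ya : - tau 0 <= y 0.
Proof. by rewrite /y teE// sub0r. Qed.
Let yb : y T <= T.
Proof. by rewrite /y teE// gerBl; apply: le_trans (ltW ht0) (tge _ _). Qed.
Let yE t : 0 <= t -> t <= T -> y t = t - tau t.
Proof. by move=> t0 tT; rewrite /y teE. Qed.

(** The delay grows at rate at most [d < 1], so the delayed time increases at rate at least
    [1 - d]. *)
Lemma delay_lt s t : 0 <= s -> s < t -> t <= T -> s - tau s < t - tau t.
Proof.
move=> s0 st tT; have := comp_lt c1 cy cy' dy y'c s0 st tT.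
by rewrite !yE// ?(le_trans s0 (ltW st))// (le_trans (ltW st)).
Qed.

Lemma delay_ge t : 0 <= t -> t <= T -> - tau 0 <= t - tau t.
Proof.
rewrite le_eqVlt => /predU1P[<-|t0] tT; first by rewrite sub0r.
by have := delay_lt (lexx 0) t0 tT; rewrite sub0r => /ltW.
Qed.

Lemma shift_L2 (f : R -> R) : L2 (- tau 0) T f -> L2 0 T (fun t => f (t - tau t)) /\
 nL 0 T (fun t => f (t - tau t)) ^+ 2 <= (1 - d)^-1 * nL (- tau 0) T f ^+ 2.
Proof.
move=> Lf; have [h1 h2] := comp_L2 c1 hT cy cy' dy y'c ya yb Lf.
have e : {in `]0, T[, f \o y =1 fun t => f (t - tau t)} by move=> t /in_oo_le[t0 tT]; rewrite /= yE.
by split; [exact: L2_eq h1|rewrite -(nL_eq e)].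
Qed.

(** Solutions are constant along characteristics, which are the level curves of
    [t - tau t * rho]. *)
Definition zt (f : R -> R) (t rho : R) : R := f (t - tau t * rho).

Let tau_gt0 t : 0 <= t -> t <= T -> 0 < tau t.
Proof. by move=> t0 tT; exact: lt_le_trans (tge t0 tT). Qed.

Lemma zt_L2 f t : 0 <= t -> t <= T -> L2 (- tau 0) T f ->
 L2 0 1 (zt f t) /\ nL 0 1 (zt f t) ^+ 2 <= (tau 0)^-1 * nL (- tau 0) T f ^+ 2.
Proof.
move=> t0 tT Lf; have tT' : t - tau t * 0 <= T by rewrite mulr0 subr0.
have ta : - tau 0 <= t - tau t * 1 by rewrite mulr1 delay_ge.
have [h1 h2] := affine_L2 (tau_gt0 t0 tT) ltr01 tT' ta Lf.
split => //; apply: (le_trans h2); rewrite ler_wpM2r ?sqr_ge0// lef_pV2 ?posrE ?tge//.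
exact: tau_gt0.
Qed.

(** Polynomials in rho whose coefficients are continuously differentiable in time. Each entry
    records a coefficient together with its derivative, so that under [goodc] the polynomial [dv] is
    the time derivative of [pv]. *)
Definition curve := seq ((R -> R) * (R -> R) * {poly R}).
Definition pv (s : curve) (t : R) : {poly R} := \sum_(x <- s) x.1.1 t *: x.2.
Definition dv (s : curve) (t : R) : {poly R} := \sum_(x <- s) x.1.2 t *: x.2.
Definition goodc (s : curve) : Prop := foldr (fun x P => [/\ continuous x.1.1, continuous x.1.2 &
 forall t : R, t \in `]0, T[ -> is_derive t 1 x.1.1 (x.1.2 t)] /\ P) True s.
Let chi (t : R) : {poly R} := t%:P - te t *: 'X.

Lemma goodc_cat s s' : goodc s -> goodc s' -> goodc (s ++ s').
Proof. by move=> + h; elim: s => //= x s IH [hx /IH]. Qed.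

(* Taylor expansion at 0 in rho of [p (t - tau t * rho)]. *)
Lemma taylor p : exists s, goodc s /\ forall t,
 pv s t = p \Po chi t /\ dv s t = (p^`() \Po chi t) * (1 - q t *: 'X).
Proof.
elim/poly_ind: p => [|p c [s [gs hs]]].
 exists [::]; split => // t; rewrite /pv /dv !big_nil deriv0 !comp_poly0 mul0r; by [].
pose tl : curve := flatten [seq [:: ((fun t => x.1.1 t * t, fun t => x.1.2 t * t + x.1.1 t), x.2);
 ((fun t => - (x.1.1 t * te t), fun t => - (x.1.2 t * te t + x.1.1 t * q t)), x.2 * 'X)] | x <- s].
have gtl : goodc tl.
 rewrite /tl; elim: (s) gs => //= x r IH [[ca ca' da] /IH h]; split; last split => //.
 - split => //=.
  + by move=> t; apply: cvgM; [exact: ca|exact: cvg_id].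
  + by move=> t; apply: cvgD; [apply: cvgM; [exact: ca'|exact: cvg_id]|exact: ca].
  + move=> t /da h1; apply: (is_derive_eq (is_deriveM h1 (is_derive_id t 1))).
   by rewrite /= -[X in X + _]/(x.1.1 t * 1) -[X in _ + X]/(t * x.1.2 t); ring.
 - split => //=.
  + by move=> t; apply: cvgN; apply: cvgM; [exact: ca|exact: te_cont].
  + by move=> t; apply: cvgN; apply: cvgD; [apply: cvgM; [exact: ca'|exact: te_cont]|apply: cvgM; [exact: ca|exact: cq]].
  + move=> t tI; have h1 := da t tI; have h2 := dte tI.
   apply: (is_derive_eq (is_deriveN (is_deriveM h1 h2))).
   by rewrite -[X in - (X + _)]/(x.1.1 t * q t) -[X in - (_ + X)]/(te t * x.1.2 t); ring.
exists (tl ++ [:: ((cst c, cst 0), 1)]); split.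
 apply: goodc_cat => //=; split => //; split => /=; try exact: cst_continuous.
 by move=> t _; exact: is_derive_cst.
move=> t; have [e1 e2] := hs t.
have [t1 t2] : pv tl t = pv s t * chi t /\ dv tl t = dv s t * chi t + pv s t * (1 - q t *: 'X).
 rewrite /tl /pv /dv; elim: (s) => [|x r [IH1 IH2]]; first by rewrite /= !big_nil !mul0r addr0.
 rewrite /= !big_cons IH1 IH2 /chi -!mul_polyC !(rmorphM, rmorphD, rmorphN) /=; split; ring.
rewrite /pv /dv !big_cat !big_seq1 -/(pv tl t) -/(dv tl t) t1 t2 /= e1 e2.
rewrite derivD derivC derivM derivX mulr1 addr0 !comp_polyD !comp_polyM comp_polyX comp_polyC scale0r addr0 alg_polyC; split => //.
by ring.
Qed.

Lemma pv_chi p t (x : R) : (p \Po chi t).[x] = p.[t - te t * x].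
Proof. by rewrite horner_comp /chi !hornerE. Qed.
Lemma pv_chi0 p t : (p \Po chi t).[0] = p.[t].
Proof. by rewrite pv_chi mulr0 subr0. Qed.
Lemma deriv_chi p t : (p \Po chi t)^`() = - (te t *: (p^`() \Po chi t)).
Proof.
by rewrite deriv_comp /chi derivB derivC derivZ derivX sub0r mulrN -scalerAr mulr1.
Qed.

Lemma lin_zero (F : {poly R} -> R) : (forall (k : R) p r, F (k *: p + r) = k * F p + F r) -> F 0 = 0.
Proof. by move=> l; have := l (-1) 0 0; rewrite scaler0 addr0 mulN1r addNr. Qed.

Lemma lin_scale (F : {poly R} -> R) : (forall (k : R) p r, F (k *: p + r) = k * F p + F r) ->
 forall k p, F (k *: p) = k * F p.
Proof. by move=> l k p; have := l k p 0; rewrite (lin_zero l) !addr0. Qed.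

Lemma dtauE x : x \in `]0, T[ -> derive1 tau x = q x.
Proof. by move=> xI; have [_ <-] := dtau xI; rewrite derive1E. Qed.

Section curve_calculus.
Variables (t : R) (m k : {poly R} -> R -> R).
Hypotheses (t0 : 0 <= t) (tT : t <= T) (kL2 : forall p, L2 0 t (k p)).
Hypothesis mlin : forall x, 0 <= x -> x <= t -> forall (l : R) p r, m (l *: p + r) x = l * m p x + m r x.
Hypothesis klin : forall x, 0 <= x -> x <= t -> forall (l : R) p r, k (l *: p + r) x = l * k p x + k r x.
Hypothesis mE : forall p x, 0 <= x -> x <= t -> m p x = m p 0 + it 0 x (k p).

Lemma mass_L2 p : L2 0 t (m p).
Proof.
have h1 := L2D (L2_cst 0 t (m p 0)) (prim_L2 t0 (kL2 p)).
by apply: L2_eq h1 => x /in_oo_le[x0 xt]; rewrite (mE p x0 xt).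
Qed.

(** Product rule for a moving test polynomial: [m] is linear in the polynomial and has time
    derivative [k] against a fixed one; each entry is integrated by parts in time. *)
Lemma curve_ftc s : goodc s -> ig 0 t (fun x => m (dv s x) x + k (pv s x) x) /\
 m (pv s t) t - m (pv s 0) 0 = it 0 t (fun x => m (dv s x) x + k (pv s x) x).
Proof.
elim: s => [_|z s IH /= [[ca ca' da] /IH [i1 e1]]].
 have z0 x : x \in `]0, t[ -> 0 = m (dv [::] x) x + k (pv [::] x) x.
  move=> /in_oo_le[x0 xt]; rewrite /dv /pv !big_nil.
  by rewrite (lin_zero (mlin x0 xt)) (lin_zero (klin x0 xt)) addr0.
 split; first by apply: (ig_eq z0); exact: ig_cst.
 rewrite -(it_eq z0) it0 /pv !big_nil.
 by rewrite (lin_zero (mlin t0 (lexx t))) (lin_zero (mlin (lexx 0) t0)) subrr.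
have da' x : x \in `]0, t[ -> is_derive x 1 z.1.1 (z.1.2 x).
 by move=> /in_oo[x0 xt]; apply: da; rewrite in_itv/= x0 (lt_le_trans xt).
have Lk := kL2 z.2; have Lm := mass_L2 z.2.
have Lca := L2_continuous 0 t ca; have Lca' := L2_continuous 0 t ca'.
have j1 : ig 0 t (fun x => m z.2 x * z.1.2 x) by exact: L2_mul.
have j2 : ig 0 t (fun x => k z.2 x * z.1.1 x) by exact: L2_mul.
have E x : x \in `]0, t[ -> (m z.2 x * z.1.2 x + k z.2 x * z.1.1 x) + (m (dv s x) x + k (pv s x) x) =
  m (dv (z :: s) x) x + k (pv (z :: s) x) x.
 move=> /in_oo_le[x0 xt]; rewrite /dv /pv !big_cons -/(dv s x) -/(pv s x).
 by rewrite (mlin x0 xt) (klin x0 xt); ring.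
have j12 := igD j1 j2.
split; first by apply: (ig_eq E); exact: igD.
rewrite -(it_eq E) (itD j12 i1) (itD j1 j2) -e1.
rewrite {1 2}/pv !big_cons -/(pv s t) -/(pv s 0) (mlin t0 (lexx t)) (mlin (lexx 0) t0).
have := it_parts t0 Lk ca ca' da'.
have -> : it 0 t (fun x => m z.2 x * z.1.2 x) = m z.2 0 * (z.1.1 t - z.1.1 0) + it 0 t (fun x => it 0 x (k z.2) * z.1.2 x).
 rewrite -(FTC_itv t0 ca' ca da') -itZ; last exact: ig_continuous.
 rewrite -itD; [|by apply: igZ; exact: ig_continuous|by apply: L2_mul => //; exact: prim_L2].
 by apply: it_eq => x /in_oo_le[x0 xt]; rewrite (mE z.2 x0 xt) mulrDl.
rewrite (mE z.2 t0 (lexx t)); move: (it _ _ (fun x => _)) (it _ _ (fun x => _)) => a b e.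
by rewrite mulrDr [_ * it _ _ _]mulrC -e; ring.
Qed.

End curve_calculus.

Lemma ibp01 (W : {poly R}) zeta : smooth zeta -> L2inner 0 1 (horner W^`()) zeta =
 W.[1] * zeta 1 - W.[0] * zeta 0 - L2inner 0 1 (horner W) (derive1 zeta).
Proof.
move=> sz; have cz := smooth_cts sz; have cz' := smooth_cts (smooth_deriv sz).
have c1' (p : {poly R}) f : continuous f -> continuous (fun x => p.[x] * f x).
 by move=> cf x; apply: cvgM; [exact: continuous_horner|exact: cf].
have D (x : R) : x \in `]0, 1[ -> is_derive x 1 (fun x => W.[x] * zeta x) (W^`().[x] * zeta x + W.[x] * derive1 zeta x).
 move=> _; apply: (is_derive_eq (is_deriveM (is_derive_poly W x) (smooth_is x sz))).
 by rewrite -[X in X + _]/(W.[x] * derive1 zeta x) -[X in _ + X]/(zeta x * W^`().[x]); ring.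
have w1 : continuous (fun x => W^`().[x] * zeta x + W.[x] * derive1 zeta x).
 by move=> x; apply: cvgD; exact: c1'.
have := FTC_itv ler01 w1 (c1' _ _ cz) D; rewrite itD; try by apply: ig_continuous; exact: c1'.
by rewrite !L2inner_def => <-; rewrite addrK.
Qed.

Lemma inner_lin (z : R -> R) (k : R) (p r : {poly R}) : L2 0 1 z ->
 L2inner 0 1 z (horner (k *: p + r)) = k * L2inner 0 1 z (horner p) + L2inner 0 1 z (horner r).
Proof.
move=> Lz; have Lp := L2_poly 0 1 p; have Lr := L2_poly 0 1 r.
rewrite hornerf_lin -[LHS]/(ip (L2ip 0 1) z (k *: horner p + horner r)).
by rewrite (ipDr (S := L2ip 0 1) (domZ (s := L2ip 0 1) k Lp) Lr Lz) (ipZr (S := L2ip 0 1) k Lp Lz).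
Qed.

Lemma inner_linl (z : R -> R) (k : R) (p r : {poly R}) : L2 0 1 z ->
 L2inner 0 1 (horner (k *: p + r)) z = k * L2inner 0 1 (horner p) z + L2inner 0 1 (horner r) z.
Proof.
move=> Lz; have C (u v : R -> R) : L2inner 0 1 u v = L2inner 0 1 v u.
 by rewrite !L2inner_def; apply: it_eq => x _; exact: mulrC.
by rewrite C (inner_lin k p r Lz) C (C z (horner r)).
Qed.

(** Composing [p] with the characteristics gives a smooth solution. The time derivative of its
    weighted pairing is minus the rho-derivative of [W] against [zeta], and an integration by parts
    on the unit interval produces the weak form. *)
Lemma transport_poly p : weak_transport T tau (zt (horner p)) (horner p) (fun s => p.[s - tau s]).
Proof.
move=> t /in_cc[t0 tT] zeta sz.
have Lz : L2 0 1 zeta by apply: L2_continuous; exact: smooth_cts.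
have [s [gs hs]] := taylor p.
pose m r := L2inner 0 1 (horner r) zeta.
have mlin (k : R) a b : m (k *: a + b) = k * m a + m b by exact: inner_linl.
have zE x : 0 <= x -> x <= T -> zt (horner p) x = horner (p \Po chi x).
 by move=> x0 xT; apply/funext => r; rewrite pv_chi /zt teE.
have lin (g : R -> R) x : 0 <= x -> x <= t -> forall (l : R) a b, g x * m (l *: a + b) = l * (g x * m a) + g x * m b.
 by move=> _ _ l a b; rewrite mlin; ring.
have kL r : L2 0 t (fun x => q x * m r) by apply: L2_continuous => x; apply: cvgMl; exact: cq.
have mE r x : 0 <= x -> x <= t -> te x * m r = te 0 * m r + it 0 x (fun y => q y * m r).
 move=> x0 xt; have xT := le_trans xt tT.
 have -> : it 0 x (fun y => q y * m r) = m r * it 0 x q.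
  by rewrite -itZ; [apply: it_eq => w _; exact: mulrC|exact: ig_continuous].
 by rewrite !teE// (tauE x0 xT); ring.
have [_ e] := curve_ftc (m := fun r x => te x * m r) (k := fun r x => q x * m r) t0 tT kL (lin te) (lin q) mE gs.
rewrite !zE// -!/(m _) -(hs t).1 -(hs 0).1 -(teE t0 tT) -(teE (lexx 0) T0) e.
apply: it_eq => x /in_oo[x0 xt].
have xT := lt_le_trans xt tT; have x0' := ltW x0; have xT' := ltW xT.
have [-> ->] := hs x; rewrite dtauE ?in_itv/= ?x0// zE//.
pose W := (1 - q x *: 'X) * (p \Po chi x).
have W' : te x *: ((p^`() \Po chi x) * (1 - q x *: 'X)) + q x *: (p \Po chi x) = - W^`().
 by rewrite /W derivM derivB derivC derivZ derivX deriv_chi sub0r -!mul_polyC; ring.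
rewrite -[q x * _](lin_scale mlin) -mlin W' -scaleN1r (lin_scale mlin) mulN1r.
rewrite /m ibp01// /W !hornerM pv_chi pv_chi0 mulr1 teE// !hornerD !hornerN !hornerZ !hornerX !hornerC mulr0 mulr1 subr0 mul1r.
have -> : L2inner 0 1 (horner ((1 - q x *: 'X) * (p \Po chi x))) (derive1 zeta) =
  L2inner 0 1 (fun rho => (1 - q x * rho) * (p \Po chi x).[rho]) (derive1 zeta).
 by rewrite !L2inner_def; apply: it_eq => r _; rewrite hornerM hornerD hornerN hornerZ hornerX hornerC.
by move: (L2inner _ _ _ _) => z; ring.
Qed.

Let Kz : R := Num.sqrt (tau 0)^-1.
Let Ks : R := Num.sqrt (1 - d)^-1.
Let Kz0 : 0 <= Kz. Proof. exact: sqrtr_ge0. Qed.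
Let Ks0 : 0 <= Ks. Proof. exact: sqrtr_ge0. Qed.

Lemma zt_le f t : 0 <= t -> t <= T -> L2 (- tau 0) T f -> nL 0 1 (zt f t) <= Kz * nL (- tau 0) T f.
Proof.
move=> t0 tT Lf; have [_ h] := zt_L2 t0 tT Lf.
rewrite -ler_sqr ?nnegrE ?nL_ge0 ?mulr_ge0 ?nL_ge0// exprMn.
by have -> : Kz ^+ 2 = (tau 0)^-1 by rewrite sqr_sqrtr// invr_ge0 ltW.
Qed.

Lemma shift_le f : L2 (- tau 0) T f -> nL 0 T (fun t => f (t - tau t)) <= Ks * nL (- tau 0) T f.
Proof.
move=> Lf; have [_ h] := shift_L2 Lf.
rewrite -ler_sqr ?nnegrE ?nL_ge0 ?mulr_ge0 ?nL_ge0// exprMn.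
by have -> : Ks ^+ 2 = (1 - d)^-1 by rewrite sqr_sqrtr// invr_ge0 ltW.
Qed.

Lemma curve_nL_cont s (t e : R) : goodc s -> 0 < e -> exists2 del : R, 0 < del & forall x,
 `|x - t| < del -> nL 0 1 (horner (pv s x - pv s t)) <= e.
Proof.
elim: s e => [|z s IH] e.
 move=> _ e0; exists 1 => // x _; rewrite /pv !big_nil subrr.
 by rewrite (nL_eq (g := 0)) ?[nL _ _ _](nrm0 (L2ip 0 1)) ?ltW// => r _; rewrite horner0.
move=> /= [[ca _ _] gs] e0; have e2 : 0 < e / 2 by lra.
have [d2 d20 h2] := IH _ gs e2.
have nr := nL_ge0 0 1 (horner z.2).
have k1 : 0 < e / 2 / (nL 0 1 (horner z.2) + 1) by rewrite divr_gt0// ltr_wpDl.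
have [d1' /= d10 h1] := (cvgrPdist_lt _ _).1 (ca t) _ k1.
exists (Num.min d1' d2); first by rewrite lt_min d10.
move=> x; rewrite lt_min => /andP[x1 x2].
have -> : horner (pv (z :: s) x - pv (z :: s) t) = (z.1.1 x - z.1.1 t) *: horner z.2 + horner (pv s x - pv s t).
 rewrite -hornerf_lin; congr horner; rewrite /pv !big_cons scalerBl opprD addrACA; by [].
apply: (le_trans (nrmD (S := L2ip 0 1) (L2Z _ (L2_poly 0 1 _)) (L2_poly 0 1 _))).
rewrite (nrmZ (S := L2ip 0 1) _ (L2_poly 0 1 _)) -!/(nL _ _ _).
have -> : e = e / 2 + e / 2 by field.
apply: lerD; last exact: h2.
apply: (@le_trans _ _ (e / 2 / (nL 0 1 (horner z.2) + 1) * nL 0 1 (horner z.2))).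
 by rewrite ler_wpM2r// distrC ltW// h1//= distrC.
by rewrite mulrC; apply: frac_le => //; exact: ltW.
Qed.

Lemma zt_cL f : L2 (- tau 0) T f -> cL 0 1 T (zt f).
Proof.
move=> Lf; split=> [t t0 tT|t e t0 tT e0]; first by have [] := zt_L2 t0 tT Lf.
have e3 : 0 < e / 3 by lra.
have ab : - tau 0 < T by apply: lt_trans hT; rewrite oppr_lt0.
have k1 : 0 < Kz + 1 by rewrite ltr_wpDl.
have [p hp] := poly_dense ab Lf (divr_gt0 e3 k1).
have [s [gs hs]] := taylor p.
have [del del0 hd] := curve_nL_cont t gs e3.
have Lfp : L2 (- tau 0) T (f - horner p) by apply: (L2B) => //; exact: L2_poly.
have Lp := L2_poly (- tau 0) T p.
have zE x : 0 <= x -> x <= T -> zt (horner p) x = horner (pv s x).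
 by move=> x0 xT; apply/funext => r; rewrite (hs x).1 pv_chi /zt teE.
exists del => // x x0 xT xt.
have [L1 _] := zt_L2 x0 xT Lf; have [L2' _] := zt_L2 t0 tT Lf.
have [L3 _] := zt_L2 x0 xT Lp; have [L4 _] := zt_L2 t0 tT Lp.
have b1 z : 0 <= z -> z <= T -> nL 0 1 (zt f z - zt (horner p) z) <= e / 3.
 move=> z0 zT; apply: (le_trans (zt_le z0 zT Lfp)).
 by apply: (@le_trans _ _ (Kz * (e / 3 / (Kz + 1)))); [rewrite ler_wpM2l|apply: frac_le => //; exact: ltW].
have t1 := nL_triangle L1 L3 L2'.
have t2 := nL_triangle L3 L4 L2'.
rewrite (nL_distC L4 L2') in t2.
have := hd x xt; rewrite hornerfB -!zE//.
have := b1 x x0 xT; have := b1 t t0 tT; move: t1 t2; rewrite -!/(nL _ _ _).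
move: (nL _ _ _) (nL _ _ _) (nL _ _ _) (nL _ _ _) (nL _ _ _) => *; lra.
Qed.

Lemma it_bound t (h : R -> R) (B : R) : 0 <= t -> ig 0 t h -> (forall s, s \in `]0, t[ -> `|h s| <= B) ->
 `|it 0 t h| <= B * t.
Proof.
move=> t0 ih hB; apply: (le_trans (it_abs ih)).
rewrite -[X in _ * X](subr0 t) -(it_cst B t0); apply: it_le; [exact: ig_norm|exact: ig_cst|].
exact: aeonW.
Qed.

(** The defects to which [L2_poly_ext] applies. The class is stable under sums and scaling, so a
    long identity can be certified term by term. *)
Definition bnd (D : (R -> R) -> R) : Prop :=
 (forall k l, L2 (- tau 0) T k -> L2 (- tau 0) T l -> D (k - l) = D k - D l) /\
 exists2 C, 0 <= C & forall k, L2 (- tau 0) T k -> `|D k| <= C * nL (- tau 0) T k.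

Lemma bndD D E : bnd D -> bnd E -> bnd (fun k => D k + E k).
Proof.
move=> [DB [C C0 hC]] [EB [C' C0' hC']]; split=> [k l Lk Ll|]; first by rewrite DB// EB//; ring.
exists (C + C') => [|k Lk]; first exact: addr_ge0.
by rewrite mulrDl; apply: (le_trans (ler_normD _ _)); exact: lerD (hC _ Lk) (hC' _ Lk).
Qed.

Lemma bndZ (c : R) D : bnd D -> bnd (fun k => c * D k).
Proof.
move=> [DB [C C0 hC]]; split=> [k l Lk Ll|]; first by rewrite DB// mulrBr.
exists (`|c| * C) => [|k Lk]; first exact: mulr_ge0.
by rewrite normrM -mulrA ler_wpM2l// hC.
Qed.

Lemma bnd_ext D f : bnd D -> (forall p, D (horner p) = 0) -> L2 (- tau 0) T f -> D f = 0.
Proof.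
move=> [DB [C C0 hC]] Dp; apply: (L2_poly_ext _ C0 DB hC Dp).
by apply: lt_trans hT; rewrite oppr_lt0.
Qed.

Lemma zt_inner_le k s w : 0 <= s -> s <= T -> L2 (- tau 0) T k -> L2 0 1 w ->
 `|L2inner 0 1 (zt k s) w| <= Kz * nL (- tau 0) T k * nL 0 1 w.
Proof.
move=> s0 sT Lk Lw; have [a _] := zt_L2 s0 sT Lk.
apply: (le_trans (cauchy_schwarz (S := L2ip 0 1) a Lw)).
by rewrite -!/(nL _ _ _) ler_wpM2r ?nL_ge0// zt_le.
Qed.

Lemma bnd_inner s w : 0 <= s -> s <= T -> L2 0 1 w -> bnd (fun k => L2inner 0 1 (zt k s) w).
Proof.
move=> s0 sT Lw; split=> [k l Lk Ll|].
 have [a _] := zt_L2 s0 sT Lk; have [b _] := zt_L2 s0 sT Ll.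
 exact: (@ipBl _ _ (L2ip 0 1) _ _ _ a b Lw).
exists (Kz * nL 0 1 w) => [|k Lk]; first by rewrite mulr_ge0 ?nL_ge0.
by rewrite mulrAC; exact: zt_inner_le.
Qed.

Section integrals.
Variable t : R.
Hypotheses (t0 : 0 <= t) (tT : t <= T).

Lemma ig_inner (a w k : R -> R) : continuous a -> L2 0 1 w -> L2 (- tau 0) T k ->
 ig 0 t (fun s => a s * L2inner 0 1 (zt k s) w).
Proof.
by move=> ca Lw Lk; exact: L2_mul (L2_continuous 0 t ca) (cL_inner_L2 T0 tT (zt_cL Lk) Lw).
Qed.

Lemma bnd_it_inner (a w : R -> R) : continuous a -> L2 0 1 w -> bnd (fun k => it 0 t (fun s => a s * L2inner 0 1 (zt k s) w)).
Proof.
move=> ca Lw; have [Q Q0 hQ] := continuous_bounded 0 T ca; split=> [k l Lk Ll|].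
 rewrite -itB; [|exact: ig_inner|exact: ig_inner]; apply: it_eq => s /in_oo_le[s0 st].
 by rewrite (bnd_inner s0 (le_trans st tT) Lw).1// mulrBr.
exists (Q * (Kz * nL 0 1 w) * t) => [|k Lk]; first by rewrite !mulr_ge0 ?nL_ge0.
rewrite mulrAC; apply: it_bound (ig_inner ca Lw Lk) _ => // s /in_oo_le[s0 st].
rewrite normrM -mulrA; apply: ler_pM => //; first by apply: hQ => //; exact: le_trans tT.
by rewrite mulrAC; apply: zt_inner_le => //; exact: le_trans tT.
Qed.

Lemma past_L2 k : L2 (- tau 0) T k -> L2 0 T k.
Proof. by apply: L2_sub => //; rewrite oppr_le0 ltW. Qed.

Lemma bnd_it : bnd (it 0 t).
Proof.
have iK k : L2 (- tau 0) T k -> ig 0 t k by move=> /past_L2 h; apply: L2_ig; exact: L2_sub (lexx 0) tT h.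
split=> [k l Lk Ll|]; first exact: (itB (iK _ Lk) (iK _ Ll)).
exists (Num.sqrt T) => [|k Lk]; first exact: sqrtr_ge0.
have := prim_le t0 tT (past_L2 Lk); rewrite subr0 mulrC => h; apply: (le_trans h).
by rewrite ler_wpM2l ?sqrtr_ge0// nL_sub// oppr_le0 ltW.
Qed.

Lemma shift_L2t k : L2 (- tau 0) T k -> L2 0 t (fun s => k (s - tau s)).
Proof. by move=> /shift_L2[h _]; exact: L2_sub h. Qed.

Lemma bnd_shift a : L2 0 t a -> bnd (fun k => it 0 t (fun s => a s * k (s - tau s))).
Proof.
move=> La; split=> [k l Lk Ll|].
 rewrite -itB; [|exact: L2_mul La (shift_L2t Lk)|exact: L2_mul La (shift_L2t Ll)].
 by apply: it_eq => s _; rewrite -mulrBr.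
exists (nL 0 t a * Ks) => [|k Lk]; first by rewrite mulr_ge0 ?nL_ge0.
apply: (le_trans (it_mul_le La (shift_L2t Lk))); rewrite -mulrA ler_wpM2l ?nL_ge0//.
by have [h _] := shift_L2 Lk; apply: (le_trans (nL_sub (lexx 0) tT h)); exact: shift_le.
Qed.

End integrals.

(** [D] is the defect of the weak equation; it is bounded in L^2 and vanishes on polynomials by
    [transport_poly]. *)
Lemma transport_zt f : L2 (- tau 0) T f ->
 weak_transport T tau (zt f) f (fun s => f (s - tau s)).
Proof.
move=> Lf t tI zeta sz; have [t0 tT] := in_cc tI.
have Lz : L2 0 1 zeta by apply: L2_continuous; exact: smooth_cts.
have Lz' : L2 0 1 (derive1 zeta) by apply: L2_continuous; exact: (smooth_cts (smooth_deriv sz)).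
have Lid := idmul_L2 Lz'; have Ly' := L2_continuous 0 t cy'.
have c1' : continuous (cst 1 : R -> R) by exact: cst_continuous.
pose X1 k s := cst 1 s * L2inner 0 1 (zt k s) (derive1 zeta).
pose X2 k s := q s * L2inner 0 1 (zt k s) (fun rho => rho * derive1 zeta rho).
pose X3 (k : R -> R) s := y' s * k (s - tau s).
pose D k := tau t * L2inner 0 1 (zt k t) zeta + (- tau 0 * L2inner 0 1 (zt k 0) zeta +
 ((-1) * it 0 t (X1 k) + (it 0 t (X2 k) + (- zeta 0 * it 0 t k + zeta 1 * it 0 t (X3 k))))).
have bD : bnd D := bndD (bndZ _ (bnd_inner t0 tT Lz)) (bndD (bndZ _ (bnd_inner (lexx 0) T0 Lz))
 (bndD (bndZ _ (bnd_it_inner t0 tT c1' Lz')) (bndD (bnd_it_inner t0 tT cq Lid)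
 (bndD (bndZ _ (bnd_it t0 tT)) (bndZ _ (bnd_shift tT Ly')))))).
have DE k : L2 (- tau 0) T k -> D k = tau t * L2inner 0 1 (zt k t) zeta - tau 0 * L2inner 0 1 (zt k 0) zeta -
  it 0 t (fun s => L2inner 0 1 (fun rho => (1 - derive1 tau s * rho) * zt k s rho) (derive1 zeta)
   + k s * zeta 0 - (1 - derive1 tau s) * k (s - tau s) * zeta 1).
 move=> Lk; have i1 : ig 0 t (X1 k) by exact: ig_inner.
 have i2 : ig 0 t (X2 k) by exact: ig_inner.
 have i3 : ig 0 t k by apply: L2_ig; exact: L2_sub (lexx 0) tT (past_L2 Lk).
 have i4 : ig 0 t (X3 k) by exact: L2_mul Ly' (shift_L2t tT Lk).
 rewrite -[X in _ - X](it_eq (f := fun s => (X1 k s - X2 k s) + (zeta 0 * k s - zeta 1 * X3 k s))).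
  rewrite (itD (igB i1 i2) (igB (igZ _ i3) (igZ _ i4))) (itB i1 i2) (itB (igZ _ i3) (igZ _ i4)) (itZ _ i3) (itZ _ i4).
  by rewrite /D; move: (it _ _ _) (it _ _ _) (it _ _ _) (it _ _ _) (L2inner _ _ _ _) (L2inner _ _ _ _) => *; ring.
 move=> s /in_oo[s0 st]; have sT := lt_le_trans st tT; have [Ls _] := zt_L2 (ltW s0) (ltW sT) Lk.
 rewrite dtauE ?in_itv/= ?s0// inner_flux// /X1 /X2 /X3 /y' mul1r.
 by move: (L2inner _ _ _ _) (L2inner _ _ _ _) => *; ring.
apply/eqP; rewrite -subr_eq0 -[X in _ - X]/(it _ _ _) -DE//; apply/eqP; apply: bnd_ext bD _ Lf => p.
by rewrite DE; [rewrite (transport_poly p tI sz) subrr|exact: L2_poly].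
Qed.

Section dual_transport.
Variables (z : R -> R -> R) (g h : R -> R).
Hypotheses (cz : cL 0 1 T z) (Lg : L2 0 T g) (Lh : L2 0 T h) (W : weak_transport T tau z g h).

Definition tmass (r : {poly R}) (x : R) : R := tau x * L2inner 0 1 (z x) (horner r).
Definition tflux (r : {poly R}) (x : R) : R := L2inner 0 1 (z x) (horner r^`()) -
 q x * L2inner 0 1 (z x) (horner ('X * r^`())) + r.[0] * g x - r.[1] * (y' x * h x).

Lemma tmass_lin x : 0 <= x -> x <= T -> forall (k : R) p r, tmass (k *: p + r) x = k * tmass p x + tmass r x.
Proof.
by move=> x0 xT k p r; rewrite /tmass inner_lin; [move: (L2inner _ _ _ _) (L2inner _ _ _ _) => *; ring|exact: cz.1].
Qed.

Lemma tflux_lin x : 0 <= x -> x <= T -> forall (k : R) p r, tflux (k *: p + r) x = k * tflux p x + tflux r x.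
Proof.
move=> x0 xT k p r; have Lx := cz.1 x x0 xT.
rewrite /tflux derivD derivZ mulrDr -scalerAr !inner_lin// !hornerD !hornerZ.
by move: (L2inner _ _ _ _) (L2inner _ _ _ _) (L2inner _ _ _ _) (L2inner _ _ _ _) => *; ring.
Qed.

Lemma tflux_L2 r : L2 0 T (tflux r).
Proof.
have mC (k l : R -> R) : continuous k -> L2 0 T l -> L2 0 T (fun s => k s * l s).
 by move=> ck Ll; apply: L2_eq (L2_mulC ck Ll) => s _; exact: mulrC.
have a1 := cL_inner_L2 T0 (lexx T) cz (L2_poly 0 1 r^`()).
have a2 := mC _ _ cq (cL_inner_L2 T0 (lexx T) cz (L2_poly 0 1 ('X * r^`()))).
have a4 := mC _ _ cy' Lh.
exact: (L2B (L2D (L2B a1 a2) (L2Z r.[0] Lg)) (L2Z r.[1] a4)).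
Qed.

Lemma tmassE r x : 0 <= x -> x <= T -> tmass r x = tmass r 0 + it 0 x (tflux r).
Proof.
move=> x0 xT; have xI : x \in `[0, T] by rewrite in_itv/= x0.
have := W xI (@smooth_poly R r); rewrite derive1_poly -!/(tmass _ _) => e.
apply/eqP; rewrite addrC -subr_eq; apply/eqP; rewrite e; apply: it_eq => s.
move=> /in_oo[s0 sx]; have sT := lt_le_trans sx xT.
rewrite dtauE ?in_itv/= ?s0// inner_flux; [|exact: cz.1 (ltW s0) (ltW sT)|exact: L2_poly].
have -> : L2inner 0 1 (z s) (fun rho => rho * r^`().[rho]) = L2inner 0 1 (z s) (horner ('X * r^`())).
 by rewrite !L2inner_def; apply: it_eq => w _; rewrite hornerM hornerX.
by rewrite /tflux /y'; move: (L2inner _ _ _ _) (L2inner _ _ _ _) => *; ring.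
Qed.

(** The test function is itself transported, so the interior terms cancel and only initial, final
    and boundary contributions remain. *)
Lemma weak_dual p : tau T * L2inner 0 1 (z T) (zt (horner p) T) -
  tau 0 * L2inner 0 1 (z 0) (zt (horner p) 0) =
 it 0 T (fun x => g x * p.[x] - y' x * h x * p.[x - tau x]).
Proof.
have [s [gs hs]] := taylor p; have [_ e] := curve_ftc T0 (lexx T) tflux_L2 tmass_lin tflux_lin tmassE gs.
have zE x : 0 <= x -> x <= T -> zt (horner p) x = horner (pv s x).
 by move=> x0 xT; apply/funext => r; rewrite (hs x).1 pv_chi /zt teE.
rewrite !zE// -!/(tmass _ _) e; apply: it_eq => x /in_oo_le[x0 xT].
have [-> ->] := hs x; have Lx := cz.1 x x0 xT.
set P := p^`() \Po chi x.
have e1 : P * (1 - q x *: 'X) = (- q x) *: ('X * P) + P by rewrite -!mul_polyC rmorphN /=; ring.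
have e2 : (p \Po chi x)^`() = (- te x) *: P + 0 by rewrite deriv_chi addr0 scaleNr.
have e3 : 'X * ((- te x) *: P + 0) = (- te x) *: ('X * P) + 0 by rewrite !addr0 -scalerAr.
have z0 : L2inner 0 1 (z x) (horner 0) = 0.
 by apply: (lin_zero (F := fun r => L2inner 0 1 (z x) (horner r))) => *; exact: inner_lin.
rewrite /tmass /tflux e1 e2 e3 !inner_lin// z0 pv_chi0 pv_chi mulr1 teE// /y'.
by move: (L2inner _ _ _ _) (L2inner _ _ _ _) => *; ring.
Qed.

End dual_transport.

(* Dual solutions are constant along the characteristics, so they may be taken to vanish at
 time [T] while being an arbitrary function of the outgoing boundary value. *)
Lemma transport_unique z f h : L2 (- tau 0) T f -> cL 0 1 T z -> L2 0 T h ->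
 ae_eq_on 0 1 (z 0) (zt f 0) -> weak_transport T tau z f h ->
 aeon 0 T (fun t => h t = f (t - tau t)).
Proof.
move=> Lf cz Lh z0 W.
have Lf0 : L2 0 T f by apply: L2_sub Lf => //; rewrite oppr_le0 ltW.
pose k t := f (t - tau t); have [Lk _] := shift_L2 Lf; rewrite -/k in Lk.
have czf := zt_cL Lf; have Wf := transport_zt Lf.
have ab : - tau 0 < T by apply: lt_trans hT; rewrite oppr_lt0.
have Lhk : L2 0 T (h - k) by exact: (L2B Lh Lk).
(* The mismatch at the outflow, weighted by the speed of the delayed time. *)
pose e t := y' t * (h - k) t.
have Le : L2 0 T e by apply: L2_eq (L2_mulC cy' Lhk) => t _; exact: mulrC.
have [LzT LfT] := (cz.1 T T0 (lexx T), czf.1 T T0 (lexx T)).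
have Lw : L2 0 1 (z T - zt f T) by exact: (L2B LzT LfT).
have dual p : tau T * L2inner 0 1 (zt (horner p) T) (z T - zt f T) + it 0 T (fun x => e x * p.[x - tau x]) = 0.
 have Lp := L2_poly (- tau 0) T p; have [LpT _] := zt_L2 T0 (lexx T) Lp.
 have [Lps _] := shift_L2 Lp.
 have := weak_dual cz Lf0 Lh W p; have := weak_dual czf Lf0 Lk Wf p.
 have -> : L2inner 0 1 (z 0) (zt (horner p) 0) = L2inner 0 1 (zt f 0) (zt (horner p) 0).
  by apply: L2inner_ae => //; exact: aeonW.
 have i1 : ig 0 T (fun x => f x * p.[x]) by apply: L2_mul => //; exact: L2_poly.
 have i2 l : L2 0 T l -> ig 0 T (fun x => y' x * l x * p.[x - tau x]).
  move=> Ll; apply: L2_mul Lps; apply: L2_eq (L2_mulC cy' Ll) => t _; exact: mulrC.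
 rewrite !itB//; try exact: i2.
 rewrite [L2inner 0 1 _ (z T - _)](ipBr (S := L2ip 0 1) LzT LfT LpT) ![ip _ (zt (horner p) T) _]ipC.
 have -> : it 0 T (fun x => e x * p.[x - tau x]) = it 0 T (fun x => y' x * h x * p.[x - tau x]) - it 0 T (fun x => y' x * k x * p.[x - tau x]).
  rewrite -itB; try exact: i2.
  by apply: it_eq => x _; rewrite /e [(h - k) x](_ : _ = h x - k x)//; ring.
 rewrite mulrBr -!/(L2inner _ _ _ _); move: (tau T * _) (tau T * _) (tau 0 * _) (it _ _ _) (it _ _ _) (it _ _ _) => a1 a2 a3 b1 b2 b3 E1 E2.
 lra.
have e0 : aeon 0 T (fun t => e t = 0).
 apply: prim0_ae => // t1 t10 t1T.
 (* An indicator function of the delayed time: transported to time [T] it is zero on the unit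
    interval, and at the outflow it cuts the integral of [e] at time [t1]. *)
 pose c := t1 - tau t1; pose Phi (x : R) : R := if x < c then 1 else 0.
 have LPhi : L2 (- tau 0) T Phi.
  apply: (@L2_bounded _ _ _ _ 1).
   apply: (@measurable_funS _ _ _ _ setT) => //.
   apply: measurable_fun_ifT; last 2 first => //.
   by apply: measurable_fun_ltr => //; exact: measurable_cst.
  by apply: aeonW => x _; rewrite /Phi; case: ifP => _; rewrite ?normr1 ?normr0.
 have Py s : 0 <= s -> s <= T -> Phi (s - tau s) = if s < t1 then 1 else 0.
  move=> s0 sT; rewrite /Phi /c; case: (ltP s t1) => st.
   by rewrite delay_lt.
  case: ifP => // hh; move: st; rewrite le_eqVlt => /predU1P[E|st].
   by move: hh; rewrite E ltxx.
  by have := lt_trans hh (delay_lt t10 st sT); rewrite ltxx.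
 have PT rho : rho \in `]0, 1[ -> zt Phi T rho = 0.
  move=> /in_oo[r0 r1]; rewrite /zt /Phi /c; case: ifP => // hh.
  have : t1 - tau t1 <= T - tau T.
   move: t1T; rewrite le_eqVlt => /predU1P[->//|t1T]; apply: ltW; exact: delay_lt.
  have : tau T * rho < tau T by rewrite gtr_pMr// tau_gt0.
  by move: hh; move: (tau T * rho) => w h1 h2 h3; lra.
 have D0 := bnd_ext (bndD (bndZ _ (bnd_inner T0 (lexx T) Lw)) (bnd_shift (lexx T) Le)) dual LPhi.
 have z1 : L2inner 0 1 (zt Phi T) (z T - zt f T) = 0.
  by rewrite L2inner_def -[RHS](it0 0 1); apply: it_eq => rho /PT ->; rewrite mul0r.
 rewrite z1 mulr0 add0r in D0; rewrite -[RHS]D0.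
 rewrite [RHS](it_split t10 t1T (L2_mul Le (shift_L2t (lexx T) LPhi))) -[LHS]addr0; congr (_ + _).
  apply: it_eq => x /in_oo[/ltW x0 xt].
  by rewrite Py ?(le_trans (ltW xt))// xt mulr1.
 rewrite -(it0 t1 T); apply: it_eq => x /in_oo[xt /ltW xT].
 by rewrite Py ?(le_trans t10 (ltW xt))// ltNge (ltW xt) mulr0.
apply: aeonS e0 => t tI /eqP; rewrite mulf_eq0 => /orP[/eqP h0|/eqP].
 by have := y'c tI; rewrite h0 => hh; have := lt_le_trans c1 hh; rewrite ltxx.
by rewrite [(h - k) t](_ : _ = h t - k t)// => /eqP; rewrite subr_eq0 => /eqP.
Qed.

End Transport.

(** * The delayed boundary condition *)

Section Glue.
Context {R : realType}.

Lemma L2_restrict a b c d (f : R -> R) : L2 c d f -> L2 a b (f \_ `]c, d[).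
Proof.
move=> /L2P[mf iF]; apply/L2P; split.
 by apply: (@measurable_funS _ _ _ _ setT) => //; apply/mfn_restrict.
have e : (EFin \o (fun x => (f \_ `]c, d[) x ^+ 2)) = (EFin \o (fun x => f x ^+ 2)) \_ `]c, d[.
 by apply/funext => x; rewrite /= !patchE; case: ifP => //; rewrite expr0n.
rewrite /ig e; apply: (@integrableS _ _ _ (@lebesgue_measure R) setT) => //.
have mI : measurable (`]c, d[%classic : set (measurableTypeR R)) by exact: measurable_itv.
exact/(integrable_mkcond _ mI).
Qed.

(** The pieces are restricted to open intervals, so the value at [b] is 0; only almost everywhere
    classes matter. *)
Definition glue a b c (f g : R -> R) : R -> R := f \_ `]a, b[ + g \_ `]b, c[.

Lemma glue_L2 a b c f g : L2 a b f -> L2 b c g -> L2 a c (glue a b c f g).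
Proof. by move=> Lf Lg; apply: L2D; exact: L2_restrict. Qed.

Lemma glue_left a b c f g x : x \in `]a, b[ -> glue a b c f g x = f x.
Proof.
move=> xI; rewrite /glue [LHS](_ : _ = (f \_ `]a, b[) x + (g \_ `]b, c[) x)// !patchE mem_set//= memNset ?addr0//.
by move: xI; rewrite /= !in_itv/= => /andP[_ xb] /andP[bx _]; have := lt_trans xb bx; rewrite ltxx.
Qed.

Lemma glue_right a b c f g x : x \in `]b, c[ -> glue a b c f g x = g x.
Proof.
move=> xI; rewrite /glue [LHS](_ : _ = (f \_ `]a, b[) x + (g \_ `]b, c[) x)// !patchE (mem_set (xI : `]b, c[%classic x)) memNset ?add0r//.
by move: xI; rewrite /= !in_itv/= => /andP[xb _] /andP[_ bx]; have := lt_trans xb bx; rewrite ltxx.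
Qed.

Lemma nL_split (a b c : R) (f : R -> R) : a <= b -> b <= c -> L2 a c f ->
 nL a c f ^+ 2 = nL a b f ^+ 2 + nL b c f ^+ 2.
Proof. by move=> ab bc Lf; rewrite !sqr_nL (it_split ab bc)//; exact: L2_igsqr. Qed.

Lemma nL_split_le (a b c : R) (f : R -> R) : a <= b -> b <= c -> L2 a c f -> nL a c f <= nL a b f + nL b c f.
Proof.
move=> ab bc Lf; rewrite -ler_sqr ?nnegrE ?addr_ge0 ?nL_ge0// (nL_split ab bc)// sqrrD.
by rewrite addrAC lerDl mulrn_wge0// mulr_ge0 ?nL_ge0.
Qed.

End Glue.

Section Delayed.
Context {R : realType}.
Variables (L al be T Ks : R) (tau : R -> R).
Hypotheses (hL : 0 < L) (hal : 0 < al) (hT : 0 < T) (ht0 : 0 < tau 0) (Ks0 : 0 <= Ks) (hk : `|be| * Ks < al).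
Notation sh f := (fun t => f (t - tau t)).
Hypothesis shL2 : forall f, L2 (- tau 0) T f -> L2 0 T (sh f).
Hypothesis shle : forall f, L2 (- tau 0) T f -> nL 0 T (sh f) <= Ks * nL (- tau 0) T f.
Notation XX := (@X0ip R L).
Notation nX := (nX L).
Implicit Types (F G : R -> R -> R) (b g : R -> R).
Let T0 : 0 <= T. Proof. exact: ltW. Qed.
Let mt0 : - tau 0 <= 0. Proof. by rewrite oppr_le0 ltW. Qed.

Lemma weak_congr u F G g g' b b' : aeon 0 T (fun t => g t = g' t) -> aeon 0 T (fun t => b t = b' t) ->
 weak_KdV L T u F G g b -> weak_KdV L T u F G g' b'.
Proof.
move=> eg eb W t tI; have [t0 tT] := in_cc tI; have [W1 W2] := W t tI; split.
 move=> phi sp p0 pL dp; rewrite W1//; apply: it_ae.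
 by apply: aeonS (aeon_sub (lexx 0) tT eb) => s _ ->.
move=> phi sp p0 pL; rewrite W2//; apply: it_ae.
by apply: aeonS (aeon_sub (lexx 0) tT eg) => s _ ->.
Qed.

Lemma weak_diff u F G g b u' F' G' g' b' : cX L T u -> cX L T u' -> src L T F G -> src L T F' G' ->
 L2 0 T g -> L2 0 T g' -> L2 0 T b -> L2 0 T b' ->
 weak_KdV L T u F G g (fun t => - al * g t + b t) ->
 weak_KdV L T u' F' G' g' (fun t => - al * g' t + b' t) ->
 weak_KdV L T (u - u') (F - F') (G - G') (g - g') (fun t => - al * (g - g') t + (b - b') t).
Proof.
move=> cu cu' sF sF' Lg Lg' Lb Lb' W W'.
have Lgb (k : R) f h : L2 0 T f -> L2 0 T h -> L2 0 T (fun t => k * f t + h t).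
 by move=> Lf Lh; exact: (L2D (L2Z k Lf) Lh).
have := weak_sub hT cu cu' sF sF' Lg Lg' (Lgb (- al) _ _ Lg Lb) (Lgb (- al) _ _ Lg' Lb') W W'.
apply: weak_congr; first exact: aeonW.
apply: aeonW => t _; rewrite [LHS](_ : _ = (- al * g t + b t) - (- al * g' t + b' t))//.
by rewrite [(g - g') t](_ : _ = g t - g' t)// [(b - b') t](_ : _ = b t - b' t)//; ring.
Qed.

(** The transport variable is eliminated: [gam] is the history followed by the unknown trace, and
    the outflow is its value at the delayed time. *)
Definition delayed u F G (gam : R -> R) : Prop := L2 (- tau 0) T gam /\
 weak_KdV L T u F G gam (fun t => - al * gam t + be * gam (t - tau t)).

Let L2be gam : L2 (- tau 0) T gam -> L2 0 T (fun t => be * gam (t - tau t)).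
Proof. by move=> /shL2 h; exact: (L2Z be h). Qed.

Let L2r gam : L2 (- tau 0) T gam -> L2 0 T gam.
Proof. exact: L2_sub. Qed.

Let nL_be gam : L2 (- tau 0) T gam -> nL 0 T (fun t => be * gam (t - tau t)) <= `|be| * Ks * nL (- tau 0) T gam.
Proof.
move=> Lg; have -> : (fun t => be * gam (t - tau t)) = be *: (sh gam) by [].
rewrite /nL (nrmZ (S := L2ip 0 T) _ (shL2 Lg)) -mulrA ler_wpM2l//; exact: shle.
Qed.

(** Compare with the solution [v] having the same initial value and source but no feedback. The
    sharp trace bound applies to the difference, and the part of the feedback due to the unknown
    trace is absorbed because [kap] is less than [al]. *)
Lemma delay_estimates : exists2 C : R, 0 <= C & forall u F G gam m, cX L T u -> src L T F G ->
 delayed u F G gam -> ig 0 T m -> aeon 0 T (fun t => nX (F t, G t) <= m t) ->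
 let D := nX (u 0) ^+ 2 + it 0 T m ^+ 2 + nL (- tau 0) 0 gam ^+ 2 in
 aeon 0 T (fun t => H1 0 L (u t).1 /\ H1 0 L (u t).2) /\ exists N,
 [/\ mfn 0 T N /\ aeon 0 T (fun t => nX (pair_wderiv L (u t)) = N t),
   forall t, 0 <= t -> t <= T -> nX (u t) ^+ 2 <= C * D, nL 0 T gam ^+ 2 <= C * D,
   ig 0 T (fun t => N t ^+ 2) & it 0 T (fun t => N t ^+ 2) <= C * D].
Proof.
have [C1 C10 h1] := lin_estimates hL hal hT; have [C2 C20 h2] := lin_exists hL hal hT.
pose kap := `|be| * Ks; have kap0 : 0 <= kap by rewrite mulr_ge0.
(* The margin left after absorption; the constants depend on it through [al / rho]. *)
pose rho := al - kap; have rho0 : 0 < rho by rewrite subr_gt0.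
pose ar := al / rho; have ar0 : 0 <= ar by rewrite divr_ge0// ltW.
pose A := 2 * ar ^+ 2 * (C2 + 1).
have A0 : 0 <= A by rewrite mulr_ge0 ?addr_ge0// mulr_ge0// sqr_ge0.
pose B := 1 + 2 * al ^+ 2 * (1 + A).
have B0 : 0 <= B by rewrite addr_ge0// mulr_ge0 ?addr_ge0// mulr_ge0// sqr_ge0.
exists (C1 * B + A); first by rewrite addr_ge0// mulr_ge0.
move=> u F G gam m cu sF [Lgam W] im hm D.
have Lg := L2r Lgam; have Lb := L2be Lgam.
have Du0 : in_X0 L (u 0) by apply: cu.1.
have Lz0 : L2 0 T (0 : R -> R) by exact: (L2_cst 0 T 0).
have [v [g1 [N1 [cv v0 Lg1 Wv [_ _ bv _]]]]] := h2 (u 0) F G 0 Du0 sF Lz0.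
have [_ bg1 _ _] := bv m im hm.
pose D1 := nX (u 0) ^+ 2 + it 0 T m ^+ 2.
have D10 : 0 <= D1 by rewrite addr_ge0 ?sqr_ge0.
have {}bg1 : nL 0 T g1 ^+ 2 <= C2 * D1.
 apply: le_trans bg1 _; rewrite [nL 0 T 0](nrm0 (L2ip 0 T)) expr0n addr0 -/D1; by [].
pose x := nL 0 T gam; pose z := nL (- tau 0) 0 gam.
have x0 : 0 <= x by exact: nL_ge0. have z0 : 0 <= z by exact: nL_ge0.
have DE : D = D1 + z ^+ 2 by [].
have nb : nL 0 T (fun t => be * gam (t - tau t)) <= kap * (z + x).
 by apply: (le_trans (nL_be Lgam)); rewrite ler_wpM2l//; exact: nL_split_le.
have Wd := weak_diff cu cv sF sF Lg Lg1 Lb Lz0 W Wv.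
have Lb' : L2 0 T ((fun t => be * gam (t - tau t)) - 0) by exact: (L2B Lb Lz0).
have Lgg : L2 0 T (gam - g1) by exact: (L2B Lg Lg1).
have [N' [_ _ _ tr]] := h1 _ _ _ _ _ (cX_sub cu cv) (src_sub sF sF) Lgg Lb' Wd.
have Dv0 : in_X0 L (v 0) by apply: cv.1.
have d0 : nX ((u - v) 0) = 0.
 have := X0_eq_nX v0; rewrite (nX_distC Dv0 Du0); exact.
have F0 : aeon 0 T (fun t => nX ((F - F) t, (G - G) t) = 0).
 apply: aeonW => t _; have -> : ((F - F) t, (G - G) t) = 0 :> pairs R by rewrite !subrr.
 exact: (nrm0 XX).
have {}tr := tr d0 F0; rewrite subr0 in tr.
have tri : x <= nL 0 T g1 + nL 0 T (gam - g1).
 by have /dist_le[] := nrm_dist (S := L2ip 0 T) Lg Lg1; rewrite -!/(nL _ _ _) => h _.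
have alx : rho * x <= al * nL 0 T g1 + kap * z.
 have a1 : al * x <= al * nL 0 T g1 + al * nL 0 T (gam - g1) by rewrite -mulrDr ler_wpM2l// ltW.
 rewrite /rho mulrBl; move: nb tr a1; rewrite mulrDr; move: (kap * z) (kap * x) (al * x) (al * nL _ _ g1) (al * nL _ _ _) (nL _ _ _) => *; lra.
have xle : x <= ar * (nL 0 T g1 + z).
 rewrite /ar mulrAC ler_pdivlMr// mulrC; apply: (le_trans alx); rewrite mulrDr lerD2l ler_wpM2r//; exact: ltW.
have D1D : D1 <= D by rewrite DE lerDl sqr_ge0.
have D0 : 0 <= D by rewrite DE addr_ge0 ?sqr_ge0.
have sq2 (p r : R) : (p + r) ^+ 2 <= 2 * (p ^+ 2 + r ^+ 2).
 by have := sqr_ge0 (p - r); rewrite sqrrB sqrrD; move: (p ^+ 2) (r ^+ 2) (p * r) => *; lra.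
have x2 : x ^+ 2 <= A * D.
 apply: (@le_trans _ _ ((ar * (nL 0 T g1 + z)) ^+ 2)).
  by rewrite ler_sqr ?nnegrE// mulr_ge0// addr_ge0// nL_ge0.
 have -> : A * D = ar ^+ 2 * (2 * ((C2 + 1) * D)) by rewrite /A; ring.
 rewrite exprMn ler_wpM2l ?sqr_ge0//.
 apply: (le_trans (sq2 _ _)); rewrite ler_wpM2l// DE.
 have c1 : C2 * D1 <= C2 * (D1 + z ^+ 2) by rewrite ler_wpM2l// lerDl sqr_ge0.
 by rewrite mulrDl mul1r; apply: lerD; [exact: le_trans bg1 c1|rewrite lerDr].
have b2 : nL 0 T (fun t => be * gam (t - tau t)) ^+ 2 <= 2 * al ^+ 2 * (1 + A) * D.
 apply: (@le_trans _ _ ((al * (z + x)) ^+ 2)).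
  rewrite ler_sqr ?nnegrE ?nL_ge0 ?mulr_ge0 ?addr_ge0 ?(ltW hal)//.
  by apply: (le_trans nb); rewrite ler_wpM2r ?addr_ge0// ltW.
 have -> : 2 * al ^+ 2 * (1 + A) * D = al ^+ 2 * (2 * ((1 + A) * D)) by ring.
 rewrite exprMn ler_wpM2l ?sqr_ge0//.
 apply: (le_trans (sq2 _ _)); rewrite ler_wpM2l// mulrDl mul1r.
 by apply: lerD => //; rewrite DE lerDr.
have [N [hH hN bd _]] := h1 _ _ _ _ _ cu sF Lg Lb W.
have [b3 b4 b5 b6] := bd m im hm.
have DD : C1 * (nX (u 0) ^+ 2 + it 0 T m ^+ 2 + nL 0 T (fun t => be * gam (t - tau t)) ^+ 2) <= C1 * B * D.
 rewrite -mulrA ler_wpM2l// /B mulrDl mul1r; apply: lerD; [exact: D1D|exact: b2].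
have DC : C1 * B * D <= (C1 * B + A) * D by rewrite mulrDl lerDl mulr_ge0.
split => //; exists N; split => //.
- by move=> t t0 tT; apply: (le_trans (b3 t t0 tT)); exact: le_trans DD DC.
- by apply: (le_trans x2); rewrite mulrDl lerDr mulr_ge0// mulr_ge0.
- by apply: (le_trans b6); exact: le_trans DD DC.
Qed.

(** Fixed point of the map that sends a guessed trace to the trace of the solution it drives.
    Differences of outputs have zero initial value and source, so the ratio is [kap / al < 1]; it
    involves [T] only through [Ks], and the whole time interval is treated at once. *)
Lemma delay_exists u0 F G z0 : in_X0 L u0 -> src L T F G -> L2 (- tau 0) 0 z0 ->
 exists u gam, [/\ cX L T u, X0_eq L (u 0) u0, ae_eq_on (- tau 0) 0 gam z0 & delayed u F G gam].
Proof.
move=> D0 sF Lz; have [C2 C20 h2] := lin_exists hL hal hT; have [C1 C10 h1] := lin_estimates hL hal hT.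
pose gl g := glue (- tau 0) 0 T z0 g.
have Lgl g : L2 0 T g -> L2 (- tau 0) T (gl g) by exact: glue_L2.
have ex g : exists p : (R -> pairs R) * (R -> R), L2 0 T g -> [/\ cX L T p.1, X0_eq L (p.1 0) u0, L2 0 T p.2 &
  weak_KdV L T p.1 F G p.2 (fun t => - al * p.2 t + be * gl g (t - tau t))].
 have [Lg|ng] := pselect (L2 0 T g); last by exists (0, 0) => /ng.
 have [u [g' [N [cu u0' Lg' W _]]]] := h2 u0 F G _ D0 sF (L2be (Lgl g Lg)).
 by exists (u, g').
have /choice[S hS] := ex.
pose kap := `|be| * Ks; have kap0 : 0 <= kap by rewrite mulr_ge0.
have contr g h : L2 0 T g -> L2 0 T h -> nL 0 T ((S g).2 - (S h).2) <= kap / al * nL 0 T (g - h).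
 move=> Lg Lh; have [cu u0' Lg' W] := hS g Lg; have [cv v0' Lh' W'] := hS h Lh.
 have Lb := L2be (Lgl g Lg); have Lb' := L2be (Lgl h Lh).
 have Wd := weak_diff cu cv sF sF Lg' Lh' Lb Lb' W W'.
 have Lgg : L2 0 T ((S g).2 - (S h).2) by exact: (L2B Lg' Lh').
 have Lbb := L2B Lb Lb'.
 have [_ [_ _ _ tr]] := h1 _ _ _ _ _ (cX_sub cu cv) (src_sub sF sF) Lgg Lbb Wd.
 have Du : in_X0 L ((S g).1 0) by apply: cu.1. have Dv : in_X0 L ((S h).1 0) by apply: cv.1.
 have d0 : nX (((S g).1 - (S h).1) 0) = 0.
  have t1 := nX_triangle Du D0 Dv; rewrite (nX_distC D0 Dv) in t1.
  have e1 := X0_eq_nX u0'; have e2 := X0_eq_nX v0'; rewrite -!/(nX _) e1 e2 addr0 in t1.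
  by apply/eqP; rewrite eq_le nX_ge0 andbT.
 have F0 : aeon 0 T (fun t => nX ((F - F) t, (G - G) t) = 0).
  apply: aeonW => t _; have -> : ((F - F) t, (G - G) t) = 0 :> pairs R by rewrite !subrr.
  exact: (nrm0 XX).
 have {}tr := tr d0 F0; rewrite mulrAC ler_pdivlMr// mulrC; apply: (le_trans tr).
 have -> : (fun t => be * gl g (t - tau t)) - (fun t => be * gl h (t - tau t)) = (fun t => be * (gl g - gl h) (t - tau t)).
  by apply/funext => t; rewrite [LHS](_ : _ = be * gl g (t - tau t) - be * gl h (t - tau t))// -mulrBr.
 have LD := L2B (Lgl g Lg) (Lgl h Lh).
 apply: (le_trans (nL_be LD)); rewrite ler_wpM2l//.
 apply: (le_trans (nL_split_le mt0 T0 LD)).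
 rewrite (nL_eq (a := - tau 0) (b := 0) (g := 0)) => [|x xI]; last first.
  by rewrite [LHS](_ : _ = gl g x - gl h x)// /gl !glue_left// subrr.
 rewrite [nL _ _ 0](nrm0 (L2ip _ _)) add0r.
 rewrite (nL_eq (g := g - h))// => x xI.
 by rewrite [LHS](_ : _ = gl g x - gl h x)// /gl !glue_right.
have q0 : 0 <= kap / al by rewrite divr_ge0// ltW.
have q1 : kap / al < 1 by rewrite ltr_pdivrMr// mul1r.
pose gs n := iter n (fun g => (S g).2) (0 : R -> R).
have Lgs n : L2 0 T (gs n).
 elim: n => [|n IH]; first exact: (L2_cst 0 T 0).
 by have [_ _ h _] := hS _ IH.
have step n : nrm (L2ip 0 T) (gs n.+1 - gs n) <= nL 0 T (gs 1%N - gs 0%N) * (kap / al) ^+ n.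
 elim: n => [|n IH]; first by rewrite expr0 mulr1.
 apply: (le_trans (contr _ _ (Lgs n.+1) (Lgs n))).
 by rewrite exprS mulrCA ler_wpM2l.
have [g Lg cg] := L2_complete Lgs (geometric_cauchy (S := L2ip 0 T) (nL_ge0 0 T _) q0 q1 Lgs step).
have [cu u0' LSg W] := hS g Lg.
have fix0 : nL 0 T ((S g).2 - g) = 0.
 apply/eqP; rewrite eq_le nL_ge0 andbT; apply/ler_addgt0Pr => e e0; rewrite add0r.
 have e2 : 0 < e / 2 by lra.
 have [n hn] := cg _ e2.
 have t1 := nL_triangle LSg (Lgs n.+1) Lg.
 have t2 := contr g (gs n) Lg (Lgs n).
 have t3 := hn n.+1 (leqnSn n); have t4 := hn n (leqnn n).
 rewrite (nL_distC (Lgs n) Lg) -/(nL _ _ _) in t4.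
 have t5 : kap / al * nL 0 T (g - gs n) <= nL 0 T (g - gs n) by rewrite ler_piMl ?nL_ge0// ltW.
 rewrite -!/(nL _ _ _) in t1; move: t1 t2 t3 t4 t5; rewrite [(S (gs n)).2](_ : _ = gs n.+1)//.
 move=> t1 t2 t3 t4 t5; apply: (le_trans t1); have -> : e = e / 2 + e / 2 by field.
 apply: lerD t3; apply: (le_trans t2); exact: le_trans t5 t4.
have eqg : aeon 0 T (fun t => (S g).2 t = gl g t).
 apply: aeonS (nL_eq0_aeeq LSg Lg fix0) => t tI ->; by rewrite /gl glue_right.
exists (S g).1, (gl g); split => //.
- by apply: aeonW => x xI; rewrite /gl glue_left.
- split; first exact: Lgl.
 apply: weak_congr W => //.
 by apply: aeonS eqg => t _ ->.
Qed.

End Delayed.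

(** * The nonlinear sources *)

Opaque wderiv.

Section Sources.
Context {R : realType}.
Variables (L : R).
Hypothesis hL : 0 < L.
Notation XX := (@X0ip R L).
Notation nX := (nX L).
Notation wd := (wderiv 0 L).
Let L0 : 0 <= L. Proof. exact: ltW. Qed.

Lemma nL_mulb (f g : R -> R) (K : R) : 0 <= K -> L2 0 L f -> mfn 0 L g ->
 aeon 0 L (fun x => `|g x| <= K) -> nL 0 L (fun x => g x * f x) <= K * nL 0 L f.
Proof.
move=> K0 Lf mg hg; rewrite -[X in X * _](ger0_norm K0) -(nrmZ (S := L2ip 0 L) K Lf) -/(nL _ _ _).
apply: nL_mono; [exact: L2_mulb Lf mg hg|exact: L2Z|].
apply: aeonS hg => x _ h; rewrite [(K *: f) x](_ : _ = K * f x)// !normrM ler_wpM2r//.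
by rewrite (ger0_norm K0).
Qed.

Lemma isH1_sub f f' g g' : isH1 0 L f f' -> isH1 0 L g g' -> isH1 0 L (f - g) (f' - g').
Proof.
move=> /isH1E[Lf Lf' hf] /isH1E[Lg Lg' hg]; apply/isH1E; split.
- exact: (L2B Lf Lg).
- exact: (L2B Lf' Lg').
- move=> phi tphi; have c1 := test_cts tphi; have c2 := smooth_cts (smooth_deriv tphi.1).
 have L1 := L2_continuous 0 L c1; have L2' := L2_continuous 0 L c2.
 have e1 : it 0 L (fun x => (f - g) x * derive1 phi x) = it 0 L (fun x => f x * derive1 phi x) - it 0 L (fun x => g x * derive1 phi x).
  rewrite -itB; try exact: L2_mul.
  by apply: it_eq => x _; rewrite -mulrBl.
 have e2 : it 0 L (fun x => (f' - g') x * phi x) = it 0 L (fun x => f' x * phi x) - it 0 L (fun x => g' x * phi x).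
  rewrite -itB; try exact: L2_mul.
  by apply: it_eq => x _; rewrite -mulrBl.
 by rewrite e1 e2 addrACA -opprD hf// hg// subrr.
Qed.

Definition pH1 (w : pairs R) : Prop := H1 0 L w.1 /\ H1 0 L w.2.
Notation pw := (pair_wderiv L).

Lemma pH1_X0 w : pH1 w -> in_X0 L w /\ in_X0 L (pw w).
Proof.
move=> [h1 h2]; have [a1 b1 _] := wderivP h1; have [a2 b2 _] := wderivP h2.
by split; split.
Qed.

Lemma pH1_sub v w : pH1 v -> pH1 w -> pH1 (v - w) /\ nX (pw (v - w)) = nX (pw v - pw w).
Proof.
move=> [v1 v2] [w1 w2].
have h1 := isH1_sub (wderivP v1) (wderivP w1); have h2 := isH1_sub (wderivP v2) (wderivP w2).
have H : pH1 (v - w) by split; apply/H1P; [exists (wd v.1 - wd w.1); exact: h1|exists (wd v.2 - wd w.2); exact: h2].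
split; first exact: H.
have [k1 k2] := H.
have e1 := nL_ae (isH1_uniq hL (wderivP k1) h1).
have e2 := nL_ae (isH1_uniq hL (wderivP k2) h2).
exact: (@nX_pair_eq R L (pw (v - w)) (pw v - pw w) e1 e2).
Qed.

Definition hn (w : pairs R) : R := nX w + nX (pw w).

(** The sources at a fixed time: at [u t] this is, by conversion, the pair of [source_eta L u t] and
    [source_omega L u t]. *)
Definition Sou (w : pairs R) : pairs R :=
 (- wd (fun x => w.1 x * w.2 x), fun x => - (w.2 x * wd w.2 x)).

Lemma hn_ge0 w : 0 <= hn w. Proof. by rewrite addr_ge0 ?nX_ge0. Qed.

Lemma sup_bound : exists2 c : R, 0 <= c & forall w, pH1 w ->
 aeon 0 L (fun x => `|w.1 x| <= c * hn w) /\ aeon 0 L (fun x => `|w.2 x| <= c * hn w).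
Proof.
have [c c0 hc] := isH1_bound hL; exists c => // w [h1 h2]; split.
 apply: aeonS (hc _ _ (wderivP h1)) => x _ h; apply: (le_trans h); rewrite ler_wpM2l//.
 by apply: lerD; [exact: nX1|exact: (nX1 L (pw w))].
apply: aeonS (hc _ _ (wderivP h2)) => x _ h; apply: (le_trans h); rewrite ler_wpM2l//.
by apply: lerD; [exact: nX2|exact: (nX2 L (pw w))].
Qed.

Lemma Sou_X0 w : pH1 w -> in_X0 L (Sou w).
Proof.
move=> H; have [h1 h2] := H; have [c c0 hc] := sup_bound; have [_ b2] := hc w H.
have hm := isH1_mul hL (wderivP h1) (wderivP h2).
have Hm : H1 0 L (fun x => w.1 x * w.2 x) by apply/H1P; eexists; exact: hm.
have [_ Lm _] := wderivP Hm; have [L2' Lw2 _] := wderivP h2.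
split; first exact: (domN (S := L2ip 0 L) Lm).
exact: (domN (S := L2ip 0 L) (L2_mulb Lw2 (L2_mfn L2') b2)).
Qed.

Lemma mul_est (c k l : R) (f g : R -> R) : 0 <= c -> 0 <= k -> L2 0 L f -> L2 0 L g ->
 aeon 0 L (fun x => `|g x| <= c * k) -> nL 0 L f <= l ->
 L2 0 L (fun x => g x * f x) /\ nL 0 L (fun x => g x * f x) <= c * k * l.
Proof.
move=> c0 k0 Lf Lg bg nf; have ck : 0 <= c * k by exact: mulr_ge0.
split; first exact: L2_mulb Lf (L2_mfn Lg) bg.
by apply: (le_trans (nL_mulb ck Lf (L2_mfn Lg) bg)); rewrite ler_wpM2l.
Qed.

Lemma two_products (c k l k' l' : R) (f g f' g' : R -> R) : 0 <= c -> 0 <= k -> 0 <= k' ->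
 L2 0 L f -> L2 0 L g -> aeon 0 L (fun x => `|g x| <= c * k) -> nL 0 L f <= l ->
 L2 0 L f' -> L2 0 L g' -> aeon 0 L (fun x => `|g' x| <= c * k') -> nL 0 L f' <= l' ->
 L2 0 L (fun x => g x * f x + g' x * f' x) /\
 nL 0 L (fun x => g x * f x + g' x * f' x) <= c * k * l + c * k' * l'.
Proof.
move=> c0 k0 k0' Lf Lg bg nf Lf' Lg' bg' nf'.
have [p1 q1] := mul_est c0 k0 Lf Lg bg nf; have [p2 q2] := mul_est c0 k0' Lf' Lg' bg' nf'.
split; first exact: (L2D p1 p2).
exact: (le_trans (nrmD (S := L2ip 0 L) p1 p2) (lerD q1 q2)).
Qed.

Lemma six_terms (c a b h : R) : 0 <= c -> 0 <= a -> 0 <= b -> 0 <= h ->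
 c * a * h + c * h * b + (c * h * a + c * b * h) + (c * h * a + c * b * h) <= 6 * c * (a + b) * h.
Proof.
move=> c0 a0 b0 h0.
have -> : c * a * h + c * h * b + (c * h * a + c * b * h) + (c * h * a + c * b * h) =
 3 * (c * a * h) + 3 * (c * b * h) by ring.
have -> : 6 * c * (a + b) * h = 6 * (c * a * h) + 6 * (c * b * h) by ring.
have : 0 <= c * a * h by rewrite !mulr_ge0.
have : 0 <= c * b * h by rewrite !mulr_ge0.
by move: (c * a * h) (c * b * h) => *; lra.
Qed.

(** The sources are quadratic, so a difference is a sum of products in which one pair is replaced by
    [v - w]. In each product the undifferentiated factor is bounded uniformly and the other stays in
    L^2. *)
Lemma Sou_diff : exists2 K : R, 0 <= K & forall v w, pH1 v -> pH1 w ->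
 nX (Sou v - Sou w) <= K * (hn v + hn w) * hn (v - w).
Proof.
have [c c0 hc] := sup_bound; exists (6 * c); first by rewrite mulr_ge0.
move=> v w Hv Hw; have [Hd ed] := pH1_sub Hv Hw.
have [bv1 bv2] := hc v Hv; have [bw1 bw2] := hc w Hw; have [bd1 bd2] := hc _ Hd.
have [v1 v2] := Hv; have [w1 w2] := Hw.
have [Lv1 Lv1' _] := wderivP v1; have [Lv2 Lv2' _] := wderivP v2.
have [Lw1 Lw1' _] := wderivP w1; have [Lw2 Lw2' _] := wderivP w2.
have hmv := isH1_mul hL (wderivP v1) (wderivP v2); have hmw := isH1_mul hL (wderivP w1) (wderivP w2).
have Hmv : H1 0 L (fun x => v.1 x * v.2 x) by apply/H1P; eexists; exact: hmv.
have Hmw : H1 0 L (fun x => w.1 x * w.2 x) by apply/H1P; eexists; exact: hmw.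
have ev' := isH1_uniq hL (wderivP Hmv) hmv; have ew' := isH1_uniq hL (wderivP Hmw) hmw.
have LB (f g : R -> R) : L2 0 L f -> L2 0 L g -> L2 0 L (f - g) by exact: (@domB _ _ (L2ip 0 L)).
have h0 := hn_ge0 (v - w); have a0 := hn_ge0 v; have b0 := hn_ge0 w.
have hw (z : pairs R) : nX (pw z) <= hn z by rewrite /hn lerDr; exact: nX_ge0.
have nd1 : nL 0 L (wd v.1 - wd w.1) <= hn (v - w) by apply: (le_trans (nX1 L (pw v - pw w))); rewrite -ed; exact: hw.
have nd2 : nL 0 L (wd v.2 - wd w.2) <= hn (v - w) by apply: (le_trans (nX2 L (pw v - pw w))); rewrite -ed; exact: hw.
have nw1 : nL 0 L (wd w.1) <= hn w by exact: (le_trans (nX1 L (pw w)) (hw w)).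
have nv2 : nL 0 L (wd v.2) <= hn v by exact: (le_trans (nX2 L (pw v)) (hw v)).
have [p1 q1] := two_products c0 a0 h0 (LB _ _ Lv1' Lw1') Lv2 bv2 nd1 Lw1' (LB _ _ Lv2 Lw2) bd2 nw1.
have [p2 q2] := two_products c0 h0 b0 Lv2' (LB _ _ Lv1 Lw1) bd1 nv2 (LB _ _ Lv2' Lw2') Lw1 bw1 nd2.
have [p3 q3] := two_products c0 h0 b0 Lv2' (LB _ _ Lv2 Lw2) bd2 nv2 (LB _ _ Lv2' Lw2') Lw2 bw2 nd2.
have N1 : nL 0 L (Sou v - Sou w).1 <= c * hn v * hn (v - w) + c * hn (v - w) * hn w + (c * hn (v - w) * hn v + c * hn w * hn (v - w)).
 apply: le_trans (lerD q1 q2); apply: le_trans (nrmD (S := L2ip 0 L) p1 p2).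
 rewrite -(nrmN (S := L2ip 0 L) (L2D p1 p2)); apply: ler_eq.
 apply: nL_ae; apply: aeonS2 ev' ew' => x _ e1 e2.
 rewrite [LHS](_ : _ = - wd (fun x => v.1 x * v.2 x) x - (- wd (fun x => w.1 x * w.2 x) x)); last exact: erefl.
 rewrite e1 e2 [RHS](_ : _ = - (v.2 x * (wd v.1 x - wd w.1 x) + (v.2 x - w.2 x) * wd w.1 x +
   ((v.1 x - w.1 x) * wd v.2 x + w.1 x * (wd v.2 x - wd w.2 x)))); last exact: erefl.
 move: (wd v.1 x) (wd v.2 x) (wd w.1 x) (wd w.2 x) => *; ring.
have N2 : nL 0 L (Sou v - Sou w).2 <= c * hn (v - w) * hn v + c * hn w * hn (v - w).
 apply: le_trans q3.
 rewrite /nL -(nrmN (S := L2ip 0 L) p3); apply: ler_eq.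
 apply: nL_eq => x _.
 rewrite [LHS](_ : _ = - (v.2 x * wd v.2 x) - (- (w.2 x * wd w.2 x))); last exact: erefl.
 rewrite [RHS](_ : _ = - ((v.2 x - w.2 x) * wd v.2 x + w.2 x * (wd v.2 x - wd w.2 x))); last exact: erefl.
 move: (wd v.2 x) (wd w.2 x) => *; ring.
exact: (le_trans (nX_le L (Sou v - Sou w)) (le_trans (lerD N1 N2) (six_terms c0 a0 b0 h0))).
Qed.

Lemma Sou0 : pH1 0 /\ hn 0 = 0 /\ nX (Sou 0) = 0.
Proof.
have h0 : isH1 0 L (0 : R -> R) 0.
 apply/isH1E; split; try exact: (L2_cst 0 L 0).
 by move=> phi _; rewrite (it_eq (g := fun=> 0)) ?[X in _ + X](it_eq (g := fun=> 0)) ?it0 ?addr0// => x _; exact: mul0r.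
have H0 : H1 0 L (0 : R -> R) by apply/H1P; exists 0.
have e0 : nL 0 L (wd (0 : R -> R)) = 0 by rewrite (nL_ae (isH1_uniq hL (wderivP H0) h0)); exact: (nrm0 (L2ip 0 L)).
have p0 : nX (pw 0) = 0.
 have a1 : nL 0 L (pw 0).1 = 0 by exact: e0.
 have a2 : nL 0 L (pw 0).2 = 0 by exact: e0.
 apply/eqP; rewrite eq_le nX_ge0 andbT; apply: (le_trans (nX_le L (pw 0))).
 by rewrite a1 ?a2 addr0.
split; first by split.
split; first by rewrite /hn p0 [nX 0](nrm0 XX) addr0.
have z : (fun x => (0 : pairs R).1 x * (0 : pairs R).2 x) = 0 :> (R -> R) by apply/funext => x; exact: mul0r.
have [_ L0' _] := wderivP H0.
have q1 : nL 0 L (Sou 0).1 = 0 by rewrite /Sou /= z [nL _ _ _](nrmN (S := L2ip 0 L) L0').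
have q2 : nL 0 L (Sou 0).2 = 0.
 rewrite (nL_eq (g := 0)); first exact: (nrm0 (L2ip 0 L)).
 by move=> x _; rewrite [LHS](_ : _ = - (0 * wd 0 x))// mul0r oppr0.
by apply/eqP; rewrite -sqrf_eq0 sqr_nX q1 q2 expr0n addr0.
Qed.

Definition bil (e : {poly R}) (f g : R -> R) : R := it 0 L (fun x => f x * (g x * e.[x])).

Lemma bil_diff e : exists2 E : R, 0 <= E & forall f g f' g', L2 0 L f -> L2 0 L g -> L2 0 L f' -> L2 0 L g' ->
 `|bil e f g - bil e f' g'| <= E * (nL 0 L (f - f') * nL 0 L g + nL 0 L f' * nL 0 L (g - g')).
Proof.
have [E E0 hE] := continuous_bounded 0 L (@continuous_horner R e); exists E => // f g f' g' Lf Lg Lf' Lg'.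
have me : mfn 0 L (horner e) by exact: L2_mfn (L2_poly 0 L e).
have be : aeon 0 L (fun x => `|e.[x]| <= E) by apply: aeonW => x /in_oo_le[x0 xL]; exact: hE.
have ge k : L2 0 L k -> L2 0 L (fun x => k x * e.[x]) /\ nL 0 L (fun x => k x * e.[x]) <= E * nL 0 L k.
 move=> Lk; have eq : {in `]0, L[, (fun x => e.[x] * k x) =1 (fun x => k x * e.[x])} by move=> x _; exact: mulrC.
 by split; [exact: L2_eq eq (L2_mulb Lk me be)|rewrite -(nL_eq eq); exact: nL_mulb].
have Lff := L2B Lf Lf'; have Lgg := L2B Lg Lg'.
have [g1 g2] := ge _ Lg; have [g3 g4] := ge _ Lgg; have [g5 _] := ge _ Lg'.
have -> : bil e f g - bil e f' g' = it 0 L (fun x => (f - f') x * (g x * e.[x])) + it 0 L (fun x => f' x * ((g - g') x * e.[x])).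
 have i1 := L2_mul Lf g1; have i2 := L2_mul Lf' g5.
 rewrite /bil -(itB i1 i2) -(itD (L2_mul Lff g1) (L2_mul Lf' g3)).
 by apply: it_eq => x _; rewrite [(f - f') x](_ : _ = f x - f' x)// [(g - g') x](_ : _ = g x - g' x)//; ring.
apply: (le_trans (ler_normD _ _)); rewrite mulrDr; apply: lerD.
 by apply: (le_trans (it_mul_le Lff g1)); rewrite mulrCA ler_wpM2l ?nL_ge0.
by apply: (le_trans (it_mul_le Lf' g3)); rewrite mulrCA ler_wpM2l ?nL_ge0.
Qed.

Section curve.
Variable T : R.
Hypothesis hT : 0 < T.
Let T0 : 0 <= T. Proof. exact: ltW. Qed.

(** Quadratic functionals are Lipschitz on bounded sets only, which suffices along a bounded
    curve. *)
Lemma cX_fun_ball u (Q : pairs R -> R) (K B : R) : cX L T u -> 0 <= K ->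
 (forall t, 0 <= t -> t <= T -> nX (u t) <= B) ->
 (forall v w, in_X0 L v -> in_X0 L w -> nX v <= B -> nX w <= B -> `|Q v - Q w| <= K * nX (v - w)) ->
 continuous (fun t => Q (u (clamp 0 T t))).
Proof.
move=> cu K0 hB hQ t; apply/cvgrPdist_le => e e0.
have k1 : 0 < K + 1 by rewrite ltr_wpDl.
have [t1 t2] := clamp_itv t T0.
have [d d0 hd] := cu.2 _ _ t1 t2 (divr_gt0 e0 k1).
exists d => // s /= sd; have [s1 s2] := clamp_itv s T0.
have := hd _ s1 s2 (le_lt_trans (clamp_lip 0 T s t) _); rewrite distrC => /(_ sd) h.
rewrite distrC; apply: (le_trans (hQ _ _ _ _ _ _)); try (by [exact: cu.1|exact: hB]).
by apply: (le_trans (ler_wpM2l K0 h)); apply: frac_le => //; exact: ltW.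
Qed.

Lemma bil_cont u e (i j : bool) : cX L T u ->
 continuous (fun t => bil e (if i then (u (clamp 0 T t)).1 else (u (clamp 0 T t)).2) (if j then (u (clamp 0 T t)).1 else (u (clamp 0 T t)).2)).
Proof.
move=> cu; have [B B0 hB] := cX_bounded hT cu; have [E E0 hE] := bil_diff e.
apply: (@cX_fun_ball u (fun w => bil e (if i then w.1 else w.2) (if j then w.1 else w.2)) (E * (B + B)) B cu) => //.
 by rewrite mulr_ge0// addr_ge0.
move=> v w [v1 v2] [w1 w2] nv nw.
have S (k : bool) (z : pairs R) : nL 0 L (if k then z.1 else z.2) <= nX z by case: k; [exact: nX1|exact: nX2].
have D (k : bool) : (if k then v.1 else v.2) - (if k then w.1 else w.2) = if k then (v - w).1 else (v - w).2 by case: k.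
have Z (k : bool) z : in_X0 L z -> L2 0 L (if k then z.1 else z.2) by case: k => -[].
have Dv : in_X0 L v by split. have Dw : in_X0 L w by split.
apply: (le_trans (hE _ _ _ _ (Z i v Dv) (Z j v Dv) (Z i w Dw) (Z j w Dw))).
rewrite -mulrA ler_wpM2l// mulrDl; apply: lerD.
 by rewrite mulrC; apply: ler_pM; rewrite ?nL_ge0//; [exact: le_trans (S _ _) nv|rewrite D].
by apply: ler_pM; rewrite ?nL_ge0//; [exact: le_trans (S _ _) nw|rewrite D].
Qed.

Lemma L2inner_bil e f g : L2inner 0 L (fun x => f x * g x) (horner e) = bil e f g.
Proof. by rewrite L2inner_def; apply: it_eq => x _; rewrite mulrA. Qed.

Definition aH1 (u : R -> pairs R) := aeon 0 T (fun t => pH1 (u t)).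

(** Integration by parts turns the coefficient of the derivative into a pairing of the curve itself,
    which is continuous in time. *)
Lemma cX_coef u (i : bool) : cX L T u -> aH1 u ->
 ccoef L T (fun t => wd (if i then (u t).1 else (u t).2)).
Proof.
move=> cu hu e [e0 eL].
pose w : pairs R := if i then (horner e^`(), 0) else (0, horner e^`()).
have Dw : in_X0 L w.
 by rewrite /w; case: (i); split; [exact: L2_poly|exact: (L2_cst 0 L 0)|exact: (L2_cst 0 L 0)|exact: L2_poly].
exists (fun t => - ip XX (u (clamp 0 T t)) w).
 by move=> t; apply: cvgN; exact: (cX_ip hT cu Dw).
apply: aeonS hu => t /in_oo_le[t0 tT] [h1 h2]; rewrite clamp_id//.
have E1 (v : pairs R) f : ip XX v (f, 0) = L2inner 0 L v.1 f.
 by rewrite [LHS](_ : _ = L2inner 0 L v.1 f + L2inner 0 L v.2 0)// L2inner0r addr0.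
have E2 (v : pairs R) f : ip XX v (0, f) = L2inner 0 L v.2 f.
 by rewrite [LHS](_ : _ = L2inner 0 L v.1 0 + L2inner 0 L v.2 f)// L2inner0r add0r.
rewrite /w; case: (i); rewrite ?E1 ?E2.
 exact: isH1_ibp hL (wderivP h1) e0 eL.
exact: isH1_ibp hL (wderivP h2) e0 eL.
Qed.

Lemma wderiv_measurable u : cX L T u -> aH1 u ->
 exists N, mfn 0 T N /\ aeon 0 T (fun t => nX (pw (u t)) = N t).
Proof.
move=> cu hu.
have D1 : aeon 0 T (fun t => L2 0 L (wd (u t).1)) by apply: aeonS hu => t _ /pH1_X0[_ []].
have D2 : aeon 0 T (fun t => L2 0 L (wd (u t).2)) by apply: aeonS hu => t _ /pH1_X0[_ []].
have [N1 m1 h1] := measurable_norm hL (cX_coef true cu hu) D1.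
have [N2 m2 h2] := measurable_norm hL (cX_coef false cu hu) D2.
exists (fun t => Num.sqrt (N1 t ^+ 2 + N2 t ^+ 2)); split.
 apply: measurableT_comp; first by apply: continuous_measurable_fun; exact: sqrt_continuous.
 by apply: measurable_funD; exact: measurable_funX.
apply: aeonS2 h1 h2 => t _ e1 e2; rewrite -e1 -e2.
have := sqr_nX L (pw (u t)); rewrite [(pw (u t)).1](_ : _ = wd (u t).1)// [(pw (u t)).2](_ : _ = wd (u t).2)// => <-.
by rewrite sqrtr_sqr ger0_norm// nX_ge0.
Qed.

(** The second source is minus half the derivative of a square; both coefficients thus reduce to
    [bil] with the derivative of the test polynomial. *)
Lemma Sou_coef u : cX L T u -> aH1 u ->
 ccoef L T (fun t => (Sou (u t)).1) /\ ccoef L T (fun t => (Sou (u t)).2).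
Proof.
move=> cu hu.
have LN (f g : R -> R) : L2 0 L f -> L2 0 L g -> L2inner 0 L (- f) g = - L2inner 0 L f g.
 by move=> Lf Lg; exact: (@ipNl _ _ (L2ip 0 L) _ _ Lf Lg).
split=> e [e0 eL]; have Le := L2_poly 0 L e.
 exists (fun t => bil e^`() (u (clamp 0 T t)).1 (u (clamp 0 T t)).2); first by have h := @bil_cont u e^`() true false cu; exact: h.
 apply: aeonS hu => t /in_oo_le[t0 tT] [h1 h2]; rewrite clamp_id//.
 have hm := isH1_mul hL (wderivP h1) (wderivP h2).
 have Hm : H1 0 L (fun x => (u t).1 x * (u t).2 x) by apply/H1P; eexists; exact: hm.
 have [_ Lm _] := wderivP Hm.
 by rewrite /Sou [LHS](LN _ _ Lm Le) (isH1_ibp hL (wderivP Hm) e0 eL) opprK L2inner_bil.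
exists (fun t => 2^-1 * bil e^`() (u (clamp 0 T t)).2 (u (clamp 0 T t)).2).
 by move=> t; apply: cvgM; [exact: cvg_cst|have h := @bil_cont u e^`() false false cu; exact: h].
apply: aeonS hu => t /in_oo_le[t0 tT] H; have [h1 h2] := H; rewrite clamp_id//.
have hm := isH1_mul hL (wderivP h2) (wderivP h2).
have := isH1_ibp hL hm e0 eL; rewrite L2inner_bil => h.
have [_ LS] := Sou_X0 H; have LS' := domN (S := L2ip 0 L) LS.
have -> : L2inner 0 L (Sou (u t)).2 (horner e) = - 2^-1 * L2inner 0 L (fun x => wd (u t).2 x * (u t).2 x + (u t).2 x * wd (u t).2 x) (horner e).
 rewrite -(@ipZl _ _ (L2ip 0 L) _ _ _ _ Le); last by have [_ a _] := hm.
 apply: it_eq => x _; congr (_ * _); rewrite [RHS](_ : _ = - 2^-1 * (wd (u t).2 x * (u t).2 x + (u t).2 x * wd (u t).2 x))//.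
 by rewrite [LHS](_ : _ = - ((u t).2 x * wd (u t).2 x))//; field.
by rewrite h mulNr mulrN opprK.
Qed.

Lemma src_pair (F G : R -> R -> R) m : ccoef L T F -> ccoef L T G -> aeon 0 T (fun t => in_X0 L (F t, G t)) ->
 ig 0 T m -> aeon 0 T (fun t => nX (F t, G t) <= m t) -> src L T F G.
Proof.
move=> cF cG D im hm; split => // eps e0; have e2 : 0 < eps / 2 by lra.
have LF : aeon 0 T (fun t => L2 0 L (F t)) by apply: aeonS D => t _ [].
have LG : aeon 0 T (fun t => L2 0 L (G t)) by apply: aeonS D => t _ [].
have bF : aeon 0 T (fun t => nL 0 L (F t) <= m t) by apply: aeonS hm => t _; apply: le_trans; exact: (nX1 L (F t, G t)).
have bG : aeon 0 T (fun t => nL 0 L (G t) <= m t) by apply: aeonS hm => t _; apply: le_trans; exact: (nX2 L (F t, G t)).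
have [s1 [M1 [i1 h1 l1]]] := poly_source hL hT cF LF im bF e2.
have [s2 [M2 [i2 h2 l2]]] := poly_source hL hT cG LG im bG e2.
exists (mapv (fun p => (p, 0)) s1 ++ mapv (fun p => (0, p)) s2), (fun t => M1 t + M2 t); split.
- exact: igD.
- apply: aeonS2 h1 h2 => t _ a b; apply: (le_trans (nX_le L _)).
 rewrite ev_cat (ev_mapv (f := fun p : {poly R} => (p, 0) : {poly R} * {poly R})); last first.
  by move=> k x y; congr pair; rewrite /= ?scaler0 ?addr0.
 rewrite (ev_mapv (f := fun p : {poly R} => (0, p) : {poly R} * {poly R})); last first.
  by move=> k x y; congr pair; rewrite /= ?scaler0 ?addr0.
 by apply: lerD; rewrite /= ?addr0 ?add0r.
- by rewrite itD//; move: l1 l2; move: (it _ _ _) (it _ _ _) => *; lra.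
Qed.

End curve.
End Sources.

(** * The space B *)

Section Bspace.
Context {R : realType}.
Notation mu := (@lebesgue_measure R).
Variables (L T : R).
Hypotheses (hL : 0 < L) (hT : 0 < T).
Notation XX := (@X0ip R L).
Notation nX := (nX L).
Notation pw := (pair_wderiv L).
Let T0 : 0 <= T. Proof. exact: ltW. Qed.

(** [N] is a measurable representative in time of the norm of the derivative; carrying it along
    makes the later time integrals legitimate. *)
Definition isB (u : R -> pairs R) (N : R -> R) : Prop :=
 [/\ cX L T u, aH1 L T u, mfn 0 T N, aeon 0 T (fun t => nX (pw (u t)) = N t) &
  ig 0 T (fun t => N t ^+ 2)].

Lemma isB_L2 u N : isB u N -> L2 0 T N.
Proof. by move=> [_ _ mN _ iN]; apply/L2P. Qed.

Lemma dx_int u N : aH1 L T u -> aeon 0 T (fun t => nX (pw (u t)) = N t) ->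
 (\int[mu]_(t in `]0%R, T[) (X0norm L (pw (u t)) ^+ 2) = \int[mu]_(t in `]0%R, T[) (N t ^+ 2)%:E)%E.
Proof.
move=> hu hN; apply: integral_ae_congr.
have h : aeon 0 T (fun t => (X0norm L (pw (u t)) ^+ 2)%E = (N t ^+ 2)%:E).
 apply: aeonS2 hu hN => t _ /pH1_X0[_ D] <-.
 by rewrite (X0normE D) EFin_expe.
exact: h.
Qed.

Lemma dxnormE u N : isB u N -> dxnorm L T u = (nL 0 T N)%:E.
Proof.
move=> [cu hu mN hN iN]; rewrite /dxnorm (dx_int hu hN) -(EFin_it iN) poweR_EFin powR12_sqrt.
 by rewrite -sqr_nL sqrtr_sqr ger0_norm// nL_ge0.
by apply: it_pos => t; exact: sqr_ge0.
Qed.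

Lemma in_BP u : in_B L T u <-> exists N, isB u N.
Proof.
split=> [[/C_X0P cu hu fin]|[N h]].
 have hu' : aH1 L T u by exact: hu.
 have [N [mN hN]] := wderiv_measurable hL hT cu hu'.
 exists N; split => //; apply/igP; split; first exact: measurable_funX.
 have e : (\int[mu]_(x in `]0%R, T[) (`|N x ^+ 2|%R)%:E = \int[mu]_(t in `]0%R, T[) (N t ^+ 2)%:E)%E.
  by apply: eq_integral => x _; rewrite ger0_norm// sqr_ge0.
 rewrite e; move: fin; rewrite /dxnorm (dx_int hu' hN).
 by apply: lty_poweRy; rewrite invr_eq0 pnatr_eq0.
have [cu hu mN hN iN] := h; split; [exact/C_X0P|exact: hu|].
by rewrite (dxnormE h) ltry.
Qed.

Definition SB (u : R -> pairs R) : R := fine (ereal_sup [set X0norm L (u t) | t in `[0%R, T]]).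
Definition DB (u : R -> pairs R) : R := fine (dxnorm L T u).
Definition rB (u : R -> pairs R) : R := SB u + DB u.

Lemma SB_spec u : cX L T u -> ereal_sup [set X0norm L (u t) | t in `[0%R, T]] = (SB u)%:E /\
 (forall t, 0 <= t -> t <= T -> nX (u t) <= SB u) /\
 forall c, (forall t, 0 <= t -> t <= T -> nX (u t) <= c) -> SB u <= c.
Proof.
move=> cu; have [K K0 hK] := cX_bounded hT cu.
have nE t : 0 <= t -> t <= T -> X0norm L (u t) = (nX (u t))%:E by move=> t0 tT; apply: X0normE; exact: cu.1.
set A := [set _ | t in _]; have ub c : (forall t, 0 <= t -> t <= T -> nX (u t) <= c) -> (ereal_sup A <= c%:E)%E.
 move=> hc; apply: ge_ereal_sup => _ [t /= tI <-]; move: tI; move=> /in_cc[t0 tT].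
 by rewrite nE// lee_fin hc.
have lb t : 0 <= t -> t <= T -> ((nX (u t))%:E <= ereal_sup A)%E.
 move=> t0 tT; rewrite -nE//; apply: ereal_sup_ubound; exists t => //=.
 by rewrite in_itv/= t0.
have fin : ereal_sup A \is a fin_num.
 rewrite fin_real//; apply/andP; split.
  by apply: lt_le_trans (lb 0 (lexx 0) T0); rewrite ltNyr.
 by apply: le_lt_trans (ub K hK) _; rewrite ltry.
have e : ereal_sup A = (SB u)%:E by rewrite /SB fineK.
split => //; split => [t t0 tT|c hc]; first by rewrite -lee_fin -e; exact: lb.
by rewrite -lee_fin -e; exact: ub.
Qed.

Lemma DBE u N : isB u N -> DB u = nL 0 T N.
Proof. by move=> h; rewrite /DB (dxnormE h). Qed.

Lemma BnormE u N : isB u N -> Bnorm L T u = (rB u)%:E.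
Proof.
move=> h; have [cu _ _ _ _] := h; have [e _] := SB_spec cu.
by rewrite /Bnorm e (dxnormE h) /rB (DBE h).
Qed.

Lemma nX_rB u N t : isB u N -> 0 <= t -> t <= T -> nX (u t) <= rB u.
Proof.
move=> h t0 tT; have [cu _ _ _ _] := h; have [_ [hS _]] := SB_spec cu.
by apply: (le_trans (hS t t0 tT)); rewrite /rB lerDl (DBE h) nL_ge0.
Qed.

Lemma SB_ge0 u : cX L T u -> 0 <= SB u.
Proof. by move=> cu; have [_ [h _]] := SB_spec cu; exact: le_trans (nX_ge0 L (u 0)) (h 0 (lexx 0) T0). Qed.

Lemma nL_rB u N : isB u N -> nL 0 T N <= rB u.
Proof. by move=> h; have [cu _ _ _ _] := h; rewrite /rB (DBE h) lerDr SB_ge0. Qed.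

Lemma rB_ge0 u N : isB u N -> 0 <= rB u.
Proof. by move=> h; exact: le_trans (nL_ge0 0 T N) (nL_rB h). Qed.

Lemma rB_le u N a b : isB u N -> (forall t, 0 <= t -> t <= T -> nX (u t) <= a) -> nL 0 T N <= b ->
 rB u <= a + b.
Proof.
move=> h ha hb; have [cu _ _ _ _] := h; have [_ [_ hS]] := SB_spec cu.
by rewrite /rB (DBE h); apply: lerD => //; exact: hS.
Qed.

Lemma ballP r u : in_Bball L T r u <-> (exists N, isB u N) /\ rB u <= r.
Proof.
split=> [[/in_BP[N h]]|[[N h] le]].
 by rewrite (BnormE h) lee_fin => le; split; [exists N|].
by split; [apply/in_BP; exists N|rewrite (BnormE h) lee_fin].
Qed.

Lemma aH1_sub u v : aH1 L T u -> aH1 L T v -> aH1 L T (u - v).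
Proof. by move=> hu hv; apply: aeonS2 hu hv => t _ a b; have [h _] := pH1_sub hL a b. Qed.

Lemma isB_sub u v N M : isB u N -> isB v M -> exists P, isB (u - v) P /\ aeon 0 T (fun t => 0 <= P t /\ P t <= N t + M t).
Proof.
move=> hu hv; have [cu au mN hN iN] := hu; have [cv av mM hM iM] := hv.
have cs := cX_sub cu cv; have as_ := aH1_sub au av.
have [P [mP hP]] := wderiv_measurable hL hT cs as_.
have h1 := aeon_and au av.
have h2 := aeon_and hN hM.
have b : aeon 0 T (fun t => 0 <= P t /\ P t <= N t + M t).
 have h3 : aeon 0 T (fun t => nX (pw ((u - v) t)) <= N t + M t).
  apply: aeonS2 h1 h2 => t _ [a b] [<- <-].
  have [_ e] := pH1_sub hL a b; have [_ Da] := pH1_X0 a; have [_ Db] := pH1_X0 b.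
  by rewrite [(u - v) t](_ : _ = u t - v t)// e; exact: (nrmB (S := XX) Da Db).
 by apply: aeonS2 hP h3 => t _ <- h; split => //; exact: nX_ge0.
exists P; split; last exact: b.
split; [exact: cs|exact: as_|exact: mP|exact: hP|].
have LNM := L2D (isB_L2 hu) (isB_L2 hv).
apply: (ig_le (measurable_funX 2 mP) _ (L2_igsqr LNM)).
apply: aeonS b => t _ [p0 pb]; rewrite ger0_norm ?sqr_ge0// ler_sqr ?nnegrE//.
exact: le_trans p0 pb.
Qed.

Lemma isB0 : isB 0 (fun=> 0) /\ rB 0 = 0.
Proof.
have [H0 [h0 _]] := Sou0 hL.
have p0 : nX (pw 0) = 0.
 apply/eqP; rewrite eq_le nX_ge0 andbT -h0 /hn lerDr; exact: nX_ge0.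
have n0 : nX 0 = 0 by exact: (nrm0 XX).
have B0 : isB 0 (fun=> 0).
 split.
 - split=> [t _ _|t e _ _ e0]; first exact: (dom0 XX).
  by exists 1 => // s _ _ _; rewrite subrr [nrm _ _]n0 ltW.
 - by apply: aeonW => t _; exact: H0.
 - exact: measurable_cst.
 - by apply: aeonW => t _; exact: p0.
 - by rewrite expr0n; exact: ig_cst.
split; first exact: B0.
apply/eqP; rewrite eq_le (rB_ge0 B0) andbT -[X in _ <= X](addr0 0).
apply: (rB_le B0) => [t _ _|]; first by rewrite n0.
by rewrite [nL _ _ _](nrm0 (L2ip 0 T)).
Qed.

Lemma rB_sub_le u v N M : isB u N -> isB v M -> rB (u - v) <= rB u + rB v.
Proof.
move=> hu hv; have [P [hP bP]] := isB_sub hu hv.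
have [[cu _ _ _ _] [cv _ _ _ _]] := (hu, hv).
have [[_ [su _]] [_ [sv _]]] := (SB_spec cu, SB_spec cv).
have -> : rB u + rB v = (SB u + SB v) + (nL 0 T N + nL 0 T M) by rewrite /rB (DBE hu) (DBE hv) addrACA.
apply: (rB_le hP) => [t t0 tT|].
 by apply: (le_trans (nrmB (S := XX) (cu.1 t t0 tT) (cv.1 t t0 tT))); apply: lerD; [exact: su|exact: sv].
have LNM := L2D (isB_L2 hu) (isB_L2 hv).
apply: (le_trans _ (nrmD (S := L2ip 0 T) (isB_L2 hu) (isB_L2 hv))).
apply: nL_mono; [exact: isB_L2 hP|exact: LNM|].
by apply: aeonS bP => t _ [p0 pb]; rewrite ger0_norm//; exact: le_trans pb (ler_norm _).
Qed.

Lemma rB_distC u v N M : isB u N -> isB v M -> rB (u - v) = rB (v - u).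
Proof.
move=> hu hv; have [B0 r0] := isB0; have le u' v' N' M' : isB u' N' -> isB v' M' -> rB (u' - v') <= rB (v' - u').
 move=> hu' hv'; have [P [hP _]] := isB_sub hv' hu'.
 by have := rB_sub_le B0 hP; rewrite r0 !add0r opprB.
apply/eqP; rewrite eq_le; apply/andP; split; [exact: (le _ _ _ _ hu hv)|exact: (le _ _ _ _ hv hu)].
Qed.

Lemma rB_triangle u v w N M P : isB u N -> isB v M -> isB w P -> rB (u - w) <= rB (u - v) + rB (v - w).
Proof.
move=> hu hv hw; have [A [hA _]] := isB_sub hu hv; have [B [hB _]] := isB_sub hw hv.
have := rB_sub_le hA hB; rewrite (rB_distC hw hv).
by have -> : u - v - (w - v) = u - w by rewrite opprB addrA subrK.
Qed.

(** Integrate the pointwise estimate of [Sou] by Cauchy-Schwarz in time. The L^2 norm in time of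
    [hn] is at most [c * rB u], the square root of [T] accounting for the sup part of the norm. *)
Lemma source_estimates : exists2 K : R, 0 <= K & forall u N, isB u N ->
 [/\ src L T (source_eta L u) (source_omega L u),
 exists m, [/\ ig 0 T m, aeon 0 T (fun t => nX (source_eta L u t, source_omega L u t) <= m t) &
  it 0 T m <= K * rB u ^+ 2] &
 forall v M, isB v M -> exists m, [/\ ig 0 T m,
  aeon 0 T (fun t => nX ((source_eta L u - source_eta L v) t, (source_omega L u - source_omega L v) t) <= m t) &
  it 0 T m <= K * (rB u + rB v) * rB (u - v)]].
Proof.
have [K K0 hK] := Sou_diff hL; pose c := 1 + Num.sqrt T.
have c0 : 0 <= c by rewrite addr_ge0// sqrtr_ge0.
exists (K * c ^+ 2); first by rewrite mulr_ge0// sqr_ge0.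
have hnE u N : isB u N -> [/\ L2 0 T (fun t => nX (u t) + N t),
  aeon 0 T (fun t => hn L (u t) = nX (u t) + N t) & nL 0 T (fun t => nX (u t) + N t) <= c * rB u].
 move=> h; have [cu au mN hN iN] := h.
 have [_ L1] := cX_clamp cu (lexx T) (cX_nrm hT cu); have L2' := isB_L2 h.
 split; first exact: (L2D L1 L2').
  by apply: aeonS hN => t _ <-.
 apply: (le_trans (nrmD (S := L2ip 0 T) L1 L2')); rewrite /c mulrDl mul1r addrC; apply: lerD.
  exact: nL_rB.
 have r0 := rB_ge0 h; have := nL_le_bound T0 L1 r0; rewrite subr0 mulrC; apply.
 apply: aeonW => t /in_oo_le[t0 tT].
 by rewrite ger0_norm ?nX_ge0//; exact: nX_rB h t0 tT.
have dif u N v M : isB u N -> isB v M -> exists m, [/\ ig 0 T m,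
  aeon 0 T (fun t => nX (Sou L (u t) - Sou L (v t)) <= m t) &
  it 0 T m <= K * c ^+ 2 * (rB u + rB v) * rB (u - v)].
 move=> hu hv; have [P [hP _]] := isB_sub hu hv.
 have [Lu eu bu] := hnE _ _ hu; have [Lv ev' bv] := hnE _ _ hv; have [Ld ed bd] := hnE _ _ hP.
 have [cu au _ _ _] := hu; have [cv av _ _ _] := hv.
 pose A : R -> R := (fun t => nX (u t) + N t) + (fun t => nX (v t) + M t).
 pose B (t : R) := nX ((u - v) t) + P t.
 have LA : L2 0 T A by exact: L2D.
 have iAB : ig 0 T (fun t => A t * B t) by exact: L2_mul LA Ld.
 exists (fun t => K * (A t * B t)); split; first exact: igZ.
  have h1 := aeon_and au av.
  have h2 := aeon_and eu ev'.
  have h3 := aeon_and h2 ed.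
  apply: aeonS2 h1 h3 => t _ [pu pv] [[e1 e2] e3].
  apply: (le_trans (hK _ _ pu pv)); rewrite -mulrA.
  by rewrite [A t](_ : _ = (nX (u t) + N t) + (nX (v t) + M t))// -e1 -e2 /B -e3.
 rewrite (itZ K iAB).
 have alg (a b e : R) : K * c ^+ 2 * (a + b) * e = K * ((c * (a + b)) * (c * e)) by ring.
 rewrite alg.
 apply: (ler_wpM2l K0); apply: (le_trans (ler_norm _)); apply: (le_trans (it_mul_le LA Ld)).
 have nA : nL 0 T A <= c * (rB u + rB v).
  apply: (le_trans (nrmD (S := L2ip 0 T) Lu Lv)).
  by rewrite (mulrDr c (rB u) (rB v)); exact: (lerD bu bv).
 by apply: ler_pM; [exact: nL_ge0|exact: nL_ge0|exact: nA|exact: bd].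
move=> u N hu; have [cu au mN hN iN] := hu.
have [m [im hm lm]] : exists m, [/\ ig 0 T m, aeon 0 T (fun t => nX (Sou L (u t)) <= m t) & it 0 T m <= K * c ^+ 2 * rB u ^+ 2].
 (* The quadratic bound is the difference bound against the zero element. *)
 have [B0 r0] := isB0; have [m [im hm lm]] := dif _ _ _ _ hu B0.
 exists m; split; first exact: im.
  have [H0 [h0 s0]] := Sou0 hL; have D0 := Sou_X0 hL H0.
  apply: aeonS2 au hm => t _ pu; apply: le_trans; have Du := Sou_X0 hL pu.
  by have := nrm_dist (S := XX) Du D0; rewrite -!/(nX _) s0 subr0 ger0_norm ?nX_ge0.
 have alg (a : R) : K * c ^+ 2 * a ^+ 2 = K * c ^+ 2 * a * a by ring.
 rewrite alg.
 by move: lm; rewrite r0 addr0 subr0.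
split.
- have [c1 c2] := Sou_coef hL hT cu au.
 apply: (src_pair hL hT c1 c2 _ im hm).
 by apply: aeonS au => t _ pu; have [a b] := Sou_X0 hL pu; split; [exact: a|exact: b].
- by exists m; split; [exact: im|exact: hm|exact: lm].
- by move=> v M hv; have [m' [a b d]] := dif _ _ _ _ hu hv; exists m'; split; [exact: a|exact: b|exact: d].
Qed.

End Bspace.

(** * Completeness of the space B *)

Section Bcomplete.
Context {R : realType}.
Variables (L T : R).
Hypotheses (hL : 0 < L) (hT : 0 < T).
Notation XX := (@X0ip R L).
Notation nX := (nX L).
Notation pw := (pair_wderiv L).
Notation rB := (rB L T).
Notation isB := (isB L T).
Let T0 : 0 <= T. Proof. exact: ltW. Qed.

Variables (un : nat -> R -> pairs R) (Nn : nat -> R -> R) (c : R).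
Hypotheses (Bn : forall n, isB (un n) (Nn n)) (c0 : 0 <= c) (step : forall n, rB (un n - un n.+1) <= c * 2^-1 ^+ n).

Lemma rB_tail n m : (n <= m)%N -> rB (un n - un m) <= 2 * c * 2^-1 ^+ n.
Proof.
move=> /subnKC <-; move: (m - n)%N => k; have h2 : 0 <= 2^-1 :> R by rewrite invr_ge0.
have h (j : nat) : 0 <= 2 * c * 2^-1 ^+ j by rewrite !mulr_ge0// exprn_ge0.
suff /le_trans : rB (un n - un (n + k)%N) <= 2 * c * 2^-1 ^+ n - 2 * c * 2^-1 ^+ (n + k) by apply; rewrite gerBl.
elim: k => [|k ih].
 by rewrite addn0 subrr [rB 0](proj2 (isB0 hL hT)) subrr.
have := rB_triangle hL hT (Bn n) (Bn (n + k)%N) (Bn (n + k.+1)%N).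
have := step (n + k)%N; rewrite -addnS.
have e1 : 2 * c * 2^-1 ^+ (n + k.+1) = c * 2^-1 ^+ (n + k) by rewrite addnS exprS; field.
have e2 : 2 * c * 2^-1 ^+ (n + k) = 2 * (c * 2^-1 ^+ (n + k)) by ring.
move: ih; rewrite e1 e2; move: (rB _) (rB _) (rB _) => x y z.
move: (c * _) (2 * c * _) => *; lra.
Qed.

Lemma uniform_limit : exists u, cX L T u /\
 forall n t, 0 <= t -> t <= T -> nX (un n t - u t) <= 2 * c * 2^-1 ^+ n.
Proof.
apply: X0_uniform_limit => [n|n m t nm t0 tT]; first by have [] := Bn n.
have [P [hP _]] := isB_sub hL hT (Bn n) (Bn m).
apply: (le_trans _ (rB_tail nm)); exact: (nX_rB hT hP t0 tT).
Qed.

Lemma ae_H1_limit u : cX L T u ->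
 (forall n t, 0 <= t -> t <= T -> nX (un n t - u t) <= 2 * c * 2^-1 ^+ n) ->
 aeon 0 T (fun t => pH1 L (u t) /\ cvg_for (fun v w => nX (v - w)) (fun n => pw (un n t)) (pw (u t))).
Proof.
move=> cu hb; have [P hP] := choice (fun n => isB_sub hL hT (Bn n) (Bn n.+1)).
have dec : aeon 0 T (fun t => exists K : R, forall n, P n t ^+ 2 <= K * 2^-1 ^+ n).
 apply: (@ae_geometric_decay _ _ _ _ (c ^+ 2)); first exact: sqr_ge0.
 - by move=> n; have [[_ _ _ _ h] _] := hP n.
 - by move=> n t; exact: sqr_ge0.
 - move=> n; have [h _] := hP n; rewrite -sqr_nL.
  have -> : 4^-1 ^+ n = (2^-1 ^+ n) ^+ 2 :> R by rewrite -exprM mulnC exprM; congr (_ ^+ _); field.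
  rewrite -exprMn lerXn2r ?nnegrE ?nL_ge0//; first by rewrite mulr_ge0// exprn_ge0// invr_ge0.
  exact: (le_trans (nL_rB hT h) (step n)).
have allH : aeon 0 T (fun t => forall n, pH1 L (un n t)) by apply: aeon_all => n; have [_ h _ _ _] := Bn n; exact: h.
have allP : aeon 0 T (fun t => forall n, nX (pw ((un n - un n.+1) t)) = P n t).
 by apply: aeon_all => n; have [[_ _ _ h _] _] := hP n; exact: h.
have both := aeon_and allH allP.
apply: aeonS2 dec both => t /in_oo_le[t0 tT] [K hK] [hH hE].
apply: (H1_pair_limit hL (cu.1 t t0 tT) (wn := un ^~ t) (k := K)) => [n|e e0|n].
- by split; [exact: wderivP (hH n).1|exact: wderivP (hH n).2].
- have [N hN] := null_half (2 * c) e0; exists N => n /hN; exact: le_trans (hb n t t0 tT).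
- have [_ e] := pH1_sub hL (hH n) (hH n.+1).
 have -> : nX (pw (un n t) - pw (un n.+1 t)) = P n t by rewrite -(hE n); exact: (esym e).
 exact: hK.
Qed.

(** The limit exists uniformly in time in X_0; for almost every time the derivatives converge too,
    and Fatou over the index [k] bounds the distance in the derivative part. *)
Lemma B_complete : exists u N, isB u N /\ forall n, rB (un n - u) <= 4 * c * 2^-1 ^+ n.
Proof.
have [u [cu hb]] := uniform_limit; have lim := ae_H1_limit cu hb.
have au : aH1 L T u by apply: aeonS lim => t _ [h _]; exact: h.
have main n : exists Q, isB (un n - u) Q /\ nL 0 T Q <= 2 * c * 2^-1 ^+ n.
 have [cn an _ _ _] := Bn n; have cs := cX_sub cn cu; have as_ := aH1_sub hL an au.
 have [Q [mQ hQ]] := wderiv_measurable hL hT cs as_.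
 have [P hP] := choice (fun k => isB_sub hL hT (Bn n) (Bn (n + k)%N)).
 have b0 : 0 <= 2 * c * 2^-1 ^+ n by rewrite !mulr_ge0// exprn_ge0// invr_ge0.
 have allH : aeon 0 T (fun t => forall k, pH1 L (un k t)) by apply: aeon_all => k; have [_ h _ _ _] := Bn k; exact: h.
 have allP : aeon 0 T (fun t => forall k, nX (pw ((un n - un (n + k)%N) t)) = P k t).
  by apply: aeon_all => k; have [[_ _ _ h _] _] := hP k; exact: h.
 have b1 := aeon_and allH allP.
 have b2 := aeon_and lim hQ.
 have [iQ bQ] : ig 0 T (fun t => Q t ^+ 2) /\ it 0 T (fun t => Q t ^+ 2) <= (2 * c * 2^-1 ^+ n) ^+ 2.
  apply: (@it_fatou _ 0 T (fun k t => P k t ^+ 2)).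
  - by move=> k; have [[_ _ _ _ h] _] := hP k.
  - by move=> k t; exact: sqr_ge0.
  - exact: measurable_funX.
  - apply: aeonS2 b1 b2 => t _ [hH hE] [[pu cl] eQ].
   apply: cvg_sqr.
   apply/cvgrPdist_le => e e0; have [N hN] := cl e e0; exists N => // k /= Nk.
   have [_ e1] := pH1_sub hL (hH n) pu; have [_ e2] := pH1_sub hL (hH n) (hH (n + k)%N).
   have [_ D1] := pH1_X0 (hH n); have [_ D2] := pH1_X0 (hH (n + k)%N); have [_ D3] := pH1_X0 pu.
   have q1 : Q t = nX (pw (un n t) - pw (u t)) by rewrite -eQ; exact: e1.
   have q2 : P k t = nX (pw (un n t) - pw (un (n + k)%N t)) by rewrite -(hE k); exact: e2.
   rewrite q1 q2; have := nrm_dist (S := XX) (X0B D1 D3) (X0B D1 D2).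
   have -> : pw (un n t) - pw (u t) - (pw (un n t) - pw (un (n + k)%N t)) = pw (un (n + k)%N t) - pw (u t).
    by rewrite opprB addrC addrA subrK.
   move=> h; apply: (le_trans h); apply: hN; exact: (leq_trans Nk (leq_addl _ _)).
  - move=> e e0; exists 0%N => k _; have [h _] := hP k; rewrite -sqr_nL.
   have h1 := le_trans (nL_rB hT h) (rB_tail (leq_addr k n)).
   apply: (@le_trans _ _ ((2 * c * 2^-1 ^+ n) ^+ 2)); last by rewrite lerDl ltW.
   by rewrite lerXn2r// nnegrE nL_ge0.
 exists Q; split; first by split; [exact: cs|exact: as_|exact: mQ|exact: hQ|exact: iQ].
 by rewrite -ler_sqr ?nnegrE ?nL_ge0// sqr_nL.
have [Q0 [B0 _]] := main 0%N; have [N [hN _]] := isB_sub hL hT (Bn 0%N) B0.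
have e0 : un 0%N - (un 0%N - u) = u by rewrite opprB addrC subrK.
rewrite e0 in hN; exists u, N; split; first exact: hN.
move=> n; have [Q [hQ bQ]] := main n.
have -> : 4 * c * 2^-1 ^+ n = 2 * c * 2^-1 ^+ n + 2 * c * 2^-1 ^+ n by ring.
by apply: (rB_le hT hQ) => [t t0 tT|]; [exact: hb|exact: bQ].
Qed.

End Bcomplete.

(** * The map Gamma *)

Section GammaDelayed.
Context {R : realType}.
Variables (L al be T d : R) (tau q : R -> R).
Hypotheses (hL : 0 < L) (hT : 0 < T) (d1 : d < 1) (ht0 : 0 < tau 0).
Hypotheses (cq : continuous q) (tauE : forall t, 0 <= t -> t <= T -> tau t = tau 0 + it 0 t q).
Hypotheses (dtau : forall t, t \in `]0, T[ -> is_derive t 1 tau (q t)).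
Hypotheses (qd : forall t, t \in `]0, T[ -> q t <= d) (tge : forall t, 0 <= t -> t <= T -> tau 0 <= tau t).
Let T0 : 0 <= T. Proof. exact: ltW. Qed.
Let mt0 : - tau 0 <= 0. Proof. by rewrite oppr_le0 ltW. Qed.

(** Rescaling of the history interval to the unit interval; the factor [tau 0] is the Jacobian. *)
Lemma history_L2 z0 : L2 0 1 (fun rho => z0 (- tau 0 * rho)) ->
 L2 (- tau 0) 0 z0 /\
 nL (- tau 0) 0 z0 ^+ 2 <= tau 0 * nL 0 1 (fun rho => z0 (- tau 0 * rho)) ^+ 2.
Proof.
move=> Lz; have ri : 0 < (tau 0)^-1 by rewrite invr_gt0.
have lm : - tau 0 < 0 by rewrite oppr_lt0.
have tb : 0 - (tau 0)^-1 * (- tau 0) <= 1 by rewrite sub0r mulrN opprK mulVf ?gt_eqF.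
have ta : 0 <= 0 - (tau 0)^-1 * 0 by rewrite mulr0 subrr.
have := affine_L2 ri lm tb ta Lz; rewrite invrK.
have -> : (fun x => (fun rho => z0 (- tau 0 * rho)) (0 - (tau 0)^-1 * x)) = z0.
 apply/funext => x; congr z0; rewrite sub0r mulNr mulrN opprK mulrA divff ?mul1r//.
 by rewrite gt_eqF.
by [].
Qed.

(** From left to right, uniqueness for the transport equation identifies the outflow [h] with the
    delayed trace; from right to left, [zt] supplies the transport variable. *)
Lemma Gamma_delayed eta0 omega0 z0 u v : L2 (- tau 0) 0 z0 ->
 Gamma L T al be tau eta0 omega0 z0 u v <->
 exists gam, [/\ cX L T v, X0_eq L (v 0) (eta0, omega0), ae_eq_on (- tau 0) 0 gam z0 &
  delayed L al be T tau v (source_eta L u) (source_omega L u) gam].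
Proof.
move=> Lz; split=> [[z [/C_X0P cv /C_L2P cz v0 zic [g [h [Lg Lh W Wt]]]]]|[gam [cv v0 hz [Lgam W]]]].
 pose gam := glue (- tau 0) 0 T z0 g.
 have Lgam : L2 (- tau 0) T gam by exact: glue_L2.
 have gr : {in `]0, T[, gam =1 g} by move=> t tI; exact: glue_right.
 have Wt' : weak_transport T tau z gam h.
  move=> t tI zeta sz; rewrite (Wt t tI zeta sz); apply: it_eq => s /in_oo[s0 st].
  by move: tI; move=> /in_cc[_ tT]; rewrite gr// in_itv/= s0 (lt_le_trans st tT).
 have ic : ae_eq_on 0 1 (z 0) (zt tau gam 0).
  have zic' : aeon 0 1 (fun x => z 0 x = z0 (- tau 0 * x)) by exact: zic.
  apply: aeonS zic' => x /in_oo[x0 x1] ->.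
  rewrite /zt sub0r -mulNr; apply/esym; apply: glue_left.
  by rewrite in_itv/= mulNr oppr_lt0 mulr_gt0// andbT ltrN2 gtr_pMr.
 have hE := transport_unique hT d1 ht0 cq tauE dtau qd tge Lgam cz Lh ic Wt'.
 exists gam; split; [exact: cv|exact: v0| |split; first exact: Lgam].
  by apply: aeonW => x xI; exact: glue_left.
 apply: weak_congr W; first by apply: aeonW => t tI; rewrite gr.
 by apply: aeonS hE => t tI ->; rewrite (gr t tI).
have Ls := (shift_L2 hT d1 ht0 cq tauE dtau qd tge Lgam).1.
exists (zt tau gam); split; [exact/C_X0P| |exact: v0| |].
- by apply/C_L2P; exact: (zt_cL hT d1 ht0 cq tauE dtau qd tge Lgam).
- have tb : 0 - tau 0 * 0 <= 0 by rewrite mulr0 subrr.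
 have ta : - tau 0 <= 0 - tau 0 * 1 by rewrite mulr1 sub0r.
 have hz' : aeon (- tau 0) 0 (fun x => gam x = z0 x) by exact: hz.
 have := affine_ae ht0 tb ta hz'.
 by apply: aeonS => x _; rewrite /zt sub0r mulNr.
- exists gam, (fun t => gam (t - tau t)); split; [exact: L2_sub Lgam|exact: Ls|exact: W|].
 exact: (transport_zt hT d1 ht0 cq tauE dtau qd tge Lgam).
Qed.

End GammaDelayed.

Section GammaEstimates.
Context {R : realType}.
Variables (L al be T Ks : R) (tau : R -> R).
Hypotheses (hL : 0 < L) (hal : 0 < al) (hT : 0 < T) (ht0 : 0 < tau 0).
Hypotheses (Ks0 : 0 <= Ks) (hk : `|be| * Ks < al).
Hypothesis shL2 : forall f, L2 (- tau 0) T f -> L2 0 T (fun t => f (t - tau t)).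
Hypothesis shle : forall f, L2 (- tau 0) T f -> nL 0 T (fun t => f (t - tau t)) <= Ks * nL (- tau 0) T f.
Notation nX := (nX L).
Notation rB := (rB L T).
Notation isB := (isB L T).
Notation delayed := (delayed L al be T tau).
Let T0 : 0 <= T. Proof. exact: ltW. Qed.
Let mt0 : - tau 0 <= 0. Proof. by rewrite oppr_le0 ltW. Qed.

Lemma delayed_isB : exists2 C : R, 0 <= C & forall u F G gam m, cX L T u -> src L T F G ->
 delayed u F G gam -> ig 0 T m -> aeon 0 T (fun t => nX (F t, G t) <= m t) ->
 exists N, isB u N /\ rB u <= C * (nX (u 0) + it 0 T m + nL (- tau 0) 0 gam).
Proof.
have [C C0 h] := delay_estimates hL hal hT ht0 Ks0 hk shL2 shle.
exists (2 * Num.sqrt C); first by rewrite mulr_ge0// sqrtr_ge0.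
move=> u F G gam m cu sF dl im hm.
have [hH [N [[mN hN] b1 _ iN b2]]] := h _ _ _ _ _ cu sF dl im hm.
have B : isB u N by split; [exact: cu|exact: hH|exact: mN|exact: hN|exact: iN].
exists N; split; first exact: B.
have m0 : 0 <= it 0 T m by apply: it_ge0; apply: aeonS hm => t _; apply: le_trans; exact: nX_ge0.
have n0 := nX_ge0 L (u 0); have g0 := nL_ge0 (- tau 0) 0 gam.
set S := _ + nL _ _ _; have S0 : 0 <= S by rewrite !addr_ge0.
have DS : nX (u 0) ^+ 2 + it 0 T m ^+ 2 + nL (- tau 0) 0 gam ^+ 2 <= S ^+ 2.
 have alg (x y z : R) : 0 <= x -> 0 <= y -> 0 <= z -> x ^+ 2 + y ^+ 2 + z ^+ 2 <= (x + y + z) ^+ 2.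
  move=> x0 y0 z0; have -> : (x + y + z) ^+ 2 = x ^+ 2 + y ^+ 2 + z ^+ 2 + 2 * (x * y + x * z + y * z) by ring.
  by rewrite lerDl mulr_ge0// !addr_ge0// mulr_ge0.
 exact: alg.
have key x : 0 <= x -> x ^+ 2 <= C * (nX (u 0) ^+ 2 + it 0 T m ^+ 2 + nL (- tau 0) 0 gam ^+ 2) ->
  x <= Num.sqrt C * S.
 move=> x0 hx; rewrite -ler_sqr ?nnegrE ?mulr_ge0 ?sqrtr_ge0// exprMn sqr_sqrtr//.
 by apply: (le_trans hx); exact: ler_wpM2l C0 _ _ DS.
have -> : 2 * Num.sqrt C * S = Num.sqrt C * S + Num.sqrt C * S by ring.
apply: (rB_le hT B) => [t t0 tT|].
 by apply: key; [exact: nX_ge0|exact: b1].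
by apply: key; [exact: nL_ge0|rewrite (sqr_nL 0 T N); exact: b2].
Qed.

(** Two images with equal initial value and history differ by a solution of the delayed problem with
    zero initial value and zero history, so only the quadratic source estimate enters. *)
Lemma Gamma_estimates : exists2 C : R, 0 <= C & forall u N v gam, isB u N -> cX L T v ->
 delayed v (source_eta L u) (source_omega L u) gam ->
 (exists P, isB v P /\ rB v <= C * (nX (v 0) + rB u ^+ 2 + nL (- tau 0) 0 gam)) /\
 forall u' N' v' gam', isB u' N' -> cX L T v' ->
  delayed v' (source_eta L u') (source_omega L u') gam' ->
  X0_eq L (v 0) (v' 0) -> ae_eq_on (- tau 0) 0 gam gam' ->
  rB (v - v') <= C * (rB u + rB u') * rB (u - u').
Proof.
have [C C0 h] := delayed_isB; have [K K0 hs] := source_estimates hL hT.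
exists (C * (K + 1)); first by rewrite mulr_ge0// addr_ge0.
move=> u N v gam Bu cv dv; have [sF [m [im hm lm]] hd] := hs _ _ Bu.
split.
 have [P [BP le]] := h _ _ _ _ _ cv sF dv im hm; exists P; split; first exact: BP.
 apply: (le_trans le).
 have := nX_ge0 L (v 0); have := nL_ge0 (- tau 0) 0 gam; have := sqr_ge0 (rB u).
 move: lm; move: (nX _) (it _ _ _) (nL _ _ _) (rB u ^+ 2) => x y z w yw w0 z0 x0.
 rewrite -mulrA; apply: (ler_wpM2l C0).
 have : 0 <= K * x by exact: mulr_ge0.
 have : 0 <= K * z by exact: mulr_ge0.
 rewrite mulrDl mul1r !mulrDr; move: (K * x) (K * w) (K * z) yw => *; lra.
move=> u' N' v' gam' Bu' cv' dv' e0 eg; have [sF' _ _] := hs _ _ Bu'.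
have [m' [im' hm' lm']] := hd _ _ Bu'.
have [Lg W] := dv; have [Lg' W'] := dv'.
have Lb f : L2 (- tau 0) T f -> L2 0 T (fun t => be * f (t - tau t)) by move=> /shL2 Lf; exact: (L2Z be Lf).
have Lr f : L2 (- tau 0) T f -> L2 0 T f by exact: L2_sub.
have Wd := weak_diff hT cv cv' sF sF' (Lr _ Lg) (Lr _ Lg') (Lb _ Lg) (Lb _ Lg') W W'.
have dd : delayed (v - v') (source_eta L u - source_eta L u') (source_omega L u - source_omega L u') (gam - gam').
 split; first exact: (L2B Lg Lg').
 apply: weak_congr Wd; first exact: aeonW.
 apply: aeonW => t _; congr (_ + _).
 have -> : (gam - gam') (t - tau t) = gam (t - tau t) - gam' (t - tau t) by exact: erefl.
 by rewrite mulrBr.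
have [P [BP le]] := h _ _ _ _ _ (cX_sub cv cv') (src_sub sF sF') dd im' hm'.
have n0 : nX ((v - v') 0) = 0 by exact: (X0_eq_nX e0).
have g0 : nL (- tau 0) 0 (gam - gam') = 0.
 have eg' : aeon (- tau 0) 0 (fun t => gam t = gam' t) by exact: eg.
 have -> : nL (- tau 0) 0 (gam - gam') = nL (- tau 0) 0 0.
  apply: nL_ae; apply: aeonS eg' => t _ e.
  have -> : (gam - gam') t = gam t - gam' t by exact: erefl.
  by rewrite e subrr.
 exact: (nrm0 (L2ip (- tau 0) 0)).
rewrite n0 g0 add0r addr0 in le; apply: (le_trans le).
have -> : C * (K + 1) * (rB u + rB u') * rB (u - u') = C * ((K + 1) * (rB u + rB u') * rB (u - u')).
 by move: (rB _) (rB _) (rB _) => *; ring.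
apply: (ler_wpM2l C0); apply: (le_trans lm').
have [Q [BQ _]] := isB_sub hL hT Bu Bu'.
have := rB_ge0 hT Bu; have := rB_ge0 hT Bu'; have := rB_ge0 hT BQ.
move: (rB _) (rB _) (rB _) => x y z z0 y0 x0.
by apply: ler_wpM2r => //; apply: ler_wpM2r; [exact: addr_ge0|rewrite lerDl].
Qed.

Lemma Gamma_exists u N v0 z0 : isB u N -> in_X0 L v0 -> L2 (- tau 0) 0 z0 ->
 exists v gam, [/\ cX L T v, X0_eq L (v 0) v0, ae_eq_on (- tau 0) 0 gam z0 &
  delayed v (source_eta L u) (source_omega L u) gam].
Proof.
move=> Bu D0 Lz; have [K _ hs] := source_estimates hL hT; have [sF _ _] := hs _ _ Bu.
exact: (delay_exists hL hal hT ht0 Ks0 hk shL2 shle D0 sF Lz).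
Qed.

End GammaEstimates.

(** * The fixed point *)

Section FixedPoint.
Context {R : realType}.

Lemma halves_le (x y z w : R) : x <= 2^-1 * y -> y <= w -> z <= 2^-1 * w -> x + z <= w.
Proof. by move=> *; lra. Qed.

Lemma half_le0 (x : R) : 0 <= x -> x <= 2^-1 * x -> x <= 0.
Proof. by move=> *; lra. Qed.

Lemma data_le (x y z s e : R) : x <= e -> z <= s * e -> x + y + z <= (1 + s) * e + y.
Proof. by rewrite mulrDl mul1r; move: (s * e) => *; lra. Qed.

(** The data may use half of the radius, and the quadratic term uses at most a quarter. *)
Lemma invariance_le (C r s e x : R) : 0 <= C -> 0 <= r -> C * r <= 4^-1 -> C * (1 + s) * e <= r / 2 ->
 0 <= x -> x <= r -> C * ((1 + s) * e + x ^+ 2) <= r.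
Proof.
move=> C0 r0 Cr h x0 xr.
have h1 : C * x ^+ 2 <= C * r ^+ 2 by apply: ler_wpM2l => //; rewrite lerXn2r ?nnegrE.
have h2 : C * r * r <= 4^-1 * r by exact: ler_wpM2r.
have -> : C * ((1 + s) * e + x ^+ 2) = C * (1 + s) * e + C * x ^+ 2 by ring.
have e2 : C * r ^+ 2 = C * r * r by ring.
move: h h1 h2; rewrite e2; move: (C * _ * e) (C * x ^+ 2) (C * r * r) => *; lra.
Qed.

Lemma contraction_le (C r x y : R) : 0 <= C -> C * r <= 4^-1 -> x <= r -> y <= r -> C * (x + y) <= 2^-1.
Proof.
move=> C0 Cr xr yr; have := ler_wpM2l C0 xr; have := ler_wpM2l C0 yr.
by rewrite mulrDr; move: (C * r) (C * x) (C * y) Cr => *; lra.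
Qed.

Variables (L T : R).
Hypotheses (hL : 0 < L) (hT : 0 < T).
Notation rB := (rB L T).
Notation isB := (isB L T).

(** With [s ^+ 2] the inverse of [1 - d], the hypothesis says that [2 * alpha] exceeds the absolute
    value of [beta] times [1 + s ^+ 2], and [1 + s ^+ 2] is at least [2 * s]. *)
Lemma damping_bounds (alpha beta d : R) : d < 1 -> (2 * alpha - `|beta|) * (1 - d) > `|beta| ->
 0 < alpha /\ `|beta| * Num.sqrt (1 - d)^-1 < alpha.
Proof.
move=> d1 h; have e0 : 0 < 1 - d by rewrite subr_gt0.
set s := Num.sqrt _; have s0 : 0 <= s by exact: sqrtr_ge0.
have s2 : s ^+ 2 = (1 - d)^-1 by rewrite sqr_sqrtr// invr_ge0 ltW.
have b0 := normr_ge0 beta; have k : `|beta| * s ^+ 2 < 2 * alpha - `|beta| by rewrite s2 ltr_pdivrMr.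
have k2 : `|beta| * (2 * s) <= `|beta| * (1 + s ^+ 2).
 by apply: ler_wpM2l => //; have := sqr_ge0 (1 - s); rewrite sqrrB expr1n mul1r; move: (s ^+ 2) => *; lra.
have k3 : 0 <= `|beta| * s by rewrite mulr_ge0.
move: k k2 k3; rewrite mulrDr mulr1 (mulrCA _ 2); move: (`|beta| * s ^+ 2) (`|beta| * s) (`|beta|) b0 => *.
by split; lra.
Qed.

Lemma Hnorm_bounds (tau eta0 omega0 z0 : R -> R) (e : R) : 0 <= e -> in_H L tau eta0 omega0 z0 ->
 (Hnorm L tau eta0 omega0 z0 <= e%:E)%E ->
 nX L (eta0, omega0) <= e /\ nL 0 1 (fun rho => z0 (- tau 0 * rho)) <= e.
Proof.
move=> e0 [[L1 L2'] L3]; rewrite /Hnorm (L2norm_nL L1) (L2norm_nL L2') (L2norm_nL L3).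
set x := nL _ _ _; set y := nL _ _ _; set z := nL _ _ _.
rewrite -!EFin_expe -!EFinD poweR_EFin powR12_sqrt ?addr_ge0 ?sqr_ge0// lee_fin => h.
have {}h : x ^+ 2 + y ^+ 2 + z ^+ 2 <= e ^+ 2.
 rewrite -(@sqr_sqrtr _ (x ^+ 2 + y ^+ 2 + z ^+ 2)) ?addr_ge0 ?sqr_ge0//.
 by rewrite lerXn2r ?nnegrE ?sqrtr_ge0.
split; rewrite -ler_sqr ?nnegrE ?nX_ge0 ?nL_ge0//; apply: le_trans h; first by rewrite sqr_nX lerDl sqr_ge0.
by rewrite lerDr addr_ge0 ?sqr_ge0.
Qed.

(** A fixed point is reached only up to [traj_eq], as the image may be another representative; the
    weak formulation does not see the difference. *)
Lemma weak_traj u v F G g b : traj_eq L T v u -> weak_KdV L T v F G g b -> weak_KdV L T u F G g b.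
Proof.
move=> e W t tI; have [t0 tT] := in_cc tI.
have i0 : 0 \in `[0, T] by rewrite in_itv/= lexx (le_trans t0 tT).
have rfl (f : R -> R) : aeon 0 L (fun x => f x = f x) by exact: aeonW.
have e1 s f : s \in `[0, T] -> L2inner 0 L (u s).1 f = L2inner 0 L (v s).1 f.
 by move=> sI; apply/esym; exact: (L2inner_ae (e s sI).1 (rfl f)).
have e2 s f : s \in `[0, T] -> L2inner 0 L (u s).2 f = L2inner 0 L (v s).2 f.
 by move=> sI; apply/esym; exact: (L2inner_ae (e s sI).2 (rfl f)).
have sub s : s \in `]0, t[ -> s \in `[0, T].
 by rewrite !in_itv/= => /andP[s0 st]; rewrite (ltW s0) (le_trans (ltW st) tT).
have [W1 W2] := W t tI; split=> [phi sp p0 pL dp|psi sp p0 pL].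
 rewrite (e1 t _ tI) (e1 0 _ i0) (W1 phi sp p0 pL dp); apply: it_eq => s sI.
 by rewrite (e2 s _ (sub s sI)).
rewrite (e2 t _ tI) (e2 0 _ i0) (W2 psi sp p0 pL); apply: it_eq => s sI.
by rewrite (e1 s _ (sub s sI)).
Qed.

Lemma X0_eq_join (v w z : pairs R) : X0_eq L v z -> X0_eq L w z -> X0_eq L v w.
Proof.
have j (f g h : R -> R) : aeon 0 L (fun x => f x = h x) -> aeon 0 L (fun x => g x = h x) ->
  aeon 0 L (fun x => f x = g x) by move=> a b; apply: aeonS2 a b => x _ -> ->.
by move=> [a1 a2] [b1 b2]; split; [exact: (j _ _ _ a1 b1)|exact: (j _ _ _ a2 b2)].
Qed.

Lemma rB_traj_eq u v N M : isB u N -> isB v M -> rB (u - v) <= 0 -> traj_eq L T u v.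
Proof.
move=> Bu Bv h t /in_cc[t0 tT].
have [P [BP _]] := isB_sub hL hT Bu Bv; have [cu _ _ _ _] := Bu; have [cv _ _ _ _] := Bv.
apply: (nX0_eq (cu.1 t t0 tT) (cv.1 t t0 tT)); apply: le_trans h; exact: (nX_rB hT BP t0 tT).
Qed.

(** Picard iteration for a relation: a selection [f] produces iterates from 0, and the contraction
    puts their limit at distance zero from an image of it. *)
Lemma ball_fixed_point (Gam : (R -> pairs R) -> (R -> pairs R) -> Prop) (r : R) : 0 <= r ->
 (forall u N, isB u N -> rB u <= r -> exists v M, [/\ Gam u v, isB v M & rB v <= r]) ->
 (forall u N u' N' v v' M M', isB u N -> rB u <= r -> isB u' N' -> rB u' <= r ->
  Gam u v -> Gam u' v' -> isB v M -> isB v' M' -> rB (v - v') <= 2^-1 * rB (u - u')) ->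
 exists u N v, [/\ isB u N, rB u <= r, Gam u v & traj_eq L T v u].
Proof.
move=> r0 ex con; have [B0 n0] := isB0 hL hT.
have exf u : exists v, (exists2 N, isB u N & rB u <= r) -> Gam u v /\ (exists2 M, isB v M & rB v <= r).
 have [[N Bu bu]|no] := pselect (exists2 N, isB u N & rB u <= r); last by exists u => /no.
 have [v [M [g Bv bv]]] := ex u N Bu bu; exists v => _; split; first exact: g.
 by exists M; [exact: Bv|exact: bv].
have [f hf] := choice exf; pose un n := iter n f 0.
have hn n : exists2 N, isB (un n) N & rB (un n) <= r.
 elim: n => [|n ih]; first by exists (fun=> 0); [exact: B0|rewrite [rB _]n0].
 by have [_] := hf _ ih; exact.
have hB n : exists N, isB (un n) N by have [N h _] := hn n; exists N; exact: h.
have [Nn hN] := choice hB.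
have bn n : rB (un n) <= r by have [N _] := hn n.
have gn n : Gam (un n) (un n.+1) by have [g _] := hf _ (hn n); exact: g.
pose c := rB (un 0%N - un 1%N).
have c0 : 0 <= c by have [P [BP _]] := isB_sub hL hT (hN 0%N) (hN 1%N); exact: (rB_ge0 hT BP).
have step n : rB (un n - un n.+1) <= c * 2^-1 ^+ n.
 elim: n => [|n ih]; first by rewrite expr0 mulr1.
 have h := con _ _ _ _ _ _ _ _ (hN n) (bn n) (hN n.+1) (bn n.+1) (gn n) (gn n.+1) (hN n.+1) (hN n.+2).
 by apply: (le_trans h); rewrite exprS mulrCA; apply: ler_wpM2l ih; rewrite invr_ge0.
have [u [N [Bu cv]]] := B_complete hL hT hN c0 step.
have small (x y : R) : (forall n, x <= y + 4 * c * 2^-1 ^+ n) -> x <= y.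
 move=> h; apply/ler_addgt0Pr => e e0; have [n0' hn0] := null_half (4 * c) e0.
 by apply: (le_trans (h n0')); rewrite lerD2l; exact: hn0.
have bu : rB u <= r.
 apply: small => n; have := rB_triangle hL hT Bu (hN n) B0; rewrite !subr0 => h.
 apply: (le_trans h); rewrite addrC; apply: lerD; first exact: bn.
 by rewrite (rB_distC hL hT Bu (hN n)); exact: cv.
have [v [M [gv Bv bv]]] := ex u N Bu bu.
exists u, N, v; split; [exact: Bu|exact: bu|exact: gv|].
apply: (rB_traj_eq Bv Bu); apply: small => n.
have := rB_triangle hL hT Bv (hN n.+1) Bu => h; apply: (le_trans h); rewrite add0r.
have k := con _ _ _ _ _ _ _ _ Bu bu (hN n) (bn n) gv (gn n) Bv (hN n.+1).
rewrite (rB_distC hL hT Bu (hN n)) in k.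
have k2 := cv n; have := cv n.+1; rewrite exprS (mulrCA _ 2^-1) => k3.
exact: halves_le k k2 k3.
Qed.

End FixedPoint.

Theorem theorem2p7 (R : realType) (L T alpha beta d M : R) (tau : R -> R)
  (hL : 0 < L) (hT : 0 < T)
  (hM : 0 < M) (hd0 : 0 < d) (hd1 : d < 1)
  (htau0 : 0 < tau 0)
  (htau : forall t : R, 0 <= t -> tau 0 <= tau t /\ tau t <= M)
  (hdtau : forall t : R, 0 < t -> derive1 tau t <= d)
  (htauW : forall T' : R, 0 < T' -> W2infty T' tau)
  (hab : (2 * alpha - `|beta|) * (1 - d) > `|beta|) :
  exists eps r : R, 0 < eps /\ 0 < r /\
  forall eta0 omega0 z0 : R -> R,
    in_H L tau eta0 omega0 z0 ->
    (Hnorm L tau eta0 omega0 z0 <= eps%:E)%E ->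
    (forall u, in_B L T u ->
       (exists v, Gamma L T alpha beta tau eta0 omega0 z0 u v) /\
       (forall v, Gamma L T alpha beta tau eta0 omega0 z0 u v -> in_B L T v) /\
       (forall v w, Gamma L T alpha beta tau eta0 omega0 z0 u v ->
          Gamma L T alpha beta tau eta0 omega0 z0 u w -> traj_eq L T v w)) /\
    (forall u v, in_Bball L T r u ->
       Gamma L T alpha beta tau eta0 omega0 z0 u v -> in_Bball L T r v) /\
    (exists k : R, 0 <= k /\ k < 1 /\
       forall u u' v v', in_Bball L T r u -> in_Bball L T r u' ->
         Gamma L T alpha beta tau eta0 omega0 z0 u v ->
         Gamma L T alpha beta tau eta0 omega0 z0 u' v' ->
         (Bnorm L T (v - v')%R <= k%:E * Bnorm L T (u - u')%R)%E) /\
    (exists u, in_Bball L T r u /\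
       nonlinear_solution L T alpha beta tau eta0 omega0 z0 u) /\
    (forall u v, in_Bball L T r u -> in_Bball L T r v ->
       nonlinear_solution L T alpha beta tau eta0 omega0 z0 u ->
       nonlinear_solution L T alpha beta tau eta0 omega0 z0 v ->
       traj_eq L T u v).
Proof.
have [hal hk] := damping_bounds hd1 hab; set Ks := Num.sqrt _ in hk.
have Ks0 : 0 <= Ks by exact: sqrtr_ge0.
have [q [cq tauE dtau]] := W2infty_C1 hT (htauW T hT).
have qd t : t \in `]0, T[ -> q t <= d.
 move=> tI; have [t0 _] := in_oo tI; apply: le_trans (hdtau t t0).
 by have h := dtau t tI; rewrite derive1E (derive_val (f := tau)).
have tge t : 0 <= t -> t <= T -> tau 0 <= tau t by move=> t0 _; have [] := htau t t0.
have shL2 f : L2 (- tau 0) T f -> L2 0 T (fun t => f (t - tau t)).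
 by move=> Lf; have [] := shift_L2 hT hd1 htau0 cq tauE dtau qd tge Lf.
have shle f : L2 (- tau 0) T f -> nL 0 T (fun t => f (t - tau t)) <= Ks * nL (- tau 0) T f.
 by move=> Lf; exact: (shift_le hT hd1 htau0 cq tauE dtau qd tge Lf).
have [C C0 hC] := Gamma_estimates hL hal hT htau0 Ks0 hk shL2 shle.
have C1 : 0 < C + 1 by rewrite ltr_wpDl.
(* On this ball the difference estimate has factor at most [2^-1], and the quadratic term of the
   bound on the image is at most a quarter of [r]. *)
pose r := (4 * (C + 1))^-1; have r0 : 0 < r by rewrite invr_gt0 mulr_gt0.
have Cr : C * r <= 4^-1 by rewrite /r invfM mulrCA ler_piMr ?invr_ge0// ler_pdivrMr// mul1r lerDl.
(* Converts the norm of the rescaled history on the unit interval into its norm on []- tau 0,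
   0[]. *)
pose s := Num.sqrt (tau 0); have s0 : 0 <= s by exact: sqrtr_ge0.
have s1 : 0 < 1 + s by rewrite ltr_wpDr.
(* Small enough that the initial data contribute at most [r / 2] to the bound on the image. *)
pose eps := r / (2 * (C + 1) * (1 + s)).
have eps0 : 0 < eps by rewrite divr_gt0// !mulr_gt0.
have Ceps : C * (1 + s) * eps <= r / 2.
 apply: (@le_trans _ _ ((C + 1) * (1 + s) * eps)).
  by apply: ler_wpM2r; [exact: ltW|apply: ler_wpM2r; [exact: ltW|rewrite lerDl]].
 rewrite /eps; apply: ler_eq; field.
 by rewrite !gt_eqF.
exists eps, r; split; first exact: eps0.
split; first exact: r0.
move=> eta0 omega0 z0 hH hnorm; have [D0 LZ] := hH.
have [nb zb] := Hnorm_bounds (ltW eps0) hH hnorm.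
have [Lz zle] := history_L2 htau0 LZ.
have {zb zle} zb : nL (- tau 0) 0 z0 <= s * eps.
 have se0 : 0 <= s * eps by apply: mulr_ge0 => //; exact: ltW.
 rewrite -ler_sqr ?nnegrE ?nL_ge0//; apply: (le_trans zle).
 have -> : (s * eps) ^+ 2 = tau 0 * eps ^+ 2 by rewrite exprMn sqr_sqrtr// ltW.
 apply: (ler_wpM2l (ltW htau0)).
 by rewrite lerXn2r ?nnegrE ?nL_ge0// ltW.
set GG := Gamma L T alpha beta tau eta0 omega0 z0.
have GD u v := Gamma_delayed L alpha beta hT hd1 htau0 cq tauE dtau qd tge eta0 omega0 u v Lz.
have Gex u N : isB L T u N -> exists v, GG u v.
 move=> Bu; have [v [gam [cv v0 hz dl]]] := Gamma_exists hL hal hT htau0 Ks0 hk shL2 shle Bu D0 Lz.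
 by exists v; apply/GD; exists gam; split; [exact: cv|exact: v0|exact: hz|exact: dl].
have GB u N v : isB L T u N -> GG u v -> exists2 P, isB L T v P &
  rB L T v <= C * ((1 + s) * eps + rB L T u ^+ 2).
 move=> Bu /GD[gam [cv v0 hz dl]]; have [[P [BP le]] _] := hC _ _ _ _ Bu cv dl.
 exists P; first exact: BP.
 apply: (le_trans le); apply: (ler_wpM2l C0); rewrite (nX_congr v0) (nL_ae hz).
 exact: data_le nb zb.
have Gdiff u N u' N' v v' : isB L T u N -> isB L T u' N' -> GG u v -> GG u' v' ->
  rB L T (v - v') <= C * (rB L T u + rB L T u') * rB L T (u - u').
 move=> Bu Bu' /GD[gam [cv v0 hz dl]] /GD[gam' [cv' v0' hz' dl']].
 have [_ h] := hC _ _ _ _ Bu cv dl; apply: (h _ _ _ _ Bu' cv' dl'); first exact: X0_eq_join v0 v0'.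
 have e1 : aeon (- tau 0) 0 (fun t => gam t = z0 t) by exact: hz.
 have e2 : aeon (- tau 0) 0 (fun t => gam' t = z0 t) by exact: hz'.
 by apply: aeonS2 e1 e2 => t _ -> ->.
have Gball u N v : isB L T u N -> rB L T u <= r -> GG u v -> exists2 P, isB L T v P & rB L T v <= r.
 move=> Bu bu g; have [P BP le] := GB u N v Bu g; exists P; first exact: BP.
 apply: (le_trans le); exact: (invariance_le C0 (ltW r0) Cr Ceps (rB_ge0 hT Bu) bu).
have Gcon u N u' N' v v' : isB L T u N -> rB L T u <= r -> isB L T u' N' -> rB L T u' <= r -> GG u v -> GG u' v' ->
  rB L T (v - v') <= 2^-1 * rB L T (u - u').
 move=> Bu bu Bu' bu' g g'; apply: (le_trans (Gdiff _ _ _ _ _ _ Bu Bu' g g')).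
 have [P [BP _]] := isB_sub hL hT Bu Bu'; apply: (ler_wpM2r (rB_ge0 hT BP)).
 exact: contraction_le C0 Cr bu bu'.
have Guniq u N v w : isB L T u N -> GG u v -> GG u w -> traj_eq L T v w.
 move=> Bu gv gw; have [P BP _] := GB _ _ _ Bu gv; have [Q BQ _] := GB _ _ _ Bu gw.
 apply: (rB_traj_eq hL hT BP BQ); apply: (le_trans (Gdiff _ _ _ _ _ _ Bu Bu gv gw)).
 have e : rB L T (u - u) = 0 by rewrite subrr; have [_ h] := isB0 hL hT; exact: h.
 by rewrite e mulr0.
(* A solution of the nonlinear system is related to itself by [Gamma], so uniqueness in the ball is
   the contraction applied to two fixed points. *)
have nlG u : nonlinear_solution L T alpha beta tau eta0 omega0 z0 u -> GG u u.
 move=> [/(in_BP hL hT)[N [cu _ _ _ _]] u0 [g [Lg gz W]]]; apply/GD.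
 by exists g; split; [exact: cu|exact: u0|exact: gz|split; [exact: Lg|exact: W]].
split.
 move=> u /(in_BP hL hT)[N Bu]; split; first exact: Gex Bu.
 split; last by move=> v w; exact: Guniq Bu.
 by move=> v g; have [P BP _] := GB _ _ _ Bu g; apply/(in_BP hL hT); exists P; exact: BP.
split.
 move=> u v /(ballP hL hT)[[N Bu] bu] g; have [P BP le] := Gball _ _ _ Bu bu g.
 by apply/(ballP hL hT); split; [exists P; exact: BP|exact: le].
split.
 exists 2^-1; split; first by rewrite invr_ge0.
 split; first by rewrite invf_lt1// ltr1n.
 move=> u u' v v' /(ballP hL hT)[[N Bu] bu] /(ballP hL hT)[[N' Bu'] bu'] g g'.
 have [P BP _] := GB _ _ _ Bu g; have [P' BP' _] := GB _ _ _ Bu' g'.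
 have [Q [BQ _]] := isB_sub hL hT BP BP'; have [Q' [BQ' _]] := isB_sub hL hT Bu Bu'.
 rewrite (BnormE hT BQ) (BnormE hT BQ') -EFinM lee_fin; exact: (Gcon _ _ _ _ _ _ Bu bu Bu' bu' g g').
split.
 have [|u N Bu bu|u N u' N' v v' P P' Bu bu Bu' bu' g g' _ _|u [N [v [Bu bu g e]]]] := @ball_fixed_point _ L T hL hT GG r.
 - exact: ltW.
 - have [v g] := Gex _ _ Bu; have [P BP bP] := Gball _ _ _ Bu bu g.
  by exists v, P; split; [exact: g|exact: BP|exact: bP].
 - exact: (Gcon _ _ _ _ _ _ Bu bu Bu' bu' g g').
 - exists u; split; first by apply/(ballP hL hT); split; [exists N; exact: Bu|exact: bu].
  move: g => /GD[gam [cv v0 hz [Lg W]]].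
  split; [by apply/(in_BP hL hT); exists N; exact: Bu| |].
   have i0 : 0 \in `[0, T] by rewrite in_itv/= lexx ltW.
   have j (f g h : R -> R) : aeon 0 L (fun x => f x = g x) -> aeon 0 L (fun x => f x = h x) ->
    aeon 0 L (fun x => g x = h x) by move=> a b; apply: aeonS2 a b => x _ -> ->.
   by have [a1 a2] := e 0 i0; have [b1 b2] := v0; split; [exact: (j _ _ _ a1 b1)|exact: (j _ _ _ a2 b2)].
  by exists gam; split; [exact: Lg|exact: hz|exact: (weak_traj e W)].
move=> u v /(ballP hL hT)[[N Bu] bu] /(ballP hL hT)[[N' Bv] bv] /nlG gu /nlG gv.
apply: (rB_traj_eq hL hT Bu Bv); have [P [BP _]] := isB_sub hL hT Bu Bv.
exact: half_le0 (rB_ge0 hT BP) (Gcon _ _ _ _ _ _ Bu bu Bv bv gu gv).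
Qed.
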